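(* Let $p\in\left[1,\frac{2n}{n-2}\right]$ if $n\ge3$, or $p\in[1,+\infty)$ if $n=2$. There is a constant $C>0$, independent of $u$, $x$ and $r$ below, such that for every $u\in W$, $x\in\mathbb R^n$ and $r>0$, $$\Big\{\frac1{m(B(x,r))}\int_{B(x,r)}\big|u(y)-u_{B(x,r)}\big|^p\,w(y)\,dy\Big\}^{1/p}\le C\,r\,\Big\{\frac1{m(B(x,r))}\int_{B(x,r)}|\nabla u(y)|^2\,w(y)\,dy\Big\}^{1/2},$$ where $u_B$ denotes either $\frac1{|B|}\int_Bu\,dz$ or $\frac1{m(B)}\int_Bu\,w(z)\,dz$ (the estimate holds for both choices). If moreover $x\in\Gamma$ and $Tu=0$ $\sigma$-a.e. on $\Gamma\cap B(x,r)$, then $$\Big\{r^{-d-1}\int_{B(x,r)}|u(y)|^p\,w(y)\,dy\Big\}^{1/p}\le C\,r\,\Big\{r^{-d-1}\int_{B(x,r)}|\nabla u(y)|^2\,w(y)\,dy\Big\}^{1/2}.$$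
   Context: Let $n\ge2$ and let $0<d<n-1$ be a real number. $\Gamma\subset\mathbb R^n$ is a nonempty closed set which is Ahlfors regular of dimension $d$: there is $C_0\ge1$ with $C_0^{-1}r^d\le\mathcal H^d(\Gamma\cap B(x,r))\le C_0r^d$ for all $x\in\Gamma$, $r>0$. Set $\Omega=\mathbb R^n\setminus\Gamma$, $\sigma=\mathcal H^d|_\Gamma$, $\delta(z)=\operatorname{dist}(z,\Gamma)$, $w(z)=\delta(z)^{d+1-n}$ and $m(E)=\int_Ew(z)\,dz$. $W=\{u\in L^1_{loc}(\Omega):\nabla u\in L^2(\Omega,w)\}$, where $\nabla u$ is the distributional gradient in $\Omega$ and $L^2(\Omega,w)=L^2(\Omega,w\,dz)$. Every $u\in W$ belongs to $L^1_{loc}(\mathbb R^n)$. For $u\in W$ the trace $Tu$ on $\Gamma$ is defined by $Tu(x)=\lim_{r\to0}\frac1{|B(x,r)|}\int_{B(x,r)}u(y)\,dy$, a limit which exists for $\sigma$-almost every $x\in\Gamma$. *)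

(* Defs.v *)
From HB Require Import structures.
From mathcomp Require Import all_boot all_order all_algebra.
From mathcomp Require Import all_classical all_reals all_analysis.
From mathcomp Require Import measurable_realfun.

Set Implicit Arguments.
Unset Strict Implicit.
Unset Printing Implicit Defensive.
Import Order.TTheory GRing.Theory Num.Theory.
Import numFieldNormedType.Exports.

Local Open Scope classical_set_scope.
Local Open Scope ring_scope.

(* R^n is 'rV[R]_n. Its library topology comes from the sup norm, so it is the
   usual one, but the library `|x| and ball are NOT Euclidean: enorm and eball
   below are. *)

Section borel.
Context (R : realType) (n : nat).

Let borel := <<s (@open 'rV[R]_n) >>.

Let borel0 : borel set0.
Proof. exact: sigma_algebra0. Qed.

Let borelC A : borel A -> borel (~` A).
Proof. exact: sigma_algebraC. Qed.

Let borel_bigcup (F : (set 'rV[R]_n)^nat) :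
  (forall i, borel (F i)) -> borel (\bigcup_i F i).
Proof. exact: sigma_algebra_bigcup. Qed.

HB.instance Definition _ :=
  @isMeasurable.Build (sigma_display (@open 'rV[R]_n)) 'rV[R]_n borel
    borel0 borelC borel_bigcup.

Lemma open_measurable_rV (A : set 'rV[R]_n) : open A -> measurable A.
Proof. by move=> oA; exact: sub_sigma_algebra. Qed.

Lemma measurable_coord (i : 'I_n) :
  measurable_fun [set: 'rV[R]_n] (fun x : 'rV[R]_n => x 0 i).
Proof.
have /continuousP cvi : continuous (fun x : 'rV[R]_n => x 0 i).
  exact: coord_continuous.
apply: (measurability _ (RGenOpens.measurableE R)).
move=> _ [_ [a [b ->]] <-]; rewrite setTI; apply: open_measurable_rV.
exact/cvi/interval_open.
Qed.

Lemma measurable_fun_rVP d (T : measurableType d) (f : T -> 'rV[R]_n) :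
  (forall i, measurable_fun [set: T] (fun t => f t 0 i)) ->
  measurable_fun [set: T] f.
Proof.
move=> mf; apply: (measurability (@open 'rV[R]_n)); first by [].
move=> _ [U oU <-]; rewrite setTI.
pose e (k : nat) : R := k.+1%:R^-1.
pose box (qk : 'rV[rat]_n * nat) : set 'rV[R]_n :=
  [set x | forall i, x 0 i \in `]ratr (qk.1 0 i) - e qk.2, ratr (qk.1 0 i) + e qk.2[].
have -> : f @^-1` U = \bigcup_(qk : 'rV[rat]_n * nat)
    if pselect (box qk `<=` U) then f @^-1` box qk else set0.
  apply/seteqP; split=> [t Uft|t [qk _]]; last by case: pselect => //= bU /bU.
  have /nbhs_ballP[r /= r0 rU] : nbhs (f t) U.
    by apply: open_nbhs_nbhs; split.
  have [k kr] : exists k, e k < r / 2.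
    have [k _ /(_ k (leqnn k)) kr] :=
      near_infty_natSinv_lt (PosNum (divr_gt0 r0 (@ltr0Sn R 1))).
    by exists k.
  have ek0 : 0 < e k by rewrite invr_gt0.
  have /choice[q qf] : forall i, exists q : rat,
      (ratr q : R) \in `]f t 0 i - e k, f t 0 i + e k[.
    by move=> i; apply: rat_in_itvoo; rewrite ltrD2l gtrN.
  have bU : box (\row_i q i, k) `<=` U.
    move=> y yb; apply: rU; split=> // i j; rewrite (ord1 i) /ball /=.
    move: (yb j) (qf j); rewrite /= mxE !in_itv/= -!ltr_distl => h1 h2.
    rewrite (le_lt_trans (ler_distD (ratr (q j)) _ _))//.
    by rewrite [ltRHS]splitr ltrD// distrC; apply: lt_trans kr.
  exists (\row_i q i, k) => //; case: pselect => //= _ i.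
  by move: (qf i); rewrite mxE !in_itv/= -!ltr_distl distrC.
apply: countable_bigcupT_measurable => [|qk]; first exact: countableP.
case: pselect => [bU|nbU] /=; last exact: measurable0.
rewrite (_ : _ @^-1` _ = \bigcap_(i in [set: 'I_n]) ((fun t => f t 0 i) @^-1`
    `]ratr (qk.1 0 i) - e qk.2, ratr (qk.1 0 i) + e qk.2[)); last first.
  by apply/seteqP; split=> [t h i _|t h i]; exact: h.
apply: fin_bigcap_measurable => // i _.
by rewrite -[X in measurable X]setTI; exact: mf.
Qed.

End borel.

Section lebesgue_rV.
Context (R : realType).

Definition cons_rV n (tx : measurableTypeR R * 'rV[R]_n) : 'rV[R]_n.+1 :=
  row_mx (const_mx tx.1 : 'rV_1) tx.2.

(* n-dimensional Lebesgue measure, on the Borel sets: the image of the product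
   of the library's 1-dimensional lebesgue_measure and lebesgue_rV n under
   (t, x) |-> (t, x_1, ..., x_n); the point mass for n = 0. *)
Fixpoint lebesgue_rV n : set 'rV[R]_n -> \bar R :=
  match n with
  | 0 => dirac (0 : 'rV[R]_0)
  | n'.+1 => pushforward (lebesgue_measure \x lebesgue_rV (n := n'))%E
               (@cons_rV n')
  end.
Arguments lebesgue_rV : clear implicits.

Lemma cons_rV0 n (tx : measurableTypeR R * 'rV[R]_n) :
  cons_rV tx 0 ord0 = tx.1.
Proof.
rewrite (_ : ord0 = @lshift 1 n ord0); last exact: val_inj.
by rewrite (@row_mxEl _ 1 1 n) mxE.
Qed.

Lemma cons_rVS n (tx : measurableTypeR R * 'rV[R]_n) i :
  cons_rV tx 0 (lift ord0 i) = tx.2 0 i.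
Proof.
rewrite (_ : lift ord0 i = @rshift 1 n i); last exact: val_inj.
by rewrite (@row_mxEr _ 1 1 n).
Qed.

Lemma measurable_cons_rV n : measurable_fun [set: _] (@cons_rV n).
Proof.
apply: measurable_fun_rVP => i; case: (unliftP ord0 i) => [j|] ->.
  rewrite (_ : (fun _ => _) = (fun x : 'rV[R]_n => x 0 j) \o snd).
    by apply: measurableT_comp; [exact: measurable_coord|exact: measurable_snd].
  by apply/funext => tx; rewrite cons_rVS.
rewrite (_ : (fun _ => _) = fst); first exact: measurable_fst.
by apply/funext => tx; rewrite cons_rV0.
Qed.

Let uncons n (x : 'rV[R]_n.+1) : measurableTypeR R * 'rV[R]_n :=
  (x 0 ord0, \row_j x 0 (lift ord0 j)).

Let measurable_uncons n : measurable_fun [set: _] (@uncons n).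
Proof.
apply: measurable_fun_pair; first exact: measurable_coord.
apply: measurable_fun_rVP => i.
rewrite (_ : (fun _ => _) = fun x : 'rV[R]_n.+1 => x 0 (lift ord0 i)).
  exact: measurable_coord.
by apply/funext => x; rewrite mxE.
Qed.

Let cons_rVK n : cancel (@cons_rV n) (@uncons n).
Proof.
move=> [t x]; rewrite /uncons cons_rV0; congr (_, _).
by apply/rowP => j; rewrite mxE cons_rVS.
Qed.

Section step.
Variables (n : nat) (m : {sigma_finite_measure set 'rV[R]_n -> \bar R}).

Local Notation mu := (@lebesgue_measure R \x m)%E.
Let nu := pushforward mu (@cons_rV n).

Let mc A : measurable A -> measurable (@cons_rV n @^-1` A).
Proof. by move=> mA; rewrite -[X in measurable X]setTI; exact: measurable_cons_rV. Qed.

Let nu0 : nu set0 = 0%E.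
Proof. by rewrite /nu /pushforward preimage_set0; exact: measure0. Qed.

Let nu_ge0 A : (0 <= nu A)%E.
Proof. exact: (measure_ge0 (lebesgue_measure \x m)%E). Qed.

Let nu_sigma_additive : semi_sigma_additive nu.
Proof.
move=> F mF tF mUF; rewrite /nu /pushforward preimage_bigcup.
apply: measure_semi_sigma_additive.
- by move=> k; exact: mc.
- apply/trivIsetP => /= i j _ _ ij; rewrite -preimage_setI.
  by move/trivIsetP : tF => /(_ _ _ _ _ ij) ->//; rewrite preimage_set0.
- by rewrite -preimage_bigcup; exact: mc.
Qed.

HB.instance Definition _ := isMeasure.Build _ _ _ nu
  nu0 nu_ge0 nu_sigma_additive.

Let nu_sigma_finite : sigma_finite setT nu.
Proof.
have [F [FT ndF mF]] := (sigma_finiteP _ _).1 (sigma_finiteT (@lebesgue_measure R)).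
have [G [GT ndG mG]] := (sigma_finiteP _ _).1 (sigma_finiteT m).
exists (fun k => @uncons n @^-1` (F k `*` G k)).
  rewrite -preimage_bigcup; apply/seteqP; split=> // x _ /=.
  have [i _ Fi] : (\bigcup_i F i) (x 0 ord0) by rewrite -FT.
  have [j _ Gj] : (\bigcup_i G i) (@uncons n x).2 by rewrite -GT.
  exists (maxn i j) => //; split => /=.
    by move/subsetPset : (ndF _ _ (leq_maxl i j)); exact.
  by move/subsetPset : (ndG _ _ (leq_maxr i j)); exact.
move=> k; have [[mFk Fk] [mGk Gk]] := (mF k, mG k); split.
  rewrite -[X in measurable X]setTI; apply: measurable_uncons => //.
  exact: measurableX.
rewrite /nu /pushforward (_ : _ @^-1` _ = F k `*` G k); last first.
  by apply/funext => z; rewrite -[z in RHS]cons_rVK.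
by rewrite product_measure1E// lte_mul_pinfty// ge0_fin_numE.
Qed.

HB.instance Definition _ := Measure_isSigmaFinite.Build _ _ _ nu nu_sigma_finite.

Lemma lebesgue_rV_step :
  exists m' : {sigma_finite_measure set 'rV[R]_n.+1 -> \bar R},
    pushforward (@lebesgue_measure R \x m)%E (@cons_rV n) = m'.
Proof. by exists nu. Qed.

End step.

Let lebesgue_rV_ex n :
  exists m : {sigma_finite_measure set 'rV[R]_n -> \bar R}, lebesgue_rV n = m.
Proof.
elim: n => [|n [m lm]]; first by exists (dirac (0 : 'rV[R]_0)).
by rewrite /= lm; exact: lebesgue_rV_step.
Qed.

Let lebesgue_rV0 n : lebesgue_rV n set0 = 0%E.
Proof. by have [m ->] := lebesgue_rV_ex n; exact: measure0. Qed.

Let lebesgue_rV_ge0 n A : (0 <= lebesgue_rV n A)%E.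
Proof. by have [m ->] := lebesgue_rV_ex n; exact: measure_ge0. Qed.

Let lebesgue_rV_sigma_additive n : semi_sigma_additive (lebesgue_rV n).
Proof.
by have [m ->] := lebesgue_rV_ex n; exact: measure_semi_sigma_additive.
Qed.

HB.instance Definition _ n := isMeasure.Build _ _ _ (lebesgue_rV n)
  (@lebesgue_rV0 n) (@lebesgue_rV_ge0 n) (@lebesgue_rV_sigma_additive n).

Let lebesgue_rV_sigma_finite n : sigma_finite setT (lebesgue_rV n).
Proof. by have [m ->] := lebesgue_rV_ex n; exact: sigma_finiteT. Qed.

HB.instance Definition _ n := Measure_isSigmaFinite.Build _ _ _
  (lebesgue_rV n) (@lebesgue_rV_sigma_finite n).

Lemma lebesgue_rV_prod n (A : 'I_n -> set (measurableTypeR R)) :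
  (forall i, measurable (A i)) ->
  lebesgue_rV n [set x : 'rV[R]_n | forall i, A i (x 0 i)] =
  (\prod_(i < n) lebesgue_measure (A i))%E.
Proof.
elim: n A => [|n IH] A mA.
  by rewrite big_ord0 /= diracE mem_set// => -[].
rewrite big_ord_recl /= /pushforward -IH => [|i]; last exact: mA.
rewrite -(product_measure1E _ (lebesgue_rV n))//; last first.
  rewrite (_ : mkset _ = \bigcap_(i in [set: 'I_n])
      ((fun x : 'rV[R]_n => x 0 i) @^-1` A (lift ord0 i))); last first.
    by apply/seteqP; split=> [x h i _|x h i]; exact: h.
  apply: fin_bigcap_measurable => // i _.
  rewrite -[X in measurable X]setTI; apply: (@measurable_coord R n i) => //.
  exact: mA.
congr (_ _); apply/seteqP; split=> [tx h|tx [/= At Ax] i].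
  by split=> [|i]; [move: (h ord0)|move: (h (lift ord0 i))];
    rewrite /= ?cons_rV0 ?cons_rVS.
by case: (unliftP ord0 i) => [j|] ->; rewrite ?cons_rVS ?cons_rV0.
Qed.

End lebesgue_rV.
Arguments lebesgue_rV : clear implicits.

Section euclidean.
Context (R : realType) (n : nat).
Implicit Types (x y z : 'rV[R]_n) (A : set 'rV[R]_n).

Definition enorm x : R := Num.sqrt (\sum_(i < n) x 0 i ^+ 2).

Definition eball x (r : R) : set 'rV[R]_n := [set y | enorm (y - x) < r].

(* The maximum with 0 only matters for the empty set, whose diameter is 0. *)
Definition ediam A : \bar R :=
  maxe 0%E (ereal_sup [set (enorm (x - y))%:E | x in A & y in A]).

Definition edist A z : R := inf [set enorm (z - y) | y in A].

(* s-dimensional Hausdorff (outer) measure, s > 0, without normalizing factor *)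
Definition hausdorff_size (s e : R) A : \bar R :=
  ereal_inf [set (\sum_(k <oo) ediam (F k) `^ s)%E | F in
    [set F : (set 'rV[R]_n)^nat |
      A `<=` \bigcup_k F k /\ forall k, (ediam (F k) <= e%:E)%E]].

Definition hausdorff (s : R) A : \bar R :=
  ereal_sup [set hausdorff_size s e A | e in [set e : R | 0 < e]].

Definition ahlfors_regular (d : R) A :=
  exists2 C0 : R, 1 <= C0 & forall x r, A x -> 0 < r ->
    ((C0^-1 * r `^ d)%:E <= hausdorff d (A `&` eball x r))%E /\
    (hausdorff d (A `&` eball x r) <= (C0 * r `^ d)%:E)%E.

End euclidean.

Section distributions.
Context (R : realType) (n : nat).
Local Notation Rn := 'rV[R]_n.
Implicit Types (f u phi : Rn -> R) (g : Rn -> Rn) (D : set Rn).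

Local Notation e_ i := (delta_mx 0 i : Rn).

Fixpoint Ck (k : nat) f : Prop :=
  match k with
  | 0 => continuous f
  | k'.+1 => (forall i x, derivable f x (e_ i)) /\ forall i, Ck k' ('D_(e_ i) f)
  end.

Definition test_function D phi :=
  (forall k, Ck k phi) /\
  exists K, [/\ compact K, K `<=` D & forall x, ~ K x -> phi x = 0].

Definition loc_integrable D f := [/\ measurable_fun D f, open D &
  forall K, K `<=` D -> compact K ->
    (\int[lebesgue_rV R n]_(x in K) `|f x|%:E < +oo)%E].

(* g is the distributional gradient of u in D *)
Definition weak_gradient D u g :=
  (forall i, loc_integrable D (fun x => g x 0 i)) /\
  forall phi, test_function D phi -> forall i,
    \int[lebesgue_rV R n]_(x in D) (u x * 'D_(e_ i) phi x) =
    - \int[lebesgue_rV R n]_(x in D) (g x 0 i * phi x).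

End distributions.

Section weighted.
Context (R : realType) (n : nat) (d : R) (Gam : set 'rV[R]_n).
Local Notation Rn := 'rV[R]_n.
Implicit Types (x y z : Rn) (B E : set Rn) (u : Rn -> R) (g : Rn -> Rn).

(* For d + 1 < n this weight is 0, not +oo, on Gam, as 0 `^ a = 0 for a != 0.
   This is harmless: the closed set Gam, of dimension d < n, is a null set. *)
Definition weight z : R := edist Gam z `^ (d + 1 - n%:R).

Definition wmeasure E : \bar R :=
  (\int[lebesgue_rV R n]_(z in E) (weight z)%:E)%E.

(* An element of W is given by a Borel representative, defined on all of R^n;
   its values on the null set Gam are immaterial. *)
Definition in_W u :=
  [/\ measurable_fun [set: Rn] u,
      loc_integrable (~` Gam) u &
      exists2 g, weak_gradient (~` Gam) u g &
        (\int[lebesgue_rV R n]_(y in ~` Gam) (enorm (g y) ^+ 2 * weight y)%:E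
          < +oo)%E].

Definition avg u B : R :=
  (fine (lebesgue_rV R n B))^-1 * \int[lebesgue_rV R n]_(z in B) u z.

Definition wavg u B : R :=
  (fine (wmeasure B))^-1 * \int[lebesgue_rV R n]_(z in B) (u z * weight z).

(* the limit defining Tu(x) exists and equals l *)
Definition has_trace u x (l : R) :=
  avg u (eball x r) @[r --> 0^'+] --> l.

Definition trace0_ae_on u B :=
  hausdorff d ((Gam `&` B) `&` [set y | ~ has_trace u y 0]) = 0%E.

End weighted.

(* Main.v *)
(* Off Gamma, u is approximated in L^1_loc by mollifications, along which the fundamental
   theorem of calculus can be applied on segments.  As d < n - 1, for x outside Gamma almost
   every segment issued from x avoids Gamma, whence for phi of class C^(1,1) and almost all x, y
     |phi(u(x)) - phi(u(y))| <= int_[x,y] |phi'(u)| |grad u|.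
   Integrate this over x in a set E and y in a ball B, with the weight w in x and no weight in y.
   Young's inequality, the bound m(B(z,s)) <= C s^n (delta(z)+s)^(d+1-n) and w^(-1) <=
   (delta+s)^(n-1-d) give a weak type estimate in which the power of m(E)/m(B) is 1 - 1/q.
   With phi a truncation of u - u_B between the levels s and 2s and E the superlevel set 2s,
   only the energy of the annulus s < |u - u_B| < 2s is involved, so that the dyadic estimates
   can be summed to the strong type estimate with exponent q.

   When Tu = 0, a covering argument shows that some y in Gamma near x has trace 0 and has small
   energy in all the balls B(y, r 16^(-j) / 2); telescoping the means of u over these balls
   bounds the mean over B(x,r), and the second estimate follows from the first. *)

From mathcomp Require Import all_boot all_order all_algebra.
From mathcomp Require Import all_classical all_reals all_analysis.
From mathcomp Require Import measurable_realfun ring lra.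
Require Import Defs.
Set Implicit Arguments.
Unset Strict Implicit.
Unset Printing Implicit Defensive.
Import Order.TTheory GRing.Theory Num.Theory.
Import numFieldNormedType.Exports.
Local Open Scope classical_set_scope.
Local Open Scope ring_scope.

(** * Euclidean norm, balls and distance *)

(** Putting the weight on one end point only is deliberate. For fixed x and t the change of
    variables y -> x + t(y - x) costs just t^(-n), and the weight in x is then integrated over the
    part of E within 2rt of z, for which both m(E) and m(B(z,2rt)) are upper bounds. With tau =
    m(E)/m(B) this leaves the integral over t in [0,1] of min(1, tau/t^n)^(1/2), which is
    O(tau^(1/2-1/q)) when n(1/2 - 1/q) <= 1, that is q <= 2n/(n-2) for n >= 3; Cauchy-Schwarz
    supplies a further tau^(1/2). Summing over truncations is what reaches the end point of that
    range, which interpolation between weak estimates would lose. Smaller exponents p follow from a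
    single q > 2 by splitting at the level r (energy/m(B))^(1/2).

    Membership in W gives integrability off Gamma only; integrability of u up to Gamma comes out of
    the oscillation estimate. Energies enter through an upper bound gam > 0, since the optimal
    parameter in Young's inequality divides by it. Hausdorff measure is handled as an outer measure
    throughout: additivity on sets at positive distance is enough. *)

Section enorm.
Context {R : realType} {n : nat}.
Implicit Types (x y z : 'rV[R]_n) (A : set 'rV[R]_n).

Lemma enorm_ge0 x : 0 <= enorm x. Proof. exact: sqrtr_ge0. Qed.

Lemma sqr_enorm x : enorm x ^+ 2 = \sum_(i < n) x 0 i ^+ 2.
Proof. by rewrite sqr_sqrtr// sumr_ge0// => i _; exact: sqr_ge0. Qed.

Lemma enormZ c x : enorm (c *: x) = `|c| * enorm x.
Proof.
rewrite /enorm -sqrtr_sqr -sqrtrM ?sqr_ge0// mulr_sumr; congr Num.sqrt.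
by apply: eq_bigr => i _; rewrite mxE exprMn.
Qed.

Lemma enormN x : enorm (- x) = enorm x.
Proof. by rewrite -scaleN1r enormZ normrN1 mul1r. Qed.

Lemma enormB x y : enorm (x - y) = enorm (y - x).
Proof. by rewrite -opprB enormN. Qed.

Lemma enorm0 : enorm (0 : 'rV[R]_n) = 0.
Proof. by rewrite -(scale0r (0 : 'rV[R]_n)) enormZ normr0 mul0r. Qed.

Lemma coord_le_enorm x i : `|x 0 i| <= enorm x.
Proof.
rewrite -sqrtr_sqr ler_wsqrtr// (bigD1 i)//= lerDl sumr_ge0// => j _.
exact: sqr_ge0.
Qed.

(** For e = 1 and e = -1 the sum of the squares (x_i b - e y_i a)^2, where a and b are the two
    norms, equals 2(ab)^2 - 2 e s ab. Its nonnegativity gives the bound after division by ab; if ab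
    = 0, one of the vectors has only zero coordinates. *)
Lemma dot_le_enorm x y : `|\sum_(i < n) x 0 i * y 0 i| <= enorm x * enorm y.
Proof.
set s := \sum_(i < n) _; set a := enorm x; set b := enorm y.
have h e : e ^+ 2 = 1 -> e * s * (a * b) *+ 2 <= (a * b) ^+ 2 *+ 2.
  move=> e2; rewrite -subr_ge0.
  have -> : (a * b) ^+ 2 *+ 2 - e * s * (a * b) *+ 2 =
            \sum_(i < n) (x 0 i * b - e * (y 0 i * a)) ^+ 2.
    under eq_bigr do rewrite sqrrB !exprMn e2 mul1r.
    rewrite big_split/= sumrB -!mulr_suml -!sqr_enorm -/a -/b.

    rewrite (_ : \sum_(i < n) _ = s * (e * (a * b) *+ 2)); first by ring.
    by rewrite /s mulr_suml; apply: eq_bigr => i _; ring.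
  by apply: sumr_ge0 => i _; exact: sqr_ge0.
have [ab0|] := eqVneq (a * b) 0; last first.
  move=> ab0; have {}ab0 : 0 < a * b by rewrite lt_neqAle eq_sym ab0 mulr_ge0 ?enorm_ge0.
  rewrite ler_norml; apply/andP; split.
    have := h (-1) (etrans (sqrrN _) (expr1n _ _)).
    by move=> ?; rewrite -(@ler_pM2r _ (a * b))//; lra.
  have := h 1 (expr1n _ _).
  by move=> ?; rewrite -(@ler_pM2r _ (a * b))//; lra.
rewrite ab0 normr_le0 /s big1// => i _; move/eqP: ab0; rewrite mulf_eq0.
by case/orP => /eqP z0; [have := coord_le_enorm x i|have := coord_le_enorm y i];
  rewrite -/a -/b z0 normr_le0 => /eqP ->; rewrite ?mul0r ?mulr0.
Qed.

Lemma enormD x y : enorm (x + y) <= enorm x + enorm y.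
Proof.
rewrite -(@ler_pXn2r _ 2) ?nnegrE ?addr_ge0 ?enorm_ge0// sqrrD !sqr_enorm.
under eq_bigr do rewrite mxE sqrrD.
rewrite big_split/= big_split/= lerD2r lerD2l sumrMnl lerMn2r/=.
by rewrite (le_trans (ler_norm _))// dot_le_enorm.
Qed.

Lemma enorm_le_sum x : enorm x <= \sum_(i < n) `|x 0 i|.
Proof.
rewrite -(@ler_pXn2r _ 2) ?nnegrE ?enorm_ge0 ?sumr_ge0//.
rewrite sqr_enorm expr2 mulr_suml ler_sum// => i _.
rewrite -real_normK ?num_real// expr2 ler_wpM2l// (bigD1 i)//= lerDl.
by rewrite sumr_ge0.
Qed.

Lemma enorm_distD z x y : enorm (x - y) <= enorm (x - z) + enorm (z - y).
Proof. by rewrite (le_trans _ (enormD _ _))// subrKA. Qed.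

Lemma enorm_sub_continuous y : continuous (fun x => enorm (x - y)).
Proof.
move=> x; apply: (@continuous_comp _ _ _ (fun x => \sum_(i < n) (x - y) 0 i ^+ 2)
  (@Num.sqrt R)); last exact: sqrt_continuous.
apply: (continuous_big (op := +%R)) => [|i _ {}x]; first exact: add_continuous.
apply: (@continuous_comp _ _ _ (fun x : 'rV[R]_n => (x - y) 0 i) (fun t => t ^+ 2)).
  rewrite /prop_for (_ : (fun _ => _) = (fun x : 'rV[R]_n => x 0 i - y 0 i)).
    apply: (@cvgB _ R _ _ (nbhs_filter x) (fun x => x 0 i) (fun=> y 0 i)).
      exact: coord_continuous.
    exact: cvg_cst.
  by apply/funext => z; rewrite !mxE.
exact: exprn_continuous.
Qed.

Lemma enorm_continuous : continuous (@enorm R n).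
Proof.
have := @enorm_sub_continuous 0; under [X in continuous X -> _]eq_fun do rewrite subr0.
exact.
Qed.

Lemma eball_open x r : open (eball x r).
Proof.
have /continuousP /(_ _ (@open_lt R r)) := @enorm_sub_continuous x.
by [].
Qed.

Lemma measurable_eball x r : measurable (eball x r).
Proof. by apply: open_measurable_rV; exact: eball_open. Qed.

Lemma nbhs_eball x r : 0 < r -> nbhs x (eball x r).
Proof.
by move=> r0; apply: open_nbhs_nbhs; split; [exact: eball_open|rewrite /eball/= subrr enorm0].
Qed.

Lemma nbhs_eballP x A : nbhs x A -> exists2 r, 0 < r & eball x r `<=` A.
Proof.
move=> /nbhs_ballP[r /= r0 rA]; exists r => // y; rewrite /eball/= => yr.
apply: rA; split => // i j; rewrite (ord1 i) /ball/= -normrN opprB.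
by have := coord_le_enorm (y - x) j; rewrite !mxE => /le_lt_trans; exact.
Qed.

Lemma eballS x r s : r <= s -> eball x r `<=` eball x s.
Proof. by move=> rs y; rewrite /eball/= => /lt_le_trans; exact. Qed.

(** The library's [bounded_set] refers to the sup norm, which the Euclidean norm dominates. *)
Lemma bounded_set_enorm A M : (forall x, A x -> enorm x <= M) -> bounded_set A.
Proof.
move=> AM; exists M; split; first exact: num_real.
move=> N MN x Ax; rewrite /= (_ : `|x| = mx_norm x)// mx_normrE.
apply/bigmax_leP; split => [|[i j] _] /=.
  by rewrite (le_trans _ (ltW MN))// (le_trans (enorm_ge0 x))// AM.
rewrite (ord1 i) (le_trans (coord_le_enorm _ _))//.
by rewrite (le_trans (AM _ Ax))// ltW.
Qed.

Lemma compact_enorm A M : closed A -> (forall x, A x -> enorm x <= M) -> compact A.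
Proof. by move=> cA AM; apply: bounded_closed_compact => //; exact: bounded_set_enorm AM. Qed.

End enorm.

Section edist.
Context {R : realType} {n : nat}.
Variable A : set 'rV[R]_n.
Hypothesis A0 : A !=set0.
Implicit Types (x y z : 'rV[R]_n).
Local Notation de := (edist A).

Let D0 z : [set enorm (z - y) | y in A] !=set0.
Proof. by have [a Aa] := A0; exists (enorm (z - a)), a. Qed.

Let Dlb z : has_lbound [set enorm (z - y) | y in A].
Proof. by exists 0 => _ [y _ <-]; exact: enorm_ge0. Qed.

Lemma edist_ge0 z : 0 <= de z.
Proof. by apply: lb_le_inf => // _ [y _ <-]; exact: enorm_ge0. Qed.

Lemma edist_le z y : A y -> de z <= enorm (z - y).
Proof. by move=> Ay; apply: ge_inf => //; exists y. Qed.

Lemma edist_adherent z e : de z < e -> exists2 y, A y & enorm (z - y) < e.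
Proof.
move=> ze; have [||_ [y Ay <-]] := @inf_adherent _ [set enorm (z - y) | y in A] (e - de z).
- by rewrite subr_gt0.
- by split.
- by rewrite -/(edist A z) [edist A z + _]addrC subrK => ?; exists y.
Qed.

Lemma edist_lip x y : de x <= de y + enorm (x - y).
Proof.
apply/ler_addgt0Pr => e e0.
have [|a Aa ya] := @edist_adherent y (de y + e); first by rewrite ltrDl.
rewrite (le_trans (edist_le _ Aa))// (le_trans (enorm_distD y _ _))//; lra.
Qed.

Lemma edist_lip2 x y : `|de x - de y| <= enorm (x - y).
Proof.
by have := edist_lip x y; have := edist_lip y x; rewrite ler_norml (enormB y x); lra.
Qed.

Lemma edist_mem x : A x -> de x = 0.
Proof.
move=> Ax; apply/eqP; rewrite eq_le edist_ge0 andbT.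
by rewrite (le_trans (edist_le _ Ax))// subrr enorm0.
Qed.

Lemma edist_continuous : continuous de.
Proof.
move=> x; apply/(@cvgrPdist_lt _ _ _ _ (nbhs_filter x)) => e e0.
apply: (@filterS _ (nbhs x) _ _ _ _ (nbhs_eball x e0)) => y.
by rewrite /eball/= -enormB => ?; rewrite (le_lt_trans (edist_lip2 _ _)).
Qed.

Lemma edist_gt0 x : closed A -> ~ A x -> 0 < de x.
Proof.
move=> cA nAx; rewrite lt_neqAle edist_ge0 andbT; apply/negP => /eqP d0.
have : nbhs x (~` A) by apply: open_nbhs_nbhs; split => //; exact: closed_openC.
move=> /nbhs_eballP[r r0 rA].
have [y Ay] := @edist_adherent x r (ltac:(by rewrite -d0)).
by rewrite enormB => /rA.
Qed.

End edist.

(** * Measurability and Lebesgue measure on R^n *)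

Section measurable_rV.
Context {R : realType} {n : nat} {d : measure_display} {T : measurableType d}.
Local Notation V := 'rV[R]_n.

Lemma continuous_measurable_rV (f : V -> R) : continuous f -> measurable_fun setT f.
Proof.
move=> /continuousP cf; apply: (measurability _ (RGenOpens.measurableE R)).
move=> _ [_ [a [b ->]] <-]; rewrite setTI; apply: open_measurable_rV.
exact/cf/interval_open.
Qed.

Lemma measurable_rVcoord (f : T -> V) i :
  measurable_fun setT f -> measurable_fun setT (fun t => f t 0 i).
Proof. by move=> mf; exact: (measurableT_comp (measurable_coord i) mf). Qed.

Lemma measurable_rVD (f g : T -> V) : measurable_fun setT f ->
  measurable_fun setT g -> measurable_fun setT (fun t => f t + g t).
Proof.
move=> mf mg; apply: measurable_fun_rVP => i; under eq_fun do rewrite mxE.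
by apply: measurable_funD; exact: measurable_rVcoord.
Qed.

Lemma measurable_rVZ (c : T -> R) (g : T -> V) : measurable_fun setT c ->
  measurable_fun setT g -> measurable_fun setT (fun t => c t *: g t).
Proof.
move=> mf mg; apply: measurable_fun_rVP => i; under eq_fun do rewrite mxE.
by apply: measurable_funM => //; exact: measurable_rVcoord.
Qed.

Lemma measurable_rVN (g : T -> V) :
  measurable_fun setT g -> measurable_fun setT (fun t => - g t).
Proof.
by move=> mg; under eq_fun do rewrite -scaleN1r; apply: measurable_rVZ.
Qed.

Lemma measurable_rVB (f g : T -> V) : measurable_fun setT f ->
  measurable_fun setT g -> measurable_fun setT (fun t => f t - g t).
Proof. by move=> mf mg; apply: measurable_rVD => //; exact: measurable_rVN. Qed.

Lemma measurable_enorm (f : T -> V) : measurable_fun setT f ->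
  measurable_fun setT (fun t => enorm (f t)).
Proof.
by move=> mf; apply: measurableT_comp mf; apply: continuous_measurable_rV;
   exact: enorm_continuous.
Qed.

Lemma measurable_edist (A : set V) (f : T -> V) : A !=set0 ->
  measurable_fun setT f -> measurable_fun setT (fun t => edist A (f t)).
Proof.
by move=> A0 mf; apply: measurableT_comp mf; apply: continuous_measurable_rV;
   exact: edist_continuous.
Qed.

End measurable_rV.

Section affine.
Context {R : realType}.
Local Open Scope ereal_scope.

(** Uniqueness of Lebesgue measure: c times its image under x -> a + c x agrees with it on half-open
    intervals, so the integral transforms as one against a scaled pushforward. *)
Lemma ge0_integral_affine1 (a c : R) (f : R -> \bar R) : (0 < c)%R ->
  measurable_fun setT f -> (forall x, 0 <= f x) ->
  \int[lebesgue_measure]_x f (a + c * x)%R =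
  (c^-1)%:E * \int[lebesgue_measure]_x f x.
Proof.
move=> c0 mf f0.
have mphi : measurable_fun [set: measurableTypeR R] (fun x : measurableTypeR R => a + c * x : measurableTypeR R)%R.
  by apply: measurable_funD => //; apply: measurable_funM.
pose mu := mscale (NngNum (ltW c0)) (pushforward (@lebesgue_measure R) (fun x : measurableTypeR R => a + c * x : measurableTypeR R)%R).
have E A : measurable A -> lebesgue_measure A = mu mphi A.
  apply: lebesgue_measure_unique => _ [[x y] _ <-].
  transitivity (c%:E * lebesgue_measure (`]((x - a) / c)%R, ((y - a) / c)%R]%classic : set R)); last first.
    rewrite /mu /mscale/= /pushforward; congr (_ * lebesgue_measure _).
    by apply/seteqP; split => t /=; rewrite !in_itv/= ltr_pdivrMr// ler_pdivlMr// (mulrC t) ltrBlDl lerBrDl//.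
  rewrite !lebesgue_measure_itv/= !lte_fin ltr_pM2r ?invr_gt0// ltrD2r.
  case: ifPn => [xy|]; last by rewrite mule0.
  by rewrite -!EFinB -EFinM -mulrBl mulrC; congr (_%:E); field; rewrite gt_eqF.
have -> : \int[lebesgue_measure]_x f x = \int[mu mphi]_x f x.
  by apply: eq_measure_integral => A mA _; exact: E.
rewrite ge0_integral_mscale//= ge0_integral_pushforward//=.
by rewrite muleA -EFinM mulVf ?gt_eqF// mul1e preimage_setT.
Qed.

Lemma ge0_integral_rVS n (f : 'rV[R]_n.+1 -> \bar R) :
  measurable_fun setT f -> (forall x, 0 <= f x) ->
  \int[lebesgue_rV R n.+1]_x f x =
  \int[lebesgue_measure]_t \int[lebesgue_rV R n]_y f (cons_rV (t, y)).
Proof.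
move=> mf f0.
rewrite (_ : \int[lebesgue_rV R n.+1]_x f x =
  \int[pushforward (lebesgue_measure \x lebesgue_rV R n) (@cons_rV R n)]_x f x)//.
rewrite ge0_integral_pushforward//=; last exact: measurable_cons_rV.
rewrite preimage_setT fubini_tonelli1//=.
by apply: measurableT_comp => //; exact: measurable_cons_rV.
Qed.

(** Induction on [n]: [lebesgue_rV] is built one coordinate at a time, and by Tonelli each
    coordinate contributes one factor c^-1 of the one-dimensional formula. *)
Lemma ge0_integral_affine n (a : 'rV[R]_n) (c : R) (f : 'rV[R]_n -> \bar R) :
  (0 < c)%R -> measurable_fun setT f -> (forall x, 0 <= f x) ->
  \int[lebesgue_rV R n]_x f (a + c *: x)%R =
  (c ^- n)%:E * \int[lebesgue_rV R n]_x f x.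
Proof.
move=> c0; elim: n a f => [|n IH] a f mf f0.
  rewrite expr0 invr1 mul1e; apply: eq_integral => x _.
  by congr f; apply/rowP => -[].
have maff m (b : 'rV[R]_m) : measurable_fun [set: 'rV[R]_m] (fun x => b + c *: x)%R.
  by apply: measurable_rVD => //; apply: measurable_rVZ.
rewrite !ge0_integral_rVS//; last by apply: (measurableT_comp mf); exact: maff.
have mg : measurable_fun [set: measurableTypeR R * 'rV[R]_n] (f \o (@cons_rV R n)).
  by apply: measurableT_comp => //; exact: measurable_cons_rV.
pose b := \row_j a 0%R (lift ord0 j).
transitivity (\int[lebesgue_measure]_t \int[lebesgue_rV R n]_y f (cons_rV ((a 0 ord0 + c * t)%R, b + c *: y)%R)).
  apply: eq_integral => t _; apply: eq_integral => y _; congr f.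
  apply/rowP => i; rewrite mxE [X in (_ + X)%R]mxE.
  case: (unliftP ord0 i) => [j|] ->; last by rewrite !cons_rV0.
  by rewrite !cons_rVS/= !mxE.
have m2 t : measurable_fun setT (fun y => f (cons_rV (t, y))).
  by apply: (measurableT_comp mg); exact: measurable_pair1.
under eq_integral => t _ do rewrite (IH b (fun y => f (cons_rV ((a 0 ord0 + c * t)%R, y)))) //.
have m3 : measurable_fun [set: measurableTypeR R] (fun t : measurableTypeR R => \int[lebesgue_rV R n]_y f (cons_rV (t, y))).
  exact: (measurable_fun_fubini_tonelli_F _ mg (fun=> f0 _)).
rewrite (ge0_integral_affine1 (a 0 ord0)%R (f := fun t => (c ^- n)%:E * \int[lebesgue_rV R n]_y f (cons_rV (t, y))))//.
- rewrite ge0_integralZl//; last 2 first.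
  by move=> ? _; exact: integral_ge0.
  by rewrite lee_fin invr_ge0 exprn_ge0// ltW.
  by rewrite muleA -EFinM exprS invfM.
- exact: measurable_funeM.
- move=> t; rewrite mule_ge0//; last exact: integral_ge0.
  by rewrite lee_fin invr_ge0 exprn_ge0// ltW.
Qed.

Lemma ge0_integral_shift n (a : 'rV[R]_n) (f : 'rV[R]_n -> \bar R) :
  measurable_fun setT f -> (forall x, 0 <= f x) ->
  \int[lebesgue_rV R n]_x f (a + x)%R = \int[lebesgue_rV R n]_x f x.
Proof.
move=> mf f0; have := ge0_integral_affine a (@ltr01 R) mf f0.
by under eq_integral do rewrite scale1r; rewrite expr1n invr1 mul1e.
Qed.

End affine.

Section ball_volume.
Context {R : realType}.
Local Open Scope ereal_scope.

Definition ball_vol (n : nat) : R := fine (lebesgue_rV R n (eball 0 1)).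

Let cube n (r : R) := [set x : 'rV[R]_n | forall i, x 0%R i \in `](- r)%R, r[ ].

Let cubeE n (r : R) : (0 < r)%R -> lebesgue_rV R n (@cube n r) = ((2 * r) ^+ n)%:E.
Proof.
move=> r0; rewrite /cube (lebesgue_rV_prod (A := fun=> `](- r)%R, r[%classic))//.
rewrite lebesgue_measure_itv/= lte_fin gtrN// -EFinB opprK (_ : r + r = 2 * r)%R; last by ring.
by rewrite (prodEFin _ xpredT (fun=> 2 * r)%R) prodr_const card_ord.
Qed.

Let mcube n r : measurable (@cube n r).
Proof.
rewrite (_ : @cube n r = \bigcap_(i in [set: 'I_n])
      ((fun x : 'rV[R]_n => x 0%R i) @^-1` `](- r)%R, r[%classic)); last first.
  by apply/seteqP; split=> [x h i _|x h i]; exact: h.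
apply: fin_bigcap_measurable => // i _.
by rewrite -[X in measurable X]setTI; exact: (@measurable_coord R n i).
Qed.

Lemma ball_volE n : lebesgue_rV R n (eball 0 1) = (ball_vol n)%:E.
Proof.
rewrite fineK// ge0_fin_numE//; apply: (@le_lt_trans _ _ (lebesgue_rV R n (@cube n 1))).
  apply: le_measure; rewrite ?inE; [exact: measurable_eball|exact: mcube|].
  move=> x; rewrite /eball/= subr0 => x1 i; rewrite in_itv/= -ltr_norml.
  by rewrite (le_lt_trans (coord_le_enorm _ _)).
by rewrite cubeE ?ltry.
Qed.

Lemma ball_vol_gt0 n : (0 < ball_vol n)%R.
Proof.
rewrite -lte_fin -ball_volE.
have e0 : (0 < n.+1%:R^-1 :> R)%R by rewrite invr_gt0.
(* The half-side 1/(n+1) keeps the sum of the moduli of the n coordinates strictly below 1, also for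
   n = 0. *)
apply: (@lt_le_trans _ _ (lebesgue_rV R n (@cube n n.+1%:R^-1))).
  by rewrite cubeE// lte_fin exprn_gt0// mulr_gt0.
apply: le_measure; rewrite ?inE; [exact: mcube|exact: measurable_eball|].
move=> x xc; rewrite /eball/= subr0 (le_lt_trans (enorm_le_sum _))//.
apply: (@le_lt_trans _ _ (\sum_(i < n) (n.+1%:R^-1 : R))%R).
  by apply: ler_sum => i _; move: (xc i); rewrite in_itv/= -ltr_norml => /ltW.
by rewrite sumr_const card_ord -[ltLHS]mulr_natr mulrC ltr_pdivrMr// mul1r ltr_nat.
Qed.

Lemma lebesgue_eball n (x : 'rV[R]_n) r : (0 < r)%R ->
  lebesgue_rV R n (eball x r) = (ball_vol n * r ^+ n)%:E.
Proof.
move=> r0; have mf : measurable_fun setT (fun y => (\1_(eball x r) y)%:E : \bar R).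
  by apply/measurable_EFinP; apply: measurable_indic; exact: measurable_eball.
have := ge0_integral_affine x r0 mf.
rewrite [X in (_ -> X = _) -> _](_ : _ = (ball_vol n)%:E); last first.
  transitivity (\int[lebesgue_rV R n]_y (\1_(eball 0 1) y)%:E); last first.
    by rewrite integral_indic; [rewrite setIT; exact: ball_volE|by []|exact: measurable_eball].
  apply: eq_integral => y _; rewrite !indicE.
  have -> // : ((x + r *: y)%R \in eball x r) = (y \in eball 0 1).
  by apply/idP/idP; rewrite !inE /eball/= addrAC subrr add0r subr0 enormZ gtr0_norm// -{2}(mulr1 r) ltr_pM2l.
rewrite integral_indic; [rewrite setIT|by []|exact: measurable_eball].
move=> /(_ (fun=> (ltac:(by rewrite lee_fin)))) E.
rewrite mulrC EFinM E.
by rewrite muleA -EFinM mulfV ?mul1e// expf_neq0// gt_eqF.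
Qed.

End ball_volume.

(** * Hausdorff measure *)

Section hausdorff_outer.
Context {R : realType} {n : nat} (s : R).
Hypothesis s0 : 0 < s.
Implicit Types (A B : set 'rV[R]_n).
Local Open Scope ereal_scope.

Lemma hausdorff_size_ge0 e A : 0 <= hausdorff_size s e A.
Proof.
apply/ereal_infP => _ [F _ <-]; apply: nneseries_ge0 => k _ _; exact: poweR_ge0.
Qed.

Lemma hausdorff_size_le_hausdorff e A : (0 < e)%R ->
  hausdorff_size s e A <= hausdorff s A.
Proof. by move=> e0; apply: ereal_sup_ubound; exists e. Qed.

Lemma hausdorff_ge0 A : 0 <= hausdorff s A.
Proof.
by apply: le_trans (hausdorff_size_le_hausdorff A ltr01); exact: hausdorff_size_ge0.
Qed.

Lemma hausdorff_sizeS e A B : A `<=` B ->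
  hausdorff_size s e A <= hausdorff_size s e B.
Proof.
move=> AB; apply/ereal_infP => _ [F [BF Fe] <-]; apply: ereal_inf_lbound.
by exists F => //; split => //; exact: subset_trans BF.
Qed.

Lemma hausdorffS A B : A `<=` B -> hausdorff s A <= hausdorff s B.
Proof.
move=> AB; apply/ereal_supP => _ [e e0 <-].
exact: le_trans (hausdorff_sizeS e AB) (hausdorff_size_le_hausdorff B e0).
Qed.

Lemma hausdorff_size_mono e e' A : (e <= e')%R ->
  hausdorff_size s e' A <= hausdorff_size s e A.
Proof.
move=> ee; apply/ereal_infP => _ [F [BF Fe] <-]; apply: ereal_inf_lbound.
by exists F => //; split => // k; rewrite (le_trans (Fe k))// lee_fin.
Qed.

(** Covers of the [A k] that are optimal up to h/2^(k+1) are merged into one sequence by a bijection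
    between nat and pairs. An [A k] of infinite size is set apart first, as it has no near-optimal
    cover in this sense. *)
Lemma hausdorff_size_subadditive e (A : nat -> set 'rV[R]_n) :
  hausdorff_size s e (\bigcup_k A k) <= \sum_(k <oo) hausdorff_size s e (A k).
Proof.
have [[i ioo]|] := pselect (exists i, hausdorff_size s e (A i) = +oo).
  rewrite (eseries_pinfty _ _ ioo) ?leey// => k _.
  by rewrite -ltNye (lt_le_trans _ (hausdorff_size_ge0 _ _)).
rewrite -forallNE => Aoo; apply/lee_addgt0Pr => h h0.
apply: le_trans (epsilon_trick _ _ (ltW h0)); last by move=> k; exact: hausdorff_size_ge0.
have /choice[G PG] : forall k, exists F : nat -> set 'rV[R]_n,
    (A k `<=` \bigcup_j F j /\ forall j, ediam (F j) <= e%:E) /\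
    \sum_(j <oo) ediam (F j) `^ s <= hausdorff_size s e (A k) + (h / (2 ^ k.+1)%:R)%:E.
  move=> k; have fk : hausdorff_size s e (A k) \is a fin_num.
    rewrite ge0_fin_numE ?hausdorff_size_ge0//.
    by rewrite ltNge leye_eq; apply/negP => /eqP; exact: Aoo.
  have hk : (0 < h / (2 ^ k.+1)%:R)%R by rewrite divr_gt0.
  have [_ [F FA <-] /ltW Fh] := lb_ereal_inf_adherent hk fk.
  by exists F.
have /card_esym/ppcard_eqP[f] := card_nat2.
pose dG (p : nat * nat) := ediam (G p.1 p.2) `^ s.
have dG0 p : 0 <= dG p by exact: poweR_ge0.
apply: (@le_trans _ _ (\sum_(i <oo) dG (f i))).
  apply: ereal_inf_lbound; exists (fun i => G (f i).1 (f i).2) => //; split => [x [k _ Akx]|k].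
    have [j _ Gx] := (PG k).1.1 _ Akx.
    by exists (f^-1%FUN (k, j)) => //; rewrite invK ?inE.
  exact: (PG _).1.2.
have -> : \sum_(i <oo) dG (f i) = \esum_(i in [set: nat]) dG (f i) by exact: nneseries_esumT.
rewrite -(@reindex_esum _ _ _ setT setT f dG)//.
have -> : [set: nat * nat] = setT `*`` (fun=> setT).
  by apply/seteqP; split.
rewrite (_ : (fun j => dG j) = (fun k => dG (k.1, k.2))); last by apply/funext => -[].
rewrite -(esum_esum (a := fun k j => dG (k, j)))//.
rewrite -nneseries_esumT; last by move=> k; exact: esum_ge0.
apply: lee_nneseries => k; first by move=> _ _; exact: esum_ge0.
move=> _; rewrite -nneseries_esumT//.
exact: (PG k).2.
Qed.

Lemma hausdorff_subadditive (A : nat -> set 'rV[R]_n) :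
  hausdorff s (\bigcup_k A k) <= \sum_(k <oo) hausdorff s (A k).
Proof.
apply/ereal_supP => _ [e e0 <-].
apply: le_trans (hausdorff_size_subadditive _ _) _.
apply: lee_nneseries => k; first by move=> _ _; exact: hausdorff_size_ge0.
by move=> _; exact: hausdorff_size_le_hausdorff.
Qed.

Lemma ediam0 : ediam (@set0 'rV[R]_n) = 0.
Proof.
rewrite /ediam; apply/max_idPl.
rewrite (_ : [set _ | x in _ & y in _] = set0) ?ereal_sup0 ?leNye//.
by apply/seteqP; split => // z [x []].
Qed.

Lemma hausdorff_size0 e : (0 < e)%R -> hausdorff_size s e (@set0 'rV[R]_n) = 0.
Proof.
move=> e0; apply/eqP; rewrite eq_le hausdorff_size_ge0 andbT.
apply: ereal_inf_lbound; exists (fun=> set0); first by split => // k; rewrite ediam0 lee_fin ltW.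
by rewrite eseries0// => k _ _; rewrite ediam0 poweR0r// gt_eqF.
Qed.

Lemma hausdorff0 : hausdorff s (@set0 'rV[R]_n) = 0.
Proof.
apply/eqP; rewrite eq_le hausdorff_ge0 andbT; apply/ereal_supP => _ [e e0 <-].
by rewrite hausdorff_size0.
Qed.

Lemma hausdorffU A B : hausdorff s (A `|` B) <= hausdorff s A + hausdorff s B.
Proof.
rewrite -bigcup2E; apply: le_trans (hausdorff_subadditive _) _.
rewrite (nneseries_split 0 2) => [|k _]; last exact: hausdorff_ge0.
rewrite add0n big_nat_recr//= big_nat1/= eseries0 ?adde0// => -[|[|k]]//= _ _.
exact: hausdorff0.
Qed.

Lemma ediam_le_dist A x y : A x -> A y -> (enorm (x - y))%:E <= ediam A.
Proof.
move=> Ax Ay; rewrite /ediam le_max; apply/orP; right.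
by apply: ereal_sup_ubound; exists x => //; exists y.
Qed.

(** A covering set of diameter at most e < h cannot meet both [A] and [B], so a cover of the union
    splits into two. Discarded members become empty sets, which cost 0 because s > 0. This metric
    additivity takes the place of measurability. *)
Lemma hausdorff_size_separated e h A B : (e < h)%R ->
  (forall x y, A x -> B y -> (h <= enorm (x - y))%R) ->
  hausdorff_size s e A + hausdorff_size s e B <= hausdorff_size s e (A `|` B).
Proof.
move=> eh hAB; apply/ereal_infP => _ [F [ABF Fe] <-].
pose FA k := if pselect (F k `&` A !=set0) then F k else set0.
pose FB k := if pselect (F k `&` A !=set0) then set0 else F k.
apply: (@le_trans _ _ (\sum_(k <oo) ediam (FA k) `^ s + \sum_(k <oo) ediam (FB k) `^ s)).
  apply: leeD; apply: ereal_inf_lbound; [exists FA|exists FB] => //; split.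
  - move=> x Ax; have [k _ Fx] := ABF _ (or_introl Ax); exists k => //.
    by rewrite /FA; case: pselect => // h'; exfalso; apply: h'; exists x.
  - move=> k; rewrite /FA; case: pselect => ?; first exact: Fe.
    rewrite ediam0.
    by apply: le_trans (Fe k); rewrite /ediam le_max lexx.
  - move=> x Bx; have [k _ Fx] := ABF _ (or_intror Bx); exists k => //.
    rewrite /FB; case: pselect => // -[y [Fy Ay]].
    have := le_trans (ediam_le_dist Fy Fx) (Fe k).
    by rewrite lee_fin => /(le_lt_trans)/(_ eh); rewrite ltNge hAB.
  - move=> k; rewrite /FB; case: pselect => ?; last exact: Fe.
    rewrite ediam0.
    by apply: le_trans (Fe k); rewrite /ediam le_max lexx.
rewrite -nneseriesD; [|by move=> *; exact: poweR_ge0|by move=> *; exact: poweR_ge0].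
apply: lee_nneseries => k; first by move=> _ _; apply: adde_ge0; exact: poweR_ge0.
move=> _; rewrite /FA /FB; case: pselect => ?;
  by rewrite ediam0 poweR0r ?gt_eqF// ?adde0 ?add0e.
Qed.

(** Sizes increase as the scale decreases, so one scale m serves both lower bounds; h/2 enters its
    definition because the scale has to be strictly below the separation h. *)
Lemma hausdorff_separated (a b h : R) A B : (0 < h)%R ->
  (forall x y, A x -> B y -> (h <= enorm (x - y))%R) ->
  a%:E <= hausdorff s A -> b%:E <= hausdorff s B ->
  (a + b)%:E <= hausdorff s (A `|` B).
Proof.
move=> h0 hAB aA bB; apply/lee_addgt0Pr => e e0.
have aA' : (a - e / 2)%:E < hausdorff s A.
  by apply: lt_le_trans aA; rewrite lte_fin ltrBlDr ltrDl divr_gt0.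
have bB' : (b - e / 2)%:E < hausdorff s B.
  by apply: lt_le_trans bB; rewrite lte_fin ltrBlDr ltrDl divr_gt0.
have [_ [e1 e10 <-] aA1] := ereal_sup_gt aA'.
have [_ [e2 e20 <-] bB1] := ereal_sup_gt bB'.
pose m : R := (Num.min (h / 2) (Num.min e1 e2))%R.
have m0 : (0 < m)%R by rewrite !lt_min e10 e20 divr_gt0.
rewrite -leeBlDr// -EFinB.
apply: (@le_trans _ _ (hausdorff_size s m A + hausdorff_size s m B)).
  rewrite (_ : a + b - e = (a - e / 2) + (b - e / 2))%R; last by field.
  rewrite EFinD; apply: leeD.
    by apply: le_trans (ltW aA1) _; apply: hausdorff_size_mono; rewrite !ge_min lexx !orbT.
  by apply: le_trans (ltW bB1) _; apply: hausdorff_size_mono; rewrite !ge_min lexx !orbT.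
apply: le_trans (hausdorff_size_le_hausdorff _ m0).
apply: (hausdorff_size_separated _ hAB).
by rewrite gt_min; apply/orP; left; rewrite ltr_pdivrMr//; lra.
Qed.

End hausdorff_outer.

(** * Maximal separated families *)

Section packing.
Context {R : realType} {n : nat}.
Local Notation V := 'rV[R]_n.

Definition separated (rho : R) (s : seq V) := pairwise (fun p q => rho <= enorm (p - q)) s.

(** The uniform bound [K] yields a separated family of largest size; a point of [P] at distance at
    least rho from all its members could be added to it. *)
Lemma maximal_separated (P : set V) (rho : R) (K : nat) :
  (forall s, separated rho s -> (forall p, p \in s -> P p) -> (size s <= K)%N) ->
  exists s, [/\ separated rho s, forall p, p \in s -> P p &
    P `<=` \bigcup_(p in [set` s]) eball p rho].
Proof.
move=> PK.
pose Q k := `[< exists s, [/\ separated rho s, forall p, p \in s -> P p & size s = k] >].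
have Q0 : exists k, Q k by exists 0%N; apply/asboolP; exists [::].
have QK k : Q k -> (k <= K)%N by move=> /asboolP[s [ss sP <-]]; exact: PK.
case: (ex_maxnP Q0 QK) => k /asboolP[s [ss sP sk]] kmax; exists s; split => // x Px.
apply: contrapT => nx.
have : Q k.+1.
  apply/asboolP; exists (x :: s); split; last by rewrite /= sk.
  - rewrite /separated/= [pairwise _ _]ss andbT; apply/allP => p ps; rewrite leNgt; apply/negP => xp.
    by apply: nx; exists p.
  - by move=> p; rewrite inE => /predU1P[->//|]; exact: sP.
by move=> /kmax; rewrite ltnn.
Qed.

End packing.

(** * Ahlfors regular sets *)

Lemma dyadic_bracket {R : realType} (t r : R) : 0 < t < r ->
  exists k : nat, r / (2 ^ k.+1)%:R <= t < r / (2 ^ k)%:R.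
Proof.
move=> /andP[t0 tr]; have r0 : 0 < r by exact: lt_trans tr.
pose P k := r / (2 ^ k)%:R <= t.
have exP : exists k, P k.
  exists (Num.bound (r / t)); rewrite /P ler_pdivrMr ?ltr0n ?expn_gt0// mulrC -ler_pdivrMr//.
  rewrite (le_trans (ltW (archi_boundP _)))// ?divr_ge0 ?(ltW r0) ?(ltW t0)//.
  by rewrite ler_nat ltnW// ltn_expl.
have := ex_minnP exP => -[[|k]] Pk kmin.
  by move: Pk; rewrite /P expn0 divr1 leNgt tr.
exists k; rewrite [_ <= t]Pk/= ltNge; apply/negP => /kmin.
by rewrite ltnn.
Qed.

Lemma powRV {R : realType} (x p : R) : 0 <= x -> x^-1 `^ p = (x `^ p)^-1.
Proof. by move=> x0; rewrite -(powR_inv1 x0) -powRrM mulN1r powRN. Qed.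

Lemma bigcup_cons {T : eqType} {U} (F : T -> set U) p s :
  \bigcup_(q in [set` p :: s]) F q = F p `|` \bigcup_(q in [set` s]) F q.
Proof.
apply/seteqP; split => x.
  move=> [q /=]; rewrite inE => /predU1P[->|qs] Fx; first by left.
  by right; exists q.
by move=> [Fx|[q qs Fx]]; [exists p|exists q] => //=; rewrite inE ?eqxx// qs orbT.
Qed.

Section ahlfors.
Context {R : realType} {n : nat} (d : R) (Gam : set 'rV[R]_n) (C0 : R).
Local Notation V := 'rV[R]_n.
Local Notation L := (lebesgue_rV R n).
Local Notation de := (edist Gam).
Hypotheses (d0 : 0 < d) (Gam0 : Gam !=set0) (Gamc : closed Gam) (C01 : 1 <= C0).
Hypothesis reg : forall x r, Gam x -> 0 < r ->
  ((C0^-1 * r `^ d)%:E <= hausdorff d (Gam `&` eball x r))%E /\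
  (hausdorff d (Gam `&` eball x r) <= (C0 * r `^ d)%:E)%E.

Let C00 : 0 < C0. Proof. exact: lt_le_trans C01. Qed.

(** The balls of radius rho/3 about rho-separated centres are at mutual distance at least rho/3, so
    the lower regularity bounds of the pieces add up. *)
Lemma separated_hausdorff_ge rho s : 0 < rho -> separated rho s ->
  (forall p, p \in s -> Gam p) ->
  (((size s)%:R * (C0^-1 * (rho / 3) `^ d))%:E <=
   hausdorff d (\bigcup_(p in [set` s]) (Gam `&` eball p (rho / 3))))%E.
Proof.
move=> rho0; have r30 : 0 < rho / 3 by rewrite divr_gt0.
elim: s => [|p s IH]; first by rewrite mul0r hausdorff_ge0.
rewrite /separated/= => /andP[/allP ps ss] sG.
rewrite bigcup_cons -natr1 mulrDl mul1r addrC.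
apply: (@hausdorff_separated _ _ _ d0 _ _ (rho / 3)) => //.
- move=> x y [_ xp] [q /= qs [_ yq]].
  have := ps _ qs; move: xp yq; rewrite /eball/=.
  move=> xp yq pq; have := enorm_distD x p q; have := enorm_distD y x q.
  by rewrite (enormB p x); lra.
- by have [] := reg (sG p (mem_head _ _)) r30.
- by apply: IH => // q qs; apply: sG; rewrite inE qs orbT.
Qed.

(** Since rho <= 3r, the pieces of radius rho/3 lie in the ball of radius 2r; their lower regularity
    is weighed against the upper regularity of that ball, and 6r/rho = 2r/(rho/3). *)
Lemma packing_bound x r rho s : Gam x -> 0 < rho <= 3 * r -> separated rho s ->
  (forall p, p \in s -> (Gam `&` eball x r) p) ->
  (size s)%:R <= C0 ^+ 2 * (6 * r / rho) `^ d.
Proof.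
move=> Gx /andP[rho0 rhor] ss sG; have r0 : 0 < r by lra.
have := separated_hausdorff_ge rho0 ss (fun p ps => (sG p ps).1).
have sub : \bigcup_(p in [set` s]) (Gam `&` eball p (rho / 3)) `<=` Gam `&` eball x (2 * r).
  move=> y [p /= ps [Gy yp]]; split => //; have [_] := sG _ ps.
  by move: yp; rewrite /eball/=; have := enorm_distD p y x; lra.
have r20 : 0 < 2 * r by lra.
move=> /le_trans/(_ (hausdorffS d sub)) /le_trans/(_ (reg Gx r20).2).
have p0 : 0 < C0^-1 * (rho / 3) `^ d by rewrite mulr_gt0 ?invr_gt0// powR_gt0// divr_gt0.
rewrite lee_fin -ler_pdivlMr// => /le_trans; apply.
rewrite (_ : 6 * r / rho = (2 * r) * (rho / 3)^-1); last by field; rewrite gt_eqF.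
have e1 : 0 <= (rho / 3)^-1 by rewrite invr_ge0 divr_ge0 ?(ltW rho0).
rewrite (powRM _ (ltW r20) e1).
rewrite powRV ?divr_ge0 ?(ltW rho0)// le_eqVlt; apply/orP; left; apply/eqP.
by field; rewrite !gt_eqF// powR_gt0// divr_gt0.
Qed.

Lemma ahlfors_cover x r rho : Gam x -> 0 < rho <= 3 * r ->
  exists s, [/\ (size s)%:R <= C0 ^+ 2 * (6 * r / rho) `^ d,
    forall p, p \in s -> (Gam `&` eball x r) p &
    Gam `&` eball x r `<=` \bigcup_(p in [set` s]) eball p rho].
Proof.
move=> Gx rr; set b := C0 ^+ 2 * _.
have b0 : 0 <= b by rewrite mulr_ge0 ?powR_ge0// exprn_ge0// ltW.
have [|s [ss sG Gs]] := @maximal_separated _ _ (Gam `&` eball x r) rho (Num.bound b).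
  move=> s ss sG; rewrite -(ler_nat R) (le_trans (packing_bound Gx rr ss sG))//.
  by rewrite ltW// archi_boundP.
by exists s; split => //; exact: packing_bound Gx rr ss sG.
Qed.

Lemma lebesgue_bigcup_eball_le (s : seq V) rho : 0 < rho ->
  (L (\bigcup_(p in [set` s]) eball p rho) <= ((size s)%:R * (ball_vol n * rho ^+ n))%:E)%E.
Proof.
move=> rho0; elim: s => [|p s IH].
  by rewrite mul0r set_nil bigcup_set0 measure0.
rewrite bigcup_cons -natr1 mulrDl mul1r addrC EFinD.
apply: le_trans (measureU2 _ _ _) _; first exact: measurable_eball.
  by apply: open_measurable_rV; apply: bigcup_open => q _; exact: eball_open.
by apply: leeD => //; rewrite [X in (X <= _)%E]lebesgue_eball.
Qed.

Lemma measurable_edist_lt rho : measurable [set z | de z < rho].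
Proof.
apply: open_measurable_rV.
by have /continuousP /(_ _ (@open_lt R rho)) := edist_continuous Gam0.
Qed.

(** A point of B(x,r) within rho <= r of [Gam] has a nearby point of [Gam] in B(x,2r). About
    (r/rho)^d balls of radius rho cover that part of [Gam], their doubles cover the neighborhood,
    and each double has volume of order rho^n. *)
Lemma neighborhood_volume x r rho : Gam x -> 0 < rho <= r ->
  (L (eball x r `&` [set z | (de z < rho)%R]) <=
   (C0 ^+ 2 * 12 `^ d * 2 ^+ n * ball_vol n * (r `^ d * rho `^ (n%:R - d)))%:E)%E.
Proof.
move=> Gx /andP[rho0 rhor]; have r0 : 0 < r by lra.
have rr : 0 < rho <= 3 * (2 * r) by lra.
have [s [ss sG Gs]] := ahlfors_cover Gx rr.
have r20 : 0 < 2 * rho by lra.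
have sub : eball x r `&` [set z | de z < rho] `<=` \bigcup_(p in [set` s]) eball p (2 * rho).
  move=> z [xz /= /(edist_adherent Gam0)[y Gy zy]].
  have /Gs[p ps py] : (Gam `&` eball x (2 * r)) y.
    by split => //; move: xz; rewrite /eball/=; have := enorm_distD z y x; rewrite (enormB y z); lra.
  by exists p => //; move: py; rewrite /eball/=; have := enorm_distD y z p; lra.
apply: (@le_trans _ _ (L (\bigcup_(p in [set` s]) eball p (2 * rho)))).
  apply: le_measure => //; rewrite inE.
    by apply: measurableI; [exact: measurable_eball|exact: measurable_edist_lt].
  by apply: open_measurable_rV; apply: bigcup_open => q _; exact: eball_open.
apply: le_trans (lebesgue_bigcup_eball_le s r20) _.
rewrite lee_fin; apply: le_trans (ler_wpM2r _ ss) _.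
  by rewrite mulr_ge0 ?exprn_ge0 ?(ltW r20)// ltW// ball_vol_gt0.
rewrite (_ : 6 * (2 * r) / rho = 12 * r * rho^-1); last by field; rewrite gt_eqF.
rewrite !powRM ?mulr_ge0 ?invr_ge0 ?(ltW r0) ?(ltW rho0)//.
rewrite powRD; last by rewrite (gt_eqF rho0) implybT.
rewrite powR_mulrn ?(ltW rho0)// powRV ?(ltW rho0)// powRN exprMn.
by rewrite le_eqVlt; apply/orP; left; apply/eqP; ring.
Qed.

End ahlfors.

(** * The weighted measure *)

Lemma ereal_small_le0 {R : realType} (x : \bar R) (c t0 : R) : 0 < t0 -> 0 <= c ->
  (forall t, 0 < t <= t0 -> (x <= (c * t)%:E)%E) -> (x <= 0)%E.
Proof.
move=> t00 c0 h; apply/lee_addgt0Pr => e e0; rewrite add0e.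
have c1 : 0 < c + 1 by lra.
have /h/le_trans : 0 < Num.min t0 (e / (c + 1)) <= t0.
  by rewrite ge_min lexx andbT lt_min t00 divr_gt0.
apply; rewrite lee_fin; apply: (@le_trans _ _ (c * (e / (c + 1)))).
  by rewrite ler_wpM2l// ge_min lexx orbT.
by rewrite mulrA ler_pdivrMr// mulrC ler_pM2l//; lra.
Qed.

Lemma nneseries_ge_term {R : realType} (f : nat -> \bar R) j :
  (forall k, (0 <= f k)%E) -> (f j <= \sum_(k <oo) f k)%E.
Proof.
move=> f0; apply: le_trans (nneseries_lim_ge j.+1 _); last by move=> k _ _; exact: f0.
by rewrite big_nat_recr//= leeDr// sume_ge0.
Qed.

Section weight.
Context {R : realType} {n : nat} (d : R) (Gam : set 'rV[R]_n).
Local Notation V := 'rV[R]_n.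
Local Notation L := (lebesgue_rV R n).
Local Notation de := (edist Gam).
Local Notation w := (weight d Gam).
Local Notation a := (n%:R - 1 - d).
Hypothesis Gam0 : Gam !=set0.

(** The form with the exponent [a], positive in the intended range. For a > 0 both sides are 0 on
    [Gam], by the convention that 0 is its own inverse. *)
Lemma weightE z : w z = (de z `^ a)^-1.
Proof. by rewrite /weight -powRN; congr (_ `^ _); ring. Qed.

Lemma weight_ge0 z : 0 <= w z. Proof. exact: powR_ge0. Qed.

Lemma measurable_weight : measurable_fun setT w.
Proof.
apply: (@measurableT_comp _ _ _ _ _ _ (fun t => t `^ (d + 1 - n%:R)) _ de).
  exact: measurable_powR.
by apply: continuous_measurable_rV; exact: edist_continuous.
Qed.

(* A doubling quantity comparable with m(B(x, s)); it is used in place of m(B(x, s)) since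
   it is explicit. *)
Definition ballm (x : V) (s : R) : R := s ^+ n * ((de x + s) `^ a)^-1.

Lemma ballm_gt0 x s : 0 < s -> 0 < ballm x s.
Proof.
move=> s0; rewrite mulr_gt0 ?exprn_gt0// invr_gt0 powR_gt0//.
by have := edist_ge0 Gam0 x; lra.
Qed.

Hypothesis (a0 : 0 < a).

Lemma weight_le c z : 0 < c <= de z -> w z <= (c `^ a)^-1.
Proof.
move=> /andP[c0 cz]; rewrite weightE lef_pV2 ?posrE ?powR_gt0//; last exact: lt_le_trans cz.
by rewrite ge0_ler_powR ?(ltW a0)// nnegrE ltW// (lt_le_trans c0).
Qed.

Lemma weight_ge c z : 0 < de z <= c -> (c `^ a)^-1 <= w z.
Proof.
move=> /andP[c0 cz]; rewrite weightE lef_pV2 ?posrE ?powR_gt0//; last exact: lt_le_trans cz.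
by rewrite ge0_ler_powR ?(ltW a0)// nnegrE ltW// (lt_le_trans c0).
Qed.

Variable C0 : R.
Hypotheses (d0 : 0 < d) (Gamc : closed Gam) (C01 : 1 <= C0).
Hypothesis reg : forall x r, Gam x -> 0 < r ->
  ((C0^-1 * r `^ d)%:E <= hausdorff d (Gam `&` eball x r))%E /\
  (hausdorff d (Gam `&` eball x r) <= (C0 * r `^ d)%:E)%E.

Let K := C0 ^+ 2 * 12 `^ d * 2 ^+ n * ball_vol n.

Let K0 : 0 <= K.
Proof.
have c0 := le_trans ler01 C01.
by rewrite /K !mulr_ge0 ?powR_ge0 ?exprn_ge0 ?(ltW (ball_vol_gt0 _)).
Qed.

Let nbv x r rho : Gam x -> 0 < rho <= r ->
  (L (eball x r `&` [set z | de z < rho]%R) <= (K * (r `^ d * rho `^ (n%:R - d)))%:E)%E.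
Proof. exact: neighborhood_volume. Qed.

(** Each bounded part of [Gam] lies in its t-neighborhood, of volume O(t^(n-d)); as n - d >= 1 this
    is O(t) for t <= 1. *)
Lemma lebesgue_ahlfors_eq0 : L Gam = 0%E.
Proof.
move: (K) K0 nbv => k k0 nbv'.
have mG : measurable Gam.
  by rewrite -(setCK Gam); apply: measurableC; apply: open_measurable_rV; exact: closed_openC.
have [x Gx] := Gam0.
have GU : Gam `<=` \bigcup_k (Gam `&` eball x k.+1%:R).
  move=> y Gy; exists (Num.truncn (enorm (y - x))) => //; split => //.
  exact: truncnS_gt.
apply/eqP; rewrite eq_le measure_ge0 andbT.
have mk j : measurable (Gam `&` eball x j.+1%:R).
  by apply: measurableI => //; exact: measurable_eball.
apply: (@le_trans _ _ (L (\bigcup_k (Gam `&` eball x k.+1%:R)))).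
  by apply: le_measure => //; rewrite inE//; exact: bigcup_measurable.
suff -> : L (\bigcup_k (Gam `&` eball x k.+1%:R)) = 0%E by [].
apply/eqP; rewrite eq_le measure_ge0 andbT.
apply: le_trans (measure_sigma_subadditive _ mk _ (@subset_refl _ _)) _.
  exact: bigcup_measurable.
rewrite eseries0// => j _ _; apply/eqP; rewrite eq_le measure_ge0 andbT.
apply: (@ereal_small_le0 _ _ (k * j.+1%:R `^ d) 1) => [//||t /andP[t0 t1]].
  by rewrite mulr_ge0 ?powR_ge0.
have tk : 0 < t <= j.+1%:R by rewrite t0 (le_trans t1)// ler1n.
apply: (@le_trans _ _ (k * (j.+1%:R `^ d * t `^ (n%:R - d)))%:E).
  apply: le_trans (le_measure _ _ _ _) (nbv' _ _ _ Gx tk).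
  - by rewrite inE.
  - by rewrite inE; apply: measurableI; [exact: measurable_eball|exact: measurable_edist_lt].
  - by move=> y [Gy yx]; split => //=; rewrite edist_mem.
have nd : 1 <= n%:R - d by have := a0; lra.
have tt : t `^ (n%:R - d) <= t by rewrite ge1r_powR// t0 t1.
by rewrite lee_fin -mulrA ler_wpM2l// ler_wpM2l// powR_ge0.
Qed.

(** Dyadic decomposition by the distance to [Gam]: where it is between r_j/2 and r_j = r/2^j, the
    weight is at most (r_j/2)^(-a), and the r_j-neighborhood has volume O(r^d r_j^(a+1)). The
    products r^d r_j form a geometric series. *)
Lemma wmeasure_eball_ahlfors x r : Gam x -> 0 < r ->
  (wmeasure d Gam (eball x r) <= (K * 2 `^ a * 2 * (r `^ d * r))%:E)%E.
Proof.
move: (K) K0 nbv => k k0 nbv'.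
move=> Gx r0; pose rj (j : nat) : R := r / (2 ^ j)%:R.
have rj0 j : 0 < rj j by rewrite divr_gt0// ltr0n expn_gt0.
pose f j z : \bar R := (((rj j.+1 `^ a)^-1)%:E * (\1_[set z | de z < rj j]%R z)%:E)%E.
have f0 j z : (0 <= f j z)%E by rewrite mule_ge0// lee_fin ?invr_ge0 ?powR_ge0.
have mi j : measurable_fun setT (fun z : V => (\1_[set z | de z < rj j]%R z)%:E : \bar R).
  by apply/measurable_EFinP; apply: measurable_indic; exact: measurable_edist_lt.
have mf j : measurable_fun setT (f j) by apply: measurable_funeM; exact: mi.
have mB : measurable (eball x r) by exact: measurable_eball.
apply: (@le_trans _ _ (\int[L]_(z in eball x r) \sum_(j <oo) f j z)%E).
  apply: ge0_le_integral => //.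
  - by move=> z _; rewrite lee_fin weight_ge0.
  - by apply: measurable_funTS; apply/measurable_EFinP; exact: measurable_weight.
  - by apply: ge0_emeasurable_fun_sum => // j _; apply: measurable_funTS; exact: mf.
  (* On [Gam] the weight is 0, so there is no dyadic shell to look for. *)
  move=> z xz; have [z0|z0] := eqVneq (de z) 0.
    by rewrite weightE z0 powR0 ?gt_eqF// invr0 nneseries_ge0.
  have zr : 0 < de z < r.
    rewrite lt_neqAle eq_sym z0 edist_ge0//=.
    exact: le_lt_trans (edist_le _ Gx) xz.
  have [j /andP[j1 j2]] := dyadic_bracket zr.
  apply: (@le_trans _ _ (f j z)).
    rewrite /f indicE mem_set ?mule1 ?lee_fin//.
    by apply: weight_le; rewrite rj0.
  exact: (@nneseries_ge_term _ (fun j => f j z)).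
rewrite integral_nneseries//; last by move=> j; apply: measurable_funTS; exact: mf.
(* The j-th term is bounded by k 2^a r^d r / 2^j; the extra factor 2 in the constant turns 2^j into
   the 2^(j+1) of this series. *)
apply: le_trans (epsilon_trick0 xpredT _); last first.
  by rewrite !mulr_ge0 ?powR_ge0// ltW.
apply: lee_nneseries => j; first by move=> _ _; exact: integral_ge0.
move=> _; rewrite ge0_integralZl//; last 2 first.
- by apply: measurable_funTS; exact: mi.
- by rewrite lee_fin invr_ge0 powR_ge0.
rewrite integral_indic//; last exact: measurable_edist_lt.
rewrite setIC; have jr : 0 < rj j <= r.
  by rewrite rj0 ler_pdivrMr ?ltr0n ?expn_gt0// ler_peMr ?(ltW r0)// ler1n expn_gt0.
apply: (@le_trans _ _ (((rj j.+1 `^ a)^-1)%:E * (k * (r `^ d * rj j `^ (n%:R - d)))%:E)%E).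
  by apply: lee_wpmul2l; [rewrite lee_fin invr_ge0 powR_ge0|exact: nbv'].
rewrite -EFinM lee_fin (_ : n%:R - d = a + 1); last by ring.
have -> : rj j `^ (a + 1) = rj j `^ a * rj j.
  by rewrite powRD ?(gt_eqF (rj0 _)) ?implybT// powRr1// ltW.
have E : rj j = 2 * rj j.+1 by rewrite /rj expnS natrM; field; rewrite pnatr_eq0 -lt0n expn_gt0.
rewrite E powRM// ?(ltW (rj0 _))//; have := powR_gt0 a (rj0 j.+1).
rewrite /rj; set q := _ `^ a => q0; rewrite le_eqVlt; apply/orP; left; apply/eqP.
by field; rewrite pnatr_eq0 -lt0n expn_gt0/= gt_eqF.
Qed.

Lemma wmeasureS (A B : set V) : measurable A -> measurable B -> A `<=` B ->
  (wmeasure d Gam A <= wmeasure d Gam B)%E.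
Proof.
move=> mA mB AB; apply: ge0_subset_integral => //.
- by apply: measurable_funTS; apply/measurable_EFinP; exact: measurable_weight.
- by move=> z _; rewrite lee_fin weight_ge0.
Qed.

(** If the distance of y is at least 2s, every point z of the ball has distance at least (de y +
    s)/3 and the weight is essentially constant. Otherwise the ball lies in B(x,3s) with x in [Gam],
    and de y + s <= 3s. *)
Lemma wmeasure_eball_le : exists2 C, 0 < C & forall y s, 0 < s ->
  (wmeasure d Gam (eball y s) <= (C * ballm y s)%:E)%E.
Proof.
move: (K) K0 wmeasure_eball_ahlfors => k k0 wm.
pose C1 := 3 `^ a * ball_vol n.
pose C2 := k * 2 `^ a * 2 * 3 `^ d * 3 * 3 `^ a.
have C10 : 0 < C1 by rewrite mulr_gt0 ?powR_gt0// ball_vol_gt0.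
have C20 : 0 <= C2 by rewrite !mulr_ge0 ?powR_ge0.
exists (C1 + C2); first by lra.
move=> y s s0; have [ys|ys] := leP (2 * s) (de y).
  apply: (@le_trans _ _ (\int[L]_(z in eball y s) (3 `^ a * ((de y + s) `^ a)^-1)%:E)%E).
    apply: ge0_le_integral.
    - exact: measurable_eball.
    - by move=> z _; rewrite lee_fin weight_ge0.
    - by apply: measurable_funTS; apply/measurable_EFinP; exact: measurable_weight.
    - by apply: measurable_funTS; exact: measurable_cst.
    move=> z yz; rewrite lee_fin.
    have -> : 3 `^ a * ((de y + s) `^ a)^-1 = (((de y + s) / 3) `^ a)^-1.
      rewrite powRM ?powRV ?invfM ?invrK// 1?mulrC//; lra.
    apply: weight_le; apply/andP; split; first by lra.
    by have := edist_lip Gam0 y z; move: yz; rewrite /eball/= enormB; lra.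
  rewrite integral_cst; last exact: measurable_eball.
  rewrite [X in (_ * X)%E]lebesgue_eball// -EFinM lee_fin /ballm.
  rewrite (_ : 3 `^ a / _ * _ = C1 * ballm y s); last by rewrite /C1 /ballm; ring.
  by rewrite -/(ballm y s) ler_wpM2r ?lerDl//; apply/ltW; exact: ballm_gt0.
have [x Gx yx] := edist_adherent Gam0 ys.
have s30 : 0 < 3 * s by lra.
apply: (@le_trans _ _ (wmeasure d Gam (eball x (3 * s)))).
  apply: wmeasureS; [exact: measurable_eball|exact: measurable_eball|].
  by move=> z; rewrite /eball/=; have := enorm_distD y z x; lra.
apply: le_trans (wm _ _ Gx s30) _; rewrite lee_fin.
apply: (@le_trans _ _ (C2 * ballm y s)); last first.
  by rewrite ler_wpM2r ?lerDr ?(ltW C10)//; apply/ltW; exact: ballm_gt0.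
have -> : k * 2 `^ a * 2 * ((3 * s) `^ d * (3 * s)) = C2 * (s ^+ n * ((3 * s) `^ a)^-1).
  have -> : s ^+ n = s `^ d * s * s `^ a.
    have -> : s `^ d * s * s `^ a = s `^ (d + 1 + a).
      by rewrite !(@powRD _ s) ?(gt_eqF s0) ?implybT// powRr1 ?(ltW s0).
    rewrite -powR_mulrn ?(ltW s0)//; congr (_ `^ _); ring.
  rewrite !powRM ?(ltW s0)// /C2.
  have := powR_gt0 a s0; have := @powR_gt0 R 3 a (ltac:(by [])).
  by set q := s `^ a; set q3 := 3 `^ a => q30 q0; field; rewrite !gt_eqF.
rewrite /ballm !ler_wpM2l ?exprn_ge0 ?(ltW s0)//.
have dy := edist_ge0 Gam0 y.
rewrite lef_pV2 ?posrE ?powR_gt0//; last by lra.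
by rewrite ge0_ler_powR ?(ltW a0) ?nnegrE//; lra.
Qed.

End weight.

(** * Segments avoiding a set of dimension less than n - 1 *)

(** [A] itself may fail to be measurable; it is enclosed in the intersection of a sequence of the
    sets S with bounds tending to 0. *)
Lemma negligible_outer_small {d} {T : measurableType d} {R : realType}
    (mu : {measure set T -> \bar R}) (A : set T) (c t0 : R) : 0 < t0 -> 0 <= c ->
  (forall t, 0 < t <= t0 ->
    exists S, [/\ measurable S, A `<=` S & (mu S <= (c * t)%:E)%E]) ->
  mu.-negligible A.
Proof.
move=> t00 c0 h.
have /choice[S hS] : forall k : nat, exists S,
    [/\ measurable S, A `<=` S & (mu S <= (c * (t0 / k.+1%:R))%:E)%E].
  by move=> k; apply: h; rewrite divr_gt0//= ler_pdivrMr// ler_peMr ?ler1n// ltW.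
exists (\bigcap_k S k); split.
- by apply: bigcap_measurable => // k _; have [] := hS k.
- apply/eqP; rewrite eq_le measure_ge0 andbT; apply/lee_addgt0Pr => e e0; rewrite add0e.
  pose k := Num.truncn (c * t0 / e).
  have [mS _ Sk] := hS k; apply: (@le_trans _ _ (mu (S k))).
    apply: le_measure; rewrite ?inE//; last exact: bigcap_inf.
    by apply: bigcap_measurable => // j _; have [] := hS j.
  apply: le_trans Sk _; rewrite lee_fin mulrA ler_pdivrMr// [leRHS]mulrC -ler_pdivrMr//.
  by apply/ltW; exact: truncnS_gt.
- by move=> x Ax k _; have [_ AS _] := hS k; exact: AS.
Qed.

Section segments.
Context {R : realType} {n : nat} (d : R) (Gam : set 'rV[R]_n).
Local Notation V := 'rV[R]_n.
Local Notation L := (lebesgue_rV R n).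
Local Notation de := (edist Gam).
Local Notation a := (n%:R - 1 - d).
Hypothesis Gam0 : Gam !=set0.
Hypothesis (a0 : 0 < a).
Variable C0 : R.
Hypotheses (d0 : 0 < d) (Gamc : closed Gam) (C01 : 1 <= C0).
Hypothesis reg : forall x r, Gam x -> 0 < r ->
  ((C0^-1 * r `^ d)%:E <= hausdorff d (Gam `&` eball x r))%E /\
  (hausdorff d (Gam `&` eball x r) <= (C0 * r `^ d)%:E)%E.

(** The exceptional set is the shadow of [Gam] seen from x. Let eta be the distance from x to [Gam]
    and take y within M of x. The relevant part of [Gam] is covered by O(rho^(-d)) balls of radius
    rho, and the shadow of each one by O(1/rho) balls of radius 2 rho M/eta, one for each value in a
    grid of parameters t. The total volume is O(rho^(n-1-d)), which tends to 0 exactly because d < n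
    - 1. *)
Lemma segment_meets_negligible x : ~ Gam x ->
  L.-negligible [set y | exists2 t : R, 0 <= t <= 1 & Gam (x + t *: (y - x))].
Proof.
move=> nGx; have eta0 : 0 < de x by exact: edist_gt0.
set eta := de x in eta0.
have [x1 Gx1] := Gam0; pose D := enorm (x - x1).
have D0 : 0 <= D by exact: enorm_ge0.
set bad := [set y | _].
have -> : bad = \bigcup_k (bad `&` eball x k.+1%:R).
  apply/seteqP; split => [y by_|y [k _ []]//].
  by exists (Num.truncn (enorm (y - x))) => //; split => //; exact: truncnS_gt.
apply: negligible_bigcup => j; set M : R := j.+1%:R; have M0 : 0 < M by [].
pose r1 := M + D.
pose c := C0 ^+ 2 * (6 * r1) `^ d * (3 * M) * (ball_vol n * (2 * M / eta) ^+ n).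
have C00 := le_trans ler01 C01.
have c0 : 0 <= c.
  by rewrite /c !mulr_ge0 ?powR_ge0 ?exprn_ge0 ?(ltW (ball_vol_gt0 _))// ?mulr_ge0 ?invr_ge0 ?(ltW M0) ?(ltW eta0).
apply: (@negligible_outer_small _ _ _ _ _ c (M `^ a)); rewrite ?powR_gt0//.
move=> tau /andP[tau0 tauM].
(* The volume comes out proportional to rho^a, hence linear in tau with this choice. *)
pose rho := tau `^ a^-1.
have rho0 : 0 < rho by exact: powR_gt0.
have rhoa : rho `^ a = tau by rewrite -powRrM mulVf ?gt_eqF// powRr1// ltW.
have rhoM : rho <= M.
  have : tau `^ a^-1 <= (M `^ a) `^ a^-1.
    by apply: ge0_ler_powR; rewrite ?invr_ge0 ?(ltW a0) ?nnegrE ?powR_ge0 ?(ltW tau0).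
  by rewrite -powRrM mulfV ?gt_eqF// powRr1// ltW.
have rr : 0 < rho <= 3 * r1 by rewrite rho0/= /r1; lra.
have [s [ss sG Gs]] := ahlfors_cover d0 C01 reg Gx1 rr.
pose N := (Num.truncn (M / rho)).+1.
have N1 : M / rho < N%:R by exact: truncnS_gt.
have N2 : N%:R <= M / rho + 1.
  rewrite /N -natr1 lerD2r; have /truncn_itv/andP[] // : 0 <= M / rho.
  by rewrite divr_ge0 ?ltW.
have N0 : 0 < N%:R :> R by rewrite ltr0n.
(* If x + t(y - x) is near p, then y is near x + (p - x)/t; the factor 1/t is replaced by N/k. *)
pose q : seq V := [seq x + (N%:R / k%:R) *: (p - x) | p <- s, k <- iota 1 N.+1].
pose rad := 2 * rho * (M / eta).
have rad0 : 0 < rad by rewrite !mulr_gt0// invr_gt0.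
exists (\bigcup_(p in [set` q]) eball p rad); split.
- by apply: open_measurable_rV; apply: bigcup_open => ? _; exact: eball_open.
- move=> y [[t /andP[t0 t1] Gy] yM].
  have ym : enorm (y - x) < M by [].
  have gx : enorm (t *: (y - x)) = t * enorm (y - x) by rewrite enormZ ger0_norm.
  have eta_le : eta <= t * enorm (y - x).
    rewrite -gx; have := edist_le x Gy; rewrite -/eta.
    by rewrite opprD addrA subrr add0r enormN.
  have tpos : 0 < t.
    rewrite lt_neqAle t0 andbT; apply/eqP => t00.
    by move: eta_le; rewrite -t00 mul0r leNgt eta0.
  have tM : eta <= t * M by rewrite (le_trans eta_le)// ler_wpM2l// ltW.
  have [p ps pg] : (\bigcup_(p in [set` s]) eball p rho) (x + t *: (y - x)).
    apply: Gs; split => //; rewrite /eball/= /r1.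
    have := enormD (t *: (y - x)) (x - x1); rewrite gx.
    rewrite (_ : t *: (y - x) + (x - x1) = x + t *: (y - x) - x1); last by rewrite addrCA addrA.
    have : t * enorm (y - x) <= 1 * enorm (y - x) by rewrite ler_wpM2r ?enorm_ge0.
    by rewrite -/D; lra.
  (* Rounding up gives t <= k/N <= t + 1/N. The first inequality yields N/k <= 1/t <= M/eta; at t =
     1 the index is N + 1, hence the length of the [iota] above. *)
  pose k := (Num.truncn (t * N%:R)).+1.
  have tN0 : 0 <= t * N%:R by rewrite mulr_ge0// ltW.
  have k1 : t * N%:R < k%:R by exact: truncnS_gt.
  have k2 : k%:R <= t * N%:R + 1.
    by rewrite /k -natr1 lerD2r; have /truncn_itv/andP[] := tN0.
  have k0 : 0 < k%:R :> R by rewrite ltr0n.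
  exists (x + (N%:R / k%:R) *: (p - x)).
    rewrite /= /q; apply/allpairsP; exists (p, k); split; [exact: ps| |by []].
    rewrite [(p, k).2]/= mem_iota add1n ltnS /= ltnS.
    rewrite truncn_le_nat -natr1.
    have : t * N%:R <= 1 * N%:R by rewrite ler_wpM2r// ltW.
    by lra.
  rewrite /eball/=.
  have -> : y - (x + (N%:R / k%:R) *: (p - x)) =
     (N%:R / k%:R) *: ((k%:R / N%:R) *: (y - x) - (p - x)).
    by apply/rowP => i; rewrite !mxE; field; rewrite !gt_eqF.
  rewrite enormZ gtr0_norm ?divr_gt0//.
  have e1 : enorm ((k%:R / N%:R) *: (y - x) - (p - x)) < 2 * rho.
    have -> : (k%:R / N%:R) *: (y - x) - (p - x) =
        (k%:R / N%:R - t) *: (y - x) + (x + t *: (y - x) - p).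
      by apply/rowP => i; rewrite !mxE; ring.
    apply: le_lt_trans (enormD _ _) _.
    rewrite enormZ ger0_norm; last by rewrite subr_ge0 ler_pdivlMr// ltW.
    have h1 : k%:R / N%:R - t <= rho / M.
      apply: (@le_trans _ _ (N%:R^-1)).
        by rewrite lerBlDr ler_pdivrMr// mulrDl mulVf ?gt_eqF//; lra.
      by rewrite -[rho / M]invrK invf_div lef_pV2 ?posrE ?divr_gt0// ltW.
    have h2 : (k%:R / N%:R - t) * enorm (y - x) <= rho / M * M.
      apply: ler_pM => //; rewrite ?enorm_ge0 ?(ltW ym)//.
      by rewrite subr_ge0 ler_pdivlMr// ltW.
    move: h2; rewrite divfK ?gt_eqF//; move: pg; rewrite /eball/=; lra.
  have e2 : N%:R / k%:R <= M / eta.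
    rewrite ler_pdivrMr// mulrAC ler_pdivlMr// mulrC.
    apply: (@le_trans _ _ (t * M * N%:R)); first by rewrite ler_wpM2r// ltW.
    by rewrite mulrAC mulrC ler_wpM2l// ltW.
  rewrite /rad mulrC; apply: (@le_lt_trans _ _ (enorm ((k%:R / N%:R) *: (y - x) - (p - x)) * (M / eta))).
    by rewrite ler_wpM2l// enorm_ge0.
  by rewrite ltr_pM2r// divr_gt0.
- apply: le_trans (lebesgue_bigcup_eball_le _ rad0) _; rewrite lee_fin.
  rewrite size_allpairs size_iota natrM.
  have hN : N.+1%:R <= 3 * M * rho^-1.
    rewrite -natr1; have : 1 <= M * rho^-1 by rewrite ler_pdivlMr// mul1r.
    by lra.
  have hs : (size s)%:R <= C0 ^+ 2 * (6 * r1) `^ d * (rho `^ d)^-1.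
    rewrite -mulrA -powRV ?(ltW rho0)// -powRM ?invr_ge0 ?(ltW rho0)//.
    by rewrite /r1; lra.
  have hn : rho ^+ n = rho * rho `^ d * tau.
    rewrite -rhoa -{2}(powRr1 (ltW rho0)) -!powRD ?(gt_eqF rho0) ?implybT//.
    by rewrite -powR_mulrn ?(ltW rho0)//; congr (_ `^ _); ring.
  apply: (@le_trans _ _ ((C0 ^+ 2 * (6 * r1) `^ d * (rho `^ d)^-1) * (3 * M * rho^-1) * (ball_vol n * rad ^+ n))).
    apply: ler_wpM2r; first by rewrite mulr_ge0 ?exprn_ge0 ?(ltW rad0)// ltW// ball_vol_gt0.
    by apply: ler_pM.
  rewrite /c /rad (_ : 2 * rho * (M / eta) = (2 * M / eta) * rho); last by ring.
  rewrite exprMn hn le_eqVlt; apply/orP; left; apply/eqP.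
  have := powR_gt0 d rho0; set Q := rho `^ d => Q0.
  set P := (_ / eta) ^+ n; set P2 := (6 * r1) `^ d.
  by field; rewrite !gt_eqF.
Qed.

End segments.

(** * Continuity of translations in L^1 *)

(** Continuity from below: otherwise every mu (F k) stays e below the finite measure of the union,
    and so does the limit. *)
Lemma measure_bigcup_approx {d} {T : measurableType d} {R : realType}
    (mu : {measure set T -> \bar R}) (F : nat -> set T) (e : R) : 0 < e ->
  (forall k, measurable (F k)) -> {homo F : i j / (i <= j)%N >-> i `<=` j} ->
  (mu (\bigcup_k F k) < +oo)%E ->
  exists k, (mu ((\bigcup_j F j) `\` F k) <= e%:E)%E.
Proof.
move=> e0 mF hF muF; set A := \bigcup_k F k.
have mA : measurable A by exact: bigcup_measurable.
have fA : mu A \is a fin_num by rewrite ge0_fin_numE.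
have sub k : F k `<=` A by exact: bigcup_sup.
apply: contrapT => /forallNP nk.
have h k : (mu (F k) <= mu A - e%:E)%E.
  have := nk k; rewrite measureD//.
  rewrite (setIidr (sub k)) => /negP; rewrite -ltNge => h.
  have fk : mu (F k) \is a fin_num.
    by rewrite ge0_fin_numE//; apply: le_lt_trans muF; apply: le_measure; rewrite ?inE.
  by rewrite leeBrDr// -leeBrDl// ltW.
have hF' : {homo F : i j / (i <= j)%N >-> (i <= j)%O}.
  by move=> i j ij; apply/subsetPset; exact: hF.
have cF := nondecreasing_cvg_mu (mu := mu) mF mA hF'.
have : (mu A <= mu A - e%:E)%E.
  rewrite -[leLHS](cvg_lim _ cF)//; apply: lime_le; first by apply/cvg_ex; eexists; exact: cF.
  by apply: nearW.
by rewrite -(fineK fA) -EFinB lee_fin; lra.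
Qed.

Import HBNNSimple.

Section translation.
Context {R : realType} {n : nat}.
Local Notation V := 'rV[R]_n.
Local Notation L := (lebesgue_rV R n).
Implicit Types (v : V -> R) (A : set V).

Definition trans_cont v := measurable_fun setT v /\
  forall eta, 0 < eta -> exists2 r, 0 < r & forall h : V, enorm h < r ->
    (\int[L]_x `|v (h + x)%R - v x|%:E <= eta%:E)%E.

Lemma measurable_shift (h : V) : measurable_fun [set: V] (fun x : V => h + x).
Proof. exact: measurable_rVD. Qed.

Lemma trans_cont_approx v : measurable_fun setT v ->
  (forall eta, 0 < eta -> exists2 v', trans_cont v' &
    (\int[L]_x `|v x - v' x|%:E <= eta%:E)%E) -> trans_cont v.
Proof.
move=> mv hv; split => // eta eta0.
have e3 : 0 < eta / 3 by rewrite divr_gt0.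
have [v' [mv' /(_ _ e3)[r r0 hr]] vv'] := hv _ e3.
exists r => // h hh.
have mvh (f : V -> R) : measurable_fun setT f -> measurable_fun setT (fun x => f (h + x)).
  by move=> mf; apply: measurableT_comp mf (measurable_shift h).
have mm (f g : V -> R) : measurable_fun setT f -> measurable_fun setT g ->
    measurable_fun setT (fun x => `|f x - g x|%:E : \bar R).
  by move=> mf mg; apply/measurable_EFinP; apply: measurableT_comp => //; exact: measurable_funB.
apply: (@le_trans _ _ (\int[L]_x (`|v (h + x)%R - v' (h + x)%R|%:E + (`|v' (h + x)%R - v' x|%:E + `|v x - v' x|%:E)))%E).
  apply: ge0_le_integral => //.
  - by apply: mm => //; exact: mvh.
  - by apply: emeasurable_funD; [apply: mm; exact: mvh|apply: emeasurable_funD; apply: mm => //; exact: mvh].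
  - move=> x _; rewrite -!EFinD lee_fin.
    have := ler_normD (v (h + x) - v' (h + x)) (v' (h + x) - v x).
    have := ler_normD (v' (h + x) - v' x) (v' x - v x).
    by rewrite !subrKA (distrC (v' x)); lra.
rewrite ge0_integralD//; last 3 first.
- by apply: mm; exact: mvh.
- by move=> x _; rewrite adde_ge0.
- by apply: emeasurable_funD; apply: mm => //; exact: mvh.
rewrite ge0_integralD//; last 2 first.
- by apply: mm => //; exact: mvh.
- exact: mm.
rewrite (ge0_integral_shift h (f := fun x => `|v x - v' x|%:E))//; last exact: mm.
rewrite (_ : eta = eta / 3 + (eta / 3 + eta / 3)); last by field.
by rewrite !EFinD leeD// leeD// hr.
Qed.

Lemma trans_contD v1 v2 : trans_cont v1 -> trans_cont v2 ->
  trans_cont (fun x => v1 x + v2 x).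
Proof.
move=> [m1 h1] [m2 h2]; split; first exact: measurable_funD.
move=> eta eta0; have e2 : 0 < eta / 2 by rewrite divr_gt0.
have [r1 r10 hr1] := h1 _ e2; have [r2 r20 hr2] := h2 _ e2.
exists (Num.min r1 r2); first by rewrite lt_min r10.
move=> h; rewrite lt_min => /andP[hh1 hh2].
have mm (f : V -> R) : measurable_fun setT f ->
    measurable_fun setT (fun x => `|f (h + x) - f x|%:E : \bar R).
  move=> mf; apply/measurable_EFinP; apply: measurableT_comp => //; apply: measurable_funB => //.
  by apply: measurableT_comp mf (measurable_shift h).
apply: (@le_trans _ _ (\int[L]_x (`|v1 (h + x)%R - v1 x|%:E + `|v2 (h + x)%R - v2 x|%:E))%E).
  apply: ge0_le_integral => //.
  - by apply: (mm (fun x => v1 x + v2 x)); exact: measurable_funD.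
  - by apply: emeasurable_funD; exact: mm.
  - move=> x _; rewrite -EFinD lee_fin; apply: le_trans (ler_normD _ _).
    by rewrite opprD addrACA.
rewrite ge0_integralD//; [|exact: mm|exact: mm].
rewrite (_ : eta = eta / 2 + eta / 2); last by field.
by rewrite EFinD leeD// ?hr1 ?hr2.
Qed.

Lemma trans_contZ c v : trans_cont v -> trans_cont (fun x => c * v x).
Proof.
move=> [mv hv]; split; first exact: measurable_funM.
move=> eta eta0.
have c0 : 0 < `|c| + 1 by have := normr_ge0 c; lra.
have [r r0 hr] := hv (eta / (`|c| + 1)) (divr_gt0 eta0 c0).
exists r => // h hh.
have mm : measurable_fun setT (fun x => `|v (h + x) - v x|%:E : \bar R).
  apply/measurable_EFinP; apply: measurableT_comp => //; apply: measurable_funB => //.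
  by apply: measurableT_comp mv (measurable_shift h).
under eq_integral do rewrite -mulrBr normrM EFinM.
rewrite ge0_integralZl//.
apply: (@le_trans _ _ (`|c|%:E * (eta / (`|c| + 1))%:E)%E).
  by apply: lee_wpmul2l => //; exact: hr.
rewrite -EFinM lee_fin mulrA ler_pdivrMr// mulrC ler_pM2l//; lra.
Qed.

Lemma trans_cont0 : trans_cont (fun=> 0).
Proof.
split => // eta eta0; exists 1 => // h _.
by under eq_integral do rewrite subr0 normr0; rewrite integral0 lee_fin ltW.
Qed.

Lemma trans_contB v1 v2 : trans_cont v1 -> trans_cont v2 ->
  trans_cont (fun x => v1 x - v2 x).
Proof.
move=> h1 h2; rewrite (_ : (fun _ => _) = (fun x => v1 x + (-1) * v2 x)).
  by apply: trans_contD => //; exact: trans_contZ.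
by apply/funext => x; rewrite mulN1r.
Qed.

(** [U] is the increasing union of the sets [F k] of points at distance at least 1/(k+1) from its
    complement. A shift by less than 1/(k+1) can leave [U] only from U minus F k, which is small;
    points entering [U] are treated by the opposite shift. *)
Lemma trans_cont_open U : open U -> (L U < +oo)%E -> trans_cont (\1_U).
Proof.
move=> oU UL; have mU := open_measurable_rV oU.
split; first exact: measurable_indic.
pose F (k : nat) := ~` (\bigcup_(y in ~` U) eball y k.+1%:R^-1).
have Fm k : measurable (F k).
  by apply: measurableC; apply: open_measurable_rV; apply: bigcup_open => ? _; exact: eball_open.
have FU : \bigcup_k F k = U.
  apply/seteqP; split => x.
    move=> [k _ Fx]; apply: contrapT => nUx; apply: Fx; exists x => //.
    by rewrite /eball/= subrr enorm0 invr_gt0.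
  move=> Ux; have /nbhs_eballP[r r0 rU] : nbhs x U by exact: open_nbhs_nbhs.
  exists (Num.truncn r^-1) => // -[y nUy]; rewrite /eball/= => xy; apply: nUy.
  apply: rU; rewrite /eball/= enormB (lt_le_trans xy)//.
  by rewrite invf_ple ?posrE// ltW// truncnS_gt.
have Fh : {homo F : i j / (i <= j)%N >-> i `<=` j}.
  move=> i j ij x Fx [y nUy]; rewrite /eball/= => xy; apply: Fx; exists y => //.
  by rewrite /eball/= (lt_le_trans xy)// lef_pV2 ?posrE// ler_nat.
move=> eta eta0; have e2 : 0 < eta / 2 by rewrite divr_gt0.
have [|k hk] := @measure_bigcup_approx _ _ _ L F (eta / 2) e2 Fm Fh; first by rewrite FU.
exists k.+1%:R^-1; first by rewrite invr_gt0.
rewrite FU in hk.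
have key h : enorm h < k.+1%:R^-1 -> (\int[L]_x (\1_U x * (1 - \1_U (h + x)))%:E <= (eta / 2)%:E)%E.
  move=> hh; apply: le_trans hk.
  rewrite -(setIT (U `\` F k)) -integral_indic//; last exact: measurableD.
  apply: ge0_le_integral => //.
  - apply/measurable_EFinP; apply: measurable_funM; first exact: measurable_indic.
    apply: measurable_funB => //; apply: (measurableT_comp _ (measurable_shift h)); exact: measurable_indic.
  - by apply/measurable_EFinP; apply: measurable_indic; exact: measurableD.
  move=> x _; rewrite lee_fin !indicE.
  have [|nU] := boolP ((h + x) \in U).
    by rewrite subrr mulr0.
  rewrite subr0 mulr1; have [Ux|//] := boolP (x \in U).
  rewrite mem_set//; split; first by rewrite inE in Ux.
  apply; exists (h + x); first by rewrite notin_setE in nU.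
  by rewrite /eball/= opprD addrCA subrr addr0 enormN.
move=> h hh.
have mh f : measurable_fun setT f -> measurable_fun setT (fun x : V => f (h + x) : R).
  by move=> mf; apply: measurableT_comp mf (measurable_shift h).
have mi : measurable_fun setT (\1_U : V -> R) by exact: measurable_indic.
apply: (@le_trans _ _ (\int[L]_x ((\1_U x * (1 - \1_U (h + x)%R))%:E + (\1_U (h + x)%R * (1 - \1_U x))%:E))%E).
  apply: ge0_le_integral => //.
  - by apply/measurable_EFinP; apply: measurableT_comp => //; apply: measurable_funB => //; exact: mh.
  - apply: emeasurable_funD; apply/measurable_EFinP; apply: measurable_funM => //; try exact: mh.
      by apply: measurable_funB => //; exact: mh.
    exact: measurable_funB.
  move=> x _; rewrite -EFinD lee_fin !indicE.
  by case: (_ \in _); case: (_ \in _); rewrite /= ?subrr ?subr0 ?sub0r ?normrN ?normr0 ?normr1 ?mulr1 ?mulr0 ?mul0r ?addr0 ?add0r.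
have i01 (y : V) : 0 <= 1 - \1_U y :> R by rewrite subr_ge0 indicE; case: (_ \in _).
rewrite ge0_integralD//; last 2 first.
- apply/measurable_EFinP; apply: measurable_funM => //.
  by apply: measurable_funB => //; exact: mh.
- apply/measurable_EFinP; apply: measurable_funM; first exact: mh.
  exact: measurable_funB.
rewrite (_ : eta = eta / 2 + eta / 2); last by field.
rewrite EFinD leeD ?key//.
rewrite -(ge0_integral_shift (- h)); last 2 first.
- apply/measurable_EFinP; apply: measurable_funM; first exact: mh.
  exact: measurable_funB.
- by move=> x; rewrite lee_fin mulr_ge0.
under eq_integral do rewrite addrA subrr add0r.
by apply: key; rewrite enormN.
Qed.

(** Dynkin's theorem: the sets [A] with this property form a lambda system containing the open sets.
    Cutting by a ball keeps the measures finite, so that an increasing union is approximated in L^1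
    by its members. *)
Lemma trans_cont_indic (r : R) A : 0 < r -> measurable A -> trans_cont (\1_(A `&` eball 0 r)).
Proof.
move=> r0; set B := eball 0 r.
have mB : measurable B by exact: measurable_eball.
have BL : (L B < +oo)%E by rewrite [X in (X < _)%E]lebesgue_eball// ltry.
have LB (D : set V) : measurable D -> D `<=` B -> (L D < +oo)%E.
  by move=> mD DB; apply: le_lt_trans BL; apply: le_measure; rewrite ?inE.
have bU (x : 'rV[R]_n) : true by [].
pose H := [set A : set V | measurable A /\ trans_cont (\1_(A `&` B))].
suff sub : @measurable _ V `<=` H by move=> mA; have [] := sub _ mA.
have -> : @measurable _ V = <<s @open V >> by [].
apply: lambda_system_subset => //.
- by move=> U W oU oW; exact: openI.
- split => //.
  + by split => //; rewrite setTI; apply: trans_cont_open => //; exact: eball_open.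
  + move=> P Q QP [mP tP] [mQ tQ]; split; first exact: measurableD.
    rewrite (_ : \1__ = (fun x => \1_(P `&` B) x - \1_(Q `&` B) x)); first exact: trans_contB.
    apply/funext => x; rewrite !indicE (classical_sets.in_setI _ (P `\` Q)) classical_sets.in_setD !classical_sets.in_setI.
    have [xQ|] := boolP (x \in Q); last by rewrite subr0 andbT.
    have -> : x \in P by rewrite inE; apply: QP; rewrite inE in xQ.
    by rewrite /= subrr.
  + move=> F hF FH; have mF : measurable (\bigcup_k F k).
      by apply: bigcup_measurable => k _; have [] := FH k.
    split => //; apply: trans_cont_approx; first by apply: measurable_indic; exact: measurableI.
    move=> eta eta0.
    have mFB k : measurable (F k `&` B) by apply: measurableI => //; have [] := FH k.
    have hFB : {homo (fun k => F k `&` B) : i j / (i <= j)%N >-> i `<=` j}.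
      by move=> i j ij; apply: setSI; apply/subsetPset; exact: hF.
    have [|k hk] := @measure_bigcup_approx _ _ _ L _ eta eta0 mFB hFB.
      by apply: LB; [exact: bigcup_measurable|move=> x [k _ []]].
    exists (\1_(F k `&` B)); first by have [] := FH k.
    apply: le_trans hk; rewrite setI_bigcupl.
    rewrite -(setIT (_ `\` _)) -integral_indic//; last by apply: measurableD => //; exact: bigcup_measurable.
    rewrite le_eqVlt; apply/orP; left; apply/eqP; apply: eq_integral => x _.
    rewrite !indicE classical_sets.in_setD; congr (_%:E).
    have [xk|] := boolP (x \in F k `&` B); last by rewrite subr0 andbT normr_nat.
    rewrite (_ : _ \in _ = true) ?subrr ?normr0//=.
    by apply/mem_set; exists k => //; rewrite inE in xk.
- move=> U oU; split; first exact: open_measurable_rV.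
  apply: trans_cont_open; first by apply: openI => //; exact: eball_open.
  by apply: LB => //; apply: measurableI => //; exact: open_measurable_rV.
Qed.

Lemma trans_cont_sum (I : Type) (s : seq I) (f : I -> V -> R) :
  (forall i, trans_cont (f i)) -> trans_cont (fun x => \sum_(i <- s) f i x).
Proof.
move=> hf; elim: s => [|i s IH].
  rewrite (_ : (fun _ => _) = (fun=> 0)); first exact: trans_cont0.
  by apply/funext => x; rewrite big_nil.
rewrite (_ : (fun _ => _) = (fun x => f i x + \sum_(j <- s) f j x)); first exact: trans_contD.
by apply/funext => x; rewrite big_cons.
Qed.

(** Simple functions increasing to v converge in L^1 by monotone convergence, and the property is
    stable under such limits. *)
Lemma trans_cont_ge0 v r : 0 < r -> measurable_fun setT v -> (forall x, 0 <= v x) ->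
  (forall x, ~ eball 0 r x -> v x = 0) -> (\int[L]_x (v x)%:E < +oo)%E -> trans_cont v.
Proof.
move=> r0 mv v0 vB vL; apply: trans_cont_approx => // eta eta0.
have mev : measurable_fun setT (EFin \o v) by exact/measurable_EFinP.
have [g [gh gv]] := approximation measurableT mev (fun x _ => v0 x).
have gE x : (limn (fun k => (g k x)%:E) = (v x)%:E)%E.
  by apply/cvg_lim => //; exact: gv.
have gle k x : g k x <= v x.
  rewrite -lee_fin -gE; apply: lime_ge; first by apply/cvg_ex; eexists; exact: (gv x I).
  by exists k => // m /= km; rewrite lee_fin; have /lefP := gh _ _ km; apply.
have gt k : trans_cont (g k).
  rewrite (_ : HBNNSimple.NonNegSimpleFun.sort (g k) = (fun x => \sum_(y <- finmap.enum_fset (fset_set (range (g k)))) y * \1_(g k @^-1` [set y]) x)); last first.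
    by apply/funext => x; rewrite fimfunE fsbig_finite.
  (* The level set of the value 0 may have infinite measure, but its term vanishes. A nonzero value
     is taken inside the ball only, because [g k] lies between 0 and v. *)
  apply: trans_cont_sum => y; have [->|y0] := eqVneq y 0.
    rewrite (_ : (fun _ => _) = (fun=> 0)); first exact: trans_cont0.
    by apply/funext => x; rewrite mul0r.
  apply: trans_contZ; rewrite (_ : g k @^-1` [set y] = (g k @^-1` [set y]) `&` eball 0 r).
    by apply: trans_cont_indic => //; exact: measurable_sfunP.
  apply/seteqP; split => [x gx|x []//]; split => //; apply: contrapT => /vB vx.
  move/eqP: y0; apply; rewrite -gx; apply/eqP; rewrite eq_le fun_ge0 andbT.
  by have := gle k x; rewrite vx.
have mg k : measurable_fun setT (g k : V -> R) by [].
have icv : (\int[L]_x (g k x)%:E)%E @[k --> \oo] --> (\int[L]_x (v x)%:E)%E.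
  have := @cvg_monotone_convergence _ _ _ L setT measurableT (fun k x => (g k x)%:E).
  under [X in _ -> _ -> _ -> _ --> X]eq_integral => x _ do rewrite gE.
  apply => //.
  - by move=> k; exact/measurable_EFinP.
  - by move=> k x _; rewrite lee_fin fun_ge0.
  - by move=> x _ i j ij; rewrite lee_fin; have /lefP := gh _ _ ij; apply.
have fv : (\int[L]_x (v x)%:E)%E \is a fin_num.
  by rewrite ge0_fin_numE// integral_ge0// => x _; rewrite lee_fin.
have [k hk] : exists k, (\int[L]_x (v x)%:E - eta%:E <= \int[L]_x (g k x)%:E)%E.
  apply: contrapT => /forallNP nk.
  have : (\int[L]_x (v x)%:E <= \int[L]_x (v x)%:E - eta%:E)%E.
    rewrite -{1}(cvg_lim _ icv)//; apply: lime_le; first by apply/cvg_ex; eexists; exact: icv.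
    by apply: nearW => k; apply/ltW; rewrite ltNge; apply/negP; exact: nk.
  by rewrite -(fineK fv) -EFinB lee_fin; lra.
exists (g k) => //.
have -> : (\int[L]_x `|v x - g k x|%:E = \int[L]_x (v x - g k x)%:E)%E.
  by apply: eq_integral => x _; rewrite ger0_norm// subr_ge0.
rewrite -(@leeD2rE _ (\int[L]_x (g k x)%:E)); last first.
  rewrite ge0_fin_numE ?integral_ge0//; last by move=> x _; rewrite lee_fin fun_ge0.
  apply: le_lt_trans vL; apply: ge0_le_integral => //; try exact/measurable_EFinP.
  - by move=> x _; rewrite lee_fin fun_ge0.
  - by move=> x _; rewrite lee_fin.
rewrite -ge0_integralD//; last 4 first.
- by move=> x _; rewrite lee_fin subr_ge0.
- by apply/measurable_EFinP; exact: measurable_funB.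
- by move=> x _; rewrite lee_fin fun_ge0.
- exact/measurable_EFinP.
under eq_integral do rewrite -EFinD subrK.
by rewrite -leeBlDl// addeC.
Qed.

Lemma trans_cont_L1 v r : 0 < r -> measurable_fun setT v ->
  (forall x, ~ eball 0 r x -> v x = 0) -> (\int[L]_x `|v x|%:E < +oo)%E -> trans_cont v.
Proof.
move=> r0 mv vB vL.
rewrite (_ : v = (fun x => v^\+ x - v^\- x)); last first.
  by apply/funext => x; rewrite -[LHS in LHS = _]/(v x) -{1}(funrposBneg v).
have h (f : V -> R) : measurable_fun setT f -> (forall x, 0 <= f x <= `|v x|) -> trans_cont f.
  move=> mf f0; apply: (@trans_cont_ge0 _ r) => //.
  - by move=> x; have /andP[] := f0 x.
  - by move=> x /vB vx; apply/eqP; rewrite eq_le; have := f0 x; rewrite vx normr0 andbC.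
  - apply: le_lt_trans vL; apply: ge0_le_integral => //.
    + by move=> x _; rewrite lee_fin; have /andP[] := f0 x.
    + exact/measurable_EFinP.
    + by apply/measurable_EFinP; exact: measurableT_comp.
    + by move=> x _; rewrite lee_fin; have /andP[] := f0 x.
apply: trans_contB; apply: h.
- exact: measurable_funrpos.
- by move=> x; rewrite /funrpos le_max lexx orbT ge_max ler_norm normr_ge0.
- exact: measurable_funrneg.
- by move=> x; rewrite /funrneg le_max lexx orbT ge_max -normrN ler_norm normr_ge0.
Qed.

End translation.

(** * Smooth kernels *)

Section derive_fun.
Context {R : realType}.
Implicit Types (f g : R -> R) (x a b : R).

Lemma is_derive_funM f g x a b : is_derive x 1 f a -> is_derive x 1 g b ->
  is_derive x 1 (fun t => f t * g t) (a * g x + f x * b).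
Proof.
move=> hf hg; apply: is_derive_eq (is_deriveM hf hg) _.
by rewrite /GRing.scale/= addrC mulrC.
Qed.

Lemma is_derive_funD f g x a b : is_derive x 1 f a -> is_derive x 1 g b ->
  is_derive x 1 (fun t => f t + g t) (a + b).
Proof. by move=> hf hg; exact: is_deriveD. Qed.

Lemma is_derive_affine c e x : is_derive x 1 (fun t : R => c + e * t) e.
Proof.
have h : is_derive x 1 (fun t : R => c + e * t) (0 + (0 * x + e * 1)).
  exact: (is_derive_funD (is_derive_cst c x 1) (is_derive_funM (is_derive_cst e x 1) (is_derive_id x 1))).
by apply: is_derive_eq h _; rewrite mul0r mulr1 !add0r.
Qed.

Lemma is_derive_comp_affine f c e x a : is_derive (c + e * x) 1 f a ->
  is_derive x 1 (fun t => f (c + e * t)) (a * e).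
Proof.
by move=> hf; exact: (is_derive1_comp (f := f) (g := fun t => c + e * t) hf (is_derive_affine c e x)).
Qed.

Lemma is_derive_continuous f x a : is_derive x 1 f a -> {for x, continuous f}.
Proof.
move=> [df _]; apply: differentiable_continuous.
exact/derivable1_diffP.
Qed.

Lemma is_derive_prod (I : eqType) (s : seq I) (f f' : I -> R -> R) x : uniq s ->
  (forall i, is_derive x 1 (f i) (f' i x)) ->
  is_derive x 1 (fun t => \prod_(i <- s) f i t)
    (\sum_(i <- s) f' i x * \prod_(j <- s | j != i) f j x).
Proof.
move=> us hf; elim: s us => [_|i s IH /= /andP[nis us]].
  rewrite big_nil (_ : (fun _ => _) = cst 1); first exact: is_derive_cst.
  by apply/funext => t; rewrite big_nil.
rewrite (_ : (fun _ => _) = (fun t => f i t * \prod_(j <- s) f j t)); last first.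
  by apply/funext => t; rewrite big_cons.
apply: is_derive_eq (is_derive_funM (hf i) (IH us)) _.
rewrite !big_cons eqxx/=; congr (_ * _ + _).
  rewrite big_seq_cond [RHS]big_seq_cond; apply: eq_bigl => j; rewrite andbT.
  by have [js|//] := boolP (j \in s); apply/esym/eqP => ji; move: nis; rewrite -ji js.
rewrite mulr_sumr [LHS]big_seq [RHS]big_seq; apply: eq_bigr => j js.
rewrite big_cons ifT; first by rewrite mulrCA.
by apply/eqP => ij; move: nis; rewrite ij js.
Qed.

End derive_fun.

Section smooth.
Context {R : realType}.

(** The derivative is carried as a witness, so that sums and products follow the rules of
    [is_derive] without computing [derive1]. *)
Fixpoint sm (k : nat) (f : R -> R) : Prop :=
  match k with
  | 0 => continuous f
  | k'.+1 => exists2 f' : R -> R, forall x : R, is_derive x 1 f (f' x) & sm k' f'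
  end.

Lemma sm_continuous k f : sm k f -> continuous f.
Proof. by case: k => // k [f' ff' _] x; exact: is_derive_continuous (ff' x). Qed.

Lemma smS k f : sm k.+1 f -> sm k f.
Proof.
elim: k f => [f|k IH f [f' ff' sf']]; first exact: sm_continuous.
by exists f' => //; exact: IH.
Qed.

Lemma sm_cst k c : sm k (fun=> c).
Proof.
elim: k c => [c|k IH c]; first exact: cst_continuous.
by exists (fun=> 0) => // x; exact: is_derive_cst.
Qed.

Lemma smD k f g : sm k f -> sm k g -> sm k (fun x => f x + g x).
Proof.
elim: k f g => [f g cf cg x|k IH f g [f' ff' sf] [g' gg' sg]].
  by apply: cvgD; [exact: cf|exact: cg].
by exists (fun x => f' x + g' x); [move=> x; exact: is_derive_funD|exact: IH].
Qed.

Lemma smM k f g : sm k f -> sm k g -> sm k (fun x => f x * g x).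
Proof.
elim: k f g => [f g cf cg x|k IH f g sf sg].
  by apply: cvgM; [exact: cf|exact: cg].
have [f' ff' sf'] := sf; have [g' gg' sg'] := sg.
exists (fun x => f' x * g x + f x * g' x); first by move=> x; exact: is_derive_funM.
by apply: smD; apply: IH => //; exact: smS.
Qed.

Lemma sm_affine k f c e : sm k f -> sm k (fun x => f (c + e * x)).
Proof.
elim: k f => [f cf x|k IH f [f' ff' sf']].
  apply: (continuous_comp (f := fun t => c + e * t)); last exact: cf.
  exact: is_derive_continuous (is_derive_affine c e x).
exists (fun x => f' (c + e * x) * e); first by move=> x; exact: is_derive_comp_affine.
by apply: smM; [exact: IH|exact: sm_cst].
Qed.

(** The derivative of t^(-k) exp(-1/t) is a combination of two other members of the family; having
    all k at hand makes smoothness a plain induction on the order. *)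
Definition flat (k : nat) (t : R) : R :=
  if 0 < t then t^-1 ^+ k * expR (- t^-1) else 0.

Lemma flat_ge0 k t : 0 <= flat k t.
Proof.
by rewrite /flat; case: ifPn => // t0; rewrite mulr_ge0 ?exprn_ge0 ?invr_ge0 ?expR_ge0// ltW.
Qed.

(** From exp(x) >= x^(k+2)/(k+2)! at x = 1/t. The square on the right is what sends the difference
    quotient at 0 to 0. *)
Lemma flat_le k t : flat k t <= k.+2`!%:R * t ^+ 2.
Proof.
rewrite /flat; case: ifPn => t0; last by rewrite mulr_ge0// sqr_ge0.
have i0 : 0 < t^-1 by rewrite invr_gt0.
have F0 : 0 < k.+2`!%:R :> R by rewrite ltr0n fact_gt0.
have := expR_ge1Dxn k.+1 (ltW i0); rewrite expRN ler_pdivrMr ?expR_gt0// => h.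
have : t^-1 ^+ k.+2 / k.+2`!%:R <= expR t^-1 by lra.
rewrite ler_pdivrMr// => {}h.

have -> : t^-1 ^+ k = t^-1 ^+ k.+2 * t ^+ 2.
  by rewrite -addn2 exprD -mulrA -exprMn mulVf ?gt_eqF// expr1n mulr1.
by rewrite (mulrAC _ (t ^+ 2)) (mulrC _ (expR _)) ler_wpM2r// exprn_ge0// ltW.
Qed.

Lemma is_derive_flat k (x : R) :
  is_derive x 1 (flat k) (- k%:R * flat k.+1 x + flat k.+2 x).
Proof.
have [x0|x0|x0] := ltgtP x 0.
- have E : - k%:R * flat k.+1 x + flat k.+2 x = 0.
    by rewrite /flat ltNge (ltW x0)/= mulr0 addr0.
  rewrite E; apply: (@near_eq_is_derive _ _ _ (cst 0)).
  near=> y; rewrite /flat ifF//; apply/negbTE; rewrite -leNgt ltW//.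
  by near: y; exact: lt_nbhsl.
- have nE : \forall y \near x, y^-1 ^+ k * expR (- y^-1) = flat k y.
    by near=> y; rewrite /flat ifT//; near: y; exact: lt_nbhsr.
  apply: (near_eq_is_derive nE).
  have dV : is_derive x 1 (fun t : R => t^-1) (- x ^- 2).
    have := @is_deriveV R id x 1 1 (lt0r_neq0 x0) (is_derive_id x 1).
    by move=> h; apply: is_derive_eq h _; rewrite /GRing.scale/= mulr1.
  have dX : is_derive x 1 (fun t : R => t^-1 ^+ k) (k%:R * x^-1 ^+ k.-1 * (- x ^- 2)).
    have := is_deriveX k dV.
    by rewrite (_ : (_ ^+ k) = (fun t : R => t^-1 ^+ k))//; apply/funext => t; rewrite exprfctE.
  have dE : is_derive x 1 (fun t : R => expR (- t^-1)) (expR (- x^-1) * x ^- 2).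
    have dN : is_derive x 1 (fun t : R => - t^-1) (x ^- 2).
      by have := is_deriveN dV; rewrite opprK.
    exact: (is_derive1_comp (is_derive_expR _) dN).
  apply: is_derive_eq (is_derive_funM dX dE) _.
  rewrite /flat x0 -!exprVn !exprS.
  by clear; case: k => [|k]; rewrite ?mulr0n /= ?exprS; ring.
- subst x; have E j : flat j 0 = 0 by rewrite /flat ltxx.
  rewrite !E mulr0 addr0.
  have c : (fun h : R => h^-1 *: (flat k (h *: 1 + 0) - flat k 0)) @ 0^' --> (0 : R).
    rewrite E; apply/cvgrPdist_le => e e0.
    have F0 : 0 < k.+2`!%:R :> R by rewrite ltr0n fact_gt0.
    near=> h; rewrite sub0r normrN subr0 addr0 /GRing.scale/= mulr1 normrM.
    have h0 : h != 0 by near: h; exact: nbhs_dnbhs_neq.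
    rewrite (ger0_norm (flat_ge0 _ _)); apply: (@le_trans _ _ (`|h^-1| * (k.+2`!%:R * h ^+ 2))).
      by rewrite ler_wpM2l// flat_le.
    have -> : `|h^-1| * (k.+2`!%:R * h ^+ 2) = k.+2`!%:R * `|h|.
      by rewrite -(real_normK (num_real h)) normfV; field; rewrite normr_eq0.
    rewrite mulrC -ler_pdivlMr//; near: h.
    apply: nbhs_dnbhs; have := @nbhsx_ballx R R 0 (e / k.+2`!%:R) (divr_gt0 e0 F0).
    apply: filterS => z; rewrite /ball/= sub0r normrN => /ltW//.
  have dv : derivable (flat k) 0 1 by apply/cvg_ex; exists 0; exact: c.
  by apply: DeriveDef => //; apply/cvg_lim.
Unshelve. all: by end_near. Qed.

Lemma sm_flat m k : sm m (flat k).
Proof.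
elim: m k => [k x|m IH k]; first exact: is_derive_continuous (is_derive_flat k x).
exists (fun x => - k%:R * flat k.+1 x + flat k.+2 x); first exact: is_derive_flat.
by apply: smD => //; apply: smM => //; exact: sm_cst.
Qed.

(** Vanishes for |t| >= 1. The arguments keep the shape c + e t expected by [sm_affine] and
    [is_derive_comp_affine]. *)
Definition bump (t : R) : R := flat 0 (1 + (-1) * t) * flat 0 (1 + 1 * t).

Lemma sm_bump m : sm m bump.
Proof. by apply: smM; apply: sm_affine; exact: sm_flat. Qed.

Lemma bump_ge0 t : 0 <= bump t.
Proof. by rewrite mulr_ge0// flat_ge0. Qed.

Lemma bump_eq0 t : 1 <= `|t| -> bump t = 0.
Proof.
rewrite ler_normr => /orP[] ht; rewrite /bump /flat; case: ifPn => h; rewrite ?mul0r//.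
  by exfalso; lra.
by rewrite ifF ?mulr0//; apply/negbTE; lra.
Qed.

Lemma bump_le1 t : bump t <= 1.
Proof.
have h s : flat 0 s <= 1.
  rewrite /flat; case: ifPn => // s0; rewrite mul1r -expR0 ler_expR lerNl oppr0.
  by rewrite invr_ge0 ltW.
by rewrite -[leRHS]mulr1; apply: ler_pM => //; exact: flat_ge0.
Qed.

Definition dbump (t : R) : R :=
  flat 0 (1 + (-1) * t) * flat 2 (1 + 1 * t) - flat 2 (1 + (-1) * t) * flat 0 (1 + 1 * t).

Lemma is_derive_bump (t : R) : is_derive t 1 bump (dbump t).
Proof.
have h c e (s : R) : is_derive s 1 (fun x => flat 0 (c + e * x)) (flat 2 (c + e * s) * e).
  apply: is_derive_comp_affine; apply: is_derive_eq (is_derive_flat 0 _) _.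
  by rewrite mulr0n oppr0 mul0r add0r.
apply: is_derive_eq (is_derive_funM (h 1 (-1) t) (h 1 1 t)) _.
by rewrite /dbump; ring.
Qed.

Lemma flat2_le t : flat 2 t <= 2.
Proof.
rewrite /flat; case: ifPn => // t0; have i0 : 0 < t^-1 by rewrite invr_gt0.
rewrite expRN ler_pdivrMr ?expR_gt0//.
have := expR_ge1Dxn 1 (ltW i0); rewrite (_ : 2`! = 2)%N//.
by rewrite -lerBrDl ler_pdivrMr//; have := expR_gt0 t^-1; lra.
Qed.

Lemma flat0_le t : flat 0 t <= 1.
Proof.
rewrite /flat; case: ifPn => // t0; rewrite mul1r -expR0 ler_expR lerNl oppr0.
by rewrite invr_ge0 ltW.
Qed.

Lemma dbump_le t : `|dbump t| <= 4.
Proof.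
have h (a b : R) : flat 0 a * flat 2 b <= 2.
  by rewrite -[leRHS]mul1r; apply: ler_pM; rewrite ?flat_ge0 ?flat0_le ?flat2_le.
rewrite /dbump (mulrC (flat 2 _)).
have := h (1 + (-1) * t) (1 + 1 * t); have := h (1 + 1 * t) (1 + (-1) * t).
have := mulr_ge0 (flat_ge0 0 (1 + (-1) * t)) (flat_ge0 2 (1 + 1 * t)).
have := mulr_ge0 (flat_ge0 0 (1 + 1 * t)) (flat_ge0 2 (1 + (-1) * t)).
by rewrite ler_norml; lra.
Qed.

Lemma dbump_eq0 t : 1 <= `|t| -> dbump t = 0.
Proof.
have h k (s : R) : s <= 0 -> flat k s = 0 by rewrite /flat ltNge => ->.
by rewrite ler_normr /dbump => /orP[] ht;
  [rewrite !(h _ (1 + (-1) * t))|rewrite !(h _ (1 + 1 * t))]; rewrite ?mul0r ?mulr0 ?subr0//; lra.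
Qed.

(** The witnesses hidden in [sm k] for different k all coincide with [derive1 f], so a single
    derivative works for every order. *)
Lemma smoothP (f : R -> R) : (forall k, sm k f) ->
  exists2 f' : R -> R, forall x : R, is_derive x 1 f (f' x) & forall k, sm k f'.
Proof.
move=> sf; exists (derive1 f).
  move=> x; have [f' /(_ x) h _] := sf 1%N; rewrite derive1E.
  by have [_ E] := h; apply: is_derive_eq h _; rewrite E.
move=> k; have [f' h s] := sf k.+1; rewrite (_ : derive1 f = f')//.
by apply/funext => x; rewrite derive1E; have [_ ->] := h x.
Qed.

End smooth.

(** * Smooth functions of product form *)

Section tensor_product.
Context {R : realType} {n : nat}.
Local Notation V := 'rV[R]_n.

Lemma is_derive_line (f : V -> R) (z v : V) l :
  is_derive (0 : R) 1 (fun t : R => f (z + t *: v)) l -> is_derive z v f l.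
Proof.
move=> [dF FE].
have E : (fun h : R => h^-1 *: (f (h *: v + z) - f z)) =
    (fun h : R => h^-1 *: ((fun t : R => f (z + t *: v)) (h *: 1 + 0) - (fun t : R => f (z + t *: v)) 0)).
  by apply/funext => h; rewrite addr0 scale0r addr0 [h *: 1]mulr1 (addrC _ z).
split; first by rewrite /derivable E; exact: dF.
by rewrite -FE /derive E.
Qed.

Definition tprod (h : 'I_n -> R -> R) (z : V) : R := \prod_(i < n) h i (z 0 i).

(** A partial derivative of a tensor product is again a tensor product, with one factor replaced by
    its derivative; this closes the induction in [Ck_tprod]. *)
Definition upd (h : 'I_n -> R -> R) i f : 'I_n -> R -> R :=
  fun j => if j == i then f else h j.

Lemma tprod_upd h i f z : tprod (upd h i f) z = f (z 0 i) * \prod_(j < n | j != i) h j (z 0 j).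
Proof.
rewrite /tprod (bigD1 i)//= /upd eqxx; congr (_ * _).
by apply: eq_bigr => j /negbTE ->.
Qed.

Lemma is_derive_tprod_line h h' (z v : V) (t : R) :
  (forall i x, is_derive (x : R) 1 (h i) (h' i x)) ->
  is_derive t 1 (fun t : R => tprod h (z + t *: v))
    (\sum_(i < n) v 0 i * tprod (upd h i (h' i)) (z + t *: v)).
Proof.
move=> hh; rewrite (_ : (fun _ => _) =
    (fun t => \prod_(i <- index_enum 'I_n) h i (z 0 i + v 0 i * t))); last first.
  by apply/funext => s; apply: eq_bigr => i _; rewrite !mxE mulrC.
have d i : is_derive t 1 (fun t => h i (z 0 i + v 0 i * t)) (h' i (z 0 i + v 0 i * t) * v 0 i).
  by apply: is_derive_comp_affine; exact: hh.
apply: is_derive_eq (is_derive_prod (f' := fun i t => h' i (z 0 i + v 0 i * t) * v 0 i) (index_enum_uniq _) d) _.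
have E j : (z + t *: v) 0 j = z 0 j + v 0 j * t by rewrite !mxE mulrC.
apply: eq_bigr => i _; rewrite tprod_upd E (mulrC (h' _ _)) -mulrA; congr (_ * (_ * _)).
by apply: eq_bigr => j _; rewrite E.
Qed.

Lemma is_derive_tprod h h' (z : V) i :
  (forall i x, is_derive (x : R) 1 (h i) (h' i x)) ->
  is_derive z (delta_mx 0 i : V) (tprod h) (tprod (upd h i (h' i)) z).
Proof.
move=> hh; apply: is_derive_line.
apply: is_derive_eq (is_derive_tprod_line z _ 0 hh) _.
rewrite (bigD1 i)//= big1 ?addr0; last by move=> j ji; rewrite mxE/= (negbTE ji) mul0r.
by rewrite mxE !eqxx mul1r scale0r addr0.
Qed.

Lemma tprod_continuous h : (forall i, continuous (h i)) -> continuous (tprod h).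
Proof.
move=> ch; rewrite (_ : tprod h = (fun z : V => \prod_(i < n) h i (z 0 i)))//.
apply: (@continuous_big R 'I_n *%R 1 xpredT _ V (index_enum _) (fun i z => h i (z 0 i))) => [|i _ x]; first exact: mul_continuous.
by apply: (@continuous_comp _ _ _ (fun x : V => x 0 i) (h i));
  [exact: coord_continuous|exact: ch].
Qed.

Lemma Ck_tprod k h : (forall i m, sm m (h i)) -> Ck k (tprod h).
Proof.
elim: k h => [h sh|k IH h sh].
  by apply: tprod_continuous => i; exact: sm_continuous (sh i 0%N).
have /choice[h' hh'] : forall i, exists f' : R -> R,
    (forall x : R, is_derive x 1 (h i) (f' x)) /\ forall m, sm m f'.
  by move=> i; have [f' ? ?] := smoothP (sh i); exists f'.
have d z i : is_derive z (delta_mx 0 i : V) (tprod h) (tprod (upd h i (h' i)) z).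
  by apply: is_derive_tprod => j x; have [] := hh' j.
split => [i x|i]; first by have [] := d x i.
rewrite (_ : 'D__ _ = tprod (upd h i (h' i))); last first.
  by apply/funext => z; have [_ ->] := d z i.
apply: IH => j m; rewrite /upd; case: eqP => [_|_]; last exact: sh.
by have [] := hh' i.
Qed.

End tensor_product.

Section kernel.
Context {R : realType} {n : nat}.
Local Notation V := 'rV[R]_n.
Local Notation L := (lebesgue_rV R n).

(** A product kernel, supported in a cube: smoothness reduces to one variable and the Euclidean norm
    never has to be differentiated. It is not normalized; [moll] divides by its mass e^n [kmass]. *)
Definition kern (e : R) : V -> R := tprod (fun _ s => bump (e^-1 * s)).
Definition dkern (e : R) (i : 'I_n) : V -> R :=
  tprod (upd (fun _ s => bump (e^-1 * s)) i (fun s => dbump (e^-1 * s) * e^-1)).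

Lemma sm_bump_scale e m : sm m (fun s : R => bump (e^-1 * s)).
Proof.
rewrite (_ : (fun _ => _) = (fun s : R => bump (0 + e^-1 * s))).
  by apply: sm_affine; exact: sm_bump.
by apply/funext => s; rewrite add0r.
Qed.

Lemma is_derive_bump_scale e (s : R) :
  is_derive s 1 (fun s : R => bump (e^-1 * s)) (dbump (e^-1 * s) * e^-1).
Proof.
have -> : (fun s : R => bump (e^-1 * s)) = (fun s : R => bump (0 + e^-1 * s)).
  by apply/funext => t; rewrite add0r.
by apply: is_derive_comp_affine; rewrite add0r; exact: is_derive_bump.
Qed.

Lemma kern_continuous e : continuous (kern e).
Proof. by apply: tprod_continuous => i; exact: sm_continuous (sm_bump_scale e 0). Qed.

Lemma sm_dbump_scale e : continuous (fun s : R => dbump (e^-1 * s) * e^-1).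
Proof.
have [f' h s] := sm_bump_scale e 1.
rewrite (_ : (fun _ => _) = f'); first exact: s.
apply/funext => x; have [_ <-] := is_derive_bump_scale e x.
by have [_ ->] := h x.
Qed.

Lemma dkern_continuous e i : continuous (dkern e i).
Proof.
apply: tprod_continuous => j; rewrite /upd; case: ifPn => _; first exact: sm_dbump_scale.
exact: sm_continuous (sm_bump_scale e 0).
Qed.

Lemma kern_ge0 e z : 0 <= kern e z.
Proof. by apply: prodr_ge0 => i _; exact: bump_ge0. Qed.

Lemma kern_le1 e z : kern e z <= 1.
Proof. by apply: prodr_ile1 => i _; rewrite bump_ge0 bump_le1. Qed.

Lemma dkern_le e i z : 0 < e -> `|dkern e i z| <= 4 / e.
Proof.
move=> e0; rewrite /dkern tprod_upd !normrM (gtr0_norm (x := e^-1)) ?invr_gt0//.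
rewrite -[leRHS]mulr1; apply: ler_pM => //; first by rewrite mulr_ge0// invr_ge0 ltW.
  by rewrite ler_wpM2r ?invr_ge0 ?(ltW e0)// dbump_le.
rewrite normr_prod; apply: prodr_ile1 => j _.
by rewrite normr_ge0/= ger0_norm ?bump_ge0// bump_le1.
Qed.

Lemma kern_eq0 e (z : V) i : 0 < e -> e <= `|z 0 i| -> kern e z = 0.
Proof.
move=> e0 ez; rewrite /kern /tprod (bigD1 i)//= bump_eq0 ?mul0r//.
by rewrite normrM gtr0_norm ?invr_gt0// -ler_pdivrMl ?invr_gt0// invrK mulr1.
Qed.

Lemma dkern_eq0 e j (z : V) i : 0 < e -> e <= `|z 0 i| -> dkern e j z = 0.
Proof.
move=> e0 ez; have h : 1 <= `|e^-1 * z 0 i|.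
  by rewrite normrM gtr0_norm ?invr_gt0// -ler_pdivrMl ?invr_gt0// invrK mulr1.
rewrite /dkern tprod_upd; have [->|ij] := eqVneq j i; first by rewrite dbump_eq0 ?mul0r.
by rewrite (bigD1 i) 1?eq_sym//= bump_eq0// mul0r mulr0.
Qed.

Lemma kern_supp e z : 0 < e -> kern e z != 0 -> enorm z <= n%:R * e.
Proof.
move=> e0 kz; apply: le_trans (enorm_le_sum _) _.
rewrite mulr_natl -[X in _ *+ X](card_ord n) -sumr_const; apply: ler_sum => i _.
by rewrite leNgt; apply/negP => /ltW /(kern_eq0 e0) z0; rewrite z0 eqxx in kz.
Qed.

Lemma test_function_kern e (x : V) (D : set V) : 0 < e ->
  (forall z : V, (forall i, `|(z - x) 0 i| <= e) -> D z) ->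
  test_function D (fun z => kern e (z - x)).
Proof.
move=> e0 hD; rewrite (_ : (fun _ => _) = tprod (fun i s => bump (- (e^-1 * x 0 i) + e^-1 * s))); last first.
  by apply/funext => z; apply: eq_bigr => i _; rewrite !mxE mulrBr addrC.
split; first by move=> k; apply: Ck_tprod => i m; apply: sm_affine; exact: sm_bump.
exists [set z : V | forall i, z 0 i \in `[x 0 i - e, x 0 i + e]]; split.
- apply: (@rV_compact _ _ (fun i => `[x 0 i - e, x 0 i + e]%classic)) => i.
  exact: segment_compact.
- move=> z zh; apply: hD => i; have := zh i; rewrite in_itv/= !mxE => /andP[h1 h2].
  by rewrite ler_norml; lra.
- move=> z nz; have : exists i, e <= `|(z - x) 0 i|.
    apply: contrapT => /forallNP h; apply: nz => i; have /negP := h i.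
    by rewrite -ltNge !mxE in_itv/= ltr_norml; lra.
  move=> [i hi]; rewrite -[LHS](_ : kern e (z - x) = _); first exact: kern_eq0 hi.
  by apply: eq_bigr => j _; rewrite !mxE mulrBr addrC.
Qed.

Lemma is_derive_kern e (z : V) i :
  is_derive z (delta_mx 0 i : V) (kern e) (dkern e i z).
Proof.
rewrite /dkern.
exact: (is_derive_tprod (h' := fun _ s => dbump (e^-1 * s) * e^-1) z i (fun _ => is_derive_bump_scale e)).
Qed.

Lemma derive_kern_shift e (x z : V) i :
  'D_(delta_mx 0 i) (fun z => kern e (z - x)) z = dkern e i (z - x).
Proof.
have [_ <-] := is_derive_kern e (z - x) i; rewrite /derive.
congr (lim (_ @ 0^')); apply/funext => h.
by rewrite /= -addrA.
Qed.

Lemma is_derive_kern_line e (z v : V) (t : R) :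
  is_derive t 1 (fun t : R => kern e (z + t *: v))
    (\sum_(i < n) v 0 i * dkern e i (z + t *: v)).
Proof.
exact: (is_derive_tprod_line (h' := fun _ s => dbump (e^-1 * s) * e^-1) z v t (fun _ => is_derive_bump_scale e)).
Qed.

Lemma measurable_kern e : measurable_fun setT (kern e).
Proof. by apply: continuous_measurable_rV; exact: kern_continuous. Qed.

Lemma measurable_dkern e i : measurable_fun setT (dkern e i).
Proof. by apply: continuous_measurable_rV; exact: dkern_continuous. Qed.

Definition kmass : R := fine (\int[L]_z (kern 1 z)%:E)%E.

Lemma kmassE : (\int[L]_z (kern 1 z)%:E)%E = kmass%:E.
Proof.
rewrite fineK// ge0_fin_numE; last by apply: integral_ge0 => z _; rewrite lee_fin kern_ge0.
have b0 : 0 < n%:R + 1 :> R by rewrite ltr_wpDl.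
apply: (@le_lt_trans _ _ (\int[L]_z (\1_(eball 0 (n%:R + 1)) z)%:E)%E).
  apply: ge0_le_integral => //.
  - by move=> z _; rewrite lee_fin kern_ge0.
  - by apply/measurable_EFinP; exact: measurable_kern.
  - by apply/measurable_EFinP; apply: measurable_indic; exact: measurable_eball.
  move=> z _; rewrite lee_fin indicE; have [->|/(kern_supp ltr01)] := eqVneq (kern 1 z) 0.
    by rewrite ler0n.
  by rewrite mulr1 => h; rewrite mem_set ?kern_le1// /eball/= subr0; lra.
rewrite integral_indic; [rewrite setIT|by []|exact: measurable_eball].
by rewrite [X in (X < _)%E]lebesgue_eball// ltry.
Qed.

Lemma kmass_gt0 : 0 < kmass.
Proof.
rewrite -lte_fin -kmassE; have h0 : 0 < 2^-1 :> R by [].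
(* For coordinates below 1/2 in modulus, both factors of [bump] have an argument at least 1/2 and
   are at least exp(-2). *)
have c0 : 0 < expR (- 4) ^+ n :> R by rewrite exprn_gt0// expR_gt0.
apply: (@lt_le_trans _ _ (\int[L]_(z in eball 0 2^-1) (expR (- 4) ^+ n)%:E)%E).
  rewrite integral_cst; last exact: measurable_eball.
  by rewrite [X in (_ < _ * X)%E]lebesgue_eball// -EFinM lte_fin mulr_gt0// mulr_gt0 ?ball_vol_gt0 ?exprn_gt0.
apply: (@le_trans _ _ (\int[L]_(z in eball 0 2^-1) (kern 1 z)%:E)%E); last first.
  apply: ge0_subset_integral => //; first exact: measurable_eball.
    by apply/measurable_EFinP; exact: measurable_kern.
  by move=> z _; rewrite lee_fin kern_ge0.
apply: ge0_le_integral.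
- exact: measurable_eball.
- by move=> z _; rewrite lee_fin ltW.
- exact: measurable_cst.
- by apply: measurable_funTS; apply/measurable_EFinP; exact: measurable_kern.
move=> z; rewrite /eball/= subr0 => z2; rewrite lee_fin.
rewrite -[X in _ ^+ X](card_ord n) -prodr_const; apply: ler_prod => i _.
rewrite expR_ge0/= invr1 mul1r.
have := le_lt_trans (coord_le_enorm z i) z2; rewrite ltr_norml => /andP[z1 z3].
have fl s : 2^-1 <= s -> expR (- 2) <= flat 0 s :> R.
  move=> s2; have s0 : 0 < s by exact: lt_le_trans s2.
  by rewrite /flat s0 mul1r ler_expR lerN2 invf_ple ?posrE.
rewrite /bump (_ : - 4 = - 2 + - 2 :> R); last by ring.
by rewrite expRD; apply: ler_pM; rewrite ?expR_ge0// fl//; lra.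
Qed.

Lemma integral_kern e (x : V) : 0 < e ->
  (\int[L]_z (kern e (z - x))%:E = (e ^+ n * kmass)%:E)%E.
Proof.
move=> e0; have mk : measurable_fun setT (fun z : V => (kern e (z - x))%:E : \bar R).
  by apply/measurable_EFinP; apply: measurableT_comp (measurable_kern e) _; exact: measurable_rVB.
have := ge0_integral_affine x e0 mk (fun z => (ltac:(by rewrite lee_fin kern_ge0) : 0 <= (kern e (z - x))%:E)%E).
rewrite (_ : \int[L]_z _ = kmass%:E)%E; last first.
  rewrite -kmassE; apply: eq_integral => z _; congr (_%:E); apply: eq_bigr => i _.
  by rewrite !mxE; congr bump; field; rewrite gt_eqF.
move=> E; rewrite mulrC EFinM E muleAC -EFinM mulVf ?mul1e//.
by rewrite expf_neq0// gt_eqF.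
Qed.

End kernel.

(** * Mollification of weak gradients *)

Lemma integrable_EFin_measurable {d} {T : measurableType d} {R : realType}
    (mu : {measure set T -> \bar R}) (D : set T) (v : T -> R) :
  mu.-integrable D (EFin \o v) -> measurable_fun D v.
Proof. by move=> /measurable_int /measurable_EFinP. Qed.

Lemma Rintegral_sum {d} {T : measurableType d} {R : realType}
    (mu : {measure set T -> \bar R}) (I : Type) (s : seq I) (f : I -> T -> R) :
  (forall i, mu.-integrable setT (EFin \o f i)) ->
  mu.-integrable setT (EFin \o (fun x => \sum_(i <- s) f i x)) /\
  \int[mu]_x (\sum_(i <- s) f i x) = \sum_(i <- s) \int[mu]_x f i x.
Proof.
move=> hf; elim: s => [|i s [IH1 IH2]].
  rewrite big_nil (_ : (fun _ => _) = cst 0); last by apply/funext => x; rewrite big_nil.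
  by split; [exact: integrable0|rewrite /Rintegral integral0].
rewrite (_ : (fun _ => _) = (fun x => f i x + \sum_(j <- s) f j x)); last first.
  by apply/funext => x; rewrite big_cons.
rewrite big_cons -IH2 -RintegralD//; split => //.
rewrite (_ : EFin \o _ = (EFin \o f i) \+ (EFin \o (fun x => (\sum_(j <- s) f j x)%R)))%E.
  exact: integrableD.
by apply/funext => x; rewrite /= EFinD.
Qed.

Section mollification.
Context {R : realType} {n : nat}.
Local Notation V := 'rV[R]_n.
Local Notation L := (lebesgue_rV R n).
Implicit Types (v : V -> R) (x z : V) (e : R).

Definition moll (e : R) v x : R :=
  (e ^+ n * @kmass R n)^-1 * \int[L]_z (kern e (z - x) * v z).

Let c_gt0 e : 0 < e -> 0 < (e ^+ n * @kmass R n)^-1.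
Proof. by move=> e0; rewrite invr_gt0 mulr_gt0 ?kmass_gt0// exprn_gt0. Qed.

Let mkern_shift e x : measurable_fun [set: V] (fun z : V => kern e (z - x)).
Proof. by apply: measurableT_comp (measurable_kern e) _; exact: measurable_rVB. Qed.

Lemma integrable_kernM e x v : L.-integrable setT (EFin \o v) ->
  L.-integrable setT (EFin \o (fun z => kern e (z - x) * v z)).
Proof.
move=> iv; apply: (le_integrable _ _ _ iv) => //.
  apply/measurable_EFinP; apply: measurable_funM => //.
  exact: integrable_EFin_measurable iv.
move=> z _; rewrite !abse_EFin lee_fin normrM ger0_norm ?kern_ge0//.
by rewrite ler_piMl// kern_le1.
Qed.

Lemma integrable_dkernM e x i v : 0 < e -> L.-integrable setT (EFin \o v) ->
  L.-integrable setT (EFin \o (fun z => dkern e i (z - x) * v z)).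
Proof.
move=> e0 iv; have i4 : L.-integrable setT (fun z => (4 / e)%:E * (EFin \o v) z)%E.
  exact: integrableZl.
apply: le_integrable i4 => //.
  apply/measurable_EFinP; apply: measurable_funM.
    by apply: measurableT_comp (measurable_dkern e i) _; exact: measurable_rVB.
  exact: integrable_EFin_measurable iv.
move=> z _; rewrite abse_EFin abseM !abse_EFin -EFinM lee_fin normrM ler_wpM2r//.
by rewrite (ger0_norm (x := 4 / e)) ?dkern_le// divr_ge0// ltW.
Qed.

Lemma moll_sub_le e v x : 0 < e -> L.-integrable setT (EFin \o v) ->
  (`|moll e v x - v x|%:E <= ((e ^+ n * @kmass R n)^-1)%:E *
     \int[L]_z (kern e (z - x) * `|v z - v x|)%:E)%E.
Proof.
move=> e0 iv; have c0 := c_gt0 e0; rewrite /moll.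
have ik : L.-integrable setT (EFin \o (fun z => kern e (z - x))).
  apply/integrableP; split; first exact/measurable_EFinP.
  under eq_integral => z _ do rewrite /= ger0_norm ?kern_ge0//.
  by rewrite integral_kern// ltry.
have vE : v x = (e ^+ n * @kmass R n)^-1 * \int[L]_z (kern e (z - x) * v x).
  rewrite RintegralZr// /Rintegral integral_kern//= mulrA mulVf ?mul1r//.
  by rewrite gt_eqF// mulr_gt0 ?kmass_gt0// exprn_gt0.
have ikv : L.-integrable setT (EFin \o (fun z => kern e (z - x) * v x)).
  rewrite (_ : EFin \o _ = fun z => (kern e (z - x))%:E * (v x)%:E)%E//.
  exact: integrableZr.
have ikm := integrable_kernM e x iv.
rewrite {1}vE -mulrBr -RintegralB// normrM EFinM (gtr0_norm c0).
apply: lee_wpmul2l; first by rewrite lee_fin ltW.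
have h : L.-integrable setT (EFin \o (fun z => kern e (z - x) * v z - kern e (z - x) * v x)).
  rewrite (_ : EFin \o _ = ((EFin \o (fun z => (kern e (z - x) * v z)%R)) \- (EFin \o (fun z => (kern e (z - x) * v x)%R)))%E); last first.
    by apply/funext => z /=; rewrite EFinB.
  exact: integrableB.
rewrite EFin_normr_Rintegral//.
apply: le_trans (le_abse_integral _ _ _) _ => //; first exact: measurable_int h.
rewrite le_eqVlt; apply/orP; left; apply/eqP; apply: eq_integral => z _.
by rewrite /= -mulrBr normrM (ger0_norm (kern_ge0 _ _)).
Qed.

Lemma measurable_moll e v : L.-integrable setT (EFin \o v) ->
  measurable_fun setT (moll e v).
Proof.
move=> iv; have mv : measurable_fun setT v by exact: integrable_EFin_measurable iv.
apply: measurable_funM => //; rewrite /Rintegral.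
apply: (measurableT_comp (f := fine)) => //.
under eq_fun do rewrite integralE.
have mk : measurable_fun [set: V * V] (fun p : V * V => kern e (p.2 - p.1) * v p.2).
  apply: measurable_funM; last exact: measurableT_comp.
  apply: measurableT_comp (measurable_kern e) _.
  by apply: measurable_rVB; [exact: measurable_snd|exact: measurable_fst].
have mek := (measurable_EFinP setT (fun p : V * V => kern e (p.2 - p.1) * v p.2)).2 mk.
apply: emeasurable_funB.
- rewrite [X in measurable_fun _ X](_ : _ = fubini_F L ((EFin \o (fun p : V * V => (kern e (p.2 - p.1) * v p.2)%R))^\+)%E).
    exact: (measurable_fun_fubini_tonelli_F _ (measurable_funepos mek) (funepos_ge0 _)).
  by apply/funext => x; rewrite /fubini_F; apply: eq_integral => z _; rewrite !funeposE.
- rewrite [X in measurable_fun _ X](_ : _ = fubini_F L ((EFin \o (fun p : V * V => (kern e (p.2 - p.1) * v p.2)%R))^\-)%E).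
    exact: (measurable_fun_fubini_tonelli_F _ (measurable_funeneg mek) (funeneg_ge0 _)).
  by apply/funext => x; rewrite /fubini_F; apply: eq_integral => z _; rewrite !funenegE.
Qed.

(** By Tonelli the error is at most the mean over z, against the kernel, of the L^1 norm of v(z + .)
    - v; only shifts of length at most n e contribute. Dividing r by n + 1 instead of n also covers
    n = 0. *)
Lemma moll_L1 v : trans_cont v -> L.-integrable setT (EFin \o v) ->
  forall eta, 0 < eta -> exists2 r, 0 < r & forall e, 0 < e < r ->
    (\int[L]_x `|moll e v x - v x|%:E <= eta%:E)%E.
Proof.
move=> [mv tv] iv eta eta0; have [r r0 hr] := tv _ eta0.
have n0 : 0 < n%:R + 1 :> R by rewrite ltr_wpDl.
exists (r / (n%:R + 1)) => [|e /andP[e0 er]]; first by rewrite divr_gt0.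
have c0 := c_gt0 e0; set c := (e ^+ n * @kmass R n)^-1 in c0.
have er' : n%:R * e < r.
  by move: er; rewrite ltr_pdivlMr//; lra.
have mm : measurable_fun [set: V * V] (fun p : V * V => (kern e p.2 * `|v (p.2 + p.1) - v p.1|)%:E : \bar R).
  apply/measurable_EFinP; apply: measurable_funM.
    by apply: measurableT_comp (measurable_kern e) _; exact: measurable_snd.
  apply: measurableT_comp => //; apply: measurable_funB; last by apply: measurableT_comp mv _; exact: measurable_fst.
  apply: measurableT_comp mv _.
  by apply: measurable_rVD; [exact: measurable_snd|exact: measurable_fst].
have mm0 (p : V * V) : (0 <= (kern e p.2 * `|v (p.2 + p.1) - v p.1|)%:E)%E.
  by rewrite lee_fin mulr_ge0// kern_ge0.
apply: (@le_trans _ _ (\int[L]_x (c%:E * \int[L]_z (kern e z * `|v (z + x)%R - v x|)%:E))%E).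
  apply: ge0_le_integral => //.
  - apply/measurable_EFinP; apply: measurableT_comp => //; apply: measurable_funB => //.
    exact: measurable_moll.
  - apply: measurable_funeM.
    exact: (measurable_fun_fubini_tonelli_F _ mm mm0).
  move=> x _; apply: le_trans (moll_sub_le x e0 iv) _.
  apply: lee_wpmul2l; first by rewrite lee_fin ltW.
  rewrite -(ge0_integral_shift x); last 2 first.
  - apply/measurable_EFinP; apply: measurable_funM => //.
    by apply: measurableT_comp => //; exact: measurable_funB.
  - by move=> z; rewrite lee_fin mulr_ge0// kern_ge0.
  rewrite le_eqVlt; apply/orP; left; apply/eqP; apply: eq_integral => z _.
  have -> : (x + z - x = z)%R by rewrite addrAC subrr add0r.
  by rewrite (addrC x z).
rewrite ge0_integralZl//; last 3 first.
- exact: (measurable_fun_fubini_tonelli_F _ mm mm0).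
- by move=> x _; apply: integral_ge0 => z _; exact: (mm0 (x, z)).
- by rewrite lee_fin ltW.
rewrite (fubini_tonelli (fun p : V * V => (kern e p.2 * `|v (p.2 + p.1) - v p.1|)%:E))//=.
apply: (@le_trans _ _ (c%:E * \int[L]_z ((kern e z)%:E * eta%:E))%E).
  apply: lee_wpmul2l; first by rewrite lee_fin ltW.
  apply: ge0_le_integral => //.
  - by move=> z _; apply: integral_ge0 => x _; exact: (mm0 (x, z)).
  - exact: (measurable_fun_fubini_tonelli_G _ mm mm0).
  - by apply: emeasurable_funM => //; apply/measurable_EFinP; exact: measurable_kern.
  move=> z _; under eq_integral do rewrite EFinM.
  rewrite ge0_integralZl//; last 2 first.
  - apply/measurable_EFinP; apply: measurableT_comp => //; apply: measurable_funB => //.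
    by apply: measurableT_comp mv _; exact: measurable_rVD.
  - by rewrite lee_fin kern_ge0.
  have [->|kz] := eqVneq (kern e z) 0; first by rewrite !mul0e.
  apply: lee_wpmul2l; first by rewrite lee_fin kern_ge0.
  by apply: hr; apply: le_lt_trans er'; exact: kern_supp.
rewrite ge0_integralZr//; last 3 first.
- by apply/measurable_EFinP; exact: measurable_kern.
- by move=> z _; rewrite lee_fin kern_ge0.
- by rewrite lee_fin ltW.
have kE : (\int[L]_z (kern e z)%:E = (e ^+ n * @kmass R n)%:E)%E.
  by rewrite -(integral_kern 0 e0); apply: eq_integral => z _; rewrite subr0.
rewrite [X in (_ * (X * _))%E]kE muleA -EFinM /c mulVf ?mul1r //.
by rewrite gt_eqF// mulr_gt0 ?kmass_gt0// exprn_gt0.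
Qed.

(** Differentiation under the integral sign, dominated by a multiple of |v| because the derivatives
    of the kernel are at most 4/e. The variable x enters as z - x, hence the minus sign. *)
Lemma is_derive_moll_line e v x (h : V) (t : R) : 0 < e -> L.-integrable setT (EFin \o v) ->
  is_derive t 1 (fun t : R => moll e v (x + t *: h))
    ((e ^+ n * @kmass R n)^-1 * - \sum_(i < n) h 0 i * \int[L]_z (dkern e i (z - (x + t *: h)) * v z)).
Proof.
move=> e0 iv; set c := (_ ^+ n * _)^-1.
pose f (s : R) z := kern e (z - (x + s *: h)) * v z.
have df (s : R) z : is_derive s 1 (f^~ z) (- (\sum_(i < n) h 0 i * dkern e i (z - (x + s *: h))) * v z).
  have := is_derive_funM (is_derive_kern_line e (z - x) (- h) s) (is_derive_cst (v z) s 1).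
  rewrite (_ : (fun _ => _) = f^~ z); last first.
    by apply/funext => s'; rewrite /f opprD addrA scalerN.
  rewrite mulr0 addr0 => dd; apply: is_derive_eq dd _.
  rewrite -sumrN; congr (_ * _); apply: eq_bigr => i _.
  by rewrite mxE mulNr opprD addrA scalerN.
have p1 s z : partial1of2 f s z = - (\sum_(i < n) h 0 i * dkern e i (z - (x + s *: h))) * v z.
  by rewrite /partial1of2 derive1E; have [_ ->] := df s z.
pose M := \sum_(i < n) `|h 0 i| * (4 / e).
have M0 : 0 <= M by apply: sumr_ge0 => i _; rewrite mulr_ge0// divr_ge0// ltW.
have bound s z : `|partial1of2 f s z| <= M * `|v z|.
  rewrite p1 normrM normrN ler_wpM2r// (le_trans (ler_norm_sum _ _ _))// ler_sum// => i _.
  by rewrite normrM ler_wpM2l// dkern_le.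
have iG : L.-integrable setT (EFin \o (fun z => M * `|v z|)).
  rewrite (_ : EFin \o _ = fun z => M%:E * (abse \o (EFin \o v)) z)%E//.
  by apply: integrableZl => //; exact: integrable_abse.
have tt : `]t - 1, t + 1[%classic t by rewrite /= in_itv/=; apply/andP; split; lra.
have dv (s : R) z : derivable (f^~ z) s 1 by have [] := df s z.
have := @cvg_differentiation_under_integral _ _ _ L f setT measurableT t (t - 1) (t + 1) tt
  (fun s _ => integrable_kernM e _ iv) (fun s z _ _ => dv s z).
move=> /(_ _ (fun z => mulr_ge0 M0 (normr_ge0 _)) iG (fun s z _ _ => bound s z)) H.
have dF : is_derive t 1 (fun s : R => \int[L]_z f s z) (\int[L]_z partial1of2 f t z).
  have H' : (fun k : R => k^-1 *: ((fun s : R => \int[L]_z f s z) (k *: 1 + t) - (fun s : R => \int[L]_z f s z) t)) @ 0^' -->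
      \int[L]_z partial1of2 f t z.
    under eq_fun => k do rewrite [k *: 1]mulr1.
    exact: H.
  apply: DeriveDef; first by apply/cvg_ex; eexists; exact: H'.
  by apply/cvg_lim => //; exact: H'.
have := is_derive_funM (is_derive_cst c t 1) dF.
rewrite mul0r add0r => d; apply: is_derive_eq d _; congr (_ * _).
under eq_Rintegral => z _ do rewrite p1.
have -> : (fun z => - (\sum_(i < n) h 0 i * dkern e i (z - (x + t *: h))) * v z) =
   (fun z => \sum_(i < n) (- h 0 i) * (dkern e i (z - (x + t *: h)) * v z)).
  apply/funext => z; rewrite -sumrN mulr_suml; apply: eq_bigr => i _; ring.
rewrite -sumrN.
have ii i : L.-integrable setT (EFin \o (fun z => (- h 0 i) * (dkern e i (z - (x + t *: h)) * v z))).
  rewrite (_ : EFin \o _ = fun z => ((- h 0 i)%:E * (EFin \o (fun z => (dkern e i (z - (x + t *: h)) * v z)%R)) z)%E)//.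
  by apply: integrableZl => //; exact: integrable_dkernM.
rewrite (Rintegral_sum _ ii).2; apply: eq_bigr => i _; rewrite RintegralZl ?mulNr//; exact: integrable_dkernM.
Qed.

End mollification.

(** * Integrals along segments *)

Section tonelli.
Context {d1 d2 : measure_display} {T1 : measurableType d1} {T2 : measurableType d2}.
Context {R : realType} (m1 : {sigma_finite_measure set T1 -> \bar R})
  (m2 : {sigma_finite_measure set T2 -> \bar R}).
Variables (A : set T1) (B : set T2) (F : T1 -> T2 -> \bar R).
Hypotheses (mA : measurable A) (mB : measurable B).
Hypothesis mF : measurable_fun setT (fun p : T1 * T2 => F p.1 p.2).
Hypothesis F0 : forall x y, (0 <= F x y)%E.
Local Open Scope ereal_scope.

Let FB (p : T1 * T2) := (F p.1 p.2 * (\1_B p.2)%:E).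

Let mFB : measurable_fun setT FB.
Proof.
apply: emeasurable_funM => //; apply/measurable_EFinP.
by apply: measurableT_comp; [exact: measurable_indic|exact: measurable_snd].
Qed.

Let FB0 p : 0 <= FB p. Proof. by rewrite mule_ge0. Qed.

Let intB x : \int[m2]_(y in B) F x y = \int[m2]_y FB (x, y).
Proof.
rewrite integral_mkcond; apply: eq_integral => y _; rewrite patchE /FB/= indicE.
by case: ifPn => _; rewrite ?mule1 ?mule0.
Qed.

Lemma measurable_integral_in : measurable_fun setT (fun x => \int[m2]_(y in B) F x y).
Proof.
under eq_fun do rewrite intB.
exact: (measurable_fun_fubini_tonelli_F _ mFB FB0).
Qed.

Lemma tonelli_in : \int[m1]_(x in A) \int[m2]_(y in B) F x y =
  \int[m2]_(y in B) \int[m1]_(x in A) F x y.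
Proof.
pose FAB (p : T1 * T2) := ((\1_A p.1)%:E * FB p).
have mFAB : measurable_fun setT FAB.
  apply: emeasurable_funM => //; apply/measurable_EFinP.
  by apply: measurableT_comp; [exact: measurable_indic|exact: measurable_fst].
have FAB0 p : 0 <= FAB p by rewrite mule_ge0.
transitivity (\int[m1]_x \int[m2]_y FAB (x, y)).
  rewrite integral_mkcond; apply: eq_integral => x _; rewrite patchE.
  case: ifPn => xA.
    by rewrite intB; apply: eq_integral => y _; rewrite /FAB/= indicE xA mul1e.
  by rewrite integral0_eq// => y _; rewrite /FAB/= indicE (negbTE xA) mul0e.
rewrite (fubini_tonelli FAB)// [RHS]integral_mkcond; apply: eq_integral => y _.
rewrite patchE; case: ifPn => yB; last first.
  by rewrite integral0_eq// => x _; rewrite /FAB /FB/= [\1_B _]indicE (negbTE yB) mule0 mule0.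
rewrite [RHS]integral_mkcond; apply: eq_integral => x _.
rewrite patchE /FAB /FB/= !indicE yB mule1.
by case: ifPn => _; rewrite ?mul1e ?mul0e.
Qed.

End tonelli.
Arguments measurable_integral_in {d1 d2 T1 T2 R m2 B F}.
Arguments tonelli_in {d1 d2 T1 T2 R m1 m2 A B F}.

Section segments_integral.
Context {R : realType} {n : nat}.
Local Notation V := 'rV[R]_n.
Local Notation L := (lebesgue_rV R n).
Local Notation I01 := (`[0%R, 1%R]%classic : set R).
Local Open Scope ereal_scope.

Lemma measurable_segment d (T : measurableType d) (p q : T -> V) (t : T -> R) :
  measurable_fun setT p -> measurable_fun setT q -> measurable_fun setT t ->
  measurable_fun setT (fun z => p z + t z *: (q z - p z))%R.
Proof.
by move=> mp mq mt; apply: measurable_rVD => //; apply: measurable_rVZ => //; exact: measurable_rVB.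
Qed.

Lemma integral_seg_right (f : V -> \bar R) (x : V) (t : R) : (0 < t)%R ->
  measurable_fun setT f -> (forall z, 0 <= f z) ->
  \int[L]_y f (x + t *: (y - x))%R = (t ^- n)%:E * \int[L]_z f z.
Proof.
move=> t0 mf f0; rewrite -(ge0_integral_affine (x - t *: x)%R t0 mf f0).
apply: eq_integral => y _; congr f; apply/rowP => i; rewrite !mxE; ring.
Qed.

(** For t >= 1/2 and fixed x, the substitution z = x + t(y - x) costs t^(-n) <= 2^n. For t < 1/2,
    exchanging x and y turns t into 1 - t and leads back to the first case. *)
Lemma segment_average (f : V -> \bar R) (B : set V) : measurable B ->
  measurable_fun setT f -> (forall z, 0 <= f z) ->
  \int[L]_(x in B) \int[L]_(y in B) \int[lebesgue_measure]_(t in I01) f (x + t *: (y - x))%R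
  <= L B * ((2 ^+ n)%:E * \int[L]_z f z).
Proof.
move=> mB mf f0.
have mI : measurable I01 by exact: measurable_itv.
have mft : measurable_fun [set: V * V * R] (fun p : V * V * R => f (p.1.1 + p.2 *: (p.1.2 - p.1.1))%R).
  apply: measurableT_comp mf _; apply: measurable_segment; last exact: measurable_snd.
    by apply: measurableT_comp; [exact: measurable_fst|exact: measurable_fst].
  by apply: measurableT_comp; [exact: measurable_snd|exact: measurable_fst].
set c := _ * \int[L]_z f z.
have c0 : 0 <= c by rewrite mule_ge0 ?lee_fin// integral_ge0.
have half (x : V) (t : R) : (2^-1 <= t)%R -> \int[L]_(y in B) f (x + t *: (y - x))%R <= c.
  move=> t2; have t0 : (0 < t)%R by exact: lt_le_trans t2.
  have mfx : measurable_fun setT (fun y : V => f (x + t *: (y - x))%R).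
    by apply: measurableT_comp mf _; exact: measurable_segment.
  apply: le_trans (@ge0_subset_integral _ _ _ L B setT _ _ _ _ _ _) _ => //.
  rewrite integral_seg_right//; apply: lee_wpmul2r; first exact: integral_ge0.
  by rewrite lee_fin -exprVn lerXn2r ?nnegrE// ?invr_ge0 ?(ltW t0)// invf_ple ?posrE.
have step (t : R) : (0 <= t <= 1)%R ->
    \int[L]_(x in B) \int[L]_(y in B) f (x + t *: (y - x))%R <= L B * c.
  have mt (s : R) : measurable_fun [set: V * V] (fun p : V * V => f (p.1 + s *: (p.2 - p.1))%R).
    by apply: measurableT_comp mf _; apply: measurable_segment.
  have key (s : R) : (2^-1 <= s)%R ->
      \int[L]_(x in B) \int[L]_(y in B) f (x + s *: (y - x))%R <= L B * c.
    move=> s2; rewrite muleC -(integral_cst L mB).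
    apply: ge0_le_integral => //.
    - by move=> x _; exact: integral_ge0.
    - apply: measurable_funTS.
      exact: (measurable_integral_in (m2 := L) (F := fun (x : V) y => f (x + s *: (y - x))%R) mB (mt s) (fun x y => f0 _)).
    - by move=> x _; exact: half.
  move=> /andP[t0 t1]; have [t2|t2] := leP 2^-1%R t; first exact: key.
  rewrite (tonelli_in (F := fun x y : V => f (x + t *: (y - x))%R) mB mB (mt t) (fun x y => f0 _)).
  apply: le_trans (key (1 - t)%R _); last by lra.
  rewrite le_eqVlt; apply/orP; left; apply/eqP.
  apply: eq_integral => y _; apply: eq_integral => x _; congr f.
  by apply/rowP => i; rewrite !mxE; ring.
under eq_integral => x _.
  rewrite (tonelli_in (m2 := lebesgue_measure) (F := fun (y : V) (t : R) => f (x + t *: (y - x))%R))//; last first.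
    by apply: measurableT_comp mf _; exact: measurable_segment.
  over.
rewrite (tonelli_in (m2 := lebesgue_measure) (F := fun (x : V) (t : R) => \int[L]_(y in B) f (x + t *: (y - x))%R))//; last 2 first.
- apply: (measurable_integral_in (m2 := L) (F := fun (q : V * measurableTypeR R) (y : V) => f (q.1 + q.2 *: (y - q.1))%R) mB _ (fun q y => f0 _)).
  apply: measurableT_comp mf _; apply: measurable_segment => //.
    by apply: measurableT_comp; [exact: measurable_fst|exact: measurable_fst].
  by apply: measurableT_comp; [exact: measurable_snd|exact: measurable_fst].
- by move=> x t; exact: integral_ge0.
apply: (@le_trans _ _ (\int[lebesgue_measure]_(t in I01) (L B * c))).
  apply: ge0_le_integral => //.
  - by move=> t _; apply: integral_ge0 => x _; exact: integral_ge0.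
  - apply: measurable_funTS.
    apply: (measurable_integral_in (m2 := L) (F := fun (t : measurableTypeR R) (x : V) => \int[L]_(y in B) f (x + t *: (y - x))%R) mB).
      apply: (measurable_integral_in (m2 := L) (F := fun (q : measurableTypeR R * V) (y : V) => f (q.2 + q.1 *: (y - q.2))%R) mB _ (fun q y => f0 _)).
      apply: measurableT_comp mf _; apply: measurable_segment => //.
        by apply: measurableT_comp; [exact: measurable_snd|exact: measurable_fst].
      by apply: measurableT_comp; [exact: measurable_fst|exact: measurable_fst].
    by move=> t x; exact: integral_ge0.
have I1 : lebesgue_measure I01 = 1 by rewrite lebesgue_measure_itv/= lte_fin ltr01 -EFinB subr0.
rewrite le_eqVlt; apply/orP; left; apply/eqP.
apply: (etrans (integral_cst lebesgue_measure mI (L B * c))).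
by transitivity (L B * c * 1); [congr (_ * _)|rewrite mule1].
Qed.

End segments_integral.

Section chain.
Context {R : realType}.
Implicit Types (f phi psi G : R -> R) (s t : R).

(** The fundamental theorem of calculus for phi o f. The derivative of f is required on [0,1] only,
    as a mollified function has the mollified gradient only while the segment stays well inside the
    domain. *)
Lemma chain_segment f phi psi G : continuous psi -> continuous G ->
  (forall s, is_derive s (1 : R) phi (psi s)) ->
  (forall t, 0 <= t <= 1 -> is_derive t (1 : R) f (G t)) ->
  (`|phi (f 1) - phi (f 0)|%:E <=
   \int[lebesgue_measure]_(t in `[0%R, 1%R]) (`|psi (f t)| * `|G t|)%:E)%E.
Proof.
move=> cpsi cG dphi df.
have dcomp t : 0 <= t <= 1 -> is_derive t (1 : R) (phi \o f) (psi (f t) * G t).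
  move=> t01; have := @is_derive1_comp _ phi f t _ _ (dphi (f t)) (df _ t01).
  by move=> h; apply: is_derive_eq h _.
have cf t : 0 <= t <= 1 -> {for t, continuous f}.
  move=> t01; have dft := df _ t01.
  by apply/differentiable_continuous/derivable1_diffP.
have cpf t : 0 <= t <= 1 -> {for t, continuous (phi \o f)}.
  move=> t01; have dft := dcomp _ t01.
  by apply/differentiable_continuous/derivable1_diffP.
have cH : {within `[0, 1], continuous (fun t => psi (f t) * G t)}.
  apply: continuous_in_subspaceT => t; rewrite inE/= in_itv/= => t01.
  apply: cvgM; last exact: cG.
  by apply: continuous_comp; [exact: cf|exact: cpsi].
rewrite -[X in (X <= _)%E]abse_EFin EFinB.
rewrite -(@continuous_FTC2 _ _ (phi \o f) 0 1 ltr01 cH); last 2 first.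
- split.
  + move=> t; rewrite in_itv/= => /andP[t0 t1].
    by have [] := dcomp t; rewrite ?(ltW t0) ?(ltW t1).
  + by apply: cvg_at_right_filter; apply: cpf; rewrite lexx ler01.
  + by apply: cvg_at_left_filter; apply: cpf; rewrite lexx ler01.
- move=> t; rewrite in_itv/= => /andP[t0 t1].
  rewrite derive1E; apply: derive_val; apply: dcomp.
  by rewrite (ltW t0) (ltW t1).
have mI : measurable (`[0, 1]%classic : set R) by exact: measurable_itv.
have mH : measurable_fun (`[0, 1]%classic : set R) (fun t => (psi (f t) * G t)%:E).
  apply/measurable_EFinP; exact: subspace_continuous_measurable_fun.
have h := le_abse_integral lebesgue_measure mI mH; apply: (le_trans h).
rewrite le_eqVlt; apply/orP; left; apply/eqP.
by apply: eq_integral => t _; rewrite abse_EFin normrM.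
Qed.

End chain.

(** * The two-point inequality *)

Lemma le_integral_dot {R : realType} {n : nat} (psi : R -> R) (x h : 'rV[R]_n)
    (U : 'rV[R]_n -> R) (W : 'I_n -> 'rV[R]_n -> R) :
  continuous psi -> continuous (fun t : R => U (x + t *: h)) ->
  (forall i, continuous (fun t : R => W i (x + t *: h))) ->
  (\int[lebesgue_measure]_(t in `[0%R, 1%R])
     (`|psi (U (x + t *: h))| * `|\sum_(i < n) h 0 i * W i (x + t *: h)|)%:E <=
   \int[lebesgue_measure]_(t in `[0%R, 1%R])
     (`|psi (U (x + t *: h))| * enorm (\row_i W i (x + t *: h)) * enorm h)%:E)%E.
Proof.
move=> cpsi cU cW.
have mI : measurable (`[0, 1]%classic : set R) by exact: measurable_itv.
have mpU : measurable_fun setT (fun t : R => `|psi (U (x + t *: h))|).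
  apply: measurableT_comp => //; apply: (measurableT_comp (f := psi)).
    exact: continuous_measurable_fun.
  exact: continuous_measurable_fun cU.
apply: ge0_le_integral => //.
- apply/measurable_EFinP/measurable_funTS/measurable_funM => //; apply: measurableT_comp => //.
  apply: measurable_sum => i; apply: measurable_funM => //.
  exact: continuous_measurable_fun (cW i).
- apply/measurable_EFinP/measurable_funTS/measurable_funM => //; apply: measurable_funM => //.
  apply: (measurableT_comp (f := @enorm R n)); first exact: measurable_enorm.
  apply: measurable_fun_rVP => i.
  under eq_fun do rewrite mxE.
  exact: continuous_measurable_fun (cW i).
- move=> t _; rewrite lee_fin -mulrA ler_wpM2l// mulrC.
  apply: le_trans (dot_le_enorm _ _).
  rewrite le_eqVlt; apply/orP; left; apply/eqP; congr (`|_|).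
  by apply: eq_bigr => i _; rewrite mxE.
Qed.

Section weak_gradient_mollified.
Context {R : realType} {n : nat}.
Local Notation V := 'rV[R]_n.
Local Notation L := (lebesgue_rV R n).
Variables (D K : set V) (u : V -> R) (g : V -> V).
Hypotheses (wg : weak_gradient D u g) (KD : K `<=` D).
Let u1 z := u z * \1_K z.
Let g1 i z := g z 0 i * \1_K z.
Hypotheses (iu : L.-integrable setT (EFin \o u1))
  (ig : forall i, L.-integrable setT (EFin \o g1 i)).
Implicit Types (e s t : R) (x y z h : V).

(** The translated kernel is a test function supported in [K], where cutting u and g by the
    indicator of [K] changes nothing. *)
Lemma weak_gradient_dkern e x i : 0 < e ->
  (forall z, enorm (z - x) <= n%:R * e -> K z) ->
  \int[L]_z (dkern e i (z - x) * u1 z) = - \int[L]_z (kern e (z - x) * g1 i z).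
Proof.
move=> e0 xK.
have cubeK (z : V) : (forall j, `|(z - x) 0 j| <= e) -> K z.
  move=> ze; apply: xK; apply: le_trans (enorm_le_sum _) _.
  by rewrite mulr_natl -[X in _ *+ X](card_ord n) -sumr_const; apply: ler_sum => j _.
have outK (z : V) : ~ K z -> exists j, e <= `|(z - x) 0 j|.
  move=> nK; apply: contrapT => /forallNP h; apply: nK; apply: cubeK => j.
  by apply/ltW; rewrite ltNge; apply/negP.
have [_ /(_ _ (test_function_kern e0 (fun z hz => KD (cubeK z hz))) i)] := wg.
rewrite Rintegral_mkcond [X in _ = - X -> _]Rintegral_mkcond => h.
transitivity (\int[L]_z ((fun z => u z * 'D_(delta_mx 0 i) (fun z => kern e (z - x)) z) \_ D) z).
  apply: eq_Rintegral => z _; rewrite patchE derive_kern_shift /u1 indicE.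
  have [zK|/negP] := boolP (z \in K).
    by rewrite mem_set; [rewrite mulr1 mulrC|exact: KD (set_mem zK)].
  rewrite inE => /outK[j zj]; rewrite mulr0 mulr0.
  by rewrite (@dkern_eq0 _ _ e i (z - x) j)// mulr0; case: ifP.
rewrite h; congr (- _); apply: eq_Rintegral => z _; rewrite patchE /g1 indicE.
have [zK|/negP] := boolP (z \in K).
  by rewrite mem_set; [rewrite mulr1 mulrC|exact: KD (set_mem zK)].
rewrite inE => /outK[j zj]; rewrite mulr0 mulr0.
by rewrite (@kern_eq0 _ _ e (z - x) j)// mulr0; case: ifP.
Qed.

Lemma is_derive_moll_weak e (x h : V) (t : R) : 0 < e ->
  (forall z, enorm (z - (x + t *: h)) <= n%:R * e -> K z) ->
  is_derive t (1 : R) (fun t : R => moll e u1 (x + t *: h))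
    (\sum_(i < n) h 0 i * moll e (g1 i) (x + t *: h)).
Proof.
move=> e0 tK; apply: is_derive_eq (is_derive_moll_line x h t e0 iu) _.
rewrite -sumrN mulr_sumr; apply: eq_bigr => i _.
rewrite (weak_gradient_dkern i e0 tK) /moll; ring.
Qed.

Lemma moll_segment e (x y : V) (phi psi : R -> R) : 0 < e ->
  continuous psi -> (forall s, is_derive s (1 : R) phi (psi s)) ->
  (forall t z, 0 <= t <= 1 -> enorm (z - (x + t *: (y - x))) <= n%:R * e -> K z) ->
  (`|phi (moll e u1 y) - phi (moll e u1 x)|%:E <=
   \int[lebesgue_measure]_(t in `[0%R, 1%R])
     (`|psi (moll e u1 (x + t *: (y - x)))| *
      enorm (\row_i moll e (g1 i) (x + t *: (y - x))) * enorm (y - x))%:E)%E.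
Proof.
move=> e0 cpsi dphi tK; set h := y - x.
pose F (t : R) := moll e u1 (x + t *: h).
pose G (t : R) := \sum_(i < n) h 0 i * moll e (g1 i) (x + t *: h).
have dF (t : R) : 0 <= t <= 1 -> is_derive t (1 : R) F (G t).
  by move=> t01; apply: is_derive_moll_weak => // z; exact: tK.
have cm (v : V -> R) : L.-integrable setT (EFin \o v) -> continuous (fun t : R => moll e v (x + t *: h)).
  move=> iv t; have dv := is_derive_moll_line x h t e0 iv.
  by apply/differentiable_continuous/derivable1_diffP.
have cG : continuous G.
  move=> t; rewrite /G; apply: cvg_big => [|i _]; first exact: add_continuous.
  by apply: cvgM; [exact: cvg_cst|exact: cm].
have F1 : F 1 = moll e u1 y by rewrite /F scale1r /h addrC subrK.
have F0 : F 0 = moll e u1 x by move: (scale0r h) => sh; rewrite /F; congr (moll _ _ _); rewrite sh addr0.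
have key := chain_segment cpsi cG dphi dF.
rewrite F1 F0 in key; apply: (le_trans key) => {key}.
exact: (le_integral_dot (W := fun i => moll e (g1 i)) cpsi (cm _ iu) (fun i => cm _ (ig i))).
Qed.

End weak_gradient_mollified.

(** * Auxiliary facts on integrals and L^1 tails *)

Section L1_lemmas.
Context d (T : measurableType d) (R : realType) (mu : {measure set T -> \bar R}).
Implicit Types (f g : T -> R) (D : set T) (a b k : R).

Lemma integrable_indicM f D : measurable D -> measurable_fun D f ->
  (\int[mu]_(z in D) `|f z|%:E < +oo)%E ->
  mu.-integrable setT (EFin \o (fun z => f z * \1_D z)).
Proof.
move=> mD mf fD.
have e1 : EFin \o (fun z => f z * \1_D z) = (EFin \o f) \_ D.
  by apply/funext => z; rewrite patchE /= indicE; case: ifP; rewrite ?mulr1 ?mulr0.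
rewrite e1; apply/(integrable_mkcond _ mD)/integrableP; split; first exact/measurable_EFinP.
by under eq_integral do rewrite abse_EFin.
Qed.

Lemma integrable_tail f : mu.-integrable setT (EFin \o f) -> (forall z, 0 <= f z) ->
  forall eta, 0 < eta -> exists2 M, 0 <= M &
    (\int[mu]_z (f z - Num.min (f z) M)%:E <= eta%:E)%E.
Proof.
move=> iF f0 eta eta0; have mf : measurable_fun setT f by exact: integrable_EFin_measurable iF.
pose h (k : nat) z := (f z - Num.min (f z) k%:R)%:E.
have h0 (k : nat) z : (0 <= h k z)%E by rewrite lee_fin subr_ge0 ge_min lexx.
have mh (k : nat) : measurable_fun setT (h k).
  by apply/measurable_EFinP; apply: measurable_funB => //; exact: measurable_minr.
have hcvg : {ae mu, forall z, setT z -> h^~ z @ \oo --> (cst 0%E) z}.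
  apply: aeW => z _; apply: (@cvg_near_cst nat _ (0%E : \bar R) (h^~ z)).
  exists (Num.truncn (f z)).+1 => // k /= fk; rewrite /h.
  rewrite min_l ?subrr//; apply/ltW; apply: lt_le_trans (Num.Theory.truncnS_gt _) _.
  by rewrite ler_nat.
have hle : {ae mu, forall z (k : nat), setT z -> (`|h k z| <= (EFin \o f) z)%E}.
  apply: aeW => z k _; rewrite gee0_abs// lee_fin lerBlDr lerDl le_min f0/=.
  exact: ler0n.
have [_ _ hlim] := dominated_convergence measurableT mh (measurable_cst _) hcvg iF hle.
rewrite integral0_eq// in hlim.
have nb : nbhs (0%E : \bar R) [set y | (y < eta%:E)%E].
  by apply: open_nbhs_nbhs; split; [exact: open_ereal_lt_ereal|rewrite /= lte_fin].
have [k _ hk] := hlim _ nb.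
exists k%:R => //; apply/ltW; exact: (hk k (leqnn k)).
Qed.

Lemma integral_addr_le f g D a b : measurable D -> measurable_fun setT f -> measurable_fun setT g ->
  (forall z, 0 <= f z) -> (forall z, 0 <= g z) ->
  (\int[mu]_(z in D) (f z)%:E <= a%:E)%E -> (\int[mu]_(z in D) (g z)%:E <= b%:E)%E ->
  (\int[mu]_(z in D) (f z + g z)%:E <= (a + b)%:E)%E.
Proof.
move=> mD mf mg f0 g0 fa gb; under eq_integral do rewrite EFinD.
rewrite ge0_integralD//.
- by rewrite EFinD; exact: leeD.
- by move=> z _; rewrite lee_fin.
- by apply/measurable_EFinP; exact: measurable_funTS.
- by move=> z _; rewrite lee_fin.
- by apply/measurable_EFinP; exact: measurable_funTS.
Qed.

Lemma integral_mulr_le k f D a : measurable D -> measurable_fun setT f -> 0 <= k ->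
  (forall z, 0 <= f z) ->
  (\int[mu]_(z in D) (f z)%:E <= a%:E)%E -> (\int[mu]_(z in D) (k * f z)%:E <= (k * a)%:E)%E.
Proof.
move=> mD mf k0 f0 fa; under eq_integral do rewrite EFinM.
rewrite ge0_integralZl_EFin//.
- by rewrite EFinM; exact: lee_wpmul2l.
- by move=> z _; rewrite lee_fin.
- by apply/measurable_EFinP; exact: measurable_funTS.
Qed.

Lemma integral_sumr_le (I : Type) (s : seq I) (f : I -> T -> R) D a : measurable D ->
  (forall i, measurable_fun setT (f i)) -> (forall i z, 0 <= f i z) ->
  (forall i, \int[mu]_(z in D) (f i z)%:E <= a%:E)%E ->
  (\int[mu]_(z in D) (\sum_(i <- s) f i z)%:E <= ((size s)%:R * a)%:E)%E.
Proof.
move=> mD mf f0 fa; elim: s => [|i s IH].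
  by under eq_integral do rewrite big_nil; rewrite integral0 mul0r.
under eq_integral do rewrite big_cons.
rewrite /= -natr1 mulrDl mul1r addrC; apply: integral_addr_le => //.
  exact: measurable_sum.
by move=> z; apply: sumr_ge0.
Qed.

Lemma integral_pair_sum (B : set T) (b : R) (A : T -> \bar R) (S : T -> T -> \bar R) :
  measurable B -> mu B = b%:E -> measurable_fun setT A -> (forall x, 0 <= A x)%E ->
  (forall x, measurable_fun setT (S x)) ->
  measurable_fun setT (fun x => \int[mu]_(y in B) S x y)%E -> (forall x y, 0 <= S x y)%E ->
  (\int[mu]_(x in B) \int[mu]_(y in B) (A x + A y + S x y) =
   (2 * b)%:E * \int[mu]_(x in B) A x + \int[mu]_(x in B) \int[mu]_(y in B) S x y)%E.
Proof.
move=> mB muB mA A0 mS mSS S0.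
have b0 : 0 <= b by rewrite -lee_fin -muB measure_ge0.
have mA' := measurable_funTS (D := B) mA.
transitivity (\int[mu]_(x in B) (A x * b%:E + (\int[mu]_(y in B) A y) + \int[mu]_(y in B) S x y))%E.
  apply: eq_integral => x _; rewrite ge0_integralD//.
  - rewrite ge0_integralD//; congr (_ + _ + _)%E.
    by rewrite -muB; exact: integral_cst.
  - by move=> y _; rewrite adde_ge0.
  - by apply: emeasurable_funD.
  - exact: measurable_funTS.
have iA0 : (0 <= \int[mu]_(y in B) A y)%E by exact: integral_ge0.
rewrite ge0_integralD//; last first.
- exact: measurable_funTS.
- by move=> x _; exact: integral_ge0.
- by apply: emeasurable_funD => //; exact: emeasurable_funM.
- by move=> x _; rewrite adde_ge0// mule_ge0.
congr (_ + _)%E; rewrite ge0_integralD//; last first.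
- exact: emeasurable_funM.
- by move=> x _; rewrite mule_ge0.
under eq_integral do rewrite muleC.
rewrite ge0_integralZl_EFin//.
rewrite [X in (_ + X)%E](_ : _ = (\int[mu]_(y in B) A y * b%:E)%E); last first.
  by rewrite -muB; exact: integral_cst.
by rewrite muleC -ge0_muleDr// -EFinD mulr2n mulrDl mul1r muleC.
Qed.

Lemma integral_le0_ae (B : set T) (F : T -> \bar R) : measurable B ->
  measurable_fun setT F -> (forall x, 0 <= F x)%E -> (\int[mu]_(x in B) F x <= 0)%E ->
  {ae mu, forall x, B x -> F x = 0%E}.
Proof.
move=> mB mF F0 iF; have mF' := measurable_funTS (D := B) mF.
apply/(ae_eq_integral_abs mu mB mF'); apply/eqP.
rewrite eq_le integral_ge0// andbT.
by under eq_integral do rewrite gee0_abs//.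
Qed.

End L1_lemmas.

(** * Passage to the limit in the inequality along segments *)

Section two_point_approximation.
Context {R : realType} {n : nat}.
Local Notation V := 'rV[R]_n.
Local Notation L := (lebesgue_rV R n).
Variables (Gam : set V) (u : V -> R) (g : V -> V).
Hypotheses (Gam0 : Gam !=set0) (cGam : closed Gam).
Hypotheses (mu : measurable_fun setT u) (mg : forall i, measurable_fun setT (fun z => g z 0 i)).
Hypotheses (lu : loc_integrable (~` Gam) u) (wg : weak_gradient (~` Gam) u g).
Implicit Types (e s t N eta : R) (x y z h : V).
Local Notation de := (edist Gam).

(** A compact exhaustion of the complement of [Gam], with one parameter for the size and for the
    distance to [Gam]. *)
Definition core N : set V := [set z | enorm z <= N /\ N^-1 <= de z].

Lemma closed_core N : closed (core N).
Proof.
apply: closedI.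
  exact: (closed_comp (fun z _ => @enorm_continuous R n z) (@closed_le R N)).
exact: (closed_comp (fun z _ => edist_continuous Gam0 (x := z)) (@closed_ge R N^-1)).
Qed.

Lemma compact_core N : compact (core N).
Proof. by apply: (compact_enorm (closed_core (N := N))) => z [zN _]; exact: zN. Qed.

Lemma measurable_core N : measurable (core N).
Proof.
rewrite -[core N]setCK; apply: measurableC; apply: open_measurable_rV.
by apply: closed_openC; exact: closed_core.
Qed.

Lemma core_sub N : 0 < N -> core N `<=` ~` Gam.
Proof.
by move=> N0 z [_ zN] /(edist_mem Gam0) dz; move: zN; rewrite dz leNgt invr_gt0 N0.
Qed.

(** The margin 1/(2N) between the levels N and 2N is the room left to the support of the
    mollifier. *)
Lemma core_thicken N z z' : 1 <= N -> core N z -> enorm (z' - z) <= (2 * N)^-1 -> core (2 * N) z'.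
Proof.
move=> N1 [zN zd] zz; have N0 : 0 < N by exact: lt_le_trans N1.
have i1 : (2 * N)^-1 <= 1 by rewrite invf_le1; lra.
have i2 : N^-1 = (2 * N)^-1 + (2 * N)^-1 by field; rewrite gt_eqF.
split.
  by have := enormD (z' - z) z; rewrite subrK; lra.
by have := edist_lip Gam0 z z'; rewrite enormB; lra.
Qed.

(** Cutting at level 2N makes the functions integrable on the whole space; the segments considered
    stay at level N. *)
Let u1 N z := u z * \1_(core (2 * N)) z.
Let g1 N i z := g z 0 i * \1_(core (2 * N)) z.

Let iu1 N : 0 < N -> L.-integrable setT (EFin \o u1 N).
Proof.
move=> N0; have N20 : 0 < 2 * N by rewrite mulr_gt0.
have [_ _ lu'] := lu.
apply: integrable_indicM; [exact: measurable_core|exact: measurable_funTS|].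
by apply: lu'; [exact: core_sub|exact: compact_core].
Qed.

Let ig1 N i : 0 < N -> L.-integrable setT (EFin \o g1 N i).
Proof.
move=> N0; have N20 : 0 < 2 * N by rewrite mulr_gt0.
have [/(_ i)[_ _ lg] _] := wg.
apply: integrable_indicM; [exact: measurable_core|exact: measurable_funTS|].
by apply: lg; [exact: core_sub|exact: compact_core].
Qed.

Let trans_cont_core N (f : V -> R) : 0 < N ->
  L.-integrable setT (EFin \o (fun z => f z * \1_(core N) z)) ->
  trans_cont (fun z => f z * \1_(core N) z).
Proof.
move=> N0 iF; apply: (@trans_cont_L1 _ _ _ (N + 1)); first by rewrite addr_gt0.
- exact: integrable_EFin_measurable iF.
- move=> z zN; rewrite indicE memNset ?mulr0// => -[zN' _]; apply: zN.
  by rewrite /eball/= subr0 (le_lt_trans zN')// ltrDl.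
- by have /integrableP[_] := iF.
Qed.

Lemma smooth_approx N eta : 1 <= N -> 0 < eta -> exists (U : V -> R) (W : 'I_n -> V -> R),
  [/\ measurable_fun setT U, (forall i, measurable_fun setT (W i)),
    (\int[L]_z `|U z - u1 N z|%:E <= eta%:E)%E,
    (forall i, \int[L]_z `|W i z - g1 N i z|%:E <= eta%:E)%E &
    forall (phi psi : R -> R) x y, continuous psi ->
      (forall s, is_derive s (1 : R) phi (psi s)) ->
      (forall t, 0 <= t <= 1 -> core N (x + t *: (y - x))) ->
      (`|phi (U y) - phi (U x)|%:E <=
       \int[lebesgue_measure]_(t in `[0%R, 1%R])
         (`|psi (U (x + t *: (y - x)))| *
          enorm (\row_i W i (x + t *: (y - x))) * enorm (y - x))%:E)%E].
Proof.
move=> N1 eta0; have N0 : 0 < N by exact: lt_le_trans N1.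
have N20 : 0 < 2 * N by rewrite mulr_gt0.
have [r0 r00 hr0] := moll_L1 (trans_cont_core N20 (iu1 N0)) (iu1 N0) eta0.
have /choice[r hr] : forall i, exists r, 0 < r /\ forall e, 0 < e < r ->
    (\int[L]_x `|moll e (g1 N i) x - g1 N i x|%:E <= eta%:E)%E.
  by move=> i; have [r ? ?] := moll_L1 (trans_cont_core N20 (ig1 i N0)) (ig1 i N0) eta0; exists r.
have k0 : 0 < (n%:R + 1)^-1 * (2 * N)^-1 by rewrite mulr_gt0// invr_gt0 ?ltr_wpDl ?mulr_gt0.
(* One radius for u and for all components of g. The extra entry keeps the support of the kernel, of
   radius n e, within the margin of [core_thicken]. *)
pose m := \big[Num.min/Num.min r0 ((n%:R + 1)^-1 * (2 * N)^-1)]_i r i.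
have m0 : 0 < m.
  by apply: lt_bigmin => [|i _]; [rewrite lt_min r00 k0|have [] := hr i].
pose e := m / 2; have e0 : 0 < e by rewrite divr_gt0.
have em : e < m by rewrite /e ltr_pdivrMr// ltr_pMr// ltr1n.
have mm : m <= Num.min r0 ((n%:R + 1)^-1 * (2 * N)^-1) by exact: bigmin_le_id.
exists (moll e (u1 N)), (fun i => moll e (g1 N i)); split.
- exact: measurable_moll (iu1 N0).
- by move=> i; exact: measurable_moll (ig1 i N0).
- by apply: hr0; rewrite e0 (lt_le_trans em)// (le_trans mm)// ge_min lexx.
- move=> i; have [_] := hr i; apply; rewrite e0 (lt_le_trans em)//.
  exact: bigmin_le.
- move=> phi psi x y cpsi dphi xyN.
  apply: (moll_segment wg (@core_sub (2 * N) _) (iu1 N0) (fun i => ig1 i N0) e0 cpsi dphi).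
    by rewrite mulr_gt0.
  move=> t z t01 zt; apply: (core_thicken N1 (xyN _ t01)); apply: le_trans zt _.
  have ek : e <= (n%:R + 1)^-1 * (2 * N)^-1.
    by apply/ltW; rewrite (lt_le_trans em)// (le_trans mm)// ge_min lexx orbT.
  have n1 : 0 < n%:R + 1 :> R by rewrite ltr_wpDl.
  apply: (@le_trans _ _ ((n%:R + 1) * e)).
    by rewrite ler_wpM2r ?(ltW e0)// lerDl.
  by rewrite -ler_pdivlMl.
Qed.

Variables (phi psi : R -> R) (M Lp : R).
Hypotheses (dphi : forall s, is_derive s (1 : R) phi (psi s)) (cpsi : continuous psi).
Hypotheses (psiM : forall s, `|psi s| <= M) (psiL : forall s t, `|psi s - psi t| <= Lp * `|s - t|).

Lemma derive_bound_lipschitz s t : `|phi s - phi t| <= M * `|s - t|.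
Proof.
wlog st : s t / t <= s.
  move=> H; have /orP[/H//|/H] := le_total t s.
  by rewrite (distrC (phi s)) (distrC s).
have cphi : {within `[t, s], continuous phi}.
  apply: continuous_subspaceT => s0; have dx := dphi s0.
  by apply/differentiable_continuous/derivable1_diffP.
have [c _ ->] := MVT_segment st (fun s _ => dphi s) cphi.
by rewrite normrM ler_wpM2r.
Qed.

Let M0 : 0 <= M. Proof. exact: le_trans (normr_ge0 _) (psiM 0). Qed.

Let Lp0 : 0 <= Lp.
Proof. by have := psiL 1 0; rewrite subr0 normr1 mulr1; exact: le_trans. Qed.

Let penorm_sum z z' : enorm z <= enorm z' + \sum_(i < n) `|z 0 i - z' 0 i|.
Proof.
have := enormD (z - z') z'; rewrite subrK => /le_trans; apply.
rewrite addrC lerD2l; apply: le_trans (enorm_le_sum _) _.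
by rewrite ler_sum// => i _; rewrite !mxE.
Qed.

(** Three errors: c against c', weighed by M; then psi a against psi b, by the Lipschitz bound on
    the part of |c'| below T, and by the crude bound 2M on the tail above T. *)
Lemma integrand_le (a b T : R) (c c' : V) : 0 <= T ->
  `|psi a| * enorm c <= `|psi b| * enorm c' +
     (M * (\sum_(i < n) `|c 0 i - c' 0 i|) + Lp * T * `|a - b| +
      2 * M * (enorm c' - Num.min (enorm c') T)).
Proof.
move=> T0; set f := enorm c'; set S := \sum_(i < n) _.
have S0 : 0 <= S by apply: sumr_ge0.
have f0 : 0 <= f by exact: enorm_ge0.
have h1 : `|psi a| * enorm c <= `|psi a| * f + M * S.
  rewrite (le_trans (ler_wpM2l (normr_ge0 _) (penorm_sum c c')))// mulrDr lerD2l.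
  by rewrite ler_wpM2r.
have h2 : `|psi a| * f <= `|psi b| * f + `|psi a - psi b| * f.
  rewrite -mulrDl ler_wpM2r// addrC -lerBlDr.
  exact: lerB_dist.
have h3 : `|psi a - psi b| * f <= Lp * T * `|a - b| + 2 * M * (f - Num.min f T).
  have [fT|Tf] := leP f T.
    rewrite subrr mulr0 addr0 mulrAC; apply: ler_pM => //; exact: psiL.
  have -> : `|psi a - psi b| * f = `|psi a - psi b| * T + `|psi a - psi b| * (f - T) by ring.
  apply: lerD; first by rewrite mulrAC ler_wpM2r.
  rewrite ler_wpM2r ?subr_ge0 ?(ltW Tf)// (le_trans (ler_normB _ _))//.
  by have := psiM a; have := psiM b; lra.
lra.
Qed.

(** The whole cost of replacing u and g by smooth functions is put into one nonnegative function of
    the end points with small double integral, so that the limit can be taken for almost every pair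
    later. *)
Lemma segment_error N eta : 1 <= N -> 0 < eta -> exists Err : V -> V -> \bar R,
  [/\ measurable_fun setT (fun p : V * V => Err p.1 p.2),
    (forall x y, 0 <= Err x y)%E,
    (\int[L]_(x in eball 0 (N + 1)) \int[L]_(y in eball 0 (N + 1)) Err x y <= eta%:E)%E &
    forall x y, (forall t, 0 <= t <= 1 -> core N (x + t *: (y - x))) ->
      (`|phi (u y) - phi (u x)|%:E <=
       \int[lebesgue_measure]_(t in `[0%R, 1%R])
         (`|psi (u (x + t *: (y - x)))| *
          enorm (g (x + t *: (y - x))) * enorm (y - x))%:E + Err x y)%E].
Proof.
move=> N1 eta0; have N0 : 0 < N by exact: lt_le_trans N1.
set B := eball 0 (N + 1).
have LB : (L B = (fine (L B))%:E)%E.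
  rewrite (@lebesgue_eball R n 0 (N + 1))//; by rewrite addr_gt0.
set b := fine (L B) in LB.
have b0 : 0 <= b by rewrite -lee_fin -LB; exact: measure_ge0.
pose f z := enorm (\row_i g1 N i z).
have mf : measurable_fun setT f.
  apply: (measurableT_comp (f := @enorm R n)); first exact: measurable_enorm.
  apply: measurable_fun_rVP => i; under eq_fun do rewrite mxE.
  exact: integrable_EFin_measurable (ig1 i N0).
have f0 z : 0 <= f z by exact: enorm_ge0.
have ifl : L.-integrable setT (EFin \o f).
  have [isum _] := Rintegral_sum (mu := L) (index_enum 'I_n) (fun i => integrable_norm (ig1 i N0)).
  apply: le_integrable isum => //; first exact/measurable_EFinP.
  move=> z _; rewrite /= !ger0_norm ?sumr_ge0//.
  rewrite lee_fin; apply: le_trans (enorm_le_sum _) _.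
  by apply: ler_sum => i _; rewrite mxE.
pose C1 := 2 * N * 2 ^+ n * b.
have C10 : 0 <= C1 by rewrite !mulr_ge0// ltW.
(* The tail budget tau comes first, then the height T it requires, then the accuracy eta' of the
   approximation, whose coefficient C2 contains T. Each of the two contributions is at most
   eta/2. *)
pose tau := eta / 2 / (C1 * (2 * M) + 1).
have den1 : 0 < C1 * (2 * M) + 1 by rewrite ltr_wpDl// (mulr_ge0 C10)// mulr_ge0.
have tau0 : 0 < tau by rewrite !divr_gt0.
have [T T0 hT] := integrable_tail ifl f0 tau0.
pose C2 := 2 * b * M + C1 * (M * n%:R + Lp * T).
have C20 : 0 <= C2 by rewrite /C2 addr_ge0 ?(mulr_ge0 C10)// ?addr_ge0// !mulr_ge0.
pose eta' := eta / 2 / (C2 + 1).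
have eta'0 : 0 < eta' by rewrite !divr_gt0// ltr_wpDl.
have [U [W [mU mW UL WL UW]]] := smooth_approx N1 eta'0.
pose errz z := M * (\sum_(i < n) `|W i z - g1 N i z|) + Lp * T * `|U z - u1 N z| +
      2 * M * (f z - Num.min (f z) T).
have fT0 z : 0 <= f z - Num.min (f z) T by rewrite subr_ge0 ge_min lexx.
have mdU : measurable_fun setT (fun z => `|U z - u1 N z|).
  apply: measurableT_comp => //; apply: measurable_funB => //.
  exact: integrable_EFin_measurable (iu1 N0).
have mdW i : measurable_fun setT (fun z => `|W i z - g1 N i z|).
  apply: measurableT_comp => //; apply: measurable_funB => //.
  exact: integrable_EFin_measurable (ig1 i N0).
have mfT : measurable_fun setT (fun z => f z - Num.min (f z) T).
  by apply: measurable_funB => //; exact: measurable_minr.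
have errz0 z : 0 <= errz z.
  by rewrite !addr_ge0// mulr_ge0// ?mulr_ge0// sumr_ge0.
have merrz : measurable_fun setT errz.
  apply: measurable_funD; [apply: measurable_funD|]; apply: measurable_funM => //.
  exact: measurable_sum.
have errL : (\int[L]_z (errz z)%:E <= (M * (n%:R * eta') + Lp * T * eta' + 2 * M * tau)%:E)%E.
  apply: integral_addr_le => //.
  - apply: measurable_funD; apply: measurable_funM => //; exact: measurable_sum.
  - exact: measurable_funM.
  - by move=> z; rewrite !addr_ge0// mulr_ge0// ?mulr_ge0// sumr_ge0.
  - by move=> z; rewrite !mulr_ge0.
  - apply: integral_addr_le => //.
    + apply: measurable_funM => //; exact: measurable_sum.
    + exact: measurable_funM.
    + by move=> z; rewrite mulr_ge0// sumr_ge0.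
    + by move=> z; rewrite !mulr_ge0.
    + apply: integral_mulr_le => //; first exact: measurable_sum.
        by move=> z; apply: sumr_ge0.
      have sz : size (index_enum 'I_n) = n by rewrite -[RHS](size_enum_ord n) enumT.
      by rewrite -[X in X%:R * _]sz; exact: integral_sumr_le.
    + by apply: integral_mulr_le => //; rewrite mulr_ge0.
  - by apply: integral_mulr_le => //; rewrite mulr_ge0.
(* Passing from u to U costs [A] at each end point, by the Lipschitz bound on phi, and [S] along the
   segment, whose length is at most 2N. *)
pose A z : \bar R := (M * `|U z - u1 N z|)%:E.
pose F z : \bar R := (errz z * (2 * N))%:E.
pose S x y : \bar R := (\int[lebesgue_measure]_(t in `[0%R, 1%R]) F (x + t *: (y - x))%R)%E.
have F0 z : (0 <= F z)%E by rewrite lee_fin mulr_ge0// mulr_ge0// ltW.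
have mF : measurable_fun setT F by apply/measurable_EFinP; exact: measurable_funM.
have mI : measurable (`[0, 1]%classic : set R) by exact: measurable_itv.
have A0 z : (0 <= A z)%E by rewrite lee_fin mulr_ge0.
have mA : measurable_fun setT A by apply/measurable_EFinP; exact: measurable_funM.
have S0 x y : (0 <= S x y)%E by exact: integral_ge0.
have mS : measurable_fun setT (fun p : V * V => S p.1 p.2).
  apply: (measurable_integral_in (m2 := lebesgue_measure) (F := fun (p : V * V) (t : measurableTypeR R) => F (p.1 + t *: (p.2 - p.1))) mI _ (fun p t => F0 _)).
  apply: measurableT_comp mF _; apply: measurable_segment => //.
    by apply: measurableT_comp; [exact: measurable_fst|exact: measurable_fst].
  by apply: measurableT_comp; [exact: measurable_snd|exact: measurable_fst].
have mB : measurable B by exact: measurable_eball.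
exists (fun x y => A x + A y + S x y)%E; split.
- apply: emeasurable_funD => //; apply: emeasurable_funD.
    by apply: measurableT_comp mA _; exact: measurable_fst.
  by apply: measurableT_comp mA _; exact: measurable_snd.
- by move=> x y; apply: adde_ge0 => //; exact: adde_ge0.
- rewrite (integral_pair_sum mB LB mA A0 _ _ S0); last 2 first.
  + move=> x; apply: (measurable_integral_in (m2 := lebesgue_measure) (F := fun (y : V) (t : measurableTypeR R) => F (x + t *: (y - x))) mI _ (fun y t => F0 _)).
    by apply: measurableT_comp mF _; exact: measurable_segment.
  + exact: (measurable_integral_in (m2 := L) mB mS S0).
  apply: (@le_trans _ _ ((2 * b)%:E * (M * eta')%:E + b%:E * ((2 ^+ n)%:E *
      ((2 * N) * (M * (n%:R * eta') + Lp * T * eta' + 2 * M * tau))%:E))%E).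
    apply: leeD.
      apply: lee_wpmul2l; first by rewrite lee_fin mulr_ge0.
      apply: integral_mulr_le => //.
      apply: le_trans UL; apply: ge0_subset_integral => //.
      exact/measurable_EFinP.
    apply: le_trans (segment_average mB mF F0) _.
    rewrite LB; apply: lee_wpmul2l; first by rewrite lee_fin.
    apply: lee_wpmul2l; first by rewrite lee_fin.
    rewrite /F; under eq_integral do rewrite mulrC.
    by apply: integral_mulr_le => //; rewrite mulr_ge0// ltW.
  rewrite -!EFinM -EFinD lee_fin.
  have -> : 2 * b * (M * eta') + b * (2 ^+ n * (2 * N * (M * (n%:R * eta') + Lp * T * eta' + 2 * M * tau))) =
      C2 * eta' + C1 * (2 * M) * tau by rewrite /C2 /C1; ring.
  have k1 : C2 * eta' <= eta / 2.
    rewrite /eta' mulrCA ler_piMr// ?divr_ge0// ?(ltW eta0)// ler_pdivrMr ?ltr_wpDl//.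
    by rewrite mul1r lerDl.
  have k2 : C1 * (2 * M) * tau <= eta / 2.
    rewrite /tau mulrCA ler_piMr// ?divr_ge0// ?(ltW eta0)// ler_pdivrMr//.
    by rewrite mul1r lerDl.
  lra.
- move=> x y xyN; have y0 := scale0r (y - x); have y1 := scale1r (y - x).
  have cx : core N x by have := xyN 0; rewrite y0 addr0; apply; rewrite lexx ler01.
  have cy : core N y by have := xyN 1; rewrite y1 addrC subrK; apply; rewrite lexx ler01.
  have core2 z : core N z -> core (2 * N) z.
    by move=> zN; apply: (core_thicken N1 zN); rewrite subrr enorm0 invr_ge0 mulr_ge0 ?ltW.
  have u1E z : core N z -> u1 N z = u z.
    by move=> zN; rewrite /u1 indicE mem_set ?mulr1//; exact: core2.
  have g1E z i : core N z -> g1 N i z = g z 0 i.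
    by move=> zN; rewrite /g1 indicE mem_set ?mulr1//; exact: core2.
  have fE z : core N z -> f z = enorm (g z).
    by move=> zN; congr enorm; apply/rowP => i; rewrite mxE g1E.
  have xyE : enorm (y - x) <= 2 * N.
    have [[xN _] [yN _]] := (cx, cy); have := enormD y (- x); rewrite enormN; lra.
  have st1 : `|phi (u y) - phi (u x)| <=
      `|phi (U y) - phi (U x)| + (M * `|U x - u1 N x| + M * `|U y - u1 N y|).
    have := derive_bound_lipschitz (U x) (u1 N x).
    have := derive_bound_lipschitz (U y) (u1 N y).
    rewrite (u1E _ cx) (u1E _ cy) => hy hx.
    have -> : phi (u y) - phi (u x) = (phi (U y) - phi (U x)) +
      ((phi (U x) - phi (u x)) - (phi (U y) - phi (u y))) by ring.
    rewrite (le_trans (ler_normD _ _))// lerD2l (le_trans (ler_normB _ _))//.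
    exact: lerD.
  apply: (@le_trans _ _ (`|phi (U y) - phi (U x)|%:E + (A x + A y))%E).
    by rewrite /A -!EFinD lee_fin.
  set I := (X in (_ <= X + (A x + A y + S x y))%E).
  have -> : (I + (A x + A y + S x y) = I + S x y + (A x + A y))%E by rewrite -addeA [(S x y + _)%E]addeC.
  rewrite leeD2r//; apply: le_trans (UW _ _ _ _ cpsi dphi xyN) _; rewrite /I.
  have ml (G : V -> R) : measurable_fun setT G ->
      measurable_fun (`[0, 1]%classic : set R) (fun t : R => G (x + t *: (y - x))).
    move=> mG; apply: measurable_funTS; apply: measurableT_comp mG _.
    exact: (measurable_segment (T := measurableTypeR R)).
  have mpsi : measurable_fun setT psi by exact: continuous_measurable_fun.
  have men : measurable_fun setT (fun z => enorm (g z)).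
    apply: (measurableT_comp (f := @enorm R n)); first exact: measurable_enorm.
    exact: measurable_fun_rVP.
  have meW : measurable_fun setT (fun z => enorm (\row_i W i z)).
    apply: (measurableT_comp (f := @enorm R n)); first exact: measurable_enorm.
    apply: measurable_fun_rVP => i; under eq_fun do rewrite mxE.
    exact: mW.
  have mpu : measurable_fun setT (fun z => `|psi (u z)|).
    by apply: measurableT_comp => //; apply: measurableT_comp.
  have mpU : measurable_fun setT (fun z => `|psi (U z)|).
    by apply: measurableT_comp => //; apply: measurableT_comp.
  have mR : measurable_fun (`[0, 1]%classic : set R) (fun t : R => (`|psi (u (x + t *: (y - x)))| *
          enorm (g (x + t *: (y - x))) * enorm (y - x))%:E).
    apply/measurable_EFinP; apply: (ml (fun z => `|psi (u z)| * enorm (g z) * enorm (y - x))).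
    by do 2!apply: measurable_funM => //.
  have mFl : measurable_fun (`[0, 1]%classic : set R) (fun t : R => F (x + t *: (y - x))).
    apply/measurable_EFinP; apply: (ml (fun z => errz z * (2 * N))).
    exact: measurable_funM.
  rewrite /S -ge0_integralD//; last first.
    by move=> t _; rewrite lee_fin !mulr_ge0// enorm_ge0.
  apply: ge0_le_integral => //.
  - by move=> t _; rewrite lee_fin !mulr_ge0// enorm_ge0.
  - apply/measurable_EFinP; apply: (ml (fun z => `|psi (U z)| * enorm (\row_i W i z) * enorm (y - x))).
    by do 2!apply: measurable_funM => //.
  - exact: emeasurable_funD.
  - move=> t; rewrite /= in_itv/= => t01; have ct := xyN t t01.
    rewrite /F -EFinD lee_fin; set z := x + _ *: _ in ct *.
    have := integrand_le (U z) (u1 N z) (\row_i W i z) (\row_i g1 N i z) T0.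
    under eq_bigr do rewrite !mxE.
    rewrite -/(f z) -/(errz z) (u1E _ ct) (fE _ ct) => hz.
    apply: (@le_trans _ _ ((`|psi (u z)| * enorm (g z) + errz z) * enorm (y - x))).
      by rewrite ler_wpM2r ?enorm_ge0// /errz (u1E _ ct) (fE _ ct).
    by rewrite mulrDl lerD2l ler_wpM2l.
Qed.

Hypotheses (LGam0 : L.-negligible Gam) (segGam : forall x, ~ Gam x ->
  L.-negligible [set y | exists2 t, 0 <= t <= 1 & Gam (x + t *: (y - x))]).

(** The distance to [Gam] has a positive minimum on a compact segment avoiding the closed set [Gam];
    k is taken above its inverse and above a bound on the norms. *)
Lemma segment_in_core x y : (forall t, 0 <= t <= 1 -> ~ Gam (x + t *: (y - x))) ->
  exists k : nat, forall t, 0 <= t <= 1 -> core k.+1%:R (x + t *: (y - x)).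
Proof.
move=> xyG; pose f t := de (x + t *: (y - x)).
have cf : continuous f.
  move=> t; apply: (@continuous_comp _ _ _ (fun t => x + t *: (y - x)) de).
    by apply: cvgD; [exact: cvg_cst|apply: cvgZr_tmp; exact: cvg_id].
  exact: edist_continuous.
have [c c01 cmin] := EVT_min ler01 (continuous_subspaceT cf).
have fc0 : 0 < f c by apply: edist_gt0 => //; apply: xyG; rewrite in_itv/= in c01.
exists (Num.truncn (2 * enorm x + enorm y + (f c)^-1)) => t t01.
set N := _.+1%:R; have NN : 2 * enorm x + enorm y + (f c)^-1 < N by exact: truncnS_gt.
have fcV : 0 < (f c)^-1 by rewrite invr_gt0.
have [x0 y0] := (enorm_ge0 x, enorm_ge0 y); split.
  have h1 := enormD x (t *: (y - x)); have h2 := enormD y (- x).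
  rewrite enormN in h2; rewrite enormZ in h1.
  have h3 : `|t| * enorm (y - x) <= enorm (y - x).
    by have /andP[t0 t1] := t01; rewrite ler_piMl ?enorm_ge0// ger0_norm.
  lra.
apply: le_trans (cmin t _); last by rewrite in_itv.
rewrite invf_ple ?posrE//; lra.
Qed.

(** For almost every x, almost every y sees x along a segment avoiding [Gam], hence contained in
    some [core]. There the inequality holds up to errors whose infimum vanishes almost
    everywhere. *)
Lemma two_point_inequality :
  {ae L, forall x, {ae L, forall y, (`|phi (u y) - phi (u x)|%:E <=
       \int[lebesgue_measure]_(t in `[0%R, 1%R])
         (`|psi (u (x + t *: (y - x)))| *
          enorm (g (x + t *: (y - x))) * enorm (y - x))%:E)%E}}.
Proof.
have /choice[Err hErr] : forall kj : nat * nat, exists Err : V -> V -> \bar R,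
  [/\ measurable_fun setT (fun p : V * V => Err p.1 p.2),
    (forall x y, 0 <= Err x y)%E,
    (\int[L]_(x in eball 0 (kj.1.+1%:R + 1)) \int[L]_(y in eball 0 (kj.1.+1%:R + 1)) Err x y <= (kj.2.+1%:R^-1)%:E)%E &
    forall x y, (forall t, 0 <= t <= 1 -> core kj.1.+1%:R (x + t *: (y - x))) ->
      (`|phi (u y) - phi (u x)|%:E <=
       \int[lebesgue_measure]_(t in `[0%R, 1%R])
         (`|psi (u (x + t *: (y - x)))| *
          enorm (g (x + t *: (y - x))) * enorm (y - x))%:E + Err x y)%E].
  by move=> [k j]; apply: segment_error; rewrite /= ?ler1n ?invr_gt0.
pose B (k : nat) : set V := eball 0 (k.+1%:R + 1).
have mB k : measurable (B k) by exact: measurable_eball.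
(* The infimum over all accuracies 1/(j+1) is measurable with zero double integral, so no almost
   everywhere convergent subsequence has to be extracted. *)
pose h (k : nat) x y : \bar R := einfs (fun j => Err (k, j) x y) 0.
have hle k j x y : (h k x y <= Err (k, j) x y)%E by apply: ereal_inf_lbound; exists j.
have h0 k x y : (0 <= h k x y)%E.
  by apply: le_ereal_inf_tmp => _ [j _ <-]; have [_ H _ _] := hErr (k, j); exact: H.
have mh k : measurable_fun setT (fun p : V * V => h k p.1 p.2).
  by apply: measurable_fun_einfs => j; have [H _ _ _] := hErr (k, j).
have mhy k x : measurable_fun setT (h k x).
  exact: (measurableT_comp (mh k) (measurable_fun_pair (measurable_cst x) (@measurable_id _ _ setT))).
have mhi k : measurable_fun setT (fun x => \int[L]_(y in B k) h k x y)%E.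
  exact: (measurable_integral_in (m2 := L) (mB k) (mh k) (h0 k)).
have hi0 k : {ae L, forall x, B k x -> (\int[L]_(y in B k) h k x y = 0)%E}.
  apply: (integral_le0_ae (mB k) (mhi k)) => [x|]; first exact: integral_ge0.
  apply: (@ereal_small_le0 _ _ 1 1) => // t /andP[t0 t1]; rewrite mul1r.
  have [_ E0 El _] := hErr (k, Num.truncn t^-1).
  apply: (@le_trans _ _ (((Num.truncn t^-1).+1%:R)^-1)%:E); last first.
    rewrite lee_fin invf_ple ?posrE//; apply/ltW; exact: truncnS_gt.
  apply: le_trans El; apply: ge0_le_integral => //.
  - by move=> x _; exact: integral_ge0.
  - exact: measurable_funTS.
  - apply: measurable_funTS; have [mE _ _ _] := hErr (k, Num.truncn t^-1).
    exact: (measurable_integral_in (m2 := L) (mB k) mE E0).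
  - move=> x _; apply: ge0_le_integral => //.
    + exact: measurable_funTS.
    + apply: measurable_funTS; have [mE _ _ _] := hErr (k, Num.truncn t^-1).
      exact: (measurableT_comp mE (measurable_fun_pair (measurable_cst x) (@measurable_id _ _ setT))).
have aex : {ae L, forall x, ~ Gam x /\ forall k, B k x -> (\int[L]_(y in B k) h k x y = 0)%E}.
  apply: filterI; last exact: ae_foralln hi0.
  apply: negligibleS LGam0 => x /=; exact: contrapT.
apply: filterS aex => x [nGx hx].
have aey k : {ae L, forall y, B k x -> B k y -> h k x y = 0%E}.
  have [xB|xB] := pselect (B k x); last exact: aeW.
  apply: filterS (integral_le0_ae (mB k) (mhy k x) (h0 k x) _) => [y H _ yB|]; first exact: H.
  by rewrite (hx k xB).
have aeseg : {ae L, forall y, forall t, 0 <= t <= 1 -> ~ Gam (x + t *: (y - x))}.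
  apply: negligibleS (segGam nGx) => y /= /existsNP[t /not_implyP[t01 /contrapT Gt]].
  by exists t.
apply: filterS2 aeseg (ae_foralln aey) => y xyG hy.
have [k kxy] := segment_in_core xyG.
have cB z : core k.+1%:R z -> B k z.
  by move=> [zN _]; rewrite /B /eball/= subr0 (le_lt_trans zN)// ltrDl.
have xB : B k x by apply: cB; have := kxy 0; move: (scale0r (y - x)) => ->; rewrite addr0; apply; rewrite lexx ler01.
have yB : B k y by apply: cB; have := kxy 1; move: (scale1r (y - x)) => ->; rewrite addrC subrK; apply; rewrite lexx ler01.
have := hy k xB yB.
set I := (\int[_]_(t in _) _)%E => h00.
have IE j : (`|phi (u y) - phi (u x)|%:E <= I + Err (k, j) x y)%E.
  by have [_ _ _ H] := hErr (k, j); exact: H.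
have I0 : (0 <= I)%E.
  by apply: integral_ge0 => t _; rewrite lee_fin !mulr_ge0// enorm_ge0.
case: I I0 IE => [r| |]//; [move=> r0 IE|by move=> _ _; rewrite leey].
have : (`|phi (u y) - phi (u x)|%:E - r%:E <= h k x y)%E.
  by apply: le_ereal_inf_tmp => _ [j _ <-]; rewrite leeBlDl.
by rewrite h00 leeBlDl// adde0.
Qed.

End two_point_approximation.

(** * The weak type estimate *)

Section radial_integral.
Context {R : realType}.
Implicit Types (t T k : R).

Lemma lebesgue_measure01 : lebesgue_measure (`[0, 1]%classic : set R) = 1%E.
Proof. by rewrite lebesgue_measure_itv/= lte_fin ltr01 -EFinB subr0. Qed.

Lemma integral_powRN_shift T k : 0 < T -> k != 1 ->
  (\int[lebesgue_measure]_(t in `[0%R, 1%R]) ((t + T) `^ (- k))%:E =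
   (((1 + T) `^ (1 - k) - T `^ (1 - k)) / (1 - k))%:E)%E.
Proof.
move=> T0 k1; have k10 : 1 - k != 0 by rewrite subr_eq0 eq_sym.
pose F t := (1 - k)^-1 * (t + T) `^ (1 - k).
have dF t : 0 <= t -> is_derive t (1 : R) F ((t + T) `^ (- k)).
  move=> t0; have tT : 0 < t + T by lra.
  have h1 : is_derive t (1 : R) (fun t => t + T) (1 + 0).
    exact: (is_derive_funD (is_derive_id t (1 : R)) (is_derive_cst T t (1 : R))).
  have h2 := @is_derive1_comp _ (fun s : R => s `^ (1 - k)) (fun t => t + T) t _ _ (is_derive1_powR (1 - k) tT) h1.
  have h3 := is_derive_funM (is_derive_cst (1 - k)^-1 t (1 : R)) h2.
  apply: is_derive_eq h3 _; rewrite mul0r add0r addr0 mulr1 mulrA mulVf// mul1r.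
  by congr (_ `^ _); ring.
have cont t : 0 <= t -> {for t, continuous F}.
  move=> t0; have dFt := dF _ t0.
  by apply/differentiable_continuous/derivable1_diffP.
have cH : {within `[0, 1], continuous (fun t => (t + T) `^ (- k))}.
  apply: continuous_in_subspaceT => t; rewrite inE/= in_itv/= => /andP[t0 _].
  have tT : 0 < t + T by lra.
  apply: (@continuous_comp _ _ _ (fun t => t + T) (fun s : R => s `^ (- k))).
    by apply: cvgD; [exact: cvg_id|exact: cvg_cst].
  have dp := is_derive1_powR (- k) tT.
  by apply/differentiable_continuous/derivable1_diffP.
rewrite (@continuous_FTC2 _ _ F 0 1 ltr01 cH).
- by rewrite -EFinB; congr EFin; rewrite /F add0r; field.
- split.
  + move=> t; rewrite in_itv/= => /andP[t0 t1].
    by have [] := dF t (ltW t0).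
  + by apply: cvg_at_right_filter; apply: cont.
  + by apply: cvg_at_left_filter; apply: cont.
- move=> t; rewrite in_itv/= => /andP[t0 t1].
  by rewrite derive1E; apply: derive_val; apply: dF; exact: ltW.
Qed.

(** The right-hand side is (2T/(t+T))^k. Its base is at least 1 for t <= T and at least T/t beyond;
    lowering the exponent n/2 to k only increases a power of T/t < 1. The sum t + T replaces a
    maximum to keep an explicit antiderivative. *)
Lemma sqrt_min_le (n : nat) T k t : 0 < T -> 0 <= k <= n%:R / 2 -> 0 <= t ->
  Num.sqrt (Num.min 1 (T ^+ n / t ^+ n)) <= (2 * T) `^ k * (t + T) `^ (- k).
Proof.
move=> T0 /andP[k0 kn] t0; have tT : 0 < t + T by lra.
have -> : (2 * T) `^ k * (t + T) `^ (- k) = (2 * T / (t + T)) `^ k.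
  by rewrite [RHS]powRM ?invr_ge0 ?mulr_ge0 ?ltW// powRV ?(ltW tT)// powRN.
have [tlT|Tlt] := leP t T.
  apply: (@le_trans _ _ 1).
    by rewrite -[leRHS]sqrtr1 ler_wsqrtr// ge_min lexx.
  have one : 1 `^ k = 1 :> R by rewrite powR1.
  rewrite -[leLHS]one ge0_ler_powR ?nnegrE// ?divr_ge0 ?mulr_ge0 ?(ltW T0) ?(ltW tT)//.
  by rewrite ler_pdivlMr// mul1r; lra.
have t00 : 0 < t by exact: lt_trans Tlt.
apply: (@le_trans _ _ ((T / t) `^ k)); last first.
  rewrite ge0_ler_powR ?nnegrE ?divr_ge0 ?mulr_ge0 ?(ltW T0) ?(ltW tT)//.
  rewrite ler_pdivrMr// mulrAC ler_pdivlMr//.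
  have : 0 <= T * (t - T) by rewrite mulr_ge0 ?subr_ge0 ?(ltW T0) ?(ltW Tlt).
  by rewrite mulrBr; lra.
apply: (@le_trans _ _ ((T / t) `^ (n%:R / 2))); last first.
  rewrite (_ : (T / t) `^ k = expR (k * ln (T / t))); last first.
    by rewrite /powR gt_eqF ?divr_gt0.
  rewrite /powR gt_eqF ?divr_gt0// ler_expR ler_wnM2r//.
  by rewrite ln_le0// ler_pdivrMr// mul1r ltW.
rewrite powRrM powR12_sqrt ?powR_ge0// powR_mulrn ?divr_ge0 ?(ltW T0)//.
by rewrite ler_wsqrtr// ge_min expr_div_n lexx orbT.
Qed.

(** With T = tau^(1/n) the goal is a bound by T^(ns), where s = 1/2 - 1/q and ns <= 1 by the
    condition on q. Comparison with (t + T)^(-k) for a suitable k != 1 avoids a logarithm. *)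
Lemma sqrt_min_integral (n : nat) (q : R) : (2 <= n)%N -> 2 < q ->
  ((3 <= n)%N -> q <= (2 * n%:R) / (n%:R - 2)) ->
  exists2 C : R, 0 < C & forall tau, 0 < tau ->
    (\int[lebesgue_measure]_(t in `[0%R, 1%R]) (Num.sqrt (Num.min 1 (tau / t ^+ n)))%:E
     <= (C * tau `^ (2^-1 - q^-1))%:E)%E.
Proof.
move=> n2 q2 nq; have n0 : 0 < n%:R :> R by rewrite ltr0n (leq_trans _ n2).
have q0 : 0 < q by lra.
pose s := 2^-1 - q^-1.
have qV : 0 < q^-1 by rewrite invr_gt0.
have qV2 : q^-1 < 2^-1 by rewrite ltf_pV2 ?posrE.
have s0 : 0 < s by rewrite subr_gt0.
have s2 : s < 2^-1 by rewrite /s; lra.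
have ns1 : n%:R * s <= 1.
  have [n3|] := ltnP 2 n; last first.
    move=> nn2; have -> : n = 2%N by apply/eqP; rewrite eqn_leq nn2 n2.
  lra.
  have n20 : 0 < n%:R - 2 :> R by rewrite subr_gt0 ltr_nat.
  have : q^-1 >= (n%:R - 2) / (2 * n%:R).
    by rewrite -[leLHS]invrK invf_div lef_pV2 ?posrE ?divr_gt0 ?mulr_gt0//; exact: nq.
  rewrite ler_pdivrMr ?mulr_gt0// /s => h; rewrite mulrBr; lra.
have n2R : 2 <= n%:R :> R by rewrite ler_nat.
(* Below the end point, k = ns < 1 and t^(-k) is integrable at 0. At the end point ns = 1, the
   integral with k = n/2 concentrates near t = T and gives T^k T^(1-k) = T; there n/2 > 1 because s
   < 1/2. *)
pose k := if n%:R * s < 1 then n%:R * s else n%:R / 2.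
have k0 : 0 <= k.
  by rewrite /k; case: ifP => _; rewrite ?mulr_ge0 ?divr_ge0 ?ltW.
have kn : k <= n%:R / 2.
  by rewrite /k; case: ifP => _ //; rewrite ler_pM2l// ltW.
have k1 : k != 1.
  rewrite /k; case: ltP => [h|h]; first by rewrite lt_eqF.
  apply/negP => /eqP nk; have nn : n%:R = 2 :> R by lra.
  by move: h; rewrite nn; lra.
exists (2 `^ k * 2 / `|1 - k| + 1).
  by rewrite ltr_wpDl// divr_ge0// mulr_ge0// powR_ge0.
move=> tau tau0; pose T := tau `^ n%:R^-1.
have T0 : 0 < T by rewrite powR_gt0.
have TE : T ^+ n = tau.
  by rewrite -powR_mulrn ?powR_ge0// -powRrM mulVf ?gt_eqF// powRr1// ltW.
have tsE : tau `^ s = T `^ (n%:R * s).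
  by rewrite -powRrM mulrA mulVf ?gt_eqF// mul1r.
have mI : measurable (`[0, 1]%classic : set R) by exact: measurable_itv.
have msq : measurable_fun (`[0, 1]%classic : set R)
    (fun t => (Num.sqrt (Num.min 1 (tau / t ^+ n)))%:E).
  apply/measurable_EFinP.
  apply: (eq_measurable_fun (fun t => Num.sqrt (Num.min 1 (tau * t `^ (- n%:R))))).
    move=> t; rewrite inE/= in_itv/= => /andP[t0 _].
    by rewrite powRN powR_mulrn.
  apply: measurable_funTS; apply: (measurableT_comp (f := @Num.sqrt R)).
    by apply: continuous_measurable_fun; exact: sqrt_continuous.
  by apply: measurable_minr => //; exact: measurable_funM.
have mp : measurable_fun (`[0, 1]%classic : set R) (fun t => ((t + T) `^ (- k))%:E).
  apply/measurable_EFinP/measurable_funTS.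
  by apply: (measurableT_comp (f := fun s : R => s `^ (- k))) => //; exact: measurable_funD.
have Ileft : (\int[lebesgue_measure]_(t in `[0%R, 1%R]) (Num.sqrt (Num.min 1 (tau / t ^+ n)))%:E <= 1)%E.
  rewrite -[leRHS](_ : \int[lebesgue_measure]_(t in `[0%R, 1%R]) 1 = 1)%E; last first.
    apply: (etrans (integral_cst lebesgue_measure mI 1%E)).
    transitivity (1 * 1 : \bar R)%E; last by rewrite mule1.
    by congr (_ * _)%E; exact: lebesgue_measure01.
  apply: ge0_le_integral => //.
  - by move=> t _; rewrite lee_fin -[leRHS]sqrtr1 ler_wsqrtr// ge_min lexx.
rewrite -/s tsE.
(* For T >= 1 the integrand is at most 1 and T^(ns) at least 1. *)
have [T1|T1] := leP 1 T.
  apply: le_trans Ileft _; rewrite lee_fin -[leLHS]mulr1; apply: ler_pM => //.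
    by rewrite lerDr divr_ge0// mulr_ge0// powR_ge0.
  have one : 1 `^ (n%:R * s) = 1 :> R by rewrite powR1.
  rewrite -[leLHS]one ge0_ler_powR ?nnegrE ?(ltW T0)//.
  by rewrite mulr_ge0 ?ltW.
apply: (@le_trans _ _ (((2 * T) `^ k)%:E * (((1 + T) `^ (1 - k) - T `^ (1 - k)) / (1 - k))%:E)%E).
  rewrite -(integral_powRN_shift T0 k1) -ge0_integralZl_EFin ?powR_ge0//.
  - apply: ge0_le_integral => //.
    + exact: emeasurable_funM.
    + move=> t; rewrite /= in_itv/= => /andP[t0 _].
      by rewrite -EFinM lee_fin -TE; apply: sqrt_min_le; rewrite ?k0.
  - by move=> t _; rewrite lee_fin powR_ge0.
rewrite -EFinM lee_fin; apply: (@le_trans _ _ (2 `^ k * 2 / `|1 - k| * T `^ (n%:R * s))); last first.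
  by rewrite ler_wpM2r ?powR_ge0// lerDl.
suff H : T `^ k * (((1 + T) `^ (1 - k) - T `^ (1 - k)) / (1 - k)) <= 2 / `|1 - k| * T `^ (n%:R * s).
  by rewrite powRM ?(ltW T0)// -!mulrA ler_wpM2l ?powR_ge0// mulrA.
have p0 := powR_ge0 T (1 - k); have p1 := powR_ge0 (1 + T) (1 - k).
move: k1 k0 p0 p1; rewrite /k; case: ifP => h _ kk p0 p1.
  have h1 : 0 < 1 - n%:R * s by rewrite subr_gt0.
  rewrite gtr0_norm// mulrC ler_wpM2r ?powR_ge0// ler_wpM2r ?invr_ge0 ?(ltW h1)//.
  rewrite lerBlDr; apply: (@le_trans _ _ 2); last by rewrite lerDl.
  apply: (@le_trans _ _ (2 `^ (1 - n%:R * s))).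
    by rewrite ge0_ler_powR ?(ltW h1) ?nnegrE//; lra.
  rewrite -[leRHS]powRr1// ler_powR//; lra.
have nsE : n%:R * s = 1 by apply/eqP; rewrite eq_le ns1 leNgt h.
have nn2 : 2 < n%:R :> R.
  rewrite lt_neqAle n2R andbT; apply/eqP => nn; move: nsE; rewrite -nn; lra.
have h1 : 1 - n%:R / 2 < 0 :> R by lra.
rewrite nsE powRr1 ?(ltW T0)// ltr0_norm//.
have TT : T `^ (n%:R / 2) * T `^ (1 - n%:R / 2) = T.
  rewrite -powRD; last by rewrite (gt_eqF T0) implybT.
  by rewrite addrC subrK powRr1// ltW.
have e0 : 1 - n%:R / 2 != 0 :> R by rewrite lt_eqF.
have H (X Y Z e : R) : e != 0 -> X * ((Z - Y) / e) = (X * Y - X * Z) / - e by move=> ?; field.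
rewrite (H _ _ _ _ e0) TT.
rewrite mulrAC ler_wpM2r ?invr_ge0 ?oppr_ge0 ?(ltW h1)//.
have : 0 <= T `^ (n%:R / 2) * (1 + T) `^ (1 - n%:R / 2) by rewrite mulr_ge0 ?powR_ge0.
by have := T0; lra.
Qed.

End radial_integral.

Section tonelli3.
Context {d1 d2 d3 : measure_display} {T1 : measurableType d1} {T2 : measurableType d2}
  {T3 : measurableType d3} {R : realType} (m1 : {sigma_finite_measure set T1 -> \bar R})
  (m2 : {sigma_finite_measure set T2 -> \bar R}) (m3 : {sigma_finite_measure set T3 -> \bar R}).
Variables (A : set T1) (B : set T2) (I : set T3) (F : T1 -> T2 -> T3 -> \bar R).
Hypotheses (mA : measurable A) (mB : measurable B) (mI : measurable I).
Hypothesis mF : measurable_fun setT (fun p : T1 * T2 * T3 => F p.1.1 p.1.2 p.2).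
Hypothesis F0 : forall x y t, (0 <= F x y t)%E.
Local Open Scope ereal_scope.

Let mF' : measurable_fun setT (fun q : T1 * T3 * T2 => F q.1.1 q.2 q.1.2).
Proof.
apply: (measurableT_comp (f := fun p : T1 * T2 * T3 => F p.1.1 p.1.2 p.2)
  (g := fun q : T1 * T3 * T2 => (q.1.1, q.2, q.1.2))) => //.
apply: measurable_fun_pair; first apply: measurable_fun_pair => //.
  by apply: measurableT_comp; [exact: measurable_fst|exact: measurable_fst].
by apply: measurableT_comp; [exact: measurable_snd|exact: measurable_fst].
Qed.

Let mFB : measurable_fun setT (fun q : T1 * T3 => \int[m2]_(y in B) F q.1 y q.2).
Proof. exact: (measurable_integral_in (m2 := m2) (F := fun (q : T1 * T3) y => F q.1 y q.2) mB mF' (fun q y => F0 _ _ _)). Qed.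

Let mFB' : measurable_fun setT (fun q : T3 * T1 => \int[m2]_(y in B) F q.2 y q.1).
Proof.
apply: (measurableT_comp mFB (g := fun q : T3 * T1 => (q.2, q.1))).
by apply: measurable_fun_pair; [exact: measurable_snd|exact: measurable_fst].
Qed.

Lemma measurable_integral3 : measurable_fun setT
  (fun t => \int[m1]_(x in A) \int[m2]_(y in B) F x y t).
Proof.
apply: (measurable_integral_in (m2 := m1) (F := fun (t : T3) (x : T1) => \int[m2]_(y in B) F x y t) mA mFB').
by move=> t x; exact: integral_ge0.
Qed.

Lemma tonelli3 : \int[m1]_(x in A) \int[m2]_(y in B) \int[m3]_(t in I) F x y t =
  \int[m3]_(t in I) \int[m1]_(x in A) \int[m2]_(y in B) F x y t.
Proof.
transitivity (\int[m1]_(x in A) \int[m3]_(t in I) \int[m2]_(y in B) F x y t).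
  apply: eq_integral => x _; apply: tonelli_in => //.
  exact: (measurableT_comp mF (measurable_fun_pair (measurable_fun_pair (measurable_cst x) (@measurable_fst _ _ T2 T3)) (@measurable_snd _ _ T2 T3))).
by apply: tonelli_in => // x t; exact: integral_ge0.
Qed.

End tonelli3.

(** The value l = (B/A)^(1/2) makes both terms equal to (AB)^(1/2)/2. Positivity of A and B is the
    reason why strict upper bounds on energies are used. *)
Lemma young_optimal {R : realType} (x : \bar R) (A B : R) : 0 < A -> 0 < B ->
  (forall l : R, 0 < l -> (x <= (l / 2 * A + (2 * l)^-1 * B)%:E)%E) ->
  (x <= (Num.sqrt (A * B))%:E)%E.
Proof.
move=> A0 B0 /(_ (Num.sqrt B / Num.sqrt A)); rewrite divr_gt0 ?sqrtr_gt0// => /(_ isT).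
move=> /le_trans; apply; rewrite lee_fin sqrtrM ?(ltW A0)//.
have a0 : 0 < Num.sqrt A by rewrite sqrtr_gt0.
have b0 : 0 < Num.sqrt B by rewrite sqrtr_gt0.
rewrite le_eqVlt; apply/orP; left; apply/eqP.
rewrite -[X in _ * X + _](sqr_sqrtr (ltW A0)) -[X in _ + _ * X](sqr_sqrtr (ltW B0)).
by field; rewrite !gt_eqF.
Qed.

(** * A bilinear estimate of Schur type *)

Section schur.
Context {disp : measure_display} {T : measurableType disp} {R : realType}.
Variables (mu : {sigma_finite_measure set T -> \bar R}) (E B : set T).
Variables (W h H G : T -> R) (k : T -> T -> R) (l A M beta : R).
Hypotheses (mE : measurable E) (mB : measurable B) (mW : measurable_fun setT W)
  (mh : measurable_fun setT h) (mH : measurable_fun setT H) (mG : measurable_fun setT G)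
  (mk : measurable_fun setT (fun p : T * T => k p.1 p.2)).
Hypotheses (W0 : forall x, 0 <= W x) (h0 : forall z, 0 <= h z) (H0 : forall z, 0 <= H z)
  (k0 : forall x z, 0 <= k x z) (l0 : 0 < l) (beta0 : 0 <= beta).
Hypothesis hH : forall z, h z <= l / 2 * H z + (2 * l)^-1.
Hypothesis rowE : forall z, B z ->
  exists2 b, 0 <= b /\ H z * b <= G z & (\int[mu]_(x in E) (W x * k x z)%:E <= b%:E)%E.
Hypothesis colB : forall x, (\int[mu]_(z in B) (k x z)%:E <= beta%:E)%E.
Hypothesis intG : (\int[mu]_(z in B) (G z)%:E <= A%:E)%E.
Hypothesis intW : (\int[mu]_(x in E) (W x)%:E <= M%:E)%E.

Let f1 x z := H z * (W x * k x z).
Let f2 x z := W x * k x z.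
Let f10 x z : 0 <= f1 x z. Proof. by rewrite mulr_ge0// mulr_ge0. Qed.
Let f20 x z : 0 <= f2 x z. Proof. by rewrite mulr_ge0. Qed.

Let mfst (f : T -> R) : measurable_fun setT f -> measurable_fun setT (fun p : T * T => f p.1).
Proof. by move=> m; apply: measurableT_comp m _; exact: measurable_fst. Qed.

Let msnd (f : T -> R) : measurable_fun setT f -> measurable_fun setT (fun p : T * T => f p.2).
Proof. by move=> m; apply: measurableT_comp m _; exact: measurable_snd. Qed.

Let mf2 : measurable_fun setT (fun p : T * T => f2 p.1 p.2).
Proof. by apply: measurable_funM; [exact: mfst|]. Qed.

Let mf1 : measurable_fun setT (fun p : T * T => f1 p.1 p.2).
Proof. by apply: measurable_funM; [exact: msnd|exact: mf2]. Qed.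

Let m1x (f : T -> T -> R) x : measurable_fun setT (fun p : T * T => f p.1 p.2) ->
  measurable_fun setT (fun z => f x z).
Proof. by move=> m; exact: (measurableT_comp m (measurable_fun_pair (measurable_cst x) (@measurable_id _ _ setT))). Qed.

Let m2x (f : T -> T -> R) z : measurable_fun setT (fun p : T * T => f p.1 p.2) ->
  measurable_fun setT (fun x => f x z).
Proof. by move=> m; exact: (measurableT_comp m (measurable_fun_pair (@measurable_id _ _ setT) (measurable_cst z))). Qed.

Let mi (f : T -> T -> R) : measurable_fun setT (fun p : T * T => f p.1 p.2) ->
  (forall x z, 0 <= f x z) -> measurable_fun E (fun x => \int[mu]_(z in B) (f x z)%:E)%E.
Proof.
move=> m ff; apply: measurable_funTS.
apply: (measurable_integral_in (m2 := mu) (F := fun x z => (f x z)%:E) mB).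
  exact/measurable_EFinP.
by move=> x z; rewrite lee_fin.
Qed.

(* Young's inequality with a parameter [l], to be optimized by [young_optimal], plays the role
   of the Cauchy-Schwarz inequality for the kernel [k]. *)
Lemma young_schur : (\int[mu]_(x in E) \int[mu]_(z in B) (W x * (h z * k x z))%:E <=
   (l / 2 * A + (2 * l)^-1 * (beta * M))%:E)%E.
Proof.
have l20 : 0 <= (2 * l)^-1 by rewrite invr_ge0 mulr_ge0// ltW.
have l2 : 0 <= l / 2 by rewrite divr_ge0// ltW.
have I1 : (\int[mu]_(x in E) \int[mu]_(z in B) (f1 x z)%:E <= A%:E)%E.
  rewrite (tonelli_in (m1 := mu) (m2 := mu) (F := fun x z => (f1 x z)%:E) mE mB).
  - apply: le_trans intG; apply: ge0_le_integral => //.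
    + by move=> z _; apply: integral_ge0 => x _; rewrite lee_fin.
    + apply: measurable_funTS.
      apply: (measurable_integral_in (m2 := mu) (F := fun z x => (f1 x z)%:E) mE).
        apply/measurable_EFinP; apply: (measurableT_comp mf1 (g := fun p : T * T => (p.2, p.1))).
        by apply: measurable_fun_pair; [exact: measurable_snd|exact: measurable_fst].
      by move=> x z; rewrite lee_fin.
    + exact/measurable_EFinP/measurable_funTS.
    + move=> z Bz; have [b [b0 bG] hb] := rowE Bz.
      apply: (@le_trans _ _ (H z * b)%:E); last by rewrite lee_fin.
      apply: integral_mulr_le => //; first exact: (m2x (f := f2) z mf2).
      by move=> x; exact: f20.
  - exact/measurable_EFinP.
  - by move=> x z; rewrite lee_fin.
have I2 : (\int[mu]_(x in E) \int[mu]_(z in B) (f2 x z)%:E <= (beta * M)%:E)%E.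
  apply: (@le_trans _ _ (\int[mu]_(x in E) (beta * W x)%:E)%E).
    apply: ge0_le_integral => //.
    + by move=> x _; apply: integral_ge0 => z _; rewrite lee_fin.
    + exact: mi.
    + by apply/measurable_EFinP/measurable_funTS; exact: measurable_funM.
    + move=> x _; rewrite (mulrC beta); apply: integral_mulr_le => //.
      exact: m1x mk.
  exact: integral_mulr_le.
pose g1 x := (\int[mu]_(z in B) (f1 x z)%:E)%E.
pose g2 x := (\int[mu]_(z in B) (f2 x z)%:E)%E.
have g10 x : (0 <= g1 x)%E by apply: integral_ge0 => z _; rewrite lee_fin.
have g20 x : (0 <= g2 x)%E by apply: integral_ge0 => z _; rewrite lee_fin.
have mg1 : measurable_fun E g1 by exact: mi mf1 f10.
have mg2 : measurable_fun E g2 by exact: mi mf2 f20.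
have mf1x x : measurable_fun B (fun z => (f1 x z)%:E).
  by apply/measurable_EFinP/measurable_funTS; exact: m1x mf1.
have mf2x x : measurable_fun B (fun z => (f2 x z)%:E).
  by apply/measurable_EFinP/measurable_funTS; exact: m1x mf2.
have mh2 : measurable_fun setT (fun p : T * T => W p.1 * (h p.2 * k p.1 p.2)).
  by apply: measurable_funM; [exact: mfst|apply: measurable_funM; [exact: msnd|]].
apply: (@le_trans _ _ (\int[mu]_(x in E) ((l / 2)%:E * g1 x + ((2 * l)^-1)%:E * g2 x))%E).
  apply: ge0_le_integral => //.
  - by move=> x _; apply: integral_ge0 => z _; rewrite lee_fin mulr_ge0// mulr_ge0.
  - by apply: (mi mh2) => x z; rewrite mulr_ge0// mulr_ge0.
  - by apply: emeasurable_funD; exact: emeasurable_funM.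
  - move=> x _; rewrite /g1 /g2 -!ge0_integralZl_EFin//; last 2 first.
    + by move=> z _; rewrite lee_fin.
    + by move=> z _; rewrite lee_fin.
    rewrite -ge0_integralD//; last first.
    + exact: emeasurable_funM.
    + by move=> z _; rewrite mule_ge0// lee_fin.
    + exact: emeasurable_funM.
    + by move=> z _; rewrite mule_ge0// lee_fin.
    apply: ge0_le_integral => //.
    + by move=> z _; rewrite lee_fin mulr_ge0// mulr_ge0.
    + by apply/measurable_EFinP/measurable_funTS; exact: (m1x (f := fun x z => W x * (h z * k x z)) x mh2).
    + by apply: emeasurable_funD; exact: emeasurable_funM.
    + move=> z _; rewrite -!EFinM -EFinD lee_fin.
      apply: (@le_trans _ _ (W x * k x z * (l / 2 * H z + (2 * l)^-1))).
        by rewrite (mulrC (h z)) mulrA ler_wpM2l// mulr_ge0.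
      by rewrite le_eqVlt; apply/orP; left; apply/eqP; rewrite /f1 /f2; ring.
rewrite ge0_integralD//; last first.
- exact: emeasurable_funM.
- by move=> x _; rewrite mule_ge0.
- exact: emeasurable_funM.
- by move=> x _; rewrite mule_ge0.
rewrite !ge0_integralZl_EFin// EFinD; apply: leeD; rewrite [leRHS]EFinM; exact: lee_wpmul2l.
Qed.

End schur.

Lemma eball_segment {R : realType} {n : nat} (x0 x y : 'rV[R]_n) (r t : R) :
  eball x0 r x -> eball x0 r y -> 0 <= t <= 1 -> eball x0 r (x + t *: (y - x)).
Proof.
rewrite /eball/= => xr yr /andP[t0 t1].
have -> : x + t *: (y - x) - x0 = (1 - t) *: (x - x0) + t *: (y - x0).
  by apply/rowP => i; rewrite !mxE; ring.
apply: le_lt_trans (enormD _ _) _; rewrite !enormZ (ger0_norm t0) ger0_norm ?subr_ge0//.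
have [->|tn] := eqVneq t 0; first by rewrite mul0r subr0 mul1r addr0.
have tp : 0 < t by rewrite lt_neqAle eq_sym tn.
have : (1 - t) * enorm (x - x0) <= (1 - t) * r by rewrite ler_wpM2l ?subr_ge0// ltW.
have : t * enorm (y - x0) < t * r by rewrite ltr_pM2l.
lra.
Qed.

(** * Weighted integrals over segments issued from a set *)

Section weighted_segments.
Context {R : realType} {n : nat} (d : R) (Gam : set 'rV[R]_n).
Local Notation V := 'rV[R]_n.
Local Notation L := (lebesgue_rV R n).
Local Notation de := (edist Gam).
Local Notation w := (weight d Gam).
Local Notation a := (n%:R - 1 - d).
Local Notation om := (@ball_vol R n).
Hypotheses (Gam0 : Gam !=set0) (a0 : 0 < a) (cGam : closed Gam).
Variable Cw : R.
Hypotheses (Cw0 : 0 < Cw) (hw : forall y s, 0 < s ->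
  (wmeasure d Gam (eball y s) <= (Cw * ballm d Gam y s)%:E)%E).
Variable h : V -> R.
Hypotheses (mh : measurable_fun setT h) (h0 : forall z, 0 <= h z) (hGam : forall z, Gam z -> h z = 0).
Implicit Types (x y z : V) (r s t l : R).

(** Off [Gam], 1 <= w(z) (de z + s)^a because a > 0, so the weight can be inserted in the square
    term of Young's inequality. On [Gam], where the weight is 0, h vanishes. *)
Lemma young_weight z s l : 0 < s -> 0 < l ->
  h z <= l / 2 * (h z ^+ 2 * w z * (de z + s) `^ a) + (2 * l)^-1.
Proof.
move=> s0 l0; have l20 : 0 < (2 * l)^-1 by rewrite invr_gt0 mulr_gt0.
have [Gz|nGz] := pselect (Gam z).
  by rewrite (hGam Gz) expr0n/= !mul0r mulr0 add0r ltW.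
have dz : 0 < de z by exact: edist_gt0.
have w1 : 1 <= w z * (de z + s) `^ a.
  rewrite weightE ler_pdivlMl ?powR_gt0// mulr1.
  by rewrite ge0_ler_powR ?(ltW a0)// ?nnegrE; lra.
apply: (@le_trans _ _ (l / 2 * h z ^+ 2 + (2 * l)^-1)); last first.
  rewrite lerD2r ler_wpM2l ?divr_ge0 ?(ltW l0)// -[leLHS]mulr1 -mulrA.
  by rewrite ler_wpM2l ?sqr_ge0.
rewrite -subr_ge0 (_ : _ - _ = (2 * l)^-1 * (l * h z - 1) ^+ 2).
  by rewrite mulr_ge0 ?sqr_ge0 ?ltW.
by field; rewrite gt_eqF.
Qed.

Variables (x0 : V) (r : R) (E : set V) (gam tau : R).
Hypotheses (r0 : 0 < r) (mE : measurable E) (EB : E `<=` eball x0 r).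
Hypotheses (gam0 : 0 < gam) (tau0 : 0 < tau).
Local Notation B := (eball x0 r).
Local Notation mu0 := (ballm d Gam x0 r).
Hypotheses (hgam : (\int[L]_(z in B) (h z ^+ 2 * w z)%:E <= gam%:E)%E).
Hypothesis (Etau : (wmeasure d Gam E <= (tau * mu0)%:E)%E).

Let mw : measurable_fun setT w. Proof. exact: measurable_weight. Qed.
Let w0 z : 0 <= w z. Proof. exact: weight_ge0. Qed.
Let mB : measurable B. Proof. exact: measurable_eball. Qed.
Let mu00 : 0 < mu0. Proof. exact: ballm_gt0. Qed.

Let near_ind s x z : R := \1_(eball x s) z.

Let near_ind_sym s x z : near_ind s x z = near_ind s z x.
Proof. by rewrite /near_ind !indicE; congr ((_ : bool)%:R); apply/idP/idP; rewrite !inE /eball/= enormB. Qed.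

Let near_ind_ge0 s x z : 0 <= near_ind s x z. Proof. by []. Qed.

Let measurable_near_ind s : measurable_fun setT (fun p : V * V => near_ind s p.1 p.2).
Proof.
rewrite (_ : (fun _ => _) = \1_[set p : V * V | enorm (p.2 - p.1) < s]).
  apply: measurable_indic; rewrite -[X in measurable X]setTI.
  have m : measurable_fun setT (fun p : V * V => enorm (p.2 - p.1)).
    apply: (measurableT_comp (f := @enorm R n)); first exact: measurable_enorm.
    by apply: measurable_rVB; [exact: measurable_snd|exact: measurable_fst].
  rewrite (_ : _ `&` _ = setT `&` ((fun p : V * V => enorm (p.2 - p.1)) @^-1` `]-oo, s[%classic)).
    exact: m.
  by apply/seteqP; split=> p [_]; rewrite /= in_itv/=.
by apply/funext => p; rewrite /near_ind !indicE; congr ((_ : bool)%:R); apply/idP/idP; rewrite !inE.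
Qed.

Let measurable_near_ind1 s x : measurable_fun setT (near_ind s x).
Proof. exact: (measurableT_comp (measurable_near_ind s) (measurable_fun_pair (measurable_cst x) (@measurable_id _ _ setT))). Qed.

(** For fixed z, the mass of the points of [E] within s of z is at most m(E) and at most m(B(z,s)).
    Multiplied by (de z + s)^a, the first bound is controlled by de z + s <= 3(de x0 + r), while in
    the second this factor cancels exactly against [ballm], leaving Cw s^n. *)
Lemma weighted_pairs_young s l : 0 < s <= 2 * r -> 0 < l ->
  (\int[L]_(x in E) \int[L]_(z in B) (w x * (h z * near_ind s x z))%:E <=
   (l / 2 * (Num.min (tau * mu0 * (3 * (de x0 + r)) `^ a) (Cw * s ^+ n) * gam) +
    (2 * l)^-1 * (om * s ^+ n * (tau * mu0)))%:E)%E.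
Proof.
move=> /andP[s0 sr] l0; set c := Num.min _ _.
pose H z := h z ^+ 2 * w z * (de z + s) `^ a.
have H0 z : 0 <= H z by rewrite !mulr_ge0 ?sqr_ge0 ?powR_ge0.
have mde : measurable_fun setT (fun z => (de z + s) `^ a).
  apply: (measurableT_comp (f := fun t : R => t `^ a)) => //.
  by apply: measurable_funD => //; exact: measurable_edist.
have mh2w : measurable_fun setT (fun z => h z ^+ 2 * w z).
  by apply: measurable_funM => //; exact: measurable_funX.
have mH : measurable_fun setT H by exact: measurable_funM.
have hw0 z : 0 <= h z ^+ 2 * w z by rewrite mulr_ge0// sqr_ge0.
have c0 : 0 <= c.
  rewrite le_min; apply/andP; split; last by rewrite mulr_ge0 ?(ltW Cw0)// exprn_ge0// ltW.
  by apply: mulr_ge0; [apply: mulr_ge0; exact: ltW|exact: powR_ge0].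
have o0 : 0 <= om * s ^+ n by rewrite mulr_ge0 ?exprn_ge0 ?(ltW s0) ?(ltW (ball_vol_gt0 _)).
have mc : measurable_fun setT (fun z => c * (h z ^+ 2 * w z)) by exact: measurable_funM.
have cw0 z : 0 <= c * (h z ^+ 2 * w z) by exact: mulr_ge0.
apply: (young_schur mE mB mw mh mH mc (measurable_near_ind s) w0 h0 H0 _ l0 o0 (fun z => young_weight z s0 l0)).
- by [].
- move=> z Bz.
  have wE1 : (\int[L]_(x in E) (w x * near_ind s x z)%:E <= (tau * mu0)%:E)%E.
    apply: le_trans Etau; apply: ge0_le_integral => //.
    + by move=> x _; rewrite lee_fin mulr_ge0.
    + apply/measurable_EFinP/measurable_funTS; apply: measurable_funM => //.
      by under eq_fun do rewrite near_ind_sym; exact: measurable_near_ind1.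
    + exact/measurable_EFinP/measurable_funTS.
    + by move=> x _; rewrite lee_fin ler_piMr// /near_ind indicE; case: (_ \in _).
  have wE2 : (\int[L]_(x in E) (w x * near_ind s x z)%:E <= (Cw * ballm d Gam z s)%:E)%E.
    apply: le_trans (hw z s0).
    apply: (@le_trans _ _ (\int[L]_x (w x * near_ind s x z)%:E)%E).
      apply: ge0_subset_integral => //.
      + apply/measurable_EFinP; apply: measurable_funM => //.
        by under eq_fun do rewrite near_ind_sym; exact: measurable_near_ind1.
      + by move=> x _; rewrite lee_fin mulr_ge0.
    rewrite /wmeasure [leRHS]integral_mkcond le_eqVlt; apply/orP; left; apply/eqP.
    apply: eq_integral => x _; rewrite patchE near_ind_sym /near_ind indicE.
    by case: ifP => _; rewrite ?mulr1 ?mulr0.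
  have zr : de z + s <= 3 * (de x0 + r).
    have := edist_lip Gam0 z x0; move: Bz; rewrite /eball/= => Bz.
    have := edist_ge0 Gam0 x0; lra.
  have dz0 := edist_ge0 Gam0 z; have dx0 := edist_ge0 Gam0 x0.
  rewrite /c; have [_|_] := leP (tau * mu0 * (3 * (de x0 + r)) `^ a).
    exists (tau * mu0) => //; split; first by rewrite mulr_ge0// ltW.
    rewrite /H -mulrA mulrC ler_wpM2r//.
    rewrite mulrC; apply: ler_wpM2l; first by apply: mulr_ge0; exact: ltW.
    by rewrite ge0_ler_powR ?(ltW a0)// nnegrE; lra.
  exists (Cw * ballm d Gam z s) => //; split; first by rewrite mulr_ge0 ?(ltW Cw0)// ltW// ballm_gt0.
  rewrite /H /ballm le_eqVlt; apply/orP; left; apply/eqP.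
  by field; rewrite gt_eqF// powR_gt0//; lra.
- move=> x; rewrite -(lebesgue_eball x s0).
  apply: (@le_trans _ _ (\int[L]_z (near_ind s x z)%:E)%E).
    have mk1 : measurable_fun setT (fun z => (near_ind s x z)%:E).
      by apply/measurable_EFinP; exact: measurable_near_ind1.
    by apply: (ge0_subset_integral L mB measurableT mk1) => // z _; rewrite lee_fin.
  by rewrite integral_indic; [rewrite setIT|by []|exact: measurable_eball].
- exact: integral_mulr_le.
- exact: Etau.
Qed.

(** The point z = x + t(y - x) lies in the convex set [B] and within 2rt of x. The factor 2r bounds
    |y - x|, and t^(-n) is the Jacobian of y -> z. *)
Let inner_segment x t : E x -> 0 < t <= 1 ->
  (\int[L]_(y in B) (w x * (h (x + t *: (y - x)) * enorm (y - x)))%:E <=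
   (2 * r * t ^- n)%:E * \int[L]_(z in B) (w x * (h z * near_ind (2 * r * t) x z))%:E)%E.
Proof.
move=> Ex /andP[t0 t1]; have Bx := EB Ex; set s := 2 * r * t.
pose f : V -> \bar R := (fun z => (w x * (h z * near_ind s x z))%:E) \_ B.
have mf : measurable_fun setT f.
  apply: (iffLR (measurable_restrictT _ mB)); apply/measurable_EFinP/measurable_funTS.
  apply: measurable_funM; first exact: measurable_cst.
  by apply: measurable_funM; [exact: mh|exact: measurable_near_ind1].
have f0 z : (0 <= f z)%E.
  by rewrite /f patchE; case: ifP => _ //; rewrite lee_fin mulr_ge0// mulr_ge0.
have mseg (g : V -> \bar R) : measurable_fun setT g -> measurable_fun setT (fun y => g (x + t *: (y - x))).
  by move=> mg; apply: measurableT_comp mg _; exact: measurable_segment.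
rewrite EFinM -muleA.
have -> : (\int[L]_(z in B) (w x * (h z * near_ind s x z))%:E = \int[L]_z f z)%E.
  by rewrite integral_mkcond.
rewrite -(integral_seg_right x t0 mf f0) -ge0_integralZl_EFin//; last 2 first.
- exact: mseg.
- by rewrite mulr_ge0// ltW.
apply: (@le_trans _ _ (\int[L]_(y in B) ((2 * r)%:E * f (x + t *: (y - x))%R))%E); last first.
  apply: ge0_subset_integral => //.
  - exact: emeasurable_funM (mseg _ mf).
  - by move=> z _; rewrite mule_ge0// lee_fin mulr_ge0// ltW.
apply: ge0_le_integral => //.
- by move=> y _; rewrite lee_fin !mulr_ge0// enorm_ge0.
- apply/measurable_EFinP/measurable_funTS; apply: measurable_funM; first exact: measurable_cst.
  apply: measurable_funM.
    by apply: measurableT_comp mh _; exact: measurable_segment.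
  apply: (measurableT_comp (f := @enorm R n)); first exact: measurable_enorm.
  exact: measurable_rVB.
- by apply: measurable_funTS; exact: emeasurable_funM (mseg _ mf).
- move=> y By; have Bg := eball_segment Bx By (introT andP (conj (ltW t0) t1)).
  rewrite /f patchE mem_set// -EFinM lee_fin.
  have yx : enorm (y - x) < 2 * r.
    have := enorm_distD x0 y x; rewrite (enormB x0); move: Bx By; rewrite /eball/=; lra.
  have -> : near_ind s x (x + t *: (y - x)) = 1.
    rewrite /near_ind indicE mem_set// /eball/= addrC addKr enormZ gtr0_norm//.
    by rewrite /s mulrC ltr_pM2r.
  rewrite mulr1 (mulrC (2 * r)) -!mulrA ler_wpM2l//.
  by rewrite ler_wpM2l// ltW.
Qed.

Let C3 := 3 `^ a + Cw * 2 ^+ n.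

Let C30 : 0 < C3.
Proof. by rewrite ltr_wpDl ?powR_ge0// mulr_gt0// exprn_gt0. Qed.

Let om0 : 0 < om. Proof. exact: ball_vol_gt0. Qed.

(** The minimum is at most C3 r^n t^n min(1, tau/t^n), and the other factor contains t^n as well, so
    the Jacobian t^(-n) cancels and only the square root of min(1, tau/t^n) depends on t. *)
Let constant_bound t : 0 < t ->
  2 * r * t ^- n * Num.sqrt (Num.min (tau * mu0 * (3 * (de x0 + r)) `^ a) (Cw * (2 * r * t) ^+ n) * gam *
     (om * (2 * r * t) ^+ n * (tau * mu0))) <=
  2 * r * (Num.sqrt (C3 * om * 2 ^+ n) * r ^+ n * Num.sqrt (gam * tau * mu0)) *
  Num.sqrt (Num.min 1 (tau / t ^+ n)).
Proof.
move=> t0; have tn : 0 < t ^+ n by exact: exprn_gt0.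
have rn : 0 < r ^+ n by exact: exprn_gt0.
have dx0 := edist_ge0 Gam0 x0; have dr : 0 < (de x0 + r) `^ a by rewrite powR_gt0// ltr_wpDl.
set m := Num.min 1 _; have m0 : 0 < m by rewrite lt_min ltr01 divr_gt0.
set c := Num.min _ _.
have cle : c <= C3 * r ^+ n * (t ^+ n * m).
  rewrite /m minr_pMr ?(ltW tn)// mulr1 (mulrC tau) mulrA mulfV ?gt_eqF// mul1r.
  have cc : C3 * r ^+ n * Num.min (t ^+ n) tau = Num.min (C3 * r ^+ n * t ^+ n) (C3 * r ^+ n * tau).
    by rewrite minr_pMr// mulr_ge0 ?ltW.
  rewrite cc le_min /c; apply/andP; split.
    rewrite ge_min; apply/orP; right; rewrite !exprMn.
    have -> : Cw * (2 ^+ n * r ^+ n * t ^+ n) = Cw * 2 ^+ n * (r ^+ n * t ^+ n) by ring.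
    by rewrite -[leRHS]mulrA ler_wpM2r ?mulr_ge0 ?(ltW rn) ?(ltW tn)// /C3 lerDr powR_ge0.
  rewrite ge_min; apply/orP; left; rewrite powRM//; last by have := r0; lra.
  rewrite /ballm; set D := _ `^ a in dr *; set U := 3 `^ a.
  have -> : tau * (r ^+ n * D^-1) * (U * D) = U * (r ^+ n * tau) by field; rewrite gt_eqF.
  rewrite -[leRHS]mulrA ler_wpM2r ?mulr_ge0 ?(ltW rn) ?(ltW tau0)// /C3.
  by rewrite lerDl mulr_ge0 ?(ltW Cw0)// exprn_ge0.
have c0 : 0 <= c.
  rewrite le_min; apply/andP; split; last by rewrite mulr_ge0 ?(ltW Cw0)// exprn_ge0// !mulr_ge0// ltW.
  by apply: mulr_ge0; [apply: mulr_ge0; exact: ltW|exact: powR_ge0].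
rewrite -(mulrA (2 * r)) -[leRHS]mulrA ler_pM2l ?mulr_gt0// ler_pdivrMl//.
have p1 : 0 <= C3 * om * 2 ^+ n by rewrite !mulr_ge0 ?(ltW C30) ?(ltW om0).
have p2 : 0 <= gam * tau * mu0 by apply: mulr_ge0; [apply: mulr_ge0; exact: ltW|exact: ltW].
have sq (X Y Z D U : R) : 0 <= X -> 0 <= Y -> 0 <= Z -> 0 <= D -> 0 <= U ->
    U * (Num.sqrt X * D * Num.sqrt Y * Num.sqrt Z) = Num.sqrt (X * Y * Z * (D * U) ^+ 2).
  move=> X0 Y0 Z0 D0 U0; rewrite [RHS]sqrtrM; last by rewrite (mulr_ge0 (mulr_ge0 X0 Y0) Z0).
  rewrite sqrtr_sqr ger0_norm; last exact: mulr_ge0.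
  rewrite [X in _ = X * _]sqrtrM; last exact: mulr_ge0.
  rewrite [X in _ = X * _ * _]sqrtrM//; ring.
rewrite (sq _ _ _ _ _ p1 p2 (ltW m0) (ltW rn) (ltW tn)).
apply: ler_wsqrtr; rewrite !exprMn.
apply: (@le_trans _ _ (C3 * r ^+ n * (t ^+ n * m) * (gam * (om * (2 ^+ n * r ^+ n * t ^+ n) * (tau * mu0))))).
  rewrite -(mulrA c) ler_wpM2r//; have p3 := mulr_ge0 (ltW tau0) (ltW mu00).
  have p4 : 0 <= 2 ^+ n * r ^+ n * t ^+ n by rewrite !mulr_ge0 ?(ltW rn) ?(ltW tn).
  exact: (mulr_ge0 (ltW gam0) (mulr_ge0 (mulr_ge0 (ltW om0) p4) p3)).
by rewrite le_eqVlt; apply/orP; left; apply/eqP; ring.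
Qed.

Lemma weighted_segments_le :
  (\int[L]_(x in E) \int[L]_(y in B) \int[lebesgue_measure]_(t in `[0%R, 1%R])
     (w x * (h (x + t *: (y - x)) * enorm (y - x)))%:E <=
   (2 * r * (Num.sqrt (C3 * om * 2 ^+ n) * r ^+ n * Num.sqrt (gam * tau * mu0)))%:E *
   \int[lebesgue_measure]_(t in `[0%R, 1%R]) (Num.sqrt (Num.min 1 (tau / t ^+ n)))%:E)%E.
Proof.
set K := 2 * r * _.
have mI : measurable (`[0, 1]%classic : set R) by exact: measurable_itv.
have mF : measurable_fun setT (fun p : V * V * measurableTypeR R =>
    (w p.1.1 * (h (p.1.1 + p.2 *: (p.1.2 - p.1.1)) * enorm (p.1.2 - p.1.1)))%:E).
  have m1 : measurable_fun setT (fun p : V * V * measurableTypeR R => p.1.1).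
    by apply: measurableT_comp; [exact: measurable_fst|exact: measurable_fst].
  have m2 : measurable_fun setT (fun p : V * V * measurableTypeR R => p.1.2).
    by apply: measurableT_comp; [exact: measurable_snd|exact: measurable_fst].
  apply/measurable_EFinP; apply: measurable_funM; first by apply: measurableT_comp mw _.
  apply: measurable_funM; first by apply: measurableT_comp mh _; exact: measurable_segment.
  apply: (measurableT_comp (f := @enorm R n)); first exact: measurable_enorm.
  exact: measurable_rVB.
have F0 x y (t : measurableTypeR R) : (0 <= (w x * (h (x + t *: (y - x)) * enorm (y - x)))%:E)%E.
  by rewrite lee_fin !mulr_ge0// enorm_ge0.
rewrite (tonelli3 L L lebesgue_measure
  (F := fun x y (t : measurableTypeR R) => (w x * (h (x + t *: (y - x)) * enorm (y - x)))%:E) mE mB mI mF F0).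
have mT := measurable_integral3 L L mE mB mF F0.
pose T t := (\int[L]_(x in E) \int[L]_(y in B) (w x * (h (x + t *: (y - x)) * enorm (y - x)))%:E)%E.
have Tle t : 0 < t <= 1 -> (T t <= (K * Num.sqrt (Num.min 1 (tau / t ^+ n)))%:E)%E.
  move=> /andP[t0 t1]; have tn : 0 < t ^+ n by exact: exprn_gt0.
  set s := 2 * r * t; have s0 : 0 < s by rewrite !mulr_gt0.
  have sr : s <= 2 * r by rewrite /s ler_piMr// mulr_ge0// ltW.
  pose S x := (\int[L]_(z in B) (w x * (h z * near_ind s x z))%:E)%E.
  have S0 x : (0 <= S x)%E by apply: integral_ge0 => z _; rewrite lee_fin mulr_ge0// mulr_ge0.
  have mS : measurable_fun setT S.
    apply: (measurable_integral_in (m2 := L) (F := fun x z => (w x * (h z * near_ind s x z))%:E) mB).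
      apply/measurable_EFinP; apply: measurable_funM; first by apply: measurableT_comp mw _; exact: measurable_fst.
      apply: measurable_funM; last exact: measurable_near_ind.
      by apply: measurableT_comp mh _; exact: measurable_snd.
    by move=> x z; rewrite lee_fin mulr_ge0// mulr_ge0.
  apply: (@le_trans _ _ (\int[L]_(x in E) ((2 * r * t ^- n)%:E * S x))%E).
    apply: ge0_le_integral => //.
    - by move=> x _; apply: integral_ge0 => y _; exact: F0.
    - apply: measurable_funTS.
      apply: (measurable_integral_in (m2 := L) (F := fun x y => (w x * (h (x + t *: (y - x)) * enorm (y - x)))%:E) mB) => //.
      exact: (measurableT_comp mF (measurable_fun_pair (@measurable_id _ _ setT) (measurable_cst (t : measurableTypeR R)))).
    - by apply: measurable_funTS; exact: emeasurable_funM.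
    - by move=> x Ex; apply: inner_segment; rewrite ?t0.
  rewrite ge0_integralZl_EFin//; last 2 first.
  - exact: measurable_funTS.
  - by rewrite !mulr_ge0 ?invr_ge0 ?(ltW r0) ?(ltW tn).
  pose c := Num.min (tau * mu0 * (3 * (de x0 + r)) `^ a) (Cw * s ^+ n).
  have c0 : 0 < c.
    rewrite lt_min; apply/andP; split; last by rewrite mulr_gt0// exprn_gt0.
    apply: mulr_gt0; [exact: mulr_gt0|rewrite powR_gt0// mulr_gt0// ltr_wpDl//].
    exact: edist_ge0.
  have := young_optimal (mulr_gt0 c0 gam0) _ (fun l hl => weighted_pairs_young (introT andP (conj s0 sr)) hl).
  have B0 : 0 < om * s ^+ n * (tau * mu0).
    by apply: mulr_gt0; [apply: mulr_gt0; [exact: om0|exact: exprn_gt0]|exact: mulr_gt0].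
  move=> /(_ B0) hS; apply: (@le_trans _ _ ((2 * r * t ^- n) *
      Num.sqrt (c * gam * (om * s ^+ n * (tau * mu0))))%:E).
    rewrite [leRHS]EFinM; apply: lee_wpmul2l hS.
    by rewrite lee_fin !mulr_ge0 ?invr_ge0 ?(ltW r0) ?(ltW tn).
  by rewrite lee_fin; exact: constant_bound.
have K0 : 0 <= K.
  rewrite /K mulr_ge0// ?mulr_ge0 ?(ltW r0)// ?sqrtr_ge0// exprn_ge0//; exact: ltW.
(* Equal to the integrand for t >= 0, and measurable on the whole line. *)
pose sm t : R := Num.sqrt (Num.min 1 (tau * t `^ (- n%:R))).
have smE t : 0 <= t -> Num.sqrt (Num.min 1 (tau / t ^+ n)) = sm t.
  by move=> t0; rewrite /sm powRN powR_mulrn.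
have msm : measurable_fun setT (fun t => (sm t)%:E).
  apply/measurable_EFinP; apply: (measurableT_comp (f := @Num.sqrt R)).
    by apply: continuous_measurable_fun; exact: sqrt_continuous.
  by apply: measurable_minr => //; exact: measurable_funM.
have -> : (\int[lebesgue_measure]_(t in `[0%R, 1%R]) (Num.sqrt (Num.min 1 (tau / t ^+ n)))%:E =
    \int[lebesgue_measure]_(t in `[0%R, 1%R]) (sm t)%:E)%E.
  by apply: eq_integral => t; rewrite inE/= in_itv/= => /andP[t0 _]; rewrite smE.
(* The point t = 0, where the change of variables degenerates, is removed from both integrals. *)
rewrite -[leLHS]integral_itv_obnd_cbnd; last exact: measurable_funTS mT.
rewrite -[X in (_ <= _ * X)%E]integral_itv_obnd_cbnd; last exact: measurable_funTS.
have sm0 t : (0 <= (sm t)%:E)%E by rewrite lee_fin sqrtr_ge0.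
rewrite -ge0_integralZl_EFin//; last exact: measurable_funTS.
apply: ge0_le_integral => //.
- by move=> t _; apply: integral_ge0 => x _; apply: integral_ge0 => y _; exact: F0.
- exact: measurable_funTS mT.
- by apply: measurable_funTS; exact: emeasurable_funM.
- move=> t; rewrite /= in_itv/= => t01; apply: le_trans (Tle _ t01) _.
  by rewrite smE ?EFinM//; have /andP[/ltW] := t01.
Qed.

End weighted_segments.

(** * Bounds on a ball from the two-point inequality *)

Section gradient_bounds.
Context {R : realType} {n : nat} (d : R) (Gam : set 'rV[R]_n).
Local Notation V := 'rV[R]_n.
Local Notation L := (lebesgue_rV R n).
Local Notation de := (edist Gam).
Local Notation w := (weight d Gam).
Local Notation a := (n%:R - 1 - d).
Local Notation om := (@ball_vol R n).
Hypotheses (Gam0 : Gam !=set0) (a0 : 0 < a) (cGam : closed Gam).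
Hypotheses (LGam : L.-negligible Gam) (segGam : forall x, ~ Gam x ->
  L.-negligible [set y | exists2 t : R, 0 <= t <= 1 & Gam (x + t *: (y - x))]).
Variable Cw : R.
Hypotheses (Cw0 : 0 < Cw) (hw : forall y s, 0 < s ->
  (wmeasure d Gam (eball y s) <= (Cw * ballm d Gam y s)%:E)%E).
Variables (u : V -> R) (g : V -> V).
Hypotheses (mu : measurable_fun setT u) (mg : forall i, measurable_fun setT (fun z => g z 0 i)).
Hypotheses (lu : loc_integrable (~` Gam) u) (wg : weak_gradient (~` Gam) u g).
Hypothesis gGam : forall z, Gam z -> g z = 0.
Implicit Types (x y z : V) (r s t : R).

Let meg : measurable_fun setT (fun z => enorm (g z)).
Proof.
apply: (measurableT_comp (f := @enorm R n)); first exact: measurable_enorm.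
exact: measurable_fun_rVP.
Qed.

Section composed.
Variables (phi psi : R -> R) (M Lp : R).
Hypotheses (dphi : forall s, is_derive s (1 : R) phi (psi s)) (cpsi : continuous psi).
Hypotheses (psiM : forall s, `|psi s| <= M) (psiL : forall s t, `|psi s - psi t| <= Lp * `|s - t|).

Let mpsi : measurable_fun setT psi. Proof. exact: continuous_measurable_fun. Qed.

Let mphi : measurable_fun setT phi.
Proof.
apply: continuous_measurable_fun => s; have ds := dphi s.
by apply/differentiable_continuous/derivable1_diffP.
Qed.

Lemma measurable_slope : measurable_fun setT (fun z => `|psi (u z)| * enorm (g z)).
Proof.
apply: measurable_funM => //; apply: measurableT_comp => //.
exact: measurableT_comp mpsi mu.
Qed.

(** The two-point inequality integrated in y and then in x, each time off a null set. [W] will be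
    the weight in the weak type estimate and the constant 1 in the oscillation estimate. *)
Lemma two_point_weighted (W : V -> R) (E B : set V) :
  measurable_fun setT W -> (forall x, 0 <= W x) -> measurable E -> measurable B ->
  (\int[L]_(x in E) \int[L]_(y in B) (W x * `|phi (u y) - phi (u x)|)%:E <=
   \int[L]_(x in E) \int[L]_(y in B) \int[lebesgue_measure]_(t in `[0%R, 1%R])
     (W x * (`|psi (u (x + t *: (y - x)))| * enorm (g (x + t *: (y - x))) * enorm (y - x)))%:E)%E.
Proof.
move=> mW W0 mE mB.
have mI : measurable (`[0, 1]%classic : set R) by exact: measurable_itv.
pose F x y (t : R) := `|psi (u (x + t *: (y - x)))| * enorm (g (x + t *: (y - x))) * enorm (y - x).
have F0 x y t : 0 <= F x y t by rewrite !mulr_ge0// enorm_ge0.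
have mF : measurable_fun setT (fun p : V * V * measurableTypeR R => W p.1.1 * F p.1.1 p.1.2 p.2).
  have m1 : measurable_fun setT (fun p : V * V * measurableTypeR R => p.1.1).
    by apply: measurableT_comp; [exact: measurable_fst|exact: measurable_fst].
  have m2 : measurable_fun setT (fun p : V * V * measurableTypeR R => p.1.2).
    by apply: measurableT_comp; [exact: measurable_snd|exact: measurable_fst].
  apply: measurable_funM; first by apply: measurableT_comp mW _.
  apply: measurable_funM; first by apply: (measurableT_comp measurable_slope); exact: measurable_segment.
  apply: (measurableT_comp (f := @enorm R n)); first exact: measurable_enorm.
  exact: measurable_rVB.
pose J x y := (\int[lebesgue_measure]_(t in `[0%R, 1%R]) (W x * F x y t)%:E)%E.
have J0 x y : (0 <= J x y)%E by apply: integral_ge0 => t _; rewrite lee_fin mulr_ge0.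
have mJ : measurable_fun setT (fun p : V * V => J p.1 p.2).
  apply: (measurable_integral_in (m2 := lebesgue_measure) (F := fun (p : V * V) (t : measurableTypeR R) => (W p.1 * F p.1 p.2 t)%:E) mI).
    exact/measurable_EFinP.
  by move=> p t; rewrite lee_fin mulr_ge0.
pose D x y := W x * `|phi (u y) - phi (u x)|.
have D0 x y : 0 <= D x y by rewrite mulr_ge0.
have mD : measurable_fun setT (fun p : V * V => (D p.1 p.2)%:E).
  apply/measurable_EFinP; apply: measurable_funM; first by apply: measurableT_comp mW _; exact: measurable_fst.
  apply: measurableT_comp => //; apply: measurable_funB.
    by apply: measurableT_comp mphi _; apply: measurableT_comp mu _; exact: measurable_snd.
  by apply: measurableT_comp mphi _; apply: measurableT_comp mu _; exact: measurable_fst.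
have m1 (f : V -> V -> \bar R) x : measurable_fun setT (fun p : V * V => f p.1 p.2) -> measurable_fun setT (f x).
  by move=> m; exact: (measurableT_comp m (measurable_fun_pair (measurable_cst x) (@measurable_id _ _ setT))).
apply: ae_ge0_le_integral => //.
- by move=> x _; apply: integral_ge0 => y _; rewrite lee_fin; exact: D0.
- apply: measurable_funTS; apply: (measurable_integral_in (m2 := L) (F := fun x y => (D x y)%:E) mB mD).
  by move=> x y; rewrite lee_fin.
- by move=> x _; apply: integral_ge0 => y _; exact: J0.
- by apply: measurable_funTS; exact: (measurable_integral_in (m2 := L) (F := J) mB mJ J0).
- have := two_point_inequality Gam0 cGam mu mg lu wg dphi cpsi psiM psiL LGam segGam.
  apply: filterS => x aey _; apply: ae_ge0_le_integral => //.
  + by move=> y _; rewrite lee_fin; exact: D0.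
  + by apply: measurable_funTS; exact: (m1 (fun x y => (D x y)%:E)).
  + by move=> y _; exact: J0.
  + by apply: measurable_funTS; exact: (m1 J).
  + apply: filterS aey => y hy _.
    have JE : (J x y = (W x)%:E * \int[lebesgue_measure]_(t in `[0%R, 1%R]) (F x y t)%:E)%E.
      rewrite -ge0_integralZl_EFin//.
      * by move=> t _; rewrite lee_fin.
      * apply/measurable_EFinP/measurable_funTS; apply: measurable_funM => //.
        by apply: (measurableT_comp measurable_slope); exact: (measurable_segment (T := measurableTypeR R)).
    suff H : ((W x * `|phi (u y) - phi (u x)|)%:E <= J x y)%E by exact: H.
    by rewrite JE EFinM; apply: lee_wpmul2l; [rewrite lee_fin; exact: W0|exact: hy].
Qed.

(** With sg = 1/2 - 1/q the right-hand side contains tau^(1/2) tau^(1/2-1/q) = tau^(1-1/q). The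
    energy is that of phi o u, not of u; this is what the truncations exploit. *)
Lemma weak_type_bound (CI sg : R) x0 r (E : set V) (gam tau : R) :
  (forall tau : R, 0 < tau -> (\int[lebesgue_measure]_(t in `[0%R, 1%R])
     (Num.sqrt (Num.min 1 (tau / t ^+ n)))%:E <= (CI * tau `^ sg)%:E)%E) ->
  0 < r -> measurable E -> E `<=` eball x0 r -> 0 < gam -> 0 < tau ->
  (\int[L]_(z in eball x0 r) ((`|psi (u z)| * enorm (g z)) ^+ 2 * w z)%:E <= gam%:E)%E ->
  (wmeasure d Gam E <= (tau * ballm d Gam x0 r)%:E)%E ->
  (\int[L]_(x in E) \int[L]_(y in eball x0 r) (w x * `|phi (u y) - phi (u x)|)%:E <=
   (2 * r * (Num.sqrt ((3 `^ a + Cw * 2 ^+ n) * om * 2 ^+ n) * r ^+ n *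
     Num.sqrt (gam * tau * ballm d Gam x0 r)) * (CI * tau `^ sg))%:E)%E.
Proof.
move=> hI r0 mE EB gam0 tau0 hgam Etau.
apply: le_trans (two_point_weighted (measurable_weight d Gam0) (weight_ge0 d Gam) mE (measurable_eball x0 r)) _.
have h0 z : 0 <= `|psi (u z)| * enorm (g z) by rewrite mulr_ge0 ?enorm_ge0.
have hG z : Gam z -> `|psi (u z)| * enorm (g z) = 0.
  by move=> Gz; rewrite gGam// enorm0 mulr0.
apply: le_trans (weighted_segments_le Gam0 a0 cGam Cw0 hw measurable_slope h0 hG r0 mE EB gam0 tau0 hgam Etau) _.
rewrite [leRHS]EFinM; apply: lee_wpmul2l; last exact: hI.
by rewrite lee_fin !mulr_ge0 ?sqrtr_ge0 ?exprn_ge0 ?(ltW r0).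
Qed.

End composed.

(** Cauchy-Schwarz between the weighted energy and the inverse weight, which is at most (2(de x0 +
    r))^a on the ball; it is carried out by Young's inequality with the optimal parameter. *)
Lemma integral_gradient_le x0 r (gam : R) : 0 < r -> 0 < gam ->
  (\int[L]_(z in eball x0 r) (enorm (g z) ^+ 2 * w z)%:E <= gam%:E)%E ->
  (\int[L]_(z in eball x0 r) (enorm (g z))%:E <=
   (Num.sqrt (2 `^ a * om) * r ^+ n * Num.sqrt (gam / ballm d Gam x0 r))%:E)%E.
Proof.
move=> r0 gam0 hgam; have dx0 := edist_ge0 Gam0 x0.
have zr z : eball x0 r z -> de z + r <= 2 * (de x0 + r).
  by have := edist_lip Gam0 z x0; rewrite /eball/=; lra.
have rn : 0 < r ^+ n by exact: exprn_gt0.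
have dr : 0 < (de x0 + r) `^ a by rewrite powR_gt0// ltr_wpDl.
have om0 : 0 < om := ball_vol_gt0 n.
pose A := 2 `^ a * (de x0 + r) `^ a * gam.
have A0 : 0 < A by rewrite /A (mulr_gt0 (mulr_gt0 _ dr))// powR_gt0.
have B0 : 0 < om * r ^+ n by exact: mulr_gt0.
have -> : Num.sqrt (2 `^ a * om) * r ^+ n * Num.sqrt (gam / ballm d Gam x0 r) = Num.sqrt (A * (om * r ^+ n)).
  have X0 : 0 <= 2 `^ a * om by rewrite mulr_ge0 ?powR_ge0// ltW.
  rewrite -[X in _ * X * _](ger0_norm (ltW rn)) -sqrtr_sqr -[X in X * _]sqrtrM//.
  rewrite -sqrtrM; last by rewrite mulr_ge0// sqr_ge0.
  congr Num.sqrt; rewrite /A /ballm; move: dr; move: (_ `^ a) => D D0.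
  by field; rewrite !gt_eqF.
apply: young_optimal => // l l0.
have g0 z : Gam z -> enorm (g z) = 0 by move=> Gz; rewrite gGam// enorm0.
have g2w : measurable_fun setT (fun z => enorm (g z) ^+ 2 * w z).
  by apply: measurable_funM; [exact: measurable_funX|exact: measurable_weight].
have gw0 z : 0 <= enorm (g z) ^+ 2 * w z by rewrite mulr_ge0 ?sqr_ge0 ?weight_ge0.
have c0 : 0 <= l / 2 * (2 `^ a * (de x0 + r) `^ a).
  by rewrite mulr_ge0 ?divr_ge0 ?(ltW l0)// mulr_ge0 ?powR_ge0.
have l20 : 0 <= (2 * l)^-1 by rewrite invr_ge0 mulr_ge0// ltW.
have mB := measurable_eball x0 r.
apply: (@le_trans _ _ (\int[L]_(z in eball x0 r)
    (l / 2 * (2 `^ a * (de x0 + r) `^ a) * (enorm (g z) ^+ 2 * w z) + (2 * l)^-1)%:E)%E).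
  apply: ge0_le_integral => //.
  - by move=> z _; rewrite lee_fin enorm_ge0.
  - exact/measurable_EFinP/measurable_funTS.
  - apply/measurable_EFinP/measurable_funTS; apply: measurable_funD => //.
    exact: measurable_funM.
  - move=> z Bz; rewrite lee_fin.
    have yw := young_weight Gam0 a0 cGam (h := fun z => enorm (g z)) g0 z r0 l0.
    apply: (le_trans yw); rewrite lerD2r -[leRHS]mulrA; apply: ler_wpM2l.
      by rewrite divr_ge0// ltW.
    rewrite [leRHS]mulrC; apply: ler_wpM2l; first exact: gw0.
    rewrite -powRM//; last exact: addr_ge0 dx0 (ltW r0).
    apply: ge0_ler_powR; [exact: ltW|exact: addr_ge0 (edist_ge0 Gam0 z) (ltW r0)| |exact: zr].
    by apply: mulr_ge0 => //; exact: addr_ge0 dx0 (ltW r0).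
apply: integral_addr_le => //.
- exact: measurable_funM.
- by move=> z; rewrite mulr_ge0.
- by rewrite /A [X in (_ <= X%:E)%E]mulrA; apply: integral_mulr_le.
- have := integral_cst L mB ((2 * l)^-1)%:E; rewrite /cst => ->.
  rewrite EFinM le_eqVlt; apply/orP; left; apply/eqP; congr (_ * _)%E.
  exact: lebesgue_eball.
Qed.

(** The case phi = id with constant weight. Segments stay in the ball and have length at most 2r, so
    [segment_average] applies to 2r |g| cut off to the ball. *)
Lemma oscillation_le x0 r (gam : R) : 0 < r -> 0 < gam ->
  (\int[L]_(z in eball x0 r) (enorm (g z) ^+ 2 * w z)%:E <= gam%:E)%E ->
  (\int[L]_(x in eball x0 r) \int[L]_(y in eball x0 r) `|u y - u x|%:E <=
   (om * r ^+ n * (2 ^+ n * (2 * r * (Num.sqrt (2 `^ a * om) * r ^+ n * Num.sqrt (gam / ballm d Gam x0 r)))))%:E)%E.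
Proof.
move=> r0 gam0 hgam; have mB := measurable_eball x0 r.
have tri x y : eball x0 r x -> eball x0 r y -> enorm (y - x) <= 2 * r.
  by have := enorm_distD x0 y x; rewrite (enormB x0) /eball/=; lra.
pose f : V -> \bar R := (fun z => (2 * r * enorm (g z))%:E) \_ (eball x0 r).
have r20 : 0 <= 2 * r by rewrite mulr_ge0// ltW.
have f0 z : (0 <= f z)%E.
  by rewrite /f patchE; case: ifP => _ //; rewrite lee_fin mulr_ge0// enorm_ge0.
have mf : measurable_fun setT f.
  apply: (iffLR (measurable_restrictT _ mB)); apply/measurable_EFinP/measurable_funTS.
  exact: measurable_funM.
have did s : is_derive s (1 : R) (@id R) ((fun _ => 1) s) by exact: is_derive_id.
have psi1 (s : R) : `|(fun _ => 1) s : R| <= 1 by rewrite normr1.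
have psi0 (s t : R) : `|((fun _ => 1) s : R) - (fun _ => 1) t| <= 0 * `|s - t|.
  by rewrite subrr normr0 mul0r.
have c1 : continuous (fun _ : R => 1 : R) by move=> s; exact: cvg_cst.
have H := two_point_weighted did c1 psi1 psi0 (measurable_cst (1 : R)) (fun _ => ler01) mB mB.
apply: (@le_trans _ _ (L (eball x0 r) * ((2 ^+ n)%:E * \int[L]_z f z))%E); last first.
  rewrite (lebesgue_eball x0 r0) [leRHS]EFinM; apply: lee_wpmul2l.
    by rewrite lee_fin mulr_ge0 ?(ltW (ball_vol_gt0 n))// exprn_ge0// ltW.
  rewrite [leRHS]EFinM; apply: lee_wpmul2l; first by rewrite lee_fin exprn_ge0.
  rewrite -integral_mkcond; apply: integral_mulr_le => //; first by move=> z; exact: enorm_ge0.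
  exact: integral_gradient_le.
apply: le_trans (segment_average mB mf f0).
have -> : (\int[L]_(x in eball x0 r) \int[L]_(y in eball x0 r) `|u y - u x|%:E =
   \int[L]_(x in eball x0 r) \int[L]_(y in eball x0 r) (1 * `|u y - u x|)%:E)%E.
  by apply: eq_integral => x _; apply: eq_integral => y _; rewrite mul1r.
apply: le_trans H _.
have mI : measurable (`[0, 1]%classic : set R) by exact: measurable_itv.
have mseg1 : measurable_fun setT (fun p : V * V * measurableTypeR R => p.1.1).
  by apply: measurableT_comp; [exact: measurable_fst|exact: measurable_fst].
have mseg2 : measurable_fun setT (fun p : V * V * measurableTypeR R => p.1.2).
  by apply: measurableT_comp; [exact: measurable_snd|exact: measurable_fst].
pose F1 x y (t : R) : \bar R := (1 * (`|1| * enorm (g (x + t *: (y - x))) * enorm (y - x)))%:E.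
pose F2 x y (t : R) : \bar R := f (x + t *: (y - x)).
have F10 x y t : (0 <= F1 x y t)%E by rewrite lee_fin mul1r normr1 mul1r mulr_ge0 ?enorm_ge0.
have F20 x y t : (0 <= F2 x y t)%E by exact: f0.
have mF1 : measurable_fun setT (fun p : V * V * measurableTypeR R => F1 p.1.1 p.1.2 p.2).
  apply/measurable_EFinP; apply: measurable_funM => //; apply: measurable_funM.
    by apply: measurable_funM => //; apply: measurableT_comp meg _; exact: measurable_segment.
  apply: (measurableT_comp (f := @enorm R n)); first exact: measurable_enorm.
  exact: measurable_rVB.
have mF2 : measurable_fun setT (fun p : V * V * measurableTypeR R => F2 p.1.1 p.1.2 p.2).
  by apply: measurableT_comp mf _; exact: measurable_segment.
rewrite (tonelli3 L L lebesgue_measure (F := F1) mB mB mI mF1 F10).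
rewrite (tonelli3 L L lebesgue_measure (F := F2) mB mB mI mF2 F20).
have mxy (F : V -> V -> R -> \bar R) (t : R) : measurable_fun setT (fun p : V * V * measurableTypeR R => F p.1.1 p.1.2 p.2) ->
    measurable_fun setT (fun p : V * V => F p.1 p.2 t).
  by move=> m; exact: (measurableT_comp m (measurable_fun_pair (@measurable_id _ _ setT) (measurable_cst (t : measurableTypeR R)))).
have mx (F : V -> V -> R -> \bar R) (t : R) x : measurable_fun setT (fun p : V * V * measurableTypeR R => F p.1.1 p.1.2 p.2) ->
    measurable_fun setT (fun y => F x y t).
  by move=> /mxy m; exact: (measurableT_comp (m t) (measurable_fun_pair (measurable_cst x) (@measurable_id _ _ setT))).
apply: ge0_le_integral => //.
- by move=> t _; apply: integral_ge0 => x _; exact: integral_ge0.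
- by apply: measurable_funTS; exact: (measurable_integral3 L L mB mB mF1 F10).
- by apply: measurable_funTS; exact: (measurable_integral3 L L mB mB mF2 F20).
move=> t; rewrite /= in_itv/= => t01; apply: ge0_le_integral => //.
- by move=> x _; exact: integral_ge0.
- by apply: measurable_funTS; exact: (measurable_integral_in (m2 := L) (F := fun x y => F1 x y t) mB (mxy _ _ mF1) (fun x y => F10 x y t)).
- by apply: measurable_funTS; exact: (measurable_integral_in (m2 := L) (F := fun x y => F2 x y t) mB (mxy _ _ mF2) (fun x y => F20 x y t)).
move=> x Bx; apply: ge0_le_integral => //.
- by apply: measurable_funTS; exact: mx mF1.
- by apply: measurable_funTS; exact: mx mF2.
move=> y By; rewrite /F1 /F2 /f patchE mem_set; last exact: eball_segment.
rewrite lee_fin mul1r normr1 mul1r mulrC ler_wpM2r ?enorm_ge0//.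
exact: tri.
Qed.

End gradient_bounds.

(** * From double oscillation to deviation from the mean *)

Section mean_oscillation.
Context {disp : measure_display} {T : measurableType disp} {R : realType}.
Variables (m : {measure set T -> \bar R}) (B : set T) (b c : R) (f : T -> R).
Hypotheses (mB : measurable B) (Bb : m B = b%:E) (b0 : 0 < b) (mf : measurable_fun setT f).
Hypothesis mF : measurable_fun setT (fun x => \int[m]_(y in B) `|f y - f x|%:E)%E.
Hypothesis osc : (\int[m]_(x in B) \int[m]_(y in B) `|f y - f x|%:E <= (b * c)%:E)%E.

Let F x := (\int[m]_(y in B) `|f y - f x|%:E)%E.

Let F0 x : (0 <= F x)%E. Proof. by apply: integral_ge0 => y _; rewrite lee_fin. Qed.

Let mfx (k : R) : measurable_fun B (fun y => `|f y - k|%:E).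
Proof.
by apply/measurable_EFinP/measurable_funTS; apply: measurableT_comp => //; exact: measurable_funB.
Qed.

(** If the inner integral exceeded c + 1 at all x of [B], the double integral would be at least b(c
    + 1) > bc. At an x where it does not, f differs from the constant f x by an integrable
    function. *)
Lemma integrable_oscillation : m.-integrable B (EFin \o f).
Proof.
have [x Bx Fx] : exists2 x, B x & (F x <= (c + 1)%:E)%E.
  apply: contrapT => /forall2NP h.
  have : (\int[m]_(x in B) (c + 1)%:E <= (b * c)%:E)%E.
    apply: le_trans osc; apply: ge0_le_integral => //.
    - move=> x _; rewrite lee_fin.
      have : (0 <= (b * c)%:E)%E by apply: le_trans osc; apply: integral_ge0 => z _; exact: F0.
      by rewrite lee_fin pmulr_rge0// => c0; rewrite addr_ge0.
    - exact: measurable_funTS.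
    - by move=> x Bx; have [//|/negP] := h x; rewrite -ltNge => /ltW.
  have := integral_cst m mB (c + 1)%:E; rewrite /cst => ->.
  by rewrite Bb -EFinM lee_fin mulrC ler_pM2l// leNgt ltrDl ltr01.
apply/integrableP; split; first exact/measurable_EFinP/measurable_funTS.
apply: (@le_lt_trans _ _ (\int[m]_(y in B) (`|f y - f x|%:E + `|f x|%:E))%E).
  apply: ge0_le_integral => //.
  - apply/measurable_EFinP/measurable_funTS; exact: measurableT_comp.
  - by apply: emeasurable_funD => //; exact: mfx.
  - by move=> y _; rewrite abse_EFin -EFinD lee_fin -[X in `|X| <= _](subrK (f x)) ler_normD.
rewrite (ge0_integralD m mB (fun y _ => (ltac:(by rewrite lee_fin) : 0 <= `|f y - f x|%:E)%E) (mfx (f x)))//.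
have := integral_cst m mB `|f x|%:E; rewrite /cst => ->.
by rewrite Bb -EFinM lte_add_pinfty ?ltry//; apply: le_lt_trans Fx _; rewrite ltry.
Qed.

(** The deviation of f x from the mean is the average over y of f x - f y. *)
Lemma mean_oscillation_le :
  (\int[m]_(x in B) `|f x - b^-1 * \int[m]_(y in B) f y|%:E <= c%:E)%E.
Proof.
have i_f := integrable_oscillation; set mf0 := b^-1 * _.
have bx x : (b%:E * `|f x - mf0|%:E <= F x)%E.
  have -> : (b%:E * `|f x - mf0|%:E = `|\int[m]_(y in B) (f y - f x)%:E|)%E.
    have ic : m.-integrable B (EFin \o cst (f x)).
      apply/integrableP; split; first exact/measurable_EFinP.
      have := integral_cst m mB `|f x|%:E; rewrite /cst => ->.
      by rewrite Bb -EFinM ltry.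
    have iB : m.-integrable B (EFin \o (fun y => f y - f x)).
      rewrite (_ : EFin \o _ = (EFin \o f) \- (EFin \o cst (f x)))%E; first exact: integrableB.
      by apply/funext => y.
    rewrite -[X in `|X|%E]fineK; last exact: integrable_fin_num.
    rewrite -/(Rintegral m B (fun y => f y - f x)) RintegralB// Rintegral_cst// Bb/=.
    rewrite -EFinM -[in LHS](gtr0_norm b0) -normrM; congr EFin; rewrite -normrN; congr (`|_|).
    by rewrite /mf0; field; rewrite gt_eqF.
  by apply: le_trans (le_abse_integral _ mB _) _ => //; apply/measurable_EFinP/measurable_funTS; exact: measurable_funB.
rewrite -(@lee_pmul2l _ b%:E) ?lte_fin// -EFinM; apply: le_trans osc.
rewrite -ge0_integralZl_EFin ?(ltW b0)//.
apply: ge0_le_integral => //.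
- by move=> x _; rewrite mule_ge0// lee_fin// ltW.
- by apply: emeasurable_funM => //; exact: mfx.
- exact: measurable_funTS.
Qed.

End mean_oscillation.

(** * The strong type estimate *)

Section truncation.
Context {R : realType}.
Implicit Types (v h s c x : R) (f : R -> R).

(** A quadratic remainder determines the derivative. For the piecewise quadratic [cut] it replaces a
    discussion of the gluing points by polynomial inequalities. *)
Lemma is_derive_quadratic f x c (D : R) :
  (forall h, `|f (x + h) - f x - D * h| <= c * h ^+ 2) -> is_derive x (1 : R) f D.
Proof.
move=> hf.
have c0 : 0 <= c by have := hf 1; rewrite expr1n !mulr1; apply: le_trans (normr_ge0 _).
have lim : h^-1 *: (f (h *: 1 + x) - f x) @[h --> 0^'] --> D.
  apply/cvgrPdist_le => e e0; near=> h.
  have hn0 : h != 0 by near: h; exact: nbhs_dnbhs_neq.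
  have -> : D - h^-1 *: (f (h *: 1 + x) - f x) = - (h^-1 * (f (x + h) - f x - D * h)).
    have -> : h *: 1 + x = x + h by rewrite addrC [h *: _]mulr1.
    by rewrite [_ *: _]mulrC; field.
  rewrite normrN normrM normfV; apply: (@le_trans _ _ (`|h|^-1 * (c * h ^+ 2))).
    by rewrite ler_wpM2l ?invr_ge0.
  have hp : 0 < `|h| by rewrite normr_gt0.
  rewrite ler_pdivrMl// -(real_normK (num_real h)) expr2 mulrCA ler_pM2l//.
  apply: (@le_trans _ _ ((c + 1) * (e / (c + 1)))); last first.
    by rewrite mulrCA divff ?mulr1// gt_eqF// ltr_wpDl.
  apply: ler_pM => //; first by rewrite lerDl.
  near: h; apply: dnbhs0_le; rewrite divr_gt0// ltr_wpDl//.
split; [by apply/cvg_ex; exists D|exact: (cvg_lim _ lim)].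
Unshelve. all: by end_near. Qed.

Definition ppart v : R := Num.max v 0.

(* The even extension of a second difference of max(v, 0)^2: a C^(1,1) function which is 0
   for |v| <= 1 and 1/2 for |v| >= 2. *)
Definition cut v : R :=
  (ppart (v - 1) ^+ 2 - 2 * ppart (v - 3 / 2) ^+ 2 + ppart (v - 2) ^+ 2) +
  (ppart (- v - 1) ^+ 2 - 2 * ppart (- v - 3 / 2) ^+ 2 + ppart (- v - 2) ^+ 2).

Definition dcut v : R :=
  2 * (ppart (v - 1) - 2 * ppart (v - 3 / 2) + ppart (v - 2)) -
  2 * (ppart (- v - 1) - 2 * ppart (- v - 3 / 2) + ppart (- v - 2)).

Lemma ppartP v : (v <= 0 /\ ppart v = 0) \/ (0 <= v /\ ppart v = v).
Proof. by rewrite /ppart; have [?|?] := leP v 0; [left|right]; split => //; exact: ltW. Qed.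

Lemma ppart_quadratic v h :
  `|ppart (v + h) ^+ 2 - ppart v ^+ 2 - 2 * ppart v * h| <= h ^+ 2.
Proof.
rewrite ler_norml; have [[a ->]|[a ->]] := ppartP (v + h);
  have [[b ->]|[b ->]] := ppartP v; apply/andP; split; nra.
Qed.

Lemma ppart_lip v h : `|ppart v - ppart h| <= `|v - h|.
Proof.
have [[a ->]|[a ->]] := ppartP v; have [[b ->]|[b ->]] := ppartP h.
- by rewrite subrr normr0.
- by rewrite sub0r normrN ger0_norm//; have := ler_norm (h - v); rewrite distrC; lra.
- by rewrite subr0 ger0_norm//; have := ler_norm (v - h); lra.
- by [].
Qed.

Lemma cut_quadratic v h : `|cut (v + h) - cut v - dcut v * h| <= 8 * h ^+ 2.
Proof.
have H c := ppart_quadratic (v - c) h; have K c := ppart_quadratic (- v - c) (- h).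
have e1 c : v + h - c = v - c + h by ring.
have e2 c : - (v + h) - c = - v - c + - h by ring.
have := H 1; have := H (3 / 2); have := H 2; have := K 1; have := K (3 / 2); have := K 2.
rewrite /cut /dcut !e1 !e2 sqrrN !ler_norml.
move=> /andP[? ?] /andP[? ?] /andP[? ?] /andP[? ?] /andP[? ?] /andP[? ?].
by apply/andP; split; lra.
Qed.

Lemma dcut_lip v h : `|dcut v - dcut h| <= 16 * `|v - h|.
Proof.
have H c := ppart_lip (v - c) (h - c); have K c := ppart_lip (- v - c) (- h - c).
have e1 c : v - c - (h - c) = v - h by ring.
have e2 c : - v - c - (- h - c) = - (v - h) by ring.
have := H 1; have := H (3 / 2); have := H 2; have := K 1; have := K (3 / 2); have := K 2.
rewrite /dcut !e1 !e2 normrN; set m := `|v - h|; rewrite !ler_norml.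
move=> /andP[? ?] /andP[? ?] /andP[? ?] /andP[? ?] /andP[? ?] /andP[? ?].
by apply/andP; split; lra.
Qed.

Let cutN v : cut (- v) = cut v.
Proof. by rewrite /cut opprK addrC. Qed.

Let dcutN v : dcut (- v) = - dcut v.
Proof. by rewrite /dcut opprK opprB. Qed.

Let ppart_neg v c : 0 <= v -> 0 <= c -> ppart (- v - c) = 0.
Proof. by move=> v0 c0; have [[_ ->]|[? ->]] := ppartP (- v - c); lra. Qed.

Let cut_ge0E v : 0 <= v ->
  cut v = ppart (v - 1) ^+ 2 - 2 * ppart (v - 3 / 2) ^+ 2 + ppart (v - 2) ^+ 2.
Proof. by move=> v0; rewrite /cut !ppart_neg//; ring. Qed.

Let dcut_ge0E v : 0 <= v ->
  dcut v = 2 * (ppart (v - 1) - 2 * ppart (v - 3 / 2) + ppart (v - 2)).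
Proof. by move=> v0; rewrite /dcut !ppart_neg//; ring. Qed.

(** On the positive side the derivative is a tent over ]1,2[ with peak 1 at 3/2; hence only the
    energy of an annulus is charged to each truncation. *)
Lemma dcut_eq0 v : ~~ (1 < `|v| < 2) -> dcut v = 0.
Proof.
wlog v0 : v / 0 <= v.
  move=> H; have [/H//|/ltW v0] := leP 0 v.
  by rewrite -normrN => /H -/(_ _); rewrite dcutN oppr_ge0 => /(_ v0)/eqP; rewrite oppr_eq0 => /eqP.
rewrite ger0_norm// negb_and -!leNgt dcut_ge0E// => /orP[h|h];
  have [[? ->]|[? ->]] := ppartP (v - 1); have [[? ->]|[? ->]] := ppartP (v - 3 / 2);
  have [[? ->]|[? ->]] := ppartP (v - 2); lra.
Qed.

Lemma dcut_le1 v : `|dcut v| <= 1.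
Proof.
wlog v0 : v / 0 <= v.
  move=> H; have [/H//|/ltW v0] := leP 0 v.
  by rewrite -normrN -dcutN; apply: H; rewrite oppr_ge0.
rewrite ler_norml dcut_ge0E//;
  have [[? ->]|[? ->]] := ppartP (v - 1); have [[? ->]|[? ->]] := ppartP (v - 3 / 2);
  have [[? ->]|[? ->]] := ppartP (v - 2); apply/andP; split; lra.
Qed.

Lemma cut_far v : 2 <= `|v| -> cut v = 2^-1.
Proof.
wlog v0 : v / 0 <= v.
  move=> H; have [/H//|/ltW v0] := leP 0 v.
  by rewrite -normrN -cutN; apply: H; rewrite oppr_ge0.
rewrite ger0_norm// cut_ge0E// => h.
have pp (x : R) : 0 <= x -> ppart x = x by move=> x0; rewrite /ppart max_l.
by rewrite !pp; [field|lra|lra|lra].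
Qed.

Lemma cut_le v : 0 <= cut v <= `|v|.
Proof.
wlog v0 : v / 0 <= v.
  move=> H; have [/H//|/ltW v0] := leP 0 v.
  by rewrite -normrN -cutN; apply: H; rewrite oppr_ge0.
rewrite ger0_norm// cut_ge0E//;
  have [[? ->]|[? ->]] := ppartP (v - 1); have [[? ->]|[? ->]] := ppartP (v - 3 / 2);
  have [[? ->]|[? ->]] := ppartP (v - 2); apply/andP; split; nra.
Qed.

End truncation.

(** Used with X = tau^(2/q) and P = tau^(1/2-1/q): both sides are squared, one factor tau on the
    left is rewritten as P^2 X, and tau m P^2 cancels. *)
Lemma level_algebra {R : realType} (tau m o rn s r K C G P S X : R) :
  0 < tau -> 0 < m -> 0 < o -> 0 < rn -> 0 < s -> 0 < r -> 0 <= K -> 0 < C -> 0 < P -> 0 <= S ->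
  S ^+ 2 = G * tau * m -> P ^+ 2 * X = tau ->
  tau * m * (o * rn * (s / 4)) <= 2 * r * (K * rn * S) * (C * P) ->
  X <= (8 * K * C / o) ^+ 2 * (r ^+ 2 * G / (m * s ^+ 2)).
Proof.
move=> tau0 m0 o0 rn0 s0 r0 K0 C0 P0 S0 SE PE H.
have H1 : tau * m * o * s <= 8 * r * K * C * S * P.
  rewrite -(@ler_pM2r _ (rn / 4)) ?divr_gt0//.
  have -> : tau * m * o * s * (rn / 4) = tau * m * (o * rn * (s / 4)) by ring.
  by apply: le_trans H _; rewrite le_eqVlt; apply/orP; left; apply/eqP; field.
have H2 : (tau * m * o * s) ^+ 2 <= (8 * r * K * C * S * P) ^+ 2.
  by rewrite lerXn2r// nnegrE !mulr_ge0// ltW.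
have l : (tau * m * o * s) ^+ 2 = (tau * m * P ^+ 2) * (X * (m * o ^+ 2 * s ^+ 2)).
  have -> : (tau * m * o * s) ^+ 2 = tau * (tau * m ^+ 2 * o ^+ 2 * s ^+ 2) by ring.
  by rewrite -{2}PE; ring.
have rr : (8 * r * K * C * S * P) ^+ 2 = (tau * m * P ^+ 2) * ((8 * K * C) ^+ 2 * r ^+ 2 * G).
  have -> : (8 * r * K * C * S * P) ^+ 2 = (8 * r * K * C * P) ^+ 2 * S ^+ 2 by ring.
  by rewrite SE; ring.
move: H2; rewrite l rr ler_pM2l ?mulr_gt0 ?exprn_gt0// -ler_pdivlMr ?mulr_gt0 ?exprn_gt0//.
move=> /le_trans; apply; rewrite le_eqVlt; apply/orP; left; apply/eqP.
by field; rewrite !gt_eqF.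
Qed.

(** * Level sets and summation of the dyadic estimates *)

Section strong_type.
Context {R : realType} {n : nat} (d : R) (Gam : set 'rV[R]_n).
Local Notation V := 'rV[R]_n.
Local Notation L := (lebesgue_rV R n).
Local Notation de := (edist Gam).
Local Notation w := (weight d Gam).
Local Notation a := (n%:R - 1 - d).
Local Notation om := (@ball_vol R n).
Hypotheses (Gam0 : Gam !=set0) (a0 : 0 < a) (cGam : closed Gam).
Hypotheses (LGam : L.-negligible Gam) (segGam : forall x, ~ Gam x ->
  L.-negligible [set y | exists2 t : R, 0 <= t <= 1 & Gam (x + t *: (y - x))]).
Variable Cw : R.
Hypotheses (Cw0 : 0 < Cw) (hw : forall y s, 0 < s ->
  (wmeasure d Gam (eball y s) <= (Cw * ballm d Gam y s)%:E)%E).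
Variables (CI q : R).
Hypotheses (q2 : 2 < q) (CI0 : 0 < CI).
Hypothesis hI : forall tau : R, 0 < tau -> (\int[lebesgue_measure]_(t in `[0%R, 1%R])
     (Num.sqrt (Num.min 1 (tau / t ^+ n)))%:E <= (CI * tau `^ (2^-1 - q^-1))%:E)%E.
Variables (u : V -> R) (g : V -> V).
Hypotheses (mu : measurable_fun setT u) (mg : forall i, measurable_fun setT (fun z => g z 0 i)).
Hypotheses (lu : loc_integrable (~` Gam) u) (wg : weak_gradient (~` Gam) u g).
Hypothesis gGam : forall z, Gam z -> g z = 0.
Variables (x0 : V) (r c0 : R).
Hypothesis r0 : 0 < r.
Local Notation B := (eball x0 r).
Local Notation mu0 := (ballm d Gam x0 r).
Implicit Types (x y z : V) (s t : R).

Let K1 := Num.sqrt ((3 `^ a + Cw * 2 ^+ n) * om * 2 ^+ n).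
Let K2 := (8 * K1 * CI / om) ^+ 2.
Let mu00 : 0 < mu0. Proof. exact: ballm_gt0. Qed.
Let om0 : 0 < om. Proof. exact: ball_vol_gt0. Qed.
Let rn : 0 < r ^+ n. Proof. exact: exprn_gt0. Qed.
Let mB : measurable B. Proof. exact: measurable_eball. Qed.

Let mdist : measurable_fun setT (fun z => `|u z - c0|).
Proof. by apply: measurableT_comp => //; exact: measurable_funB. Qed.

Definition super s : set V := B `&` [set z | 2 * s <= `|u z - c0|].
Definition annulus s : set V := B `&` [set z | s < `|u z - c0| < 2 * s].

Lemma measurable_super s : measurable (super s).
Proof.
apply: measurableI => //; rewrite -[X in measurable X]setTI.
rewrite (_ : _ `&` _ = setT `&` ((fun z => `|u z - c0|) @^-1` `[2 * s, +oo[%classic)).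
  exact: mdist.
by apply/seteqP; split=> z [_]; rewrite /= in_itv/= andbT.
Qed.

Lemma measurable_annulus s : measurable (annulus s).
Proof.
apply: measurableI => //; rewrite -[X in measurable X]setTI.
rewrite (_ : _ `&` _ = setT `&` ((fun z => `|u z - c0|) @^-1` `]s, 2 * s[%classic)).
  exact: mdist.
by apply/seteqP; split=> z [_]; rewrite /= in_itv/=.
Qed.

(** On [super s] the truncation phi(u) equals s/2, while phi(u) <= |u - c0| has mean at most s/4
    over the ball. So |phi(u y) - phi(u x)| has mean at least s/4 in y for each x in [super s], and
    comparison with [weak_type_bound] is solved for tau = m(E)/mu0. *)
Lemma level_estimate s (gk : R) : 0 < s -> 0 <= gk ->
  (\int[L]_(x in B) `|u x - c0|%:E <= (om * r ^+ n * (s / 4))%:E)%E ->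
  (\int[L]_(z in annulus s) (enorm (g z) ^+ 2 * w z)%:E <= gk%:E)%E ->
  (wmeasure d Gam (super s) <= (mu0 * (K2 * (r ^+ 2 * gk / (mu0 * s ^+ 2))) `^ (q / 2))%:E)%E.
Proof.
move=> s0 gk0 hu hgk.
have wE : (wmeasure d Gam (super s) <= (Cw * mu0)%:E)%E.
  apply: le_trans (hw x0 r0); apply: wmeasureS => //; first exact: measurable_super.
  exact: subIsetl.
have wE0 : (0 <= wmeasure d Gam (super s))%E.
  by apply: integral_ge0 => z _; rewrite lee_fin weight_ge0.
have wfin : wmeasure d Gam (super s) \is a fin_num.
  by rewrite ge0_fin_numE//; apply: le_lt_trans wE _; rewrite ltry.
pose tau := fine (wmeasure d Gam (super s)) / mu0.
have tauE : (wmeasure d Gam (super s) = (tau * mu0)%:E)%E.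
  by rewrite /tau divfK ?gt_eqF// fineK.
have tau0 : 0 <= tau by rewrite divr_ge0 ?(ltW mu00)// fine_ge0.
rewrite tauE lee_fin mulrC ler_pM2l//.
have [->|tn0] := eqVneq tau 0; first exact: powR_ge0.
have tp : 0 < tau by rewrite lt_neqAle eq_sym tn0.
(* The rescaling keeps the slope at most 1 and puts its support on s < |t - c0| < 2s. *)
pose phi t := s * cut ((t - c0) / s).
pose psi t := dcut ((t - c0) / s).
have sV : 0 < s^-1 by rewrite invr_gt0.
have dphi t : is_derive t (1 : R) phi (psi t).
  apply: (@is_derive_quadratic _ _ _ (8 / s)) => h.
  have -> : phi (t + h) - phi t - psi t * h = s * (cut ((t - c0) / s + h / s) - cut ((t - c0) / s) - dcut ((t - c0) / s) * (h / s)).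
    rewrite /phi /psi (_ : (t + h - c0) / s = (t - c0) / s + h / s); first by field; rewrite gt_eqF.
    by field; rewrite gt_eqF.
  rewrite normrM gtr0_norm//; apply: (@le_trans _ _ (s * (8 * (h / s) ^+ 2))).
    by rewrite ler_pM2l//; exact: cut_quadratic.
  by rewrite le_eqVlt; apply/orP; left; apply/eqP; field; rewrite gt_eqF.
have psiL t t' : `|psi t - psi t'| <= 16 / s * `|t - t'|.
  apply: le_trans (dcut_lip _ _) _; rewrite -mulrA ler_wpM2l//.
  have -> : (t - c0) / s - (t' - c0) / s = s^-1 * (t - t') by ring.
  by rewrite normrM gtr0_norm.
have psiM t : `|psi t| <= 1 by exact: dcut_le1.
have cpsi : continuous psi.
  move=> t; apply/cvgrPdist_le => e e0; near=> t'.
  have k0 : 0 < 16 / s by rewrite divr_gt0.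
  apply: le_trans (psiL _ _) _; rewrite -ler_pdivlMl//.
  near: t'; apply: (@cvgr_dist_le _ _ _ (nbhs t) _ id t); first exact: cvg_id.
  by rewrite mulr_gt0// invr_gt0 divr_gt0.
have q0 : 0 < q by apply: lt_trans q2.
have mpw (f : R -> R) : continuous f -> measurable_fun setT (fun z => f (u z)).
  by move=> cf; apply: measurableT_comp mu; exact: continuous_measurable_fun.
have cphi : continuous phi.
  by move=> t; have dt := dphi t; apply/differentiable_continuous/derivable1_diffP.
have meg : measurable_fun setT (fun z => enorm (g z)).
  apply: (measurableT_comp (f := @enorm R n)); first exact: measurable_enorm.
  exact: measurable_fun_rVP.
have mw := measurable_weight d Gam0.
have slope : (\int[L]_(z in B) ((`|psi (u z)| * enorm (g z)) ^+ 2 * w z)%:E <= gk%:E)%E.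
  apply: le_trans hgk; rewrite /annulus integral_mkcondr.
  have mgw : measurable_fun setT (fun z => (enorm (g z) ^+ 2 * w z)%:E).
    by apply/measurable_EFinP; apply: measurable_funM => //; exact: measurable_funX.
  have mS : measurable [set z | s < `|u z - c0| < 2 * s].
    rewrite -[X in measurable X]setTI.
    rewrite (_ : _ `&` _ = setT `&` ((fun z => `|u z - c0|) @^-1` `]s, 2 * s[%classic)).
      exact: mdist.
    by apply/seteqP; split=> z [_]; rewrite /= in_itv/=.
  apply: ge0_le_integral => //.
  - by move=> z _; rewrite lee_fin mulr_ge0 ?sqr_ge0 ?weight_ge0.
  - apply/measurable_EFinP/measurable_funTS/measurable_funM => //.
    apply: measurable_funX; apply: measurable_funM => //.
    by apply: measurableT_comp => //; exact: mpw.
  - apply: measurable_funTS; apply: (iffLR (measurable_restrictT _ mS)); exact: measurable_funTS.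
  - move=> z _; rewrite patchE; case: ifPn => [_|]; last first.
      rewrite notin_setE/= => /negP zS; rewrite lee_fin /psi dcut_eq0 ?normr0 ?mul0r ?expr0n ?mul0r//.
      apply: contra zS => /andP[z1 z2]; move: z1 z2; rewrite normrM (gtr0_norm sV).
      by rewrite ltr_pdivlMr// mul1r ltr_pdivrMr// => -> ->.
    rewrite lee_fin exprMn ler_wpM2r ?weight_ge0// ler_piMl ?sqr_ge0//.
    by rewrite expr_le1.
have lower : ((tau * mu0 * (om * r ^+ n * (s / 4)))%:E <=
    \int[L]_(x in super s) \int[L]_(y in B) (w x * `|phi (u y) - phi (u x)|)%:E)%E.
  have K0 : 0 <= om * r ^+ n * (s / 4) by rewrite !mulr_ge0 ?(ltW om0) ?(ltW rn) ?divr_ge0 ?(ltW s0).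
  have mE := measurable_super s.
  have w0 := weight_ge0 d Gam.
  pose I x := (\int[L]_(y in B) `|phi (u y) - phi (u x)|%:E)%E.
  have mI x : measurable_fun setT (fun y => `|phi (u y) - phi (u x)|).
    by apply: measurableT_comp => //; apply: measurable_funB => //; exact: mpw.
  have Ige x : super s x -> ((om * r ^+ n * (s / 4))%:E <= I x)%E.
    move=> [Bx xs]; have phix : phi (u x) = s / 2.
      rewrite /phi cut_far// normrM (gtr0_norm sV) ler_pdivlMr//.
    have : (\int[L]_(y in B) (s / 2)%:E <= I x + \int[L]_(y in B) `|u y - c0|%:E)%E.
      rewrite -ge0_integralD//.
      - apply: ge0_le_integral => //.
        + by move=> y _; rewrite lee_fin divr_ge0// ltW.
        + by apply: emeasurable_funD; apply/measurable_EFinP; exact: measurable_funTS.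
        + move=> y _; rewrite -EFinD lee_fin phix.
          have : phi (u y) <= `|u y - c0|.
            have /andP[_] := cut_le ((u y - c0) / s); rewrite normrM (gtr0_norm sV) => h.
            by rewrite /phi -ler_pdivlMl// [leRHS]mulrC.
          have := ler_norm (s / 2 - phi (u y)); rewrite distrC; lra.
      - by apply/measurable_EFinP; exact: measurable_funTS.
      - by apply/measurable_EFinP; exact: measurable_funTS.
    have := integral_cst L mB (s / 2)%:E; rewrite /cst => ->.
    move=> /le_trans /(_ (leeD (lexx _) hu)).
    have -> : ((s / 2)%:E * L B = (om * r ^+ n * (s / 4) + om * r ^+ n * (s / 4))%:E)%E.
      transitivity ((s / 2)%:E * (om * r ^+ n)%:E)%E; last by rewrite -EFinM; congr EFin; field.
      by congr (_ * _)%E; exact: lebesgue_eball.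
    by rewrite EFinD leeD2rE.
  apply: (@le_trans _ _ (\int[L]_(x in super s) (om * r ^+ n * (s / 4) * w x)%:E)%E).
    under eq_integral do rewrite EFinM.
    rewrite ge0_integralZl_EFin//; last 2 first.
    - by move=> x _; rewrite lee_fin.
    - exact/measurable_EFinP/measurable_funTS.
    by rewrite -/(wmeasure d Gam (super s)) tauE -EFinM lee_fin mulrC.
  apply: ge0_le_integral => //.
  - by move=> x _; rewrite lee_fin mulr_ge0.
  - by apply/measurable_EFinP/measurable_funTS; exact: measurable_funM.
  - apply: measurable_funTS.
    apply: (measurable_integral_in (m2 := L) (F := fun x y => (w x * `|phi (u y) - phi (u x)|)%:E) mB).
      apply/measurable_EFinP; apply: measurable_funM.
        by apply: measurableT_comp mw _; exact: measurable_fst.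
      apply: measurableT_comp => //; apply: measurable_funB.
        by apply: measurableT_comp (mpw _ cphi) _; exact: measurable_snd.
      by apply: measurableT_comp (mpw _ cphi) _; exact: measurable_fst.
    by move=> x y; rewrite lee_fin mulr_ge0.
  - move=> x Ex; under eq_integral do rewrite EFinM.
    rewrite ge0_integralZl_EFin//; last by apply/measurable_EFinP; exact: measurable_funTS.
    by rewrite mulrC EFinM; apply: lee_wpmul2l; [rewrite lee_fin|exact: Ige].
(* The energy of the annulus may be 0, so e is added and sent to 0 afterwards. *)
have main (e : R) : 0 < e -> tau `^ (2 / q) <= K2 * (r ^+ 2 * (gk + e) / (mu0 * s ^+ 2)).
  move=> e0; have gke0 : 0 < gk + e by rewrite ltr_wpDl.
  have slope' : (\int[L]_(z in B) ((`|psi (u z)| * enorm (g z)) ^+ 2 * w z)%:E <= (gk + e)%:E)%E.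
    by apply: (le_trans slope); rewrite lee_fin lerDl ltW.
  have tauE' : (wmeasure d Gam (super s) <= (tau * mu0)%:E)%E by rewrite tauE.
  have := weak_type_bound Gam0 a0 cGam LGam segGam Cw0 hw mu mg lu wg gGam dphi cpsi psiM psiL
    hI r0 (measurable_super s) (@subIsetl _ _ _) gke0 tp slope' tauE'.
  move=> /(le_trans lower); rewrite lee_fin.
  apply: (level_algebra tp mu00 om0 rn s0 r0 (sqrtr_ge0 _) CI0 (powR_gt0 _ tp) (sqrtr_ge0 _)).
  - rewrite sqr_sqrtr//; apply: mulr_ge0; last exact: ltW.
    by apply: mulr_ge0; exact: ltW.
  - rewrite -powR_mulrn ?powR_ge0// -powRrM -powRD; last by rewrite (gt_eqF tp) implybT.
    by rewrite (_ : _ + _ = 1) ?powRr1//; field; rewrite gt_eqF.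
have main0 : tau `^ (2 / q) <= K2 * (r ^+ 2 * gk / (mu0 * s ^+ 2)).
  apply/ler_addgt0Pr => e e0.
  pose c := K2 * r ^+ 2 / (mu0 * s ^+ 2).
  have c0' : 0 <= c.
    by apply: mulr_ge0; [apply: mulr_ge0; exact: sqr_ge0|rewrite invr_ge0; apply: mulr_ge0; [exact: ltW|exact: sqr_ge0]].
  apply: (le_trans (main (e / (c + 1)) _)); first by rewrite divr_gt0// ltr_wpDl.
  have -> : K2 * (r ^+ 2 * (gk + e / (c + 1)) / (mu0 * s ^+ 2)) = K2 * (r ^+ 2 * gk / (mu0 * s ^+ 2)) + c * (e / (c + 1)).
    by rewrite /c; ring.
  rewrite lerD2l mulrCA ler_piMr ?(ltW e0)// ler_pdivrMr ?ltr_wpDl// mul1r lerDl//.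
have -> : tau = (tau `^ (2 / q)) `^ (q / 2).
  by rewrite -powRrM (_ : 2 / q * (q / 2) = 1) ?powRr1//; field; rewrite gt_eqF.
rewrite ge0_ler_powR ?nnegrE ?powR_ge0//; first by rewrite divr_ge0// ltW.
exact: le_trans (powR_ge0 _ _) main0.
Unshelve. all: by end_near.
Qed.

(** The powers of s cancel. With Y = r^2 G/(mu0 Lam^2) <= 1 and q/2 >= 1, Y^(q/2) <= Y makes the
    term linear in the energy G, hence summable over disjoint annuli. *)
Lemma dyadic_term (s G Lam : R) : 0 < s -> 0 < Lam -> 0 <= G -> r ^+ 2 * G <= mu0 * Lam ^+ 2 ->
  (4 * s) `^ q * (mu0 * (K2 * (r ^+ 2 * G / (mu0 * s ^+ 2))) `^ (q / 2)) <=
  mu0 * Lam `^ q * (4 `^ q * K2 `^ (q / 2)) * (r ^+ 2 / (mu0 * Lam ^+ 2)) * G.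
Proof.
move=> s0 L0 G0 GL; have q0 : 0 < q by apply: lt_trans q2.
have K20 : 0 <= K2 by exact: sqr_ge0.
pose X := r ^+ 2 * G / mu0; have X0 : 0 <= X.
  by rewrite /X; apply: mulr_ge0; [rewrite mulr_ge0 ?sqr_ge0|rewrite invr_ge0 ltW].
have sq_q (t : R) : 0 <= t -> (t ^+ 2) `^ (q / 2) = t `^ q.
  by move=> t0; rewrite -powR_mulrn// -powRrM; congr (_ `^ _); field.
have -> : r ^+ 2 * G / (mu0 * s ^+ 2) = X * (s ^+ 2)^-1 by rewrite /X; field; rewrite !gt_eqF.
have -> : (4 * s) `^ q = 4 `^ q * s `^ q by rewrite powRM// ltW.
have s20 : 0 <= (s ^+ 2)^-1 by rewrite invr_ge0 sqr_ge0.
have -> : (K2 * (X * (s ^+ 2)^-1)) `^ (q / 2) = K2 `^ (q / 2) * (X `^ (q / 2) * (s `^ q)^-1).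
  rewrite powRM//; last exact: mulr_ge0.
  by rewrite [(X * _) `^ _]powRM// powRV ?sqr_ge0// sq_q// ltW.
have sp : 0 < s `^ q by exact: powR_gt0.
have -> : 4 `^ q * s `^ q * (mu0 * (K2 `^ (q / 2) * (X `^ (q / 2) * (s `^ q)^-1))) =
    mu0 * (4 `^ q * K2 `^ (q / 2)) * X `^ (q / 2) by field; rewrite gt_eqF.
have -> : mu0 * Lam `^ q * (4 `^ q * K2 `^ (q / 2)) * (r ^+ 2 / (mu0 * Lam ^+ 2)) * G =
    mu0 * (4 `^ q * K2 `^ (q / 2)) * (Lam `^ q * (X / Lam ^+ 2)).
  by rewrite /X; field; rewrite !gt_eqF.
apply: ler_wpM2l; first by apply: mulr_ge0; [exact: ltW|rewrite mulr_ge0 ?powR_ge0].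
set Y := X / Lam ^+ 2; have L2 : 0 < Lam ^+ 2 by exact: exprn_gt0.
have Y0 : 0 <= Y by rewrite divr_ge0// ltW.
have Y1 : Y <= 1.
  by rewrite /Y ler_pdivrMr// /X ler_pdivrMr// mul1r (mulrC _ mu0).
have -> : X = Lam ^+ 2 * Y by rewrite /Y mulrCA divff ?mulr1// gt_eqF.
rewrite powRM ?(ltW L2)// sq_q ?(ltW L0)// ler_wpM2l ?powR_ge0//.
have [->|Yn0] := eqVneq Y 0; first by rewrite powR0// gt_eqF// divr_gt0.
have Yp : 0 < Y by rewrite lt_neqAle eq_sym Yn0.
by apply: ge1r_powR; rewrite ?Yp// ler_pdivlMr// mul1r ltW.
Qed.

(** The levels are A Lam 2^k, and the bound on the mean of |u - c0| makes [level_estimate] available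
    at all of them. Values below the first level give the term with [Cw]; beyond it, |u - c0| < 4 S
    k on a part of [super (S k)], and the disjoint annuli share the energy gam. *)
Lemma strong_type (A Lam gam : R) : 0 < A -> 0 < Lam -> 0 <= gam ->
  (\int[L]_(z in B) (enorm (g z) ^+ 2 * w z)%:E <= gam%:E)%E ->
  r ^+ 2 * gam <= mu0 * Lam ^+ 2 ->
  (\int[L]_(x in B) `|u x - c0|%:E <= (om * r ^+ n * (A * Lam / 4))%:E)%E ->
  (\int[L]_(x in B) (`|u x - c0| `^ q * w x)%:E <=
   (mu0 * Lam `^ q * ((2 * A) `^ q * Cw + 4 `^ q * K2 `^ (q / 2)))%:E)%E.
Proof.
move=> A0 L0 gam0 hgam gL hu; have q0 : 0 < q by apply: lt_trans q2.
pose S (k : nat) := A * Lam * 2 ^+ k.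
have S0 k : 0 < S k by rewrite !mulr_gt0// exprn_gt0.
have SS j k : (j < k)%N -> 2 * S j <= S k.
  move=> jk; rewrite /S mulrCA ler_pM2l ?mulr_gt0// -exprS.
  by rewrite ler_eXn2l// ltr1n.
have S1 k : S k.+1 = 2 * S k by rewrite /S exprS; ring.
have hS k : (\int[L]_(x in B) `|u x - c0|%:E <= (om * r ^+ n * (S k / 4))%:E)%E.
  apply: (le_trans hu); rewrite lee_fin ler_wpM2l ?mulr_ge0 ?(ltW om0) ?(ltW rn)//.
  rewrite ler_wpM2r// /S ler_peMr ?mulr_ge0 ?(ltW A0) ?(ltW L0)//.
  by rewrite exprn_ege1// ler1n.
have meg : measurable_fun setT (fun z => enorm (g z)).
  apply: (measurableT_comp (f := @enorm R n)); first exact: measurable_enorm.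
  exact: measurable_fun_rVP.
have mw := measurable_weight d Gam0; have w0 := weight_ge0 d Gam.
have mgw : measurable_fun setT (fun z => (enorm (g z) ^+ 2 * w z)%:E).
  by apply/measurable_EFinP; apply: measurable_funM => //; exact: measurable_funX.
have gw0 z : (0 <= (enorm (g z) ^+ 2 * w z)%:E)%E by rewrite lee_fin mulr_ge0 ?sqr_ge0.
pose I k := (\int[L]_(z in annulus (S k)) (enorm (g z) ^+ 2 * w z)%:E)%E.
have I0 k : (0 <= I k)%E by exact: integral_ge0.
have Ile k : (I k <= gam%:E)%E.
  apply: le_trans hgam; apply: ge0_subset_integral => //.
  - exact: measurable_annulus.
  - exact: measurable_funTS.
  - exact: subIsetl.
have Ifin k : I k \is a fin_num.
  by rewrite ge0_fin_numE//; apply: le_lt_trans (Ile k) _; rewrite ltry.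
pose G k := fine (I k); have GE k : I k = (G k)%:E by rewrite /G fineK.
have G0 k : 0 <= G k by exact: fine_ge0.
have Ggam k : G k <= gam by rewrite -lee_fin -GE.
have sumG : (\sum_(k <oo) (G k)%:E <= gam%:E)%E.
  under eq_eseriesr do rewrite -GE.
  rewrite -ge0_integral_bigcup//.
  - apply: le_trans hgam; apply: ge0_subset_integral => //.
    + by apply: bigcup_measurable => k _; exact: measurable_annulus.
    + exact: measurable_funTS.
    + by move=> z [k _ []].
  - by move=> k; exact: measurable_annulus.
  - exact: measurable_funTS.
  - apply/trivIsetP => j k _ _ jk; apply/seteqP; split => // z [[_ /= /andP[j1 j2]] [_ /= /andP[k1 k2]]].
    have [/SS h|/SS h|jk'] := ltngtP j k; last by rewrite jk' eqxx in jk.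
      by have := lt_trans (lt_le_trans j2 h) k1; rewrite ltxx.
    by have := lt_trans (lt_le_trans k2 h) j1; rewrite ltxx.
pose C := mu0 * Lam `^ q * (4 `^ q * K2 `^ (q / 2)) * (r ^+ 2 / (mu0 * Lam ^+ 2)).
have mL : 0 < mu0 * Lam ^+ 2 by apply: mulr_gt0 => //; exact: exprn_gt0.
have C0 : 0 <= C.
  apply: mulr_ge0; last by rewrite divr_ge0 ?sqr_ge0// ltW.
  apply: mulr_ge0; last by rewrite mulr_ge0 ?powR_ge0.
  by apply: mulr_ge0; [exact: ltW|exact: powR_ge0].
have term k : (((4 * S k) `^ q)%:E * wmeasure d Gam (super (S k)) <= (C * G k)%:E)%E.
  apply: (@le_trans _ _ (((4 * S k) `^ q)%:E * (mu0 * (K2 * (r ^+ 2 * G k / (mu0 * (S k) ^+ 2))) `^ (q / 2))%:E)%E).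
    apply: lee_wpmul2l; first by rewrite lee_fin powR_ge0.
    by apply: level_estimate => //; rewrite -GE.
  rewrite -EFinM lee_fin; apply: dyadic_term => //.
  by apply: le_trans gL; rewrite ler_wpM2l ?sqr_ge0.
have mq : measurable_fun setT (fun z => `|u z - c0| `^ q * w z).
  apply: measurable_funM => //.
  exact: (measurableT_comp (f := fun t : R => t `^ q)).
pose T k z : \bar R := (((4 * S k) `^ q * w z) * \1_(super (S k)) z)%:E.
have T0 k z : (0 <= T k z)%E by rewrite lee_fin !mulr_ge0 ?powR_ge0.
have mT k : measurable_fun setT (T k).
  apply/measurable_EFinP; apply: measurable_funM; first exact: measurable_funM.
  by apply: measurable_indic; exact: measurable_super.
have TI k : (\int[L]_(z in B) T k z <= (C * G k)%:E)%E.
  apply: le_trans (term k).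
  rewrite -ge0_integralZl_EFin ?powR_ge0//; last 3 first.
  - exact: measurable_super.
  - by move=> z _; rewrite lee_fin.
  - exact/measurable_EFinP/measurable_funTS.
  rewrite [leRHS](_ : _ = \int[L]_(z in super (S k)) ((4 * S k) `^ q * w z)%:E)%E; last first.
    by apply: eq_integral => z _; rewrite EFinM.
  rewrite le_eqVlt; apply/orP; left; apply/eqP.
  rewrite integral_mkcond [RHS]integral_mkcond; apply: eq_integral => z _.
  rewrite !patchE /T indicE; have [zS|zS] := boolP (z \in super (S k)).
    by rewrite mem_set ?mulr1//; have [] := set_mem zS.
  by rewrite mulr0; case: ifP.
apply: (@le_trans _ _ (\int[L]_(z in B) (((2 * S 0) `^ q * w z)%:E + \sum_(k <oo) T k z))%E).
  apply: ge0_le_integral => //.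
  - by move=> z _; rewrite lee_fin mulr_ge0// powR_ge0.
  - exact/measurable_EFinP/measurable_funTS.
  - apply: measurable_funTS; apply: emeasurable_funD.
      by apply/measurable_EFinP; exact: measurable_funM.
    by apply: ge0_emeasurable_sum => // k z _.
  - move=> z Bz; set v := `|u z - c0|; have v0 : 0 <= v := normr_ge0 _.
    have sT0 : (0 <= \sum_(k <oo) T k z)%E by apply: nneseries_ge0 => k _ _.
    have [vS|Sv] := ltP v (2 * S 0%N).
      apply: (@le_trans _ _ ((2 * S 0%N) `^ q * w z)%:E); last exact: leeDl.
      rewrite lee_fin ler_wpM2r// ge0_ler_powR ?nnegrE ?(ltW q0) ?(ltW vS)//.
      by rewrite mulr_ge0// ltW.
    (* The least k with v < 4 S k: either k = 0, where v >= 2 S 0 is known, or the preceding index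
       fails and 4 S (k-1) = 2 S k. *)
    have [k /andP[kv vk]] : exists k, 2 * S k <= v < 4 * S k.
      have exP : exists k, v < 4 * S k.
        have AL : 0 < 4 * (A * Lam) by rewrite !mulr_gt0.
        exists (Num.truncn (v / (4 * (A * Lam)))).+1; set k := (Num.truncn _).+1.
        have vk : v / (4 * (A * Lam)) < k%:R by exact: truncnS_gt.
        rewrite /S mulrA -ltr_pdivrMl// mulrC (lt_trans vk)//.
        by rewrite -natrX ltr_nat ltn_expl.
      have := ex_minnP exP => -[[|k] vk kmin]; [exists 0%N|exists k.+1]; rewrite vk andbT//.
      rewrite leNgt; apply/negP; rewrite S1 => vk'.
      have /kmin : v < 4 * S k by lra.
      by rewrite ltnn.
    apply: (@le_trans _ _ (T k z)); last first.
      apply: (@le_trans _ _ (\sum_(k <oo) T k z)%E); first by apply: nneseries_ge_term => j.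
      by apply: leeDr; rewrite lee_fin mulr_ge0 ?powR_ge0.
    rewrite /T indicE mem_set// mulr1 lee_fin ler_wpM2r// ge0_ler_powR ?nnegrE ?(ltW q0) ?(ltW vk)//.
    by rewrite mulr_ge0// ltW.
rewrite ge0_integralD//.
- rewrite integral_nneseries//.
  + have -> : mu0 * Lam `^ q * ((2 * A) `^ q * Cw + 4 `^ q * K2 `^ (q / 2)) =
       (2 * S 0%N) `^ q * (Cw * mu0) + mu0 * Lam `^ q * (4 `^ q * K2 `^ (q / 2)).
      rewrite /S expr0 mulr1 [2 * (A * Lam)]mulrA (powRM (x := 2 * A)) ?mulr_ge0 ?(ltW A0) ?(ltW L0)//; ring.
    rewrite EFinD; apply: leeD.
      apply: integral_mulr_le => //; first exact: powR_ge0.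
      exact: hw.
    apply: (@le_trans _ _ (\sum_(k <oo) (C%:E * (G k)%:E))%E).
      apply: lee_nneseries => [k _ _|k _]; first by apply: integral_ge0 => z _; exact: T0.
      by rewrite -EFinM.
    rewrite nneseriesZl; last by move=> k _; rewrite lee_fin.
    apply: (@le_trans _ _ (C%:E * gam%:E)%E); first exact: lee_wpmul2l.
    rewrite -EFinM lee_fin /C; set D := mu0 * _ * _.
    have D0 : 0 <= D.
      apply: mulr_ge0; last by rewrite mulr_ge0 ?powR_ge0.
      by apply: mulr_ge0; [exact: ltW|exact: powR_ge0].
    by rewrite -mulrA ler_piMr// mulrAC ler_pdivrMr// mul1r.
  + by move=> k; exact: measurable_funTS.
- by move=> z _; rewrite lee_fin mulr_ge0 ?powR_ge0.
- by apply/measurable_EFinP/measurable_funTS; exact: measurable_funM.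
- by move=> z _; apply: nneseries_ge0 => k _ _.
- by apply: measurable_funTS; apply: ge0_emeasurable_sum => // k z _.
Qed.

End strong_type.

(** * The inequality centred at the unweighted mean *)

Section poincare.
Context {R : realType} {n : nat} (d : R) (Gam : set 'rV[R]_n).
Local Notation V := 'rV[R]_n.
Local Notation L := (lebesgue_rV R n).
Local Notation de := (edist Gam).
Local Notation w := (weight d Gam).
Local Notation a := (n%:R - 1 - d).
Local Notation om := (@ball_vol R n).
Implicit Types (x y z : V) (r s t gam p : R) (u : V -> R) (g : V -> V).

(** The gradient is normalized to be Borel on the whole space and zero on [Gam], which
    [young_weight] requires at points where the weight vanishes. *)
Definition admissible u g := [/\ measurable_fun setT u,
  forall i, measurable_fun setT (fun z => g z 0 i),
  loc_integrable (~` Gam) u, weak_gradient (~` Gam) u g & forall z, Gam z -> g z = 0].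

Definition energy_le g x r gam :=
  (\int[L]_(z in eball x r) (enorm (g z) ^+ 2 * w z)%:E <= gam%:E)%E.

(** The right-hand side of the Poincare inequality without its constant, with [ballm] in place of
    m(B) and gam in place of the energy. *)
Definition scale x r gam := r * Num.sqrt (gam / ballm d Gam x r).

Hypotheses (Gam0 : Gam !=set0) (a0 : 0 < a) (cGam : closed Gam).
Hypotheses (LGam : L.-negligible Gam) (segGam : forall x, ~ Gam x ->
  L.-negligible [set y | exists2 t : R, 0 <= t <= 1 & Gam (x + t *: (y - x))]).

Lemma scale_gt0 x r gam : 0 < r -> 0 < gam -> 0 < scale x r gam.
Proof. by move=> r0 g0; rewrite mulr_gt0// sqrtr_gt0 divr_gt0// ballm_gt0. Qed.

Lemma sqr_scale x r gam : 0 < r -> 0 < gam ->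
  r ^+ 2 * gam = ballm d Gam x r * scale x r gam ^+ 2.
Proof.
move=> r0 g0; have m0 := ballm_gt0 d Gam0 x r0.
rewrite /scale exprMn sqr_sqrtr; last by rewrite divr_ge0 ?ltW.
by field; rewrite gt_eqF.
Qed.

Let K3 := 2 ^+ n * 2 * Num.sqrt (2 `^ a * om).

Let K30 : 0 < K3.
Proof. by rewrite !mulr_gt0 ?exprn_gt0// sqrtr_gt0 mulr_gt0 ?powR_gt0// ball_vol_gt0. Qed.

(** Besides the estimate, this yields integrability of u on balls meeting [Gam], where it is only
    known to be locally integrable off [Gam]; means over such balls become meaningful. *)
Lemma avg_oscillation u g x r gam : admissible u g -> 0 < r -> 0 < gam -> energy_le g x r gam ->
  L.-integrable (eball x r) (EFin \o u) /\
  (\int[L]_(z in eball x r) `|u z - avg u (eball x r)|%:E <= (K3 * r ^+ n * scale x r gam)%:E)%E.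
Proof.
move=> [mu mg lu wg gG] r0 gam0 hg; have mB := measurable_eball x r.
have osc := oscillation_le Gam0 a0 cGam LGam segGam mu mg lu wg gG r0 gam0 hg.
have LB : L (eball x r) = (om * r ^+ n)%:E by exact: lebesgue_eball.
have b0 : 0 < om * r ^+ n by rewrite mulr_gt0 ?exprn_gt0 ?ball_vol_gt0.
have mF : measurable_fun setT (fun x0 => \int[L]_(y in eball x r) `|u y - u x0|%:E)%E.
  apply: (measurable_integral_in (m2 := L) (F := fun x y => `|u y - u x|%:E) mB) => //.
  apply/measurable_EFinP; apply: measurableT_comp => //; apply: measurable_funB.
    by apply: measurableT_comp mu _; exact: measurable_snd.
  by apply: measurableT_comp mu _; exact: measurable_fst.
split; first exact: (integrable_oscillation mB LB b0 mu mF osc).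
have := mean_oscillation_le mB LB b0 mu mF osc.
have -> : avg u (eball x r) = (om * r ^+ n)^-1 * \int[L]_(y in eball x r) u y by rewrite /avg LB.
move=> /le_trans; apply; rewrite lee_fin le_eqVlt; apply/orP; left; apply/eqP.
by rewrite /K3 /scale; ring.
Qed.

Variable Cw : R.
Hypotheses (Cw0 : 0 < Cw) (hw : forall y s, 0 < s ->
  (wmeasure d Gam (eball y s) <= (Cw * ballm d Gam y s)%:E)%E).
Variables (CI q : R).
Hypotheses (q2 : 2 < q) (CI0 : 0 < CI).
Hypothesis hI : forall tau : R, 0 < tau -> (\int[lebesgue_measure]_(t in `[0%R, 1%R])
     (Num.sqrt (Num.min 1 (tau / t ^+ n)))%:E <= (CI * tau `^ (2^-1 - q^-1))%:E)%E.

(** From q to a smaller p without Hoelder's inequality: v^p <= Lam^p + Lam^(p-q) v^q, according to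
    whether v <= Lam. The constant is the same for all p, so that exponent 1 is available as
    well. *)
Lemma poincare_avg : exists2 C, 0 < C & forall u g x r gam, admissible u g ->
  0 < r -> 0 < gam -> energy_le g x r gam -> forall p, 0 < p <= q ->
  (\int[L]_(z in eball x r) (`|u z - avg u (eball x r)| `^ p * w z)%:E <=
   (C * scale x r gam `^ p * ballm d Gam x r)%:E)%E.
Proof.
have om0 : 0 < om := ball_vol_gt0 n.
(* Chosen to turn the bound of [avg_oscillation] into the mean value hypothesis of [strong_type]. *)
pose A := 4 * K3 / om; have A0 : 0 < A by rewrite divr_gt0// mulr_gt0.
pose K1 := Num.sqrt ((3 `^ a + Cw * 2 ^+ n) * om * 2 ^+ n).
pose K2 := (8 * K1 * CI / om) ^+ 2.
pose Cq := (2 * A) `^ q * Cw + 4 `^ q * K2 `^ (q / 2).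
have Cq0 : 0 <= Cq by rewrite addr_ge0 ?mulr_ge0 ?powR_ge0 ?(ltW Cw0).
exists (Cw + Cq) => [|u g x r gam adm r0 gam0 hg p /andP[p0 pq]]; first by rewrite ltr_pwDl.
set B := eball x r; set c0 := avg u B; set Lam := scale x r gam.
have L0 : 0 < Lam by exact: scale_gt0.
have [_ osc] := avg_oscillation adm r0 gam0 hg.
have [mu mg lu wg gG] := adm.
have m0 := ballm_gt0 d Gam0 x r0.
have hu : (\int[L]_(z in B) `|u z - c0|%:E <= (om * r ^+ n * (A * Lam / 4))%:E)%E.
  apply: le_trans osc _; rewrite lee_fin le_eqVlt; apply/orP; left; apply/eqP.
  by rewrite /A -/Lam; field; rewrite gt_eqF.
have gL : r ^+ 2 * gam <= ballm d Gam x r * Lam ^+ 2 by rewrite (sqr_scale x r0 gam0).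
have st := strong_type Gam0 a0 cGam LGam segGam Cw0 hw q2 CI0 hI mu mg lu wg gG r0 A0 L0 (ltW gam0) hg gL hu.
have mw := measurable_weight d Gam0; have w0 := weight_ge0 d Gam.
have mB : measurable B by exact: measurable_eball.
have mpow (e : R) : measurable_fun setT (fun z => `|u z - c0| `^ e * w z).
  apply: measurable_funM => //; apply: (measurableT_comp (f := fun t : R => t `^ e)) => //.
  by apply: measurableT_comp => //; exact: measurable_funB.
have Lp0 : 0 <= Lam `^ p by exact: powR_ge0.
have Lpq0 : 0 <= Lam `^ (p - q) by exact: powR_ge0.
apply: (@le_trans _ _ (\int[L]_(z in B) (Lam `^ p * w z + Lam `^ (p - q) * (`|u z - c0| `^ q * w z))%:E)%E).
  apply: ge0_le_integral => //.
  - by move=> z _; rewrite lee_fin mulr_ge0 ?powR_ge0.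
  - by apply/measurable_EFinP; exact: measurable_funTS.
  - apply/measurable_EFinP/measurable_funTS; apply: measurable_funD; exact: measurable_funM.
  - move=> z _; rewrite lee_fin mulrA -mulrDl ler_wpM2r//; set v := `|_|.
    have v0 : 0 <= v := normr_ge0 _.
    have [vL|Lv] := leP v Lam.
      apply: (@le_trans _ _ (Lam `^ p)); last by rewrite lerDl mulr_ge0 ?powR_ge0.
      by rewrite ge0_ler_powR ?nnegrE ?(ltW p0) ?(ltW L0).
    apply: (@le_trans _ _ (Lam `^ (p - q) * v `^ q)); last by rewrite lerDr.
    have vp : 0 < v by exact: lt_trans Lv.
    have -> : v `^ p = v `^ (p - q) * v `^ q.
      by rewrite -powRD ?subrK// (gt_eqF vp) implybT.
    rewrite ler_wpM2r ?powR_ge0// -opprB !powRN lef_pV2 ?posrE ?powR_gt0//.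
    by rewrite ge0_ler_powR ?nnegrE ?subr_ge0 ?(ltW L0) ?(ltW Lv).
have -> : (Cw + Cq) * Lam `^ p * ballm d Gam x r =
  Lam `^ p * (Cw * ballm d Gam x r) + Lam `^ (p - q) * (ballm d Gam x r * Lam `^ q * Cq).
  have -> : Lam `^ (p - q) * (ballm d Gam x r * Lam `^ q * Cq) = (Lam `^ (p - q) * Lam `^ q) * (ballm d Gam x r * Cq) by ring.
  rewrite -powRD; last by rewrite (gt_eqF L0) implybT.
  by rewrite subrK; ring.
apply: integral_addr_le => //.
- exact: measurable_funM.
- exact: measurable_funM.
- by move=> z; rewrite mulr_ge0.
- by move=> z; rewrite mulr_ge0// mulr_ge0 ?powR_ge0.
- by apply: integral_mulr_le => //; exact: hw.
- by apply: integral_mulr_le => // z; rewrite mulr_ge0 ?powR_ge0.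
Qed.

End poincare.

(** * Traces *)

Section trace.
Context {R : realType} {n : nat} (d : R) (Gam : set 'rV[R]_n).
Local Notation V := 'rV[R]_n.
Local Notation L := (lebesgue_rV R n).
Local Notation de := (edist Gam).
Local Notation w := (weight d Gam).
Local Notation a := (n%:R - 1 - d).
Local Notation om := (@ball_vol R n).
Local Notation energy_le := (energy_le d Gam).
Local Notation scale := (scale d Gam).
Implicit Types (x y z : V) (r s t gam : R) (u : V -> R) (g : V -> V).

Hypotheses (Gam0 : Gam !=set0) (d0 : 0 < d) (a0 : 0 < a) (cGam : closed Gam).
Hypotheses (LGam : L.-negligible Gam) (segGam : forall x, ~ Gam x ->
  L.-negligible [set y | exists2 t : R, 0 <= t <= 1 & Gam (x + t *: (y - x))]).
Variable C0 : R.
Hypothesis C01 : 1 <= C0.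
Hypothesis reg : forall x r, Gam x -> 0 < r ->
  ((C0^-1 * r `^ d)%:E <= hausdorff d (Gam `&` eball x r))%E /\
  (hausdorff d (Gam `&` eball x r) <= (C0 * r `^ d)%:E)%E.

Let mw : measurable_fun setT w. Proof. exact: measurable_weight. Qed.

(** This is where the normalization r^(-d-1) of the second estimate comes from. *)
Lemma ballm_on x s : 0 < s -> Gam x -> ballm d Gam x s = s `^ (d + 1).
Proof.
move=> s0 Gx; rewrite /ballm (edist_mem Gam0 Gx) add0r -powR_mulrn ?(ltW s0)// -powRN -powRD.
  by congr (_ `^ _); ring.
by rewrite (gt_eqF s0) implybT.
Qed.

Lemma avg_sub_le u x s c X (B : set V) : 0 < s -> measurable B -> eball x s `<=` B ->
  measurable_fun setT u -> L.-integrable (eball x s) (EFin \o u) ->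
  (\int[L]_(z in B) `|u z - c|%:E <= X%:E)%E ->
  `|avg u (eball x s) - c| <= (om * s ^+ n)^-1 * X.
Proof.
move=> s0 mB sB mu iu hX; have mS := measurable_eball x s.
have b0 : 0 < om * s ^+ n by rewrite mulr_gt0 ?exprn_gt0 ?ball_vol_gt0.
have LS : L (eball x s) = (om * s ^+ n)%:E by exact: lebesgue_eball.
have ic : L.-integrable (eball x s) (EFin \o cst c).
  apply/integrableP; split; first exact/measurable_EFinP.
  have := integral_cst L mS `|c|%:E; rewrite /cst => ->.
  by rewrite [X in (_ * X)%E]LS -EFinM ltry.
have -> : avg u (eball x s) - c = (om * s ^+ n)^-1 * \int[L]_(z in eball x s) (u z - c).
  rewrite RintegralB// /avg Rintegral_cst//.
  have -> : fine (L (eball x s)) = om * s ^+ n by rewrite LS.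
  by rewrite mulrBr [in RHS]mulrCA mulVf ?gt_eqF// mulr1.
rewrite normrM gtr0_norm ?invr_gt0// ler_pM2l ?invr_gt0//.
have iB : L.-integrable (eball x s) (EFin \o (fun z => u z - c)).
  rewrite (_ : EFin \o _ = (EFin \o u) \- (EFin \o cst c))%E; first exact: integrableB.
  by apply/funext => z.
rewrite -lee_fin -abse_EFin /Rintegral fineK; last exact: integrable_fin_num.
have mf : measurable_fun setT (fun z => u z - c) by exact: measurable_funB.
apply: le_trans hX.
have := le_abse_integral L mS (f := fun z => (u z - c)%:E).
move=> /(_ (ltac:(apply/measurable_EFinP; exact: measurable_funTS))) /le_trans; apply.
apply: ge0_subset_integral => //.
by apply: measurable_funTS; apply/measurable_EFinP; exact: measurableT_comp.
Qed.

Lemma disjoint_energy (F : V -> \bar R) s (e : R) (S : seq V) :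
  measurable_fun setT F -> (forall z, 0 <= F z)%E -> 0 < s -> separated (2 * s) S ->
  (forall p, p \in S -> (e%:E <= \int[L]_(z in eball p s) F z)%E) ->
  (((size S)%:R * e)%:E <= \int[L]_(z in \bigcup_(p in [set` S]) eball p s) F z)%E.
Proof.
move=> mF F0 s0; elim: S => [|p S IH].
  by rewrite set_nil bigcup_set0 integral_set0 mul0r.
rewrite /separated /= => /andP[pS sS] hS; rewrite bigcup_cons.
have mU : measurable (\bigcup_(q in [set` S]) eball q s).
  by apply: fin_bigcup_measurable => // q _; exact: measurable_eball.
rewrite ge0_integral_setU//.
- rewrite -nat1r mulrDl mul1r EFinD; apply: leeD.
    by apply: hS; rewrite inE eqxx.
  by apply: IH => // q qS; apply: hS; rewrite inE qS orbT.
- exact: measurable_eball.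
- exact: measurable_funTS.
- apply/disj_setPS => z [pz [q /= qS qz]].
  have /allP/(_ q qS) := pS; rewrite leNgt => /negP; apply.
  apply: le_lt_trans (enorm_distD z _ _) _; rewrite enormB.
  by move: pz qz; rewrite /eball/=; lra.
Qed.

Lemma hausdorff_cover_le (P : set V) s (S : seq V) : 0 < s -> (forall p, p \in S -> Gam p) ->
  P `<=` Gam -> P `<=` \bigcup_(p in [set` S]) eball p s ->
  (hausdorff d P <= ((size S)%:R * (C0 * s `^ d))%:E)%E.
Proof.
move=> s0 SG PG PS.
apply: (@le_trans _ _ (hausdorff d (\bigcup_(p in [set` S]) (Gam `&` eball p s)))).
  apply: hausdorffS => z Pz; have [p pS pz] := PS _ Pz.
  by exists p => //; split => //; exact: PG.
elim: S SG {PS} => [|p S IH] SG; first by rewrite set_nil bigcup_set0 hausdorff0// mul0r.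
rewrite bigcup_cons; apply: le_trans (hausdorffU _ _ _) _ => //.
rewrite /= -nat1r mulrDl mul1r EFinD; apply: leeD.
  by have [] := reg (SG p (mem_head _ _)) s0.
by apply: IH => q qS; apply: SG; rewrite inE qS orbT.
Qed.

(* Makes the union of the sets [bad] below at most half as large as the lower bound for
   hausdorff d (Gam `&` eball x (r / 2)). *)
Let kap := 4 * C0 ^+ 2 * 4 `^ d.

Let C00 : 0 < C0. Proof. exact: lt_le_trans C01. Qed.
Let kap0 : 0 < kap. Proof. by rewrite !mulr_gt0 ?exprn_gt0 ?powR_gt0. Qed.

(** The factor 1/2 places the first ball about a point of B(x,r/2) inside B(x,r). The ratio 16 makes
    square roots at most 4^(-j) and fourth roots at most 2^(-j), so that both geometric series are
    explicit. *)
Definition shrink (j : nat) : R := (2 * 16 ^+ j)^-1.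
(* Any exponent of [shrink j] between d - 1 and d works: above d - 1 the oscillations at the
   scales r * shrink j are summable, below d so are the sizes of the sets [bad]. *)
Definition share gam (j : nat) : R := kap * shrink j `^ (d - 2^-1) * gam.

Lemma shrink_gt0 j : 0 < shrink j.
Proof. by rewrite invr_gt0 mulr_gt0// exprn_gt0. Qed.

Lemma shrink_le_half j : shrink j <= 2^-1.
Proof. by rewrite lef_pV2 ?posrE ?mulr_gt0 ?exprn_gt0// ler_peMr// exprn_ege1// ler1n. Qed.

Lemma shrinkS j : shrink j = 16 * shrink j.+1.
Proof. by rewrite /shrink exprS; field; rewrite expf_neq0. Qed.

Lemma sqrt_shrink j : shrink j `^ 2^-1 <= (4 ^+ j)^-1.
Proof.
rewrite powR12_sqrt ?(ltW (shrink_gt0 j))//.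
have p4 : 0 < (4 ^+ j)^-1 :> R by rewrite invr_gt0 exprn_gt0.
rewrite -[leRHS](ger0_norm (ltW p4)) -sqrtr_sqr ler_wsqrtr// /shrink exprVn -exprM mulnC exprM.
have -> : 4 ^+ 2 = 16 :> R by ring.
by rewrite lef_pV2 ?posrE ?mulr_gt0 ?exprn_gt0// ler_peMl ?exprn_ge0// ler1n.
Qed.

Lemma share_gt0 gam j : 0 < gam -> 0 < share gam j.
Proof. by move=> g0; rewrite !mulr_gt0// powR_gt0// shrink_gt0. Qed.

Definition bad g x r gam j : set V := (Gam `&` eball x (r / 2)) `&`
  [set y | ~ energy_le g y (r * shrink j) (share gam j)].

(** Balls of radius s = r [shrink j] about 2s-separated bad points are disjoint, lie in B(x,r) and
    each carry more energy than e = [share gam j], so there are at most gam/e of them. A maximal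
    family then covers the bad set by balls of radius 2s, whose measure upper regularity
    controls. *)
Lemma bad_small g x r gam j : (forall i, measurable_fun setT (fun z => g z 0 i)) ->
  0 < r -> 0 < gam -> energy_le g x r gam ->
  (hausdorff d (bad g x r gam j) <= (kap^-1 * C0 * 2 `^ d * r `^ d * (4 ^+ j)^-1)%:E)%E.
Proof.
move=> mg r0 gam0 hg; set s := r * shrink j; set e := share gam j.
have sh0 := shrink_gt0 j.
have s0 : 0 < s by rewrite mulr_gt0.
have s2 : s <= r / 2 by rewrite ler_pM2l// shrink_le_half.
have e0 : 0 < e by exact: share_gt0.
pose F z := (enorm (g z) ^+ 2 * w z)%:E : \bar R.
have F0 z : (0 <= F z)%E by rewrite lee_fin mulr_ge0 ?sqr_ge0 ?weight_ge0.
have mF : measurable_fun setT F.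
  apply/measurable_EFinP; apply: measurable_funM => //; apply: measurable_funX.
  apply: (measurableT_comp (f := @enorm R n)); first exact: measurable_enorm.
  exact: measurable_fun_rVP.
have count (S : seq V) : separated (2 * s) S -> (forall p, p \in S -> bad g x r gam j p) ->
    (size S)%:R <= gam / e.
  move=> sS hS; rewrite ler_pdivlMr// -lee_fin; apply: le_trans hg.
  apply: le_trans (disjoint_energy mF F0 s0 sS _) _.
    by move=> p /hS[_ /negP]; rewrite -ltNge => /ltW.
  apply: ge0_subset_integral => //.
  - by apply: fin_bigcup_measurable => // q _; exact: measurable_eball.
  - exact: measurable_eball.
  - exact: measurable_funTS.
  - move=> z [p /= /hS[[_ px] _] pz]; move: px pz; rewrite /eball/= => px pz.
    have := enorm_distD p z x; lra.
have [|S [sS hS cS]] := @maximal_separated _ _ (bad g x r gam j) (2 * s) (Num.truncn (gam / e)).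
  move=> S s1 s2'; rewrite -ltnS -(ltr_nat R).
  by apply: le_lt_trans (count S s1 s2') (truncnS_gt _).
have s20 : 0 < 2 * s by rewrite mulr_gt0.
have SG p : p \in S -> Gam p by move=> /hS[[]].
apply: le_trans (hausdorff_cover_le s20 SG _ cS) _; first by move=> z [[]].
rewrite lee_fin; apply: (@le_trans _ _ (gam / e * (C0 * (2 * s) `^ d))).
  by rewrite ler_wpM2r ?count// mulr_ge0 ?powR_ge0// ltW.
have -> : gam / e * (C0 * (2 * s) `^ d) = kap^-1 * C0 * 2 `^ d * r `^ d * shrink j `^ 2^-1.
  rewrite /e /share /s powRM ?(ltW s0)// powRM ?(ltW r0) ?(ltW sh0)//.
  have -> : shrink j `^ 2^-1 = shrink j `^ d / shrink j `^ (d - 2^-1).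
    rewrite -powRN -powRD; last by rewrite (gt_eqF sh0) implybT.
    by congr (_ `^ _); ring.
  by field; rewrite !gt_eqF// powR_gt0.
by rewrite ler_wpM2l ?sqrt_shrink// !mulr_ge0 ?powR_ge0 ?invr_ge0 ?(ltW kap0) ?(ltW C00).
Qed.

(** Otherwise [Gam] within B(x,r/2) would be covered by the exceptional set of the trace, of measure
    0, and by the sets [bad], of total measure at most 2D, against the lower regularity bound 4D. *)
Lemma good_point u g x r gam : (forall i, measurable_fun setT (fun z => g z 0 i)) ->
  Gam x -> 0 < r -> 0 < gam -> energy_le g x r gam -> trace0_ae_on d Gam u (eball x r) ->
  exists y, [/\ Gam y, eball x (r / 2) y, has_trace u y 0 &
    forall j, energy_le g y (r * shrink j) (share gam j)].
Proof.
move=> mg Gx r0 gam0 hg tr; apply/not_existsP => /= nex.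
have r20 : 0 < r / 2 by rewrite divr_gt0.
pose T := (Gam `&` eball x r) `&` [set y | ~ has_trace u y 0].
pose D := kap^-1 * C0 * 2 `^ d * r `^ d.
have D0 : 0 <= D by rewrite !mulr_ge0 ?powR_ge0 ?invr_ge0 ?(ltW kap0) ?(ltW C00).
have sub : Gam `&` eball x (r / 2) `<=` T `|` \bigcup_j bad g x r gam j.
  move=> y [Gy xy].
  have [ty|nty] := pselect (has_trace u y 0); last first.
    left; split => //; split => //; move: xy; rewrite /eball/=; lra.
  right; apply: contrapT => nb; apply: (nex y); split => // j.
  by apply: contrapT => ne; apply: nb; exists j.
have := le_trans (hausdorffS d sub) (hausdorffU _ _ _).
have -> : hausdorff d T = 0 by exact: tr.
rewrite add0e => h; have [lo _] := reg Gx r20.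
have := le_trans lo (h d0).
have -> : C0^-1 * (r / 2) `^ d = 4 * D.
  have r2 : r `^ d = (r / 2) `^ d * 2 `^ d by rewrite -powRM ?(ltW r20)// divfK.
  have f4 : 4 `^ d = 2 `^ d * 2 `^ d :> R by rewrite -powRM//; congr (_ `^ _); ring.
  by rewrite /D /kap r2 f4; field; rewrite !gt_eqF ?powR_gt0.
apply/negP; rewrite -ltNge.
apply: (@le_lt_trans _ _ (2 * D)%:E).
  apply: le_trans (hausdorff_subadditive _ _) _.
  apply: le_trans (epsilon_trick0 xpredT _); last by rewrite mulr_ge0.
  apply: lee_nneseries => k; first by move=> _ _; exact: hausdorff_ge0.
  move=> _.
  apply: le_trans (bad_small k mg r0 gam0 hg) _; rewrite -/D lee_fin.
  rewrite natrX exprS invfM mulrACA divff// mul1r ler_wpM2l// lef_pV2 ?posrE ?exprn_gt0//.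
  by rewrite lerXn2r ?nnegrE// ler_nat.
rewrite lte_fin ltr_pM2r ?ltr_nat//.
by rewrite !mulr_gt0 ?powR_gt0 ?invr_gt0.
Qed.

(** Since [ballm] is s^(d+1) on [Gam], the square of the scale carries the power 2 + (d - 1/2) - (d
    + 1) = 1/2 of [shrink j], which is at most 4^(-j). *)
Lemma scale_share x y r gam j : Gam x -> Gam y -> 0 < r -> 0 < gam ->
  scale y (r * shrink j) (share gam j) <= Num.sqrt kap * scale x r gam * (2 ^+ j)^-1.
Proof.
move=> Gx Gy r0 gam0; have h0 := shrink_gt0 j; have s0 : 0 < r * shrink j by rewrite mulr_gt0.
have sh := share_gt0 j gam0.
have L0 := scale_gt0 d Gam0 y s0 sh; have L1 := scale_gt0 d Gam0 x r0 gam0.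
rewrite -(ler_pXn2r (n := 2)) ?nnegrE ?(ltW L0)//; last first.
  by apply: mulr_ge0; [exact: mulr_ge0 (sqrtr_ge0 _) (ltW L1)|rewrite invr_ge0 exprn_ge0].
have ds : 0 <= share gam j / ballm d Gam y (r * shrink j).
  by rewrite divr_ge0 ?(ltW sh)// (ltW (ballm_gt0 d Gam0 y s0)).
have dr : 0 <= gam / ballm d Gam x r.
  by rewrite divr_ge0 ?(ltW gam0)// (ltW (ballm_gt0 d Gam0 x r0)).
rewrite /scale !exprMn (sqr_sqrtr ds) (sqr_sqrtr dr) (sqr_sqrtr (ltW kap0)).
rewrite !ballm_on// powRM ?(ltW r0) ?(ltW h0)//.
have hh : shrink j ^+ 2 * shrink j `^ (d - 2^-1) = shrink j `^ (d + 1) * shrink j `^ 2^-1.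
  rewrite -powR_mulrn ?(ltW h0)// -!powRD ?(gt_eqF h0) ?implybT//.
  by congr (_ `^ _); field.
have -> : r ^+ 2 * shrink j ^+ 2 * (share gam j / (r `^ (d + 1) * shrink j `^ (d + 1))) =
   kap * (r ^+ 2 * (gam / r `^ (d + 1))) * shrink j `^ 2^-1.
  rewrite /share; transitivity (kap * r ^+ 2 * gam / (r `^ (d + 1) * shrink j `^ (d + 1)) *
    (shrink j ^+ 2 * shrink j `^ (d - 2^-1))); first by ring.
  by rewrite hh; field; rewrite !gt_eqF ?powR_gt0.
rewrite ler_wpM2l//.
  apply: mulr_ge0 (ltW kap0) _; apply: mulr_ge0; first exact: sqr_ge0.
  by rewrite divr_ge0 ?powR_ge0 ?(ltW gam0).
apply: le_trans (sqrt_shrink j) _.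
have -> : 4 = 2 ^+ 2 :> R by ring.
by rewrite -exprM exprVn -exprM mulnC.
Qed.

Let K3 := 2 ^+ n * 2 * Num.sqrt (2 `^ a * om).

Let K30 : 0 < K3.
Proof. by rewrite !mulr_gt0 ?exprn_gt0// sqrtr_gt0 mulr_gt0 ?powR_gt0// ball_vol_gt0. Qed.

(** The vanishing trace at the good point forces the means over the chain of balls to 0, while
    consecutive ones differ by a geometric sequence; their starting point is therefore bounded, and
    so is the mean over B(x,r), at the cost of one more comparison. *)
Lemma trace_bound : exists2 C, 0 < C & forall u g x r gam, admissible Gam u g ->
  Gam x -> 0 < r -> 0 < gam -> energy_le g x r gam -> trace0_ae_on d Gam u (eball x r) ->
  `|avg u (eball x r)| <= C * scale x r gam.
Proof.
have om0 : 0 < om := ball_vol_gt0 n.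
(* 16^n is the volume ratio of consecutive balls, and the square root of [kap] comes from
   [scale_share]. Summing 2^(-j) doubles A below. *)
pose A := 16 ^+ n * K3 / om * Num.sqrt kap.
have KO : 0 < K3 / om by rewrite divr_gt0.
have A0 : 0 < A.
  by rewrite /A -mulrA -mulrA mulr_gt0 ?exprn_gt0// mulrA mulr_gt0// sqrtr_gt0.
exists (2 ^+ n * K3 / om + 2 * A) => [|u g x r gam adm Gx r0 gam0 hg tr].
  apply: addr_gt0; last exact: mulr_gt0.
  by rewrite -mulrA; apply: mulr_gt0 => //; exact: exprn_gt0.
have [mu mg _ _ _] := adm.
have [y [Gy xy ty hy]] := good_point mg Gx r0 gam0 hg tr.
set c0 := avg u (eball x r); set Lam := scale x r gam.
have L0 : 0 < Lam by exact: scale_gt0.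
pose s j := r * shrink j; pose b j := avg u (eball y (s j)).
have s0 j : 0 < s j by rewrite mulr_gt0 ?shrink_gt0.
have [iB oB] := avg_oscillation Gam0 a0 cGam LGam segGam adm r0 gam0 hg.
have osc j := avg_oscillation Gam0 a0 cGam LGam segGam adm (s0 j) (share_gt0 j gam0) (hy j).
have b0 : `|b 0 - c0| <= 2 ^+ n * K3 / om * Lam.
  have sub : eball y (s 0) `<=` eball x r.
    move=> z; move: xy; rewrite /s /shrink expr0 mulr1 /eball/= => h1 h2.
    by have := enorm_distD y z x; lra.
  apply: le_trans (avg_sub_le (s0 0) (measurable_eball x r) sub mu (osc 0).1 oB) _.
  rewrite -/K3 -/Lam le_eqVlt; apply/orP; left; apply/eqP.
  rewrite /s /shrink expr0 mulr1 exprMn exprVn.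
  by field; rewrite !gt_eqF// exprn_gt0.
have step j : `|b j.+1 - b j| <= A * Lam * (2 ^+ j)^-1.
  have sub : eball y (s j.+1) `<=` eball y (s j).
    apply: eballS; rewrite /s (shrinkS j) ler_pM2l// ler_peMl ?(ltW (shrink_gt0 _))//.
    by rewrite ler1n.
  apply: le_trans (avg_sub_le (s0 j.+1) (measurable_eball y (s j)) sub mu (osc j.+1).1 (osc j).2) _.
  rewrite -/K3.
  have -> : (om * s j.+1 ^+ n)^-1 * (K3 * s j ^+ n * scale y (s j) (share gam j)) =
     16 ^+ n * K3 / om * scale y (s j) (share gam j).
    have -> : s j = 16 * s j.+1 by rewrite /s (shrinkS j); ring.
    move: (s j.+1) (scale _ _ _) (s0 j.+1) => S1 S sj; rewrite exprMn.
    by field; rewrite !gt_eqF// exprn_gt0.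
  apply: le_trans (ler_wpM2l _ (scale_share j Gx Gy r0 gam0)) _.
    by rewrite !mulr_ge0 ?exprn_ge0 ?invr_ge0 ?(ltW om0) ?(ltW K30).
  by rewrite -/Lam /A !mulrA.
(* The partial sum of the geometric series is kept in closed form for the induction. *)
have tel j : `|b j - b 0| <= 2 * A * Lam * (1 - (2 ^+ j)^-1).
  elim: j => [|j IH]; first by rewrite subrr normr0 expr0 invr1 subrr mulr0.
  apply: (@le_trans _ _ (`|b j.+1 - b j| + `|b j - b 0|)).
    by rewrite (le_trans _ (ler_normD _ _))// addrA subrK.
  apply: le_trans (lerD (step j) IH) _.
  rewrite le_eqVlt; apply/orP; left; apply/eqP; rewrite exprS.
  by field; rewrite expf_neq0.
apply/ler_addgt0Pl => e e0.
have [j bj] : exists j, `|b j| < e.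
  move: ty => /cvgrPdist_lt/(_ e e0) [del /= del0 H].
  (* With this j, r/del < j + 1 <= 16^j, so the j-th radius is below del. *)
  exists (Num.truncn (r / del)); rewrite -normrN -[- b _]add0r; apply: H => //=.
  rewrite sub0r normrN gtr0_norm// /s /shrink -[ltRHS]mulr1 -ltr_pdivrMl//.
  rewrite mulrA ltr_pdivrMr ?mulr_gt0 ?exprn_gt0// mul1r mulrC.
  apply: lt_le_trans (truncnS_gt _) _.
  rewrite -natrX -natrM ler_nat; set k := Num.truncn _.
  by apply: leq_trans (ltn_expl k (isT : (1 < 16)%N)) _; rewrite leq_pmull.
have B1 : `|c0| <= `|b 0 - c0| + `|b j - b 0| + `|b j|.
  rewrite -(normrN (b j)).
  rewrite (le_trans _ (le_trans (ler_normD _ _) (lerD (ler_normD _ _) (lexx _))))//.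
  by rewrite (_ : b 0 - c0 + (b j - b 0) - b j = - c0) ?normrN//; ring.
have tj : `|b j - b 0| <= 2 * A * Lam.
  apply: le_trans (tel j) _; rewrite ler_piMr//.
  by apply: mulr_ge0 (ltW L0); apply: mulr_ge0 (ltW A0).
rewrite mulrDl; move: b0 tj bj B1; move: (2 ^+ n * K3 / om * Lam) (2 * A * Lam) => X Y; lra.
Qed.

End trace.

(** * Conclusion *)

(** The sum is at most twice its larger term; the constant is not sharp, which is harmless here. *)
Lemma powR_add_le {R : realType} (p v1 v2 : R) : 0 < p -> 0 <= v1 -> 0 <= v2 ->
  (v1 + v2) `^ p <= 2 `^ p * (v1 `^ p + v2 `^ p).
Proof.
move=> p0 v10 v20; have mono (s t : R) : 0 <= s -> s <= t -> s `^ p <= t `^ p.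
  by move=> s0 st; rewrite ge0_ler_powR ?nnegrE ?(ltW p0)// (le_trans s0).
have p1 := powR_ge0 v1 p; have p2 := powR_ge0 v2 p.
have [v12|v21] := leP v1 v2.
  apply: (@le_trans _ _ ((2 * v2) `^ p)); first by apply: mono; lra.
  by rewrite powRM// ler_wpM2l ?powR_ge0// lerDr.
apply: (@le_trans _ _ ((2 * v1) `^ p)); first by apply: mono; lra.
by rewrite powRM// ler_wpM2l ?powR_ge0// lerDl.
Qed.

(* The energy [I] is only known through the strict upper bounds [gam] of it, so that
   a vanishing energy needs no separate treatment. *)
Lemma normalized_le {R : realType} (N I : \bar R) (K p c1 c2 mu M r : R) :
  (0 <= N)%E -> (0 <= I)%E -> 0 < K -> 0 < p -> 0 < c1 -> 0 < c2 -> 0 < mu -> 0 < r ->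
  c1 * mu <= M <= c2 * mu ->
  (forall gam, 0 < gam -> (I <= gam%:E)%E ->
    (N <= (K * (r * Num.sqrt (gam / mu)) `^ p * mu)%:E)%E) ->
  (((M^-1)%:E * N) `^ p^-1 <=
   ((K / c1) `^ p^-1 * Num.sqrt c2 * r)%:E * ((M^-1)%:E * I) `^ 2^-1)%E.
Proof.
move=> N0 I0 K0 p0 c10 c20 mu0 r0 /andP[M1 M2] H.
have M0 : 0 < M by apply: lt_le_trans M1; exact: mulr_gt0.
have MV0 : 0 < M^-1 by rewrite invr_gt0.
set C := (K / c1) `^ p^-1 * Num.sqrt c2.
have C00 : 0 < C by rewrite mulr_gt0 ?powR_gt0 ?sqrtr_gt0// divr_gt0.
have C0r : 0 < C * r by rewrite mulr_gt0.
have bound gam : 0 < gam -> (I <= gam%:E)%E ->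
    (((M^-1)%:E * N) `^ p^-1 <= (C * r * Num.sqrt (gam / M))%:E)%E.
  move=> gam0 Ig; have := H gam gam0 Ig; set Lam := r * _ => hN.
  have L0 : 0 <= Lam by rewrite mulr_ge0 ?sqrtr_ge0 ?ltW.
  have Nf : N \is a fin_num by rewrite ge0_fin_numE// (le_lt_trans hN)// ltry.
  move: hN; rewrite -(fineK Nf) lee_fin -EFinM poweR_EFin lee_fin; set Nr := fine N => hN.
  have Nr0 : 0 <= Nr by rewrite fine_ge0.
  have h1 : M^-1 * Nr <= K / c1 * Lam `^ p.
    rewrite ler_pdivrMl//; apply: le_trans hN _.
    have -> : K * Lam `^ p * mu = c1 * mu * (K / c1 * Lam `^ p) by field; rewrite gt_eqF.
    by rewrite ler_wpM2r// mulr_ge0 ?powR_ge0// divr_ge0 ?ltW.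
  apply: (@le_trans _ _ ((K / c1 * Lam `^ p) `^ p^-1)).
    have h2 : 0 <= K / c1 * Lam `^ p by rewrite mulr_ge0 ?powR_ge0// divr_ge0 ?ltW.
    by rewrite ge0_ler_powR ?nnegrE ?invr_ge0 ?(ltW p0)// mulr_ge0// ltW.
  rewrite powRM ?powR_ge0 ?divr_ge0 ?(ltW K0) ?(ltW c10)// -powRrM divff ?gt_eqF// powRr1//.
  rewrite /C -!mulrA ler_wpM2l ?powR_ge0// /Lam mulrCA ler_wpM2l ?(ltW r0)//.
  rewrite -sqrtrM ?(ltW c20)// ler_wsqrtr// mulrCA ler_wpM2l ?(ltW gam0)//.
  rewrite -(invrK c2) -invfM lef_pV2 ?posrE ?mulr_gt0 ?invr_gt0//.
  by rewrite mulrC ler_pdivrMr// mulrC.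
(* With infinite energy the right-hand side is +oo, as all its other factors are positive. *)
have [Iy|If] := eqVneq I +oo%E.
  rewrite Iy gt0_muley ?lte_fin// poweRyr ?invr_neq0// gt0_muley ?lte_fin//.
  exact: leey.
have fI : I \is a fin_num by rewrite ge0_fin_numE// ltey.
pose G := fine I; have -> : ((M^-1)%:E * I = (M^-1 * G)%:E)%E by rewrite EFinM fineK.
rewrite poweR_EFin -EFinM.
have G0 : 0 <= G by rewrite fine_ge0.
have Xf : (((M^-1)%:E * N) `^ p^-1)%E \is a fin_num.
  rewrite ge0_fin_numE ?poweR_ge0//.
  apply: le_lt_trans (bound (G + 1) _ _) (ltry _); first by rewrite ltr_wpDl.
  by rewrite -(fineK fI) lee_fin lerDl.
move: bound Xf (poweR_ge0 ((M^-1)%:E * N)%E p^-1); case: (_ `^ p^-1)%E => // X bound _.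
rewrite lee_fin => X0; rewrite lee_fin powR12_sqrt; last by rewrite mulr_ge0// ltW.
rewrite -(ger0_norm X0) -(ger0_norm (ltW C0r)) -!sqrtr_sqr -sqrtrM ?sqr_ge0//.
(* The slack [eps] in the energy is tuned so that the square of the resulting bound exceeds its
   limit by exactly e. *)
apply: ler_wsqrtr; apply/ler_addgt0Pr => e e0.
have k0 : 0 < (C * r) ^+ 2 / M by rewrite divr_gt0// exprn_gt0.
pose eps := e / ((C * r) ^+ 2 / M); have eps0 : 0 < eps by rewrite divr_gt0.
have Ge : 0 < G + eps by rewrite ltr_wpDl.
have := bound (G + eps) Ge; rewrite -(fineK fI) !lee_fin lerDl => /(_ (ltW eps0)) hX.
have : X ^+ 2 <= (C * r * Num.sqrt ((G + eps) / M)) ^+ 2.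
  by rewrite ler_pXn2r ?nnegrE// mulr_ge0 ?sqrtr_ge0// ltW.
rewrite exprMn sqr_sqrtr; last by rewrite divr_ge0 ?ltW.
move=> /le_trans; apply; rewrite le_eqVlt; apply/orP; left; apply/eqP.
by rewrite /eps; field; rewrite !gt_eqF.
Qed.

Section conclusion.
Context {R : realType} {n : nat} (d : R) (Gam : set 'rV[R]_n).
Local Notation V := 'rV[R]_n.
Local Notation L := (lebesgue_rV R n).
Local Notation de := (edist Gam).
Local Notation w := (weight d Gam).
Local Notation a := (n%:R - 1 - d).
Local Notation om := (@ball_vol R n).
Local Notation energy_le := (energy_le d Gam).
Local Notation scale := (scale d Gam).
Implicit Types (x y z : V) (r s gam : R) (u : V -> R) (g : V -> V).

Hypotheses (Gam0 : Gam !=set0) (a0 : 0 < a) (cGam : closed Gam) (LGam : L.-negligible Gam).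

Let mw : measurable_fun setT w. Proof. exact: measurable_weight. Qed.
Let w0 z : 0 <= w z. Proof. exact: weight_ge0. Qed.

(** On the ball the distance is at most de x + s, which bounds the weight from below off [Gam]; on
    [Gam] the weight is 0, so the comparison is only almost everywhere. *)
Lemma wmeasure_eball_ge x s : 0 < s -> ((om * ballm d Gam x s)%:E <= wmeasure d Gam (eball x s))%E.
Proof.
move=> s0; have mB := measurable_eball x s; pose c := ((de x + s) `^ a)^-1.
have c0 : 0 <= c by rewrite invr_ge0 powR_ge0.
apply: (@le_trans _ _ (\int[L]_(z in eball x s) c%:E)%E).
  have := integral_cst L mB c%:E; rewrite /cst => ->.
  have LS : L (eball x s) = (om * s ^+ n)%:E by exact: lebesgue_eball.
  by rewrite [X in (_ * X)%E]LS -EFinM lee_fin /ballm -/c le_eqVlt; apply/orP; left; apply/eqP; ring.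
apply: ae_ge0_le_integral => //.
- by move=> z _; rewrite lee_fin.
- by apply/measurable_EFinP; exact: measurable_funTS.
apply: negligibleS LGam => z /= nz; apply: contrapT => ncz; apply: nz => zB.
rewrite lee_fin; apply: weight_ge => //; rewrite edist_gt0//=.
apply: le_trans (edist_lip Gam0 z x) _; rewrite lerD2l.
by move: zB; rewrite /eball/= => /ltW.
Qed.

(** Changing the centre by at most E Lam changes only the constant. This passes from the plain mean
    to the weighted mean, and to 0 when the trace vanishes. *)
Lemma recenter u (B : set V) (c0 c1 p C E Cw Lam mu : R) : measurable_fun setT u -> measurable B ->
  0 < p -> 0 <= E -> 0 <= Lam -> `|c0 - c1| <= E * Lam -> (wmeasure d Gam B <= (Cw * mu)%:E)%E ->
  (\int[L]_(z in B) (`|u z - c0| `^ p * w z)%:E <= (C * Lam `^ p * mu)%:E)%E ->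
  (\int[L]_(z in B) (`|u z - c1| `^ p * w z)%:E <=
    (2 `^ p * (C + E `^ p * Cw) * Lam `^ p * mu)%:E)%E.
Proof.
move=> mu_ mB p0 E0 L0 hc hw h0; pose b := 2 `^ p * (E * Lam) `^ p.
have b0 : 0 <= b by rewrite mulr_ge0 ?powR_ge0.
have mpow (c : R) : measurable_fun setT (fun z => `|u z - c| `^ p * w z).
  apply: measurable_funM => //; apply: (measurableT_comp (f := fun t : R => t `^ p)) => //.
  by apply: measurableT_comp => //; exact: measurable_funB.
apply: (@le_trans _ _ (\int[L]_(z in B) (2 `^ p * (`|u z - c0| `^ p * w z) + b * w z)%:E)%E).
  apply: ge0_le_integral => //.
  - by move=> z _; rewrite lee_fin mulr_ge0 ?powR_ge0.
  - by apply/measurable_EFinP; exact: measurable_funTS.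
  - apply/measurable_EFinP/measurable_funTS; apply: measurable_funD; exact: measurable_funM.
  - move=> z _; rewrite lee_fin mulrA -mulrDl ler_wpM2r// /b -mulrDr.
    apply: (@le_trans _ _ ((`|u z - c0| + E * Lam) `^ p)); last first.
      by rewrite powR_add_le ?mulr_ge0.
    rewrite ge0_ler_powR ?nnegrE ?(ltW p0) ?addr_ge0 ?mulr_ge0//.
    apply: (@le_trans _ _ (`|u z - c0| + `|c0 - c1|)); last by rewrite lerD2l.
    by rewrite (le_trans _ (ler_normD _ _))// addrA subrK.
have -> : 2 `^ p * (C + E `^ p * Cw) * Lam `^ p * mu =
    2 `^ p * (C * Lam `^ p * mu) + b * (Cw * mu).
  by rewrite /b powRM//; ring.
apply: integral_addr_le => //.
- exact: measurable_funM.
- exact: measurable_funM.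
- by move=> z; rewrite !mulr_ge0 ?powR_ge0.
- by move=> z; rewrite mulr_ge0.
- have pw0 z : 0 <= `|u z - c0| `^ p * w z by rewrite mulr_ge0 ?powR_ge0.
  exact: (integral_mulr_le mB (mpow c0) (powR_ge0 2 p) pw0 h0).
- exact: integral_mulr_le.
Qed.

Lemma wavg_sub_le u (B : set V) (c X M : R) : measurable_fun setT u -> measurable B ->
  0 < M -> wmeasure d Gam B = M%:E ->
  (\int[L]_(z in B) (`|u z - c| * w z)%:E <= X%:E)%E ->
  `|c - wavg d Gam u B| <= M^-1 * X.
Proof.
move=> mu mB M0 hM hX.
have iw : L.-integrable B (EFin \o w).
  apply/integrableP; split; first by apply/measurable_EFinP; exact: measurable_funTS.
  rewrite (eq_integral (EFin \o w)) => [|z _]; last by rewrite /= ger0_norm.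
  by move: hM; rewrite /wmeasure => ->; rewrite ltry.
have mh : measurable_fun setT (fun z => (u z - c) * w z).
  by apply: measurable_funM => //; exact: measurable_funB.
have ih : L.-integrable B (fun z => ((u z - c) * w z)%:E).
  apply/integrableP; split; first by apply/measurable_EFinP; exact: measurable_funTS.
  rewrite (eq_integral (fun z => (`|u z - c| * w z)%:E)) => [|z _].
    by rewrite (le_lt_trans hX)// ltry.
  by rewrite /= normrM (ger0_norm (w0 z)).
have icw : L.-integrable B (fun z => (c * w z)%:E) by exact: (integrableZl mB c iw).
have e1 : \int[L]_(z in B) (u z * w z) = \int[L]_(z in B) ((u z - c) * w z) + c * M.
  have -> : c * M = \int[L]_(z in B) (c * w z).
    by rewrite RintegralZl// /Rintegral -/(wmeasure d Gam B) hM.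
  rewrite -(RintegralD mB ih icw); apply: eq_Rintegral => z _; ring.
have -> : c - wavg d Gam u B = - (M^-1 * \int[L]_(z in B) ((u z - c) * w z)).
  by rewrite /wavg hM /= e1; field; rewrite gt_eqF.
rewrite normrN normrM gtr0_norm ?invr_gt0// ler_pM2l ?invr_gt0//.
rewrite -lee_fin -abse_EFin /Rintegral fineK; last exact: integrable_fin_num.
apply: le_trans hX.
have := le_abse_integral L mB (f := fun z => ((u z - c) * w z)%:E).
move=> /(_ (ltac:(apply/measurable_EFinP; exact: measurable_funTS))) /le_trans; apply.
rewrite le_eqVlt; apply/orP; left; apply/eqP; apply: eq_integral => z _.
by rewrite /= normrM (ger0_norm (w0 z)).
Qed.

(* Turns the gradient, given on ~` Gam only, into a Borel field on the whole space; the energy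
   is unchanged since the weight vanishes on Gam. *)
Definition zero_on (k : V -> V) z : V := if `[< Gam z >] then 0 else k z.

Lemma admissible_zero_on u g : in_W d Gam u -> weak_gradient (~` Gam) u g -> admissible Gam u (zero_on g).
Proof.
move=> [mu lu _] [lg wg].
have mG : measurable (~` Gam) by apply: open_measurable_rV; exact: closed_openC.
have offE z : (~` Gam) z -> zero_on g z = g z by move=> nz; rewrite /zero_on; case: asboolP.
split => // [i||z Gz].
- have [mgi _ _] := lg i.
  have := (iffLR (measurable_restrictT _ mG)) mgi.
  apply: eq_measurable_fun => z _; rewrite /patch /zero_on; case: asboolP => Gz.
    by rewrite memNset//= mxE.
  by rewrite mem_set.
- split => [i|phi tphi i].
    have [mgi oG hK] := lg i; split => //.
      by apply: eq_measurable_fun mgi => z /set_mem/offE ->.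
    move=> K KG cK; rewrite (eq_integral (fun z => `|g z 0 i|%:E)) ?hK// => z /set_mem/KG/offE ->.
    by [].
  by rewrite wg//; congr (- _); apply: eq_Rintegral => z /set_mem/offE ->.
- by rewrite /zero_on; case: asboolP.
Qed.

Lemma energy_zero_on g (B : set V) :
  (\int[L]_(z in B) (enorm (zero_on g z) ^+ 2 * w z)%:E = \int[L]_(z in B) (enorm (g z) ^+ 2 * w z)%:E)%E.
Proof.
apply: eq_integral => z _; rewrite /zero_on; case: asboolP => // Gz.
by rewrite weightE edist_mem// powR0 ?gt_eqF// invr0 !mulr0.
Qed.

End conclusion.

Theorem lemma4p2 (R : realType) (n : nat) (d p : R) (Gam : set 'rV[R]_n) :
  (2 <= n)%N -> 0 < d < n%:R - 1 ->
  Gam !=set0 -> closed Gam -> ahlfors_regular d Gam ->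
  1 <= p -> ((3 <= n)%N -> p <= (2 * n%:R) / (n%:R - 2)) ->
  exists2 C : R, 0 < C &
    forall (u : 'rV[R]_n -> R) (grad_u : 'rV[R]_n -> 'rV[R]_n),
    in_W d Gam u -> weak_gradient (~` Gam) u grad_u ->
    forall (x : 'rV[R]_n) (r : R), 0 < r ->
    let B := eball x r in
    (forall uB : R, uB = avg u B \/ uB = wavg d Gam u B ->
      (((wmeasure d Gam B)^-1 *
          \int[lebesgue_rV R n]_(y in B)
            (`|u y - uB| `^ p * weight d Gam y)%:E) `^ p^-1
       <= (C * r)%:E *
          ((wmeasure d Gam B)^-1 *
             \int[lebesgue_rV R n]_(y in B)
               (enorm (grad_u y) ^+ 2 * weight d Gam y)%:E) `^ 2^-1)%E)
    /\
    (Gam x -> trace0_ae_on d Gam u B ->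
      (((r `^ (- d - 1))%:E *
          \int[lebesgue_rV R n]_(y in B)
            (`|u y| `^ p * weight d Gam y)%:E) `^ p^-1
       <= (C * r)%:E *
          ((r `^ (- d - 1))%:E *
             \int[lebesgue_rV R n]_(y in B)
               (enorm (grad_u y) ^+ 2 * weight d Gam y)%:E) `^ 2^-1)%E).
Proof.
move=> n2 /andP[d0 dn] Gam0 cGam [C0 C01 reg] p1 pn.
have a0 : 0 < n%:R - 1 - d by lra.
have p0 : 0 < p by lra.
have LG0 := lebesgue_ahlfors_eq0 Gam0 a0 d0 cGam C01 reg.
have LGam : (lebesgue_rV R n).-negligible Gam.
  exists Gam; split => //; rewrite -(setCK Gam); apply: measurableC.
  by apply: open_measurable_rV; exact: closed_openC.
have segGam := fun x => @segment_meets_negligible _ _ _ _ Gam0 a0 _ d0 cGam C01 reg x.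
have [Cw Cw0 hw] := wmeasure_eball_le Gam0 a0 d0 C01 reg.
(* For n >= 3 the critical exponent itself is above 2 and at least p. For n = 2 any finite exponent
   is allowed, and p + 2 exceeds both p and 2. *)
have [q [q2 pq qn]] : exists q, [/\ 2 < q, p <= q & (3 <= n)%N -> q <= (2 * n%:R) / (n%:R - 2)].
  have [n3|n3] := leqP 3 n; last by exists (p + 2); split; lra.
  have n2' : 2 < n%:R :> R by rewrite ltr_nat.
  exists ((2 * n%:R) / (n%:R - 2)); split => //; last exact: pn.
  by rewrite ltr_pdivlMr ?subr_gt0//; lra.
have [CI CI0 hI] := sqrt_min_integral n2 q2 qn.
have [Cp Cp0 hp] := poincare_avg Gam0 a0 cGam LGam segGam Cw0 hw q2 CI0 hI.
have [Ct Ct0 ht] := trace_bound Gam0 d0 a0 cGam LGam segGam C01 reg.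
have om0 : 0 < ball_vol n :> R := ball_vol_gt0 n.
(* The two terms bound the distance from the mean to the weighted mean and to 0, in units of
   [scale]; one recentering constant then serves all the choices. *)
pose E := Cp / ball_vol n + Ct; have E0 : 0 < E by rewrite addr_gt0// divr_gt0.
pose K := 2 `^ p * (Cp + E `^ p * Cw).
have K0 : 0 < K by rewrite mulr_gt0 ?powR_gt0// ltr_wpDr// mulr_ge0 ?powR_ge0// ltW.
(* The constants of [normalized_le] when the normalizing mass M is m(B), between [ball_vol n] and
   [Cw] times [ballm], and when M is [ballm] itself. *)
pose C1 := (K / ball_vol n) `^ p^-1 * Num.sqrt Cw.
pose C2 := (K / 1) `^ p^-1 * Num.sqrt 1.
have C10 : 0 < C1 by rewrite mulr_gt0 ?powR_gt0 ?sqrtr_gt0// divr_gt0.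
have C20 : 0 < C2 by rewrite mulr_gt0 ?powR_gt0 ?sqrtr_gt0// divr_gt0.
exists (C1 + C2); first exact: addr_gt0.
move=> u grad_u uW wg x r r0 B.
have adm := admissible_zero_on cGam uW wg; have [mu _ _ _ _] := adm.
have mB : measurable B by exact: measurable_eball.
have m0 : 0 < ballm d Gam x r := ballm_gt0 d Gam0 x r0.
set I := (\int[_]_(_ in _) (enorm _ ^+ 2 * _)%:E)%E.
have w0 := weight_ge0 d Gam.
have I0 : (0 <= I)%E by apply: integral_ge0 => z _; rewrite lee_fin mulr_ge0 ?sqr_ge0.
have hE gam : (I <= gam%:E)%E -> energy_le d Gam (zero_on Gam grad_u) x r gam.
  by rewrite /energy_le energy_zero_on.
(* All the estimates to prove have this form, with the mean, the weighted mean or 0 as centre. *)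
have near_center uB : (forall gam, 0 < gam -> (I <= gam%:E)%E ->
    `|avg u B - uB| <= E * scale d Gam x r gam) -> forall gam, 0 < gam -> (I <= gam%:E)%E ->
    (\int[lebesgue_rV R n]_(y in B) (`|u y - uB| `^ p * weight d Gam y)%:E <=
      (K * scale d Gam x r gam `^ p * ballm d Gam x r)%:E)%E.
  move=> huB gam gam0 hg; have L0 := scale_gt0 d Gam0 x r0 gam0.
  apply: (recenter Gam0 mu mB p0 (ltW E0) (ltW L0) (huB gam gam0 hg) (hw x r r0)).
  by apply: (hp _ _ _ _ _ adm r0 gam0 (hE _ hg)); rewrite p0.
have N0 (c : R) : (0 <= \int[lebesgue_rV R n]_(y in B) (`|u y - c| `^ p * weight d Gam y)%:E)%E.
  by apply: integral_ge0 => z _; rewrite lee_fin mulr_ge0 ?powR_ge0.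
split=> [uB huB|Gx tr].
  have lo := wmeasure_eball_ge Gam0 a0 cGam LGam x r0; have hi := hw x r r0.
  have mf : wmeasure d Gam B \is a fin_num.
    rewrite ge0_fin_numE ?(le_lt_trans hi) ?ltry//.
    by apply: integral_ge0 => z _; rewrite lee_fin.
  pose M := fine (wmeasure d Gam B); have hM : wmeasure d Gam B = M%:E by rewrite fineK.
  move: lo hi; rewrite -/B hM !lee_fin => lo hi.
  have M0 : 0 < M by apply: lt_le_trans lo; exact: mulr_gt0.
  rewrite inver gt_eqF//.
  apply: (@le_trans _ _ ((C1 * r)%:E * ((M^-1)%:E * I) `^ 2^-1)%E).
    apply: (normalized_le (mu := ballm d Gam x r)) => //; first by rewrite lo.
    apply: near_center => gam gam0 hg; have L0 := scale_gt0 d Gam0 x r0 gam0.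
    case: huB => ->; first by rewrite subrr normr0 mulr_ge0 ?ltW.
    (* The weighted mean is within the weighted L^1 deviation of u from its plain mean, normalized
       by m(B): the case of exponent 1. *)
    have h1 := hp _ _ _ _ _ adm r0 gam0 (hE _ hg) 1.
    have {h1} : (\int[lebesgue_rV R n]_(z in B) (`|u z - avg u B| * weight d Gam z)%:E <=
        (Cp * scale d Gam x r gam * ballm d Gam x r)%:E)%E.
      rewrite -[X in Cp * X]powRr1 ?(ltW L0)//.
      rewrite (eq_integral (fun z => (`|u z - avg u B| `^ 1 * weight d Gam z)%:E)) => [|z _].
        by apply: h1; lra.
      by rewrite powRr1.
    move=> /(wavg_sub_le Gam0 mu mB M0 hM)/le_trans; apply.
    rewrite ler_pdivrMl//; move: L0; set Lam := scale _ _ _ _ _ => L0.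
    apply: (@le_trans _ _ (Cp / ball_vol n * Lam * (ball_vol n * ballm d Gam x r))).
      by rewrite le_eqVlt; apply/orP; left; apply/eqP; field; rewrite gt_eqF.
    rewrite mulrC; apply: ler_pM => //.
    - by apply: mulr_ge0; rewrite ltW.
    - by apply: mulr_ge0 (ltW L0); rewrite divr_ge0 ?ltW.
    - by rewrite ler_wpM2r ?(ltW L0)// /E lerDl ltW.
  rewrite lee_wpmul2r ?poweR_ge0// lee_fin ler_wpM2r ?(ltW r0)//.
  by rewrite lerDl ltW.
have bE : ballm d Gam x r = r `^ (d + 1) by exact: ballm_on.
have -> : r `^ (- d - 1) = (ballm d Gam x r)^-1.
  by rewrite bE -powRN; congr (_ `^ _); ring.
(* Here the centre is 0, which [trace_bound] places close enough to the mean. *)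
apply: (@le_trans _ _ ((C2 * r)%:E * (((ballm d Gam x r)^-1)%:E * I) `^ 2^-1)%E).
  rewrite (eq_integral (fun y => (`|u y - 0| `^ p * weight d Gam y)%:E)) => [|z _]; last first.
    by rewrite subr0.
  apply: (normalized_le (mu := ballm d Gam x r)) => //; first by rewrite mul1r lexx.
  apply: near_center => gam gam0 hg; have L0 := scale_gt0 d Gam0 x r0 gam0.
  rewrite subr0; apply: le_trans (ht _ _ _ _ _ adm Gx r0 gam0 (hE _ hg) tr) _.
  by rewrite ler_wpM2r ?(ltW L0)// /E lerDr divr_ge0 ?ltW.
rewrite lee_wpmul2r ?poweR_ge0// lee_fin ler_wpM2r ?(ltW r0)//.
by rewrite lerDr ltW.
Qed.
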